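(* Let $r>0$, $x_0>0$, let $P$ satisfy hypothesis (H) of the context, and let $X=(X_t)_{t\ge0}$ be the process constructed from $P$, $r$, $x_0$ and a Brownian motion $B$ in the context. Then the perpetual put prices for $X$ are given by $P$, i.e. $$\sup_\tau\mathbb{E}\bigl[e^{-r\tau}(K-X_\tau)^+\bigr]=P(K)\qquad\text{for all }K\ge0,$$ where the supremum is over stopping times $\tau$ of the filtration $(\mathcal{F}_t)_{t\ge0}$ defined in the context.
   Context: Hypothesis (H) on $P:[0,\infty)\to[0,\infty)$: (i) $(K-x_0)^+\le P(K)\le K$ for all $K$; (ii) $P$ is nondecreasing and convex; (iii) there exists $K^*\in(x_0,\infty)$ such that $P(K)=K-x_0$ for $K\ge K^*$ and $P(K)>K-x_0$ for $K\in[x_0,K^* )$. Construction of $X$. (1) For $x\in(0,x_0]$ let $\varphi(x)=\sup_{K\ge x}\frac{K-x}{P(K)}\in[1,\infty]$ (with $a/0=\infty$ for $a>0$ and $0/0=0$), and let $\underline x=\inf\{x>0:\varphi(x)<\infty\}$. Extend $\varphi$ to $(x_0,\infty)$ in any way such that $\varphi$ is convex, nonincreasing and nonnegative and $\lim_{x\to\infty}\varphi(x)=0$. (2) For $x\in(\underline x,\infty)$ let $s(x)=2\int_{x_0}^x\varphi(y)\,dy+x_0-x\varphi(x)$; $s$ is concave, increasing and continuous with $s(x_0)=0$. Write $s(\underline x)=\lim_{x\downarrow\underline x}s(x)$ and $s(\infty)=\lim_{x\uparrow\infty}s(x)$. If $\underline x>0$, put $s(0)=-\infty$. Let $g:(s(\underline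 x),s(\infty))\to(\underline x,\infty)$ be the inverse of $s$, and if $s(\underline x)>-\infty$ set $g(y)=\underline x$ for $y\le s(\underline x)$. Then $g$ is convex and nondecreasing with $g(0)=x_0$. Let $\bar g=\lim_{y\uparrow s(\infty)}g(y)\in(0,\infty]$. (3) Let $\nu$ be the Borel measure on $\mathbb{R}$ given on $(s(0),s(\infty))$ by $\nu(dy)=\frac1{2r}\frac{g''(dy)}{g(y)}$, where $g''(dy)$ is the second distributional derivative of $g$; if $\underline x=0$ and $s(0)>-\infty$, set $\nu(\{y\})=\infty$ for $y\le s(0)$; if $s(\infty)<\infty$, set $\nu(\{y\})=\infty$ for $y\ge s(\infty)$. (4) Let $B$ be a Brownian motion started at $0$ for a filtration $(\mathcal{F}^B_u)_{u\ge0}$, with local times $L^z_u$. Let $\Gamma$ be the left-continuous increasing additive functional $\Gamma_u=\int_{\mathbb{R}}L^z_u\,\nu(dz)$, $\Gamma_0=0$, and let $A_t=\inf\{u:\Gamma_u>t\}$ be its right-continuous inverse. Set $Z_0=0$ and $Z_t=B_{A_t}$ for $t>0$, and $\mathcal{F}_t=\mathcal{F}^B_{A_t}$. Let $\xi$ be the first explosion time of $\Gamma$, which is the first time $B$ hits $s(0)$ or $s(\infty)$. (5) Set $X_0=x_0$ and $X_t=g(Z_t)$ for $t<\Gamma_\xi$. If $\Gamma_\xi<\infty$ then: if $B_\xi=s(0)$, set $X_t=0$ for all $t\ge\Gamma_\xi$; if $B_\xi=s(\infty)$ (in which case necessarily $\bar g<\infty$), set $X_t=e^{r(t-\Gamma_\xi)}\bar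 g$ for all $t\ge\Gamma_\xi$. Conventions: $y^+=\max(y,0)$, and $e^{-r\tau}(K-X_\tau)^+$ is interpreted as $0$ on $\{\tau=\infty\}$.
   Formalization: At time 0 the filtration is taken as F_0 = F^B_0 instead of F^B_{A_0} (the latter reveals the jump of X right after 0 when ν vanishes near 0, and the claim then fails); F^B is assumed to satisfy the usual conditions, so that F^B_{A_t} is defined. *)

(* Defs.v *)
From HB Require Import structures.
From mathcomp Require Import all_boot all_order all_algebra.
From mathcomp Require Import all_classical all_reals all_analysis.

Set Implicit Arguments.
Unset Strict Implicit.
Unset Printing Implicit Defensive.

Import Order.TTheory GRing.Theory Num.Theory.
Import numFieldNormedType.Exports.

Local Open Scope classical_set_scope.
Local Open Scope ring_scope.

Section price_function.
Context {R : realType}.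
Implicit Types (x y : R) (P : R -> R) (phi : R -> \bar R).

(* Only the restriction of P to [0, +oo[ matters. *)
Record hypothesis_H (x0 : R) P : Prop := HypothesisH {
  H_bounds : forall K : R, 0 <= K -> Num.max (K - x0) 0 <= P K <= K ;
  H_nondecreasing : {in `[0, +oo[ &, {homo P : K1 K2 / K1 <= K2}} ;
  H_convex : convex_function (`[0, +oo[%classic : set R^o) P ;
  H_threshold : exists Kstar, [/\ x0 < Kstar,
      forall K : R, Kstar <= K -> P K = K - x0 &
      forall K : R, x0 <= K < Kstar -> K - x0 < P K] }.

(* Quotient of nonnegative reals with a / 0 = +oo for 0 < a, and 0 / 0 = 0. *)
Definition ediv0 (a b : R) : \bar R :=
  if b == 0 then (if a == 0 then 0%E else +oo%E) else (a / b)%:E.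

(* phi is given by P on ]0, x0], and on ]x0, +oo[ it is an arbitrary extension
   subject to the shape constraints, which are imposed on all of ]0, +oo[.
   Its values on ]-oo, 0] are irrelevant. *)
Record admissible_phi (x0 : R) P phi : Prop := AdmissiblePhi {
  phi_sup : forall x : R, 0 < x <= x0 ->
    phi x = ereal_sup [set ediv0 (K - x) (P K) | K in [set K | x <= K]] ;
  phi_convex : forall (t : R) x y, 0 <= t <= 1 -> 0 < x -> 0 < y ->
    (phi (t * x + (1 - t) * y)%R <= t%:E * phi x + (1 - t)%:E * phi y)%E ;
  phi_nonincreasing : forall x y, 0 < x -> x <= y -> (phi y <= phi x)%E ;
  phi_ge0 : forall x : R, 0 < x -> (0 <= phi x)%E ;
  phi_cvg0 : phi x @[x --> +oo] --> 0%E }.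

Definition x_low (x0 : R) phi : R := inf [set x | 0 < x <= x0 /\ (phi x < +oo)%E].

(* Integral from a to b, with the usual sign convention when b < a. *)
Definition oriented_integral (a b : R) (f : R -> R) : R :=
  if a <= b then \int[lebesgue_measure]_(y in `[a, b]) f y
  else - \int[lebesgue_measure]_(y in `[b, a]) f y.

Definition scale (x0 : R) phi x : R :=
  2 * oriented_integral x0 x (fun y => fine (phi y)) + x0 - x * fine (phi x).

Definition scale_low (x0 : R) phi : \bar R :=
  lim ((scale x0 phi x)%:E @[x --> (x_low x0 phi)^'+]).

Definition scale_infty (x0 : R) phi : \bar R :=
  lim ((scale x0 phi x)%:E @[x --> +oo]).

Definition scale_zero (x0 : R) phi : \bar R :=
  if 0 < x_low x0 phi then -oo%E else scale_low x0 phi.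

(* Where the scale function is below its supremum it is strictly increasing,
   so the preimage below is unique for y in ]scale_low, scale_infty[.
   The value for y >= scale_infty is irrelevant. *)
Definition inv_scale (x0 : R) phi y : R :=
  if (y%:E <= scale_low x0 phi)%E then x_low x0 phi
  else xget (x_low x0 phi) [set x | x_low x0 phi < x /\ scale x0 phi x = y].

Definition inv_scale_sup (x0 : R) phi : \bar R :=
  let g := inv_scale x0 phi in
  if scale_infty x0 phi is c%:E then lim ((g y)%:E @[y --> c^'-])
  else lim ((g y)%:E @[y --> +oo]).

End price_function.

Section speed_measure.
Context {R : realType}.

Definition test_function (a b : \bar R) (psi : R -> R) : Prop :=
  (forall n x, derivable (derive1n n psi : R -> R^o) x 1) /\
  exists c e : R, [/\ (a < c%:E)%E, (e%:E < b)%E &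
                      forall x, ~ (c <= x <= e) -> psi x = 0].

(* The Radon measure mu on ]a, b[ is the second distributional derivative of g
   on ]a, b[; the values of mu outside ]a, b[ are irrelevant. *)
Definition is_second_distributional_derivative (a b : \bar R) (g : R -> R)
    (mu : {measure set R -> \bar R}) : Prop :=
  let I := [set y : R | (a < y%:E < b)%E] in
  (forall c e : R, (a < c%:E)%E -> (e%:E < b)%E ->
    (mu `[c, e]%classic < +oo)%E) /\
  (forall psi, test_function a b psi ->
    (\int[mu]_(y in I) (psi y)%:E =
     \int[lebesgue_measure]_(y in I) (g y * derive1n 2 psi y)%:E)%E).

(* These requirements determine nu on all Borel sets. *)
Record is_speed_measure (r x0 : R) (phi : R -> \bar R)
    (nu : {measure set R -> \bar R}) : Prop := IsSpeedMeasure {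
  speed_interior : exists2 g2 : {measure set R -> \bar R},
    is_second_distributional_derivative
      (scale_zero x0 phi) (scale_infty x0 phi) (inv_scale x0 phi) g2 &
    forall S : set R, measurable S ->
      S `<=` [set y : R | (scale_zero x0 phi < y%:E < scale_infty x0 phi)%E] ->
      nu S = (((2 * r)^-1)%:E *
              \int[g2]_(y in S) ((inv_scale x0 phi y)^-1)%:E)%E ;
  speed_left : x_low x0 phi = 0 -> (-oo < scale_zero x0 phi)%E ->
    forall y : R, (y%:E <= scale_zero x0 phi)%E -> nu [set y] = +oo%E ;
  speed_right : (scale_infty x0 phi < +oo)%E ->
    forall y : R, (scale_infty x0 phi <= y%:E)%E -> nu [set y] = +oo%E }.

End speed_measure.

(* Time is indexed by R, and only times t >= 0 matter. *)
Section brownian_motion.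
Context {R : realType} {d : measure_display} {T : measurableType d}.
Variable Pr : probability T R.
Implicit Types (F : R -> set (set T)) (B : R -> T -> R).

(* Filtration satisfying the usual conditions. *)
Record usual_filtration F : Prop := UsualFiltration {
  filtration_sigma_algebra : forall t : R, 0 <= t -> sigma_algebra setT (F t) ;
  filtration_measurable : forall t : R, 0 <= t -> F t `<=` measurable ;
  filtration_nondecreasing : forall s t : R, 0 <= s -> s <= t -> F s `<=` F t ;
  filtration_right_continuous : forall t : R, 0 <= t ->
    \bigcap_(s in [set s | t < s]) F s `<=` F t ;
  filtration_complete : forall N, Pr.-negligible N -> F 0 N }.

Definition increment B (s t : R) (w : T) : R := B t w - B s w.

Record brownian_motion F B : Prop := BrownianMotion {
  bm_adapted : forall t : R, 0 <= t ->
    forall S : set R, measurable S -> F t (B t @^-1` S) ;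
  bm_start : {ae Pr, forall w, B 0 w = 0} ;
  bm_increment : forall s t : R, 0 <= s -> s < t ->
    forall S : set R, measurable S ->
    Pr (increment B s t @^-1` S) = normal_prob 0 (Num.sqrt (t - s)) S ;
  bm_independent : forall s t : R, 0 <= s -> s < t ->
    forall (A : set T) (S : set R), F s A -> measurable S ->
    Pr (A `&` increment B s t @^-1` S) =
      (Pr A * Pr (increment B s t @^-1` S))%E ;
  bm_continuous :
    {ae Pr, forall w, {within `[0, +oo[, continuous (fun t => B t w)}} }.

(* L z u w is the local time at level z up to time u: the jointly continuous
   density, with respect to Lebesgue measure, of the occupation measure
   (so that Tanaka's formula reads |B_u - z| = |z| + int sgn(B - z) dB + L). *)
Definition is_local_time B (L : R -> R -> T -> R) : Prop :=
  {ae Pr, forall w,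
    {within [set zu : R * R | 0 <= zu.2],
       continuous (fun zu => L zu.1 zu.2 w)} /\
    forall (u : R) (S : set R), 0 <= u -> measurable S ->
      lebesgue_measure [set s : R | 0 <= s <= u /\ S (B s w)] =
      (\int[lebesgue_measure]_(z in S) (L z u w)%:E)%E}.

End brownian_motion.

Section stopping.
Context {R : realType} {d : measure_display} {T : measurableType d}.

Definition stopping_time (F : R -> set (set T)) (tau : T -> \bar R) : Prop :=
  (forall w, (0 <= tau w)%E) /\
  (forall t : R, 0 <= t -> F t [set w | (tau w <= t%:E)%E]).

Definition stopped_sigma_algebra (F : R -> set (set T)) (tau : T -> \bar R)
    : set (set T) :=
  [set A | measurable A /\
     forall t : R, 0 <= t -> F t (A `&` [set w | (tau w <= t%:E)%E])].

End stopping.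

Section construction.
Context {R : realType} {d : measure_display} {T : measurableType d}.
Variables (nu : {measure set R -> \bar R}) (L : R -> R -> T -> R).
Implicit Types (F : R -> set (set T)) (B : R -> T -> R).

Definition additive_functional (u : R) (w : T) : \bar R :=
  (\int[nu]_z (L z u w)%:E)%E.

Definition time_change (t : R) (w : T) : \bar R :=
  ereal_inf [set u%:E | u in
               [set u | 0 <= u /\ (t%:E < additive_functional u w)%E]].

Definition explosion_time (w : T) : \bar R :=
  ereal_inf [set u%:E | u in
               [set u | 0 <= u /\ additive_functional u w = +oo%E]].

Definition additive_functional_at_explosion (w : T) : \bar R :=
  if explosion_time w is u%:E then additive_functional u w
  else lim (additive_functional u w @[u --> +oo]).

(* The time change is almost surely finite, so the value of fine at +oo is
   irrelevant. *)
Definition time_changed_bm B (t : R) (w : T) : R :=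
  if t <= 0 then 0 else B (fine (time_change t w)) w.

(* Z is defined as B at the time change for t > 0 only, with Z_0 = 0 = B_0;
   correspondingly the sigma-algebra at time 0 is that of B at time 0.
   The two differ when nu vanishes near 0: then time_change 0 > 0 and Z, hence
   X, jumps right after time 0.  The sigma-algebra of B stopped at
   time_change 0 already reveals that jump, whereas X_0 = x0, and using it at
   time 0 would let an option holder look ahead. *)
Definition time_changed_filtration F (t : R) : set (set T) :=
  if t <= 0 then F 0 else stopped_sigma_algebra F (time_change t).

Definition stock (r x0 : R) (phi : R -> \bar R) B (t : R) (w : T) : R :=
  let G := additive_functional_at_explosion w in
  if t <= 0 then x0
  else if (t%:E < G)%E then inv_scale x0 phi (time_changed_bm B t w)
  else if (B (fine (explosion_time w)) w)%:E == scale_zero x0 phi then 0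
  else expR (r * (t - fine G)) * fine (inv_scale_sup x0 phi).

End construction.

Definition discounted_put {R : realType} {T : Type} (r K : R) (X : R -> T -> R)
    (tau : T -> \bar R) (w : T) : R :=
  if tau w is t%:E then expR (- (r * t)) * Num.max (K - X t w) 0 else 0.

(* Main.v *)
Require Import Defs.
From HB Require Import structures.
From mathcomp Require Import all_boot all_order all_algebra.
From mathcomp Require Import all_classical all_reals all_analysis.
From mathcomp Require Import measurable_realfun ring lra.

Set Implicit Arguments.
Unset Strict Implicit.
Unset Printing Implicit Defensive.

Import Order.TTheory GRing.Theory Num.Theory.
Import numFieldNormedType.Exports.

Local Open Scope classical_set_scope.
Local Open Scope ring_scope.

(* Let g be the inverse scale, f = phi, I = ]s(0), s(oo)[ and Gamma the additive functional.  On I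
   put h = f o g, continued linearly below s(x_low).  Convexity of f gives (h / g)' = - 1 / g^2, so h
   solves the same equation g'' = 2 r nu g as g (reduction of order), and exp(- r Gamma_u) g(B_u) and
   exp(- r Gamma_u) h(B_u) are martingales up to the exit from I.  This is shown without stochastic
   calculus: for smooth g, by comparing exp(- int c(B)) F(B), where F'' = 2 c F, with products over
   a time grid; in general, by mollifying g, which turns the killing rate into a density whose
   integral along the path is, by the occupation formula, an integral of local times converging to
   r Gamma.

   Upper bound: (K - g)^+ <= P(K) h on I when K < K*, so Fatou's lemma and h(0) = 1 bound the value
   of any stopping rule by P(K).  Lower bound: exercise when B first goes below a level y, that is,
   when X reaches x = g(y).  Optional stopping of h(B) gives E[exp(- r tau)] = 1 / f(x), up to the
   paths on which h is small, and the value (K - x) / f(x) has supremum P(K) by convex duality. *)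

(** * Integrals of nonmeasurable functions and Gaussian moments *)

(** A payoff stopped by an arbitrary rule may be nonmeasurable; its expectation is a lower integral,
    so every bound is an almost sure comparison with a measurable majorant or minorant. Three
    obstacles shape the rest. On levels that [nu] does not charge, Gamma is flat and its inverse
    jumps, so [X] can jump over the intended exercise level; the lower bound exercises once the
    level has been passed, and recovers the mean price at that moment from the martingale of [g]. To
    the right of the spot phi is an arbitrary convex extension, so the majorant of the payoff is
    available only for strikes below the threshold; larger strikes are reached from strikes just
    below it, the payoff being 1-Lipschitz in the strike. Finally the ends of I need path
    properties: on reaching a finite end, B almost surely goes strictly beyond it at once, which
    makes Gamma infinite immediately afterwards; and a bound on the mean of the discounted [g]
    excludes reaching an end where [g] is unbounded. *)

Section integral_complements.
Context d (T : measurableType d) (R : realType).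
Local Open Scope ereal_scope.
Import HBNNSimple.

(* The integral of a nonnegative function is a lower integral, so neither function has to be
   measurable. *)
Lemma ge0_ae_le_integral_nonmeasurable (mu : {measure set T -> \bar R})
    (f g : T -> \bar R) :
  (forall x, 0 <= f x) -> (forall x, 0 <= g x) ->
  {ae mu, forall x, f x <= g x} -> \int[mu]_x f x <= \int[mu]_x g x.
Proof.
move=> f0 g0 [N [mN muN fgN]].
rewrite !ge0_integralTE//; apply: ge_ereal_sup => /= _ [h hf <-].
have mNC : measurable (~` N) by exact: measurableC.
have -> : sintegral mu h = sintegral mu (proj_nnsfun h mNC).
  rewrite -mrestrict -integral_nnsfun// -[sintegral mu h](_ : \int[mu]_x (h x)%:E = _).
    rewrite (ge0_negligible_integral _ _ _ _ muN)//.
    - by rewrite setTD.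
    - exact/measurable_EFinP.
    - by move=> x _; rewrite lee_fin.
  by rewrite integral_nnsfun// patch_setT.
apply: ereal_sup_ubound; exists (proj_nnsfun h mNC) => //= x.
rewrite mindicE; have [xN|_] := boolP (x \in ~` N); last by rewrite mulr0.
rewrite mulr1; apply: (le_trans (hf x)); apply: contrapT => fgx.
by move: xN; rewrite inE; apply; exact: fgN.
Qed.

(** Simple functions and monotone convergence. The measures are arbitrary because the lemma is
    applied to [nu], which may give infinite mass to points. *)
Lemma ge0_integral_density (m1 m2 : {measure set T -> \bar R}) (D : set T)
    (k : T -> R) (f : T -> \bar R) :
  measurable D -> measurable_fun D k -> (forall x, D x -> 0 <= k x)%R ->
  (forall S, measurable S -> S `<=` D -> m1 S = \int[m2]_(x in S) (k x)%:E) ->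
  measurable_fun D f -> (forall x, D x -> 0 <= f x) ->
  \int[m1]_(x in D) f x = \int[m2]_(x in D) (f x * (k x)%:E).
Proof.
move=> mD mk k0 m1E mf f0.
pose f_ := nnsfun_approx mD mf.
have mEk : measurable_fun D (EFin \o k) by exact/measurable_EFinP.
transitivity (limn (fun n => \int[m1]_(x in D) (f_ n x)%:E)).
  rewrite -monotone_convergence//.
  - apply: eq_integral => y /[!inE] yD; apply/esym/cvg_lim => //.
    exact: cvg_nnsfun_approx.
  - by move=> n; exact/measurable_EFinP/measurable_funP.
  - by move=> n y _; rewrite lee_fin.
  - by move=> y _ m n mn; rewrite lee_fin; exact/lefP/nd_nnsfun_approx.
transitivity (limn (fun n => \int[m2]_(x in D) ((f_ n x)%:E * (k x)%:E))); last first.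
  rewrite -monotone_convergence//.
  - apply: eq_integral => y /[!inE] yD; apply/cvg_lim => //.
    by apply: cvgeZr => //; exact: cvg_nnsfun_approx.
  - by move=> n; apply: emeasurable_funM => //; exact/measurable_EFinP/measurable_funTS.
  - by move=> n y yD; rewrite mule_ge0// lee_fin ?k0.
  - move=> y yD m n mn; apply: lee_wpmul2r; first by rewrite lee_fin k0.
    by rewrite lee_fin; exact/lefP/nd_nnsfun_approx.
congr (limn _); apply/funext => n.
have mfn r : measurable (f_ n @^-1` [set r]) by exact: measurable_sfunP.
transitivity (\sum_(r \in range (f_ n))
    \int[m1]_(x in D) (r * \1_(f_ n @^-1` [set r]) x)%:E).
  under eq_integral do rewrite fimfunE -fsumEFin//.
  rewrite ge0_integral_fsum//.
  - by move=> y; exact/measurable_EFinP/measurable_funM.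
  - by move=> y x _; rewrite nnfun_muleindic_ge0.
transitivity (\sum_(r \in range (f_ n))
    \int[m2]_(x in D) ((r * \1_(f_ n @^-1` [set r]) x)%:E * (k x)%:E)).
  apply: eq_fsbigr => r; rewrite inE => -[x0 _ fx0].
  have r0 : (0 <= r)%R by rewrite -fx0.
  rewrite integralZl_indic_nnsfun//; rewrite integral_indic//.
  rewrite m1E; [|exact: measurableI|by move=> ? []].
  under [RHS]eq_integral do rewrite EFinM -muleA.
  rewrite ge0_integralZl_EFin//; first last.
  - by apply: emeasurable_funM => //; exact/measurable_EFinP/measurable_funTS.
  - by move=> x xD; rewrite mule_ge0// lee_fin ?k0.
  congr (_ * _); rewrite setIC integral_mkcondr; apply: eq_integral => x xD.
  rewrite patchE indicE; case: ifPn => h; first by rewrite mul1e.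
  by rewrite mul0e.
rewrite -ge0_integral_fsum//.
- apply: eq_integral => x _; rewrite -ge0_mule_fsuml; last first.
    by move=> r; rewrite nnfun_muleindic_ge0.
  by rewrite fsumEFin// -fimfunE.
- move=> r; apply: emeasurable_funM => //.
  by apply/measurable_EFinP/measurable_funM.
- by move=> r x xD; rewrite mule_ge0 ?nnfun_muleindic_ge0 ?lee_fin ?k0.
Qed.

End integral_complements.

Section gaussian_moments.
Context {R : realType}.
Notation mu := (@lebesgue_measure R).

Lemma is_derive_FTC2 (f F : R -> R) (a b : R) : a < b -> continuous f ->
  (forall x : R, is_derive x 1 F (f x)) ->
  (\int[mu]_(x in `[a, b]) (f x)%:E)%E = (F b - F a)%:E.
Proof.
move=> ab cf dF; have cF x : {for x, continuous F}.
  by apply: differentiable_continuous; apply/derivable1_diffP; have [] := dF x.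
rewrite (@continuous_FTC2 _ f F)//; first exact: continuous_subspaceT.
- split; first by move=> x _; have [] := dF x.
  + by apply: cvg_at_right_filter; exact: cF.
  + by apply: cvg_at_left_filter; exact: cF.
- by move=> x _; rewrite derive1E; have [] := dF x.
Qed.

Lemma is_derive_FTC2y (f F : R -> R) (a l : R) : continuous f ->
  (forall x, a <= x -> 0 <= f x) ->
  (forall x : R, is_derive x 1 F (f x)) -> F x @[x --> +oo] --> l ->
  (\int[mu]_(x in `[a, +oo[) (f x)%:E)%E = (l - F a)%:E.
Proof.
move=> cf f0 dF Fl; have cF x : {for x, continuous F}.
  by apply: differentiable_continuous; apply/derivable1_diffP; have [] := dF x.
rewrite (@ge0_continuous_FTC2y _ f F a l)//; first exact: continuous_subspaceT.
- by apply: cvg_at_right_filter; exact: cF.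
- by move=> x _; rewrite derive1E; have [] := dF x.
Qed.

Variable s : R.
Hypothesis s0 : 0 < s.

Let G (x : R) : R := normal_fun 0 s x.

Let GE x : G x = expR (- (x ^+ 2 / (s ^+ 2 *+ 2))).
Proof. by rewrite /G /normal_fun subr0 mulNr. Qed.

Let G0 x : 0 < G x. Proof. by rewrite GE expR_gt0. Qed.

Let dG (x : R) : is_derive x 1 G (- (x / s ^+ 2) * G x).
Proof.
have -> : G = expR \o (fun x : R => - ((s ^+ 2 *+ 2)^-1 * x ^+ 2)).
  by apply/funext => y /=; rewrite GE mulrC.
apply: is_derive_eq; rewrite /GRing.scale/=.
by field; rewrite gt_eqF.
Qed.

Let cG : continuous G.
Proof.
move=> x; apply: differentiable_continuous; apply/derivable1_diffP.
by have [] := dG x.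
Qed.

(** With [t = x ^+ 2 / (2 * s ^+ 2)], the bound [t ^+ 2 / 2 <= expR t] gives
    [x ^+ 2 * G x <= 8 * s ^+ 4 / x ^+ 2], which is at most [8 * s ^+ 4 / x] for [1 <= x]. *)
Let x2G_cvg0 : x ^+ 2 * G x @[x --> +oo] --> 0.
Proof.
apply: (@squeeze_cvgr _ _ _ _ (cst 0) (fun x => 8 * s ^+ 4 * x^-1)).
- near=> x; have x1 : 1 <= x by near: x; exact: nbhs_pinfty_ge.
  have x0 : 0 < x by lra.
  apply/andP; split; first by rewrite mulr_ge0 ?sqr_ge0// ltW.
  set t := x ^+ 2 / (s ^+ 2 *+ 2).
  have t0 : 0 < t by rewrite divr_gt0 ?exprn_gt0// pmulrn_lgt0 ?exprn_gt0.
  have tge : t ^+ 2 / 2 <= expR t.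
    have := @expR_ge1Dxn R t 1 (ltW t0); rewrite (_ : 2`! = 2)%N//; lra.
  rewrite GE -/t expRN.
  have et0 := expR_gt0 t.
  rewrite ler_pdivrMr//.
  apply: (@le_trans _ _ (8 * s ^+ 4 * x^-1 * (t ^+ 2 / 2))); last first.
    by rewrite ler_pM2l// mulr_gt0 ?invr_gt0// mulr_gt0// exprn_gt0.
  have -> : 8 * s ^+ 4 * x^-1 * (t ^+ 2 / 2) = x ^+ 3.
    by rewrite /t; field; rewrite !gt_eqF.
  by rewrite [leRHS]exprS ler_peMl// sqr_ge0.
- exact: cvg_cst.
- rewrite -[X in _ --> X](mulr0 (8 * s ^+ 4)); apply: cvgM; first exact: cvg_cst.
  by apply/gtr0_cvgV0; [exact: nbhs_pinfty_gt|exact: cvg_id].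
Unshelve. all: by end_near. Qed.

Let xG_cvg0 : x * G x @[x --> +oo] --> 0.
Proof.
apply: (@squeeze_cvgr _ _ _ _ (cst 0) (fun x => x ^+ 2 * G x)) => //.
- near=> x; have x1 : 1 <= x by near: x; exact: nbhs_pinfty_ge.
  apply/andP; split; first by rewrite mulr_ge0 ?(ltW (G0 _))//; lra.
  by rewrite ler_pM2r// expr2 ler_peMl//; lra.
- exact: cvg_cst.
Unshelve. all: by end_near. Qed.

Let G_cvg0 : G x @[x --> +oo] --> 0.
Proof.
apply: (@squeeze_cvgr _ _ _ _ (cst 0) (fun x => x ^+ 2 * G x)) => //.
- near=> x; have x1 : 1 <= x by near: x; exact: nbhs_pinfty_ge.
  apply/andP; split; first exact: ltW.
  rewrite ler_peMl//; first exact: ltW.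
  by rewrite expr2; nra.
- exact: cvg_cst.
Unshelve. all: by end_near. Qed.

Let int_x3 : (\int[mu]_(x in `[0%R, +oo[) (x ^+ 3 * G x)%:E)%E = (2 * s ^+ 4)%:E.
Proof.
pose F := fun x : R => - s ^+ 2 * (x ^+ 2 * G x + 2 * s ^+ 2 * G x).
have dF (x : R) : is_derive x 1 F (x ^+ 3 * G x).
  apply: is_derive_eq; rewrite /GRing.scale/= -[expR _]/(G x).
  by field; rewrite gt_eqF.
rewrite (@is_derive_FTC2y _ F _ 0 _ _ dF).
- have G00 : G 0 = 1 by rewrite GE expr0n/= mul0r oppr0 expR0.
  by rewrite /F G00; congr (_%:E); ring.
- by move=> x; apply: cvgM; [exact: exprn_continuous|exact: cG].
- by move=> x x0; rewrite mulr_ge0 ?exprn_ge0// (ltW (G0 _)).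
- rewrite -[X in _ --> X](_ : - s ^+ 2 * (0 + 2 * s ^+ 2 * 0) = _); last by ring.
  apply: cvgM; first exact: cvg_cst.
  by apply: cvgD => //; apply: cvgM => //; exact: cvg_cst.
Qed.

(** The difference of the integrands has the primitive [- s ^+ 2 * (x * G x)], but it changes sign
    at [s]. Cutting there leaves two differences of constant sign, whose boundary term
    [s ^+ 3 * G s] is the same on both sides. *)
Let int_x2 : (\int[mu]_(x in `[0%R, +oo[) (x ^+ 2 * G x)%:E =
  \int[mu]_(x in `[0%R, +oo[) (s ^+ 2 * G x)%:E)%E.
Proof.
have c1 : continuous (fun x : R => x ^+ 2 * G x).
  by move=> x; apply: cvgM; [exact: exprn_continuous|exact: cG].
have c2 : continuous (fun x : R => s ^+ 2 * G x).
  by move=> x; apply: cvgM; [exact: cvg_cst|exact: cG].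
have m1 (D : set R) : measurable D -> measurable_fun D (fun x => (x ^+ 2 * G x)%:E).
  move=> mD; apply/measurable_EFinP; apply: measurable_funTS.
  exact: continuous_measurable_fun.
have m2 (D : set R) : measurable D -> measurable_fun D (fun x => (s ^+ 2 * G x)%:E).
  move=> mD; apply/measurable_EFinP; apply: measurable_funTS.
  exact: continuous_measurable_fun.
have F2 (x : R) : is_derive x 1 (fun x => - s ^+ 2 * (x * G x)) (x ^+ 2 * G x - s ^+ 2 * G x).
  apply: is_derive_eq; rewrite /GRing.scale/= -[expR _]/(G x).
  by field; rewrite gt_eqF.
have p1 x : (0 <= (x ^+ 2 * G x)%:E)%E by rewrite lee_fin mulr_ge0 ?sqr_ge0// ltW.
have p2 x : (0 <= (s ^+ 2 * G x)%:E)%E by rewrite lee_fin mulr_ge0 ?sqr_ge0// ltW.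
have split0 : (`[0%R, +oo[ = `[0, s] `|` `]s, +oo[ :> set R)%classic.
  apply/seteqP; split=> x /=; rewrite !in_itv/= ?andbT.
    by move=> x0; have [xs|sx] := leP x s; [left; rewrite x0|right].
  by case=> [/andP[]|] //; move=> /ltW; exact/le_trans/ltW.
have dj : [disjoint `[0, s]%classic & `]s, +oo[%classic].
  apply/disj_setPS => x /= [] /=; rewrite !in_itv/= andbT => /andP[_ xs].
  by rewrite ltNge xs.
have i1 : (\int[mu]_(x in `[0%R, s]) (s ^+ 2 * G x)%:E =
    (s ^+ 3 * G s)%:E + \int[mu]_(x in `[0%R, s]) (x ^+ 2 * G x)%:E)%E.
  rewrite -[(s ^+ 3 * G s)%:E](_ : \int[mu]_(x in `[0%R, s]) (s ^+ 2 * G x - x ^+ 2 * G x)%:E = _)%E; last first.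
    have F2' (x : R) : is_derive x 1 (fun x => s ^+ 2 * (x * G x))
        (s ^+ 2 * G x - x ^+ 2 * G x).
      apply: is_derive_eq; rewrite /GRing.scale/= -[expR _]/(G x).
  by field; rewrite gt_eqF.
    rewrite (is_derive_FTC2 _ _ F2')//.
    - by rewrite mul0r mulr0 subr0 mulrA -exprSr.
    - by move=> x; apply: cvgB; [exact: c2|exact: c1].
  rewrite -ge0_integralD//.
  - by apply: eq_integral => x _; rewrite -EFinD; congr (_%:E); ring.
  - move=> x; rewrite /= in_itv/= => /andP[x0 xs].
    by rewrite lee_fin -mulrBl mulr_ge0 ?(ltW (G0 _))// subr_ge0 lerXn2r ?nnegrE// ltW.
  - apply/measurable_EFinP; apply: measurable_funTS.
    apply: continuous_measurable_fun => x; apply: cvgB; [exact: c2|exact: c1].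
  - exact: m1.
have i2 : (\int[mu]_(x in `[s, +oo[) (x ^+ 2 * G x)%:E =
    (s ^+ 3 * G s)%:E + \int[mu]_(x in `[s, +oo[) (s ^+ 2 * G x)%:E)%E.
  rewrite -[(s ^+ 3 * G s)%:E](_ : \int[mu]_(x in `[s, +oo[) (x ^+ 2 * G x - s ^+ 2 * G x)%:E = _)%E; last first.
    rewrite (@is_derive_FTC2y _ _ _ 0 _ _ F2)//.
    - by congr (_%:E); ring.
    - by move=> x; apply: cvgB; [exact: c1|exact: c2].
    - move=> x sx; rewrite -mulrBl mulr_ge0 ?(ltW (G0 _))// subr_ge0 lerXn2r ?nnegrE//.
        exact: ltW.
      by apply: (le_trans _ sx); exact: ltW.
    - rewrite -[X in _ --> X](mulr0 (- s ^+ 2)).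
      by apply: cvgM => //; exact: cvg_cst.
  rewrite -ge0_integralD//.
  - by apply: eq_integral => x _; rewrite -EFinD; congr (_%:E); ring.
  - move=> x; rewrite /= in_itv/= andbT => sx.
    rewrite lee_fin -mulrBl mulr_ge0 ?(ltW (G0 _))// subr_ge0 lerXn2r ?nnegrE//.
      exact: ltW.
    by apply: (le_trans _ sx); exact: ltW.
  - apply/measurable_EFinP; apply: measurable_funTS.
    apply: continuous_measurable_fun => x; apply: cvgB; [exact: c1|exact: c2].
  - exact: m2.
rewrite split0 !ge0_integral_setU//; try by [apply: m1|apply: m2|apply: m1; exact: measurableU|apply: m2; exact: measurableU].
rewrite !integral_itv_obnd_cbnd; try by [apply: m1|apply: m2].
by rewrite i1 i2 addeA [X in (X + _)%E]addeC.
Qed.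

Let pdfE x : normal_pdf 0 s x = normal_peak s * G x.
Proof. by rewrite normal_pdfE// gt_eqF. Qed.

Let integral_normal_prob (f : R -> R) : measurable_fun setT f ->
  (forall x, 0 <= f x) ->
  (\int[normal_prob 0 s]_x (f x)%:E = \int[mu]_x (f x * normal_pdf 0 s x)%:E)%E.
Proof.
move=> mf f0; rewrite (@ge0_integral_density _ _ _ _ mu setT (normal_pdf 0 s))//.
- exact: measurable_normal_pdf.
- by move=> x _; exact: normal_pdf_ge0.
- exact/measurable_EFinP.
- by move=> x _; rewrite lee_fin.
Qed.

Let peak_half (f : R -> R) (l : R) : continuous f -> (forall x, 0 <= f x) ->
  (forall x, f (- x) = f x) ->
  (\int[mu]_(x in `[0%R, +oo[) (f x * G x)%:E = l%:E ->
  \int[normal_prob 0 s]_x (f x)%:E = (normal_peak s * (2 * l))%:E)%E.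
Proof.
move=> cf f0 fN fl; rewrite integral_normal_prob//; last first.
  exact: continuous_measurable_fun.
have cfG : continuous (fun x => f x * G x).
  by move=> x; apply: cvgM; [exact: cf|exact: cG].
under eq_integral do rewrite pdfE mulrCA EFinM.
rewrite ge0_integralZl_EFin//; last 3 first.
- by move=> x _; rewrite lee_fin mulr_ge0// ltW.
- by apply/measurable_EFinP; exact: continuous_measurable_fun.
- exact: normal_peak_ge0.
rewrite ge0_symfun_integralT//; first by rewrite -set_itvcy fl.
- by move=> x; rewrite mulr_ge0// ltW.
- by move=> x /=; rewrite fN !GE sqrrN.
Qed.

(** The mass [m] of a half line stays unspecified: its relation to the peak, read off from the
    normalisation of the density, replaces the value of the Gaussian integral. *)
Let half_mass : exists2 m : R, (\int[mu]_(x in `[0%R, +oo[) (G x)%:E = m%:E)%E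
  & normal_peak s * (2 * m) = 1.
Proof.
have p0 : 0 < normal_peak s by rewrite normal_peak_gt0// gt_eqF.
have : (\int[mu]_x (normal_pdf 0 s x)%:E = 1)%E by exact: integral_normal_pdf.
under eq_integral do rewrite pdfE EFinM.
rewrite ge0_integralZl_EFin//; last 3 first.
- by move=> x _; rewrite lee_fin ltW.
- by apply/measurable_EFinP; exact: continuous_measurable_fun.
- exact: normal_peak_ge0.
rewrite ge0_symfun_integralT//; last 2 first.
- by move=> x; rewrite ltW.
- by move=> x /=; rewrite !GE sqrrN.
rewrite -set_itvcy; move: (integral _ _ _) => [r|//|]; last first.
- by rewrite mulrNy/= gtr0_sg// mul1e mulrNy/= gtr0_sg// mul1e.
- by rewrite mulry/= gtr0_sg// mul1e mulry/= gtr0_sg// mul1e.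
- by rewrite -!EFinM => -[rE]; exists r.
Qed.

Lemma normal_second_moment :
  (\int[normal_prob 0 s]_x (x ^+ 2)%:E = (s ^+ 2)%:E)%E.
Proof.
have [m mE hm] := half_mass.
rewrite (@peak_half _ (s ^+ 2 * m)).
- by congr (_%:E); transitivity (s ^+ 2 * (normal_peak s * (2 * m)));
    [ring|rewrite hm mulr1].
- exact: exprn_continuous.
- by move=> x; rewrite sqr_ge0.
- by move=> x; rewrite sqrrN.
rewrite int_x2; under eq_integral do rewrite EFinM.
rewrite ge0_integralZl_EFin//.
- by rewrite mE.
- by move=> x _; rewrite lee_fin ltW.
- apply/measurable_EFinP; apply: measurable_funTS.
  exact: continuous_measurable_fun.
- exact: sqr_ge0.
Qed.

Let peak_le : normal_peak s <= s^-1.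
Proof.
rewrite /normal_peak lef_pV2 ?posrE//; last first.
  by rewrite sqrtr_gt0 pmulrn_lgt0// mulr_gt0 ?exprn_gt0 ?pi_gt0.
rewrite -[leLHS]gtr0_norm// -sqrtr_sqr ler_wsqrtr// mulr2n.
have := pi_ge2 R; have : 0 < s ^+ 2 by rewrite exprn_gt0.
by move: (s ^+ 2) => t ? ?; nra.
Qed.

(** The constant is twice the half-line integral [2 * s ^+ 4], with the peak bounded by [s^-1]. *)
Lemma normal_third_moment :
  (\int[normal_prob 0 s]_x (`|x| ^+ 3)%:E <= (4 * s ^+ 3)%:E)%E.
Proof.
have cabs3 : continuous (fun x : R => `|x| ^+ 3).
  move=> x; apply: (@continuous_comp _ _ _ (fun x : R => `|x|) (fun x : R => x ^+ 3)).
    exact: norm_continuous.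
  exact: exprn_continuous.
rewrite (@peak_half _ (2 * s ^+ 4)).
- rewrite lee_fin; apply: (@le_trans _ _ (s^-1 * (2 * (2 * s ^+ 4)))).
    by rewrite ler_wpM2r// !mulr_ge0 ?exprn_ge0 ?ltW.
  by rewrite le_eqVlt; apply/orP; left; apply/eqP; field; rewrite gt_eqF.
- exact: cabs3.
- by move=> x; rewrite exprn_ge0.
- by move=> x; rewrite normrN.
rewrite -int_x3; apply: eq_integral => x; rewrite inE/= in_itv/= andbT => x0.
by rewrite ger0_norm.
Qed.

Lemma normal_first_moment_integrable :
  (normal_prob 0 s).-integrable setT (fun x : R => x%:E).
Proof.
apply/integrableP; split; first exact/measurable_EFinP.
apply: (@le_lt_trans _ _ (\int[normal_prob 0%R s]_x (1 + x ^+ 2)%:E)%E).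
  apply: ge0_le_integral => //.
  - by apply: measurableT_comp => //; exact: EFin_measurable.
  - apply/measurable_EFinP; apply: measurable_funD => //.
  - move=> x _ /=; rewrite lee_fin ler_norml; apply/andP; split; nra.
under eq_integral do rewrite EFinD.
rewrite ge0_integralD//.
- rewrite normal_second_moment integral_cst// mul1e.
  by rewrite [X in (X + _)%E](@probability_setT _ _ _ (normal_prob 0 s)) ltry.
- by move=> x _; rewrite lee_fin sqr_ge0.
- by apply/measurable_EFinP; apply: measurable_funX.
Qed.

(** The centred Gaussian law is invariant under reflection, so its mean equals its own opposite. *)
Lemma normal_first_moment : (\int[normal_prob 0 s]_x x%:E = 0)%E.
Proof.
have ix := normal_first_moment_integrable.
have mN : measurable_fun setT (-%R : R -> R) by exact: oppr_measurable.
have NE (A : set R) : measurable A -> A `<=` setT ->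
    normal_prob 0 s A = pushforward (normal_prob 0 s) (-%R : R -> measurableTypeR R) A.
  move=> mA _; rewrite /pushforward /normal_prob.
  have mNA : measurable (-%R @^-1` A) by rewrite -[X in measurable X]setTI; exact: mN.
  transitivity (\int[pushforward mu (-%R : R -> measurableTypeR R)]_(x in A) (normal_pdf 0 s x)%:E)%E.
    apply: eq_measure_integral => D mD _; rewrite -[LHS]lebesgue_measureN//.
  rewrite ge0_integral_pushforward//.
  - by apply: eq_integral => x _ /=; rewrite !pdfE !GE sqrrN.
  - apply/measurable_EFinP; apply: measurable_funTS; exact: measurable_normal_pdf.
  - by move=> x _; rewrite lee_fin normal_pdf_ge0.
have : (\int[normal_prob 0 s]_x x%:E = - \int[normal_prob 0 s]_x x%:E)%E.
  rewrite [LHS](eq_measure_integral (pushforward (normal_prob 0 s) (-%R : R -> measurableTypeR R)))//.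
  rewrite integral_pushforward//.
  - rewrite preimage_setT -integralN//; last first.
      exact: integrable_add_def.
  - rewrite preimage_setT (_ : _ \o _ = (fun x => - x%:E)%E)//.
    exact: integrableN.
have := integrable_fin_num measurableT ix.
by move=> /fineK <-; rewrite -EFinN; case; set m := fine _ => h; congr EFin; lra.
Qed.

End gaussian_moments.

(** * Riemann products converging to the exponential of an integral *)

Section riemann_products.
Context {R : realType}.
Notation mu := (@lebesgue_measure R).

Lemma continuous_cvg_seq (f : R -> R) (u : nat -> R) (x : R) :
  {for x, continuous f} -> u n @[n --> \oo] --> x ->
  f (u n) @[n --> \oo] --> f x.
Proof. by move=> cf ux; exact: (cvg_comp _ _ ux cf). Qed.

(** By compactness. The point [y] may lie outside the segment; with [a = b] this is continuity at
    one point. *)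
Lemma segment_unif_continuous (f : R -> R) (a b e : R) :
  continuous f -> 0 < e ->
  exists2 d, 0 < d & forall x y, a <= x <= b -> `|y - x| < d -> `|f y - f x| < e.
Proof.
move=> cf e0.
have /compact_near_coveringP cov := @segment_compact R a b.
have := cov R 0^'+ (fun d x => forall y, `|y - x| < d -> `|f y - f x| < e) _.
case.
- move=> x _; have e20 : 0 < e / 2 by rewrite divr_gt0.
  have /cvgrPdist_lt/(_ _ e20) := cf x.
  rewrite -nbhs_nbhs_norm || idtac.
  move=> /nbhs_normP[r /= r0 xr].
  exists (ball x (r / 2), [set d | 0 < d < r / 2]) => /=.
    split; first by apply: nbhsx_ballx; rewrite divr_gt0.
    near=> d; apply/andP; split => //; near: d; apply: nbhs_right_lt.
    by rewrite divr_gt0.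
  move=> [x' d] /= [xx' /andP[d0 dr]] y yx'.
  have h1 : `|f x - f y| < e / 2.
    apply: xr; rewrite /ball_ /=; move: xx'; rewrite /ball/= => xx'.
    have := ler_distD x' x y; rewrite [`|x' - y|]distrC; lra.
  have h2 : `|f x - f x'| < e / 2.
    by apply: xr; rewrite /ball_ /=; move: xx'; rewrite /ball/=; lra.
  have := ler_distD (f x) (f y) (f x'); rewrite [`|f y - f x|]distrC; lra.
- move=> r /= r0 H; exists (r / 2); first by rewrite divr_gt0.
  move=> x y xab; apply: (H (r / 2)) => //=.
  + by rewrite sub0r normrN gtr0_norm ?divr_gt0//; lra.
  + by rewrite divr_gt0.
Unshelve. all: by end_near. Qed.

Let contI (f : R -> R) (a b : R) : continuous f -> mu.-integrable `[a, b] (EFin \o f).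
Proof.
move=> cf; apply: continuous_compact_integrable; first exact: segment_compact.
exact: continuous_subspaceT.
Qed.

Lemma continuous_itv_integrable (f : R -> R) (i : interval R) (a b : R) :
  continuous f -> [set` i] `<=` `[a, b]%classic ->
  mu.-integrable [set` i] (EFin \o f).
Proof.
move=> cf iab; apply: integrableS (contI a b cf) => //.
Qed.

(** From [1 + (x ^+ 2 - x) <= expR (x ^+ 2 - x)] and [(1 + x ^+ 2 - x) * (1 + x) = 1 + x ^+ 3]. *)
Lemma ler_ln1D_sqr (x : R) : 0 <= x -> x - x ^+ 2 <= ln (1 + x).
Proof.
move=> x0; rewrite -ler_expR lnK ?posrE; last lra.
have h : 0 < 1 + x by lra.
have := expR_ge1Dx (x ^+ 2 - x); have := expR_gt0 (x ^+ 2 - x).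
rewrite -[x - _]opprB expRN => E0 E1.
rewrite invf_ple ?posrE//; apply: le_trans E1.
by rewrite -[_^-1]mul1r ler_pdivrMr//; nra.
Qed.

(** Minus the logarithm of the product is a Riemann sum up to an error quadratic in the step per
    factor. The grid ends at the first points past [s], because the products are stopped at a grid
    time strictly after a stopping time. *)
Lemma riemann_product_cvg (f : R -> R) (s : R) (k : nat -> nat) :
  continuous f -> (forall x, 0 <= f x) -> 0 <= s ->
  (forall n, s < (k n)%:R / n.+1%:R <= s + n.+1%:R^-1) ->
  \prod_(i < k n) (1 + n.+1%:R^-1 * f (i%:R / n.+1%:R))^-1 @[n --> \oo] -->
  expR (- \int[mu]_(x in `[0, s]) f x).
Proof.
move=> cf f0 s0 ks.
pose del n : R := n.+1%:R^-1.
have del0 n : 0 < del n by rewrite invr_gt0.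
have del1 n : del n <= 1 by rewrite invf_le1 ?ler1n.
pose Phi u := \int[mu]_(x in `[0, u]) f x.
pose L n := \sum_(i < k n) ln (1 + del n * f (i%:R * del n)).
have E n : \prod_(i < k n) (1 + n.+1%:R^-1 * f (i%:R / n.+1%:R))^-1 = expR (- L n).
  rewrite /L -sumrN expR_sum; apply: eq_bigr => i _.
  have p : 0 < 1 + del n * f (i%:R * del n).
    by rewrite ltr_wpDr// mulr_ge0// ltW.
  by rewrite expRN lnK.
under eq_fun do rewrite E.
apply: (@cvg_comp _ _ _ (fun n => - L n) (@expR R) \oo (nbhs (- Phi s)));
  last exact: continuous_expR.
apply: cvgN.
have PhiB t t' : 0 <= t -> t <= t' -> Phi t' - Phi t = \int[mu]_(x in `]t, t']) f x.
  move=> t0 tt'; rewrite /Phi (@Rintegral_itvB _ f (BLeft 0) (BRight t') t)//.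
  exact: contI.
have [M M0 fM] : exists2 M, 0 < M & forall x, 0 <= x <= s + 1 -> f x <= M.
  have s1 : 0 <= s + 1 by lra.
  have [c _ fc] := EVT_max s1 (continuous_subspaceT cf).
  by exists (1 + f c); [have := f0 c; lra|move=> x /fc; lra].
have PhiE t t' m : 0 <= t -> t <= t' -> (forall x, t <= x <= t' -> f x <= m) ->
    Phi t' - Phi t <= (t' - t) * m.
  move=> t0 tt' fm; rewrite PhiB//.
  apply: (@le_trans _ _ (\int[mu]_(x in `]t, t']) m)).
    apply: le_Rintegral => //.
    - by apply: (@continuous_itv_integrable _ _ t t') => //; exact: subset_itv_oc_cc.
    - apply: (@continuous_itv_integrable _ _ t t'); last exact: subset_itv_oc_cc.
      exact: cst_continuous.
    - by move=> x /=; rewrite in_itv/= => /andP[tx xt']; apply: fm; rewrite xt' ltW.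
  rewrite Rintegral_cst//= lebesgue_measure_itv/= lte_fin mulrC.
  by move: tt'; rewrite le_eqVlt => /predU1P[->|->//]; rewrite ltxx subrr ?mul0r ?mulr0.
have PhiG t t' m : 0 <= t -> t <= t' -> (forall x, t <= x <= t' -> m <= f x) ->
    (t' - t) * m <= Phi t' - Phi t.
  move=> t0 tt' fm; rewrite PhiB//.
  apply: (@le_trans _ _ (\int[mu]_(x in `]t, t']) m)); last first.
    apply: le_Rintegral => //.
    - apply: (@continuous_itv_integrable _ _ t t'); last exact: subset_itv_oc_cc.
      exact: cst_continuous.
    - by apply: (@continuous_itv_integrable _ _ t t') => //; exact: subset_itv_oc_cc.
    - by move=> x /=; rewrite in_itv/= => /andP[tx xt']; apply: fm; rewrite xt' ltW.
  rewrite Rintegral_cst//= lebesgue_measure_itv/= lte_fin mulrC.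
  by move: tt'; rewrite le_eqVlt => /predU1P[->|->//]; rewrite ltxx subrr ?mul0r ?mulr0.
apply/cvgrPdist_le => e e0.
(* The grid has length at most [s + 1], so an oscillation [eta] of [f] in each cell costs at most
   [e / 2]. The quadratic terms of the logarithm and the overshoot past [s] share the other half. *)
pose eta := e / (2 * (s + 2)).
have eta0 : 0 < eta by rewrite divr_gt0// mulr_gt0//; lra.
have [d d0 ucf] := @segment_unif_continuous f 0 (s + 1) eta cf eta0.
have C0 : 0 < M ^+ 2 * (s + 1) + M.
  by rewrite ltr_wpDl// mulr_ge0 ?sqr_ge0//; lra.
near=> n.
have nd : del n < d by near: n; exact: near_infty_natSinv_lt (PosNum d0).
have ne : del n * (M ^+ 2 * (s + 1) + M) <= e / 2.
  rewrite -ler_pdivlMr//; near: n.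
  have e2 : 0 < e / 2 / (M ^+ 2 * (s + 1) + M) by rewrite !divr_gt0.
  by have := near_infty_natSinv_lt (PosNum e2); apply: filterS => n /ltW.
have /andP[k1 k2] := ks n.
have dn0 := del0 n; have dn1 := del1 n.
have e1 : (s + 1) * eta <= e / 2.
  rewrite /eta; have -> : (s + 1) * (e / (2 * (s + 2))) = (s + 1) / (s + 2) * (e / 2).
    by field; lra.
  apply: ler_piMl; first by apply: divr_ge0 => //; exact: ltW.
  by rewrite ler_pdivrMr; lra.
pose t i : R := i%:R * del n.
have tS i : t i.+1 = t i + del n by rewrite /t -natr1 mulrDl mul1r.
have t0 i : 0 <= t i by rewrite /t mulr_ge0// ltW.
have tk : t (k n) <= s + del n by [].
have tle i j : (i <= j)%N -> t i <= t j by move=> ij; rewrite ler_pM2r// ler_nat.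
have step i : (i < k n)%N ->
    `|(Phi (t i.+1) - Phi (t i)) - ln (1 + del n * f (t i))| <= del n * (del n * M ^+ 2 + eta).
  move=> ik.
  have tis : t i <= s + 1 by have := tle _ _ (ltnW ik); lra.
  have fti : f (t i) <= M by apply: fM; rewrite t0.
  have fclose x : t i <= x <= t i.+1 -> `|f x - f (t i)| < eta.
    rewrite tS => /andP[xl xr]; apply: ucf; first by rewrite t0.
    by rewrite ger0_norm; lra.
  have U := @PhiE (t i) (t i.+1) (f (t i) + eta) (t0 i) (tle _ _ (leqnSn i)) _.
  have {}U : Phi (t i.+1) - Phi (t i) <= (t i.+1 - t i) * (f (t i) + eta).
    by apply: U => x /fclose; rewrite ltr_distl => /andP[? ?]; lra.
  have V : (t i.+1 - t i) * (f (t i) - eta) <= Phi (t i.+1) - Phi (t i).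
    apply: PhiG => //; first by apply: tle.
    by move=> x /fclose; rewrite ltr_distl => /andP[? ?]; lra.
  have x0 : 0 <= del n * f (t i) by rewrite mulr_ge0// ltW.
  have xM : (del n * f (t i)) ^+ 2 <= del n * (del n * M ^+ 2).
    rewrite exprMn expr2 -mulrA ler_pM2l// ler_pM2l// lerXn2r ?nnegrE//.
    exact: ltW.
  have lA := ler_ln1D_sqr x0.
  have lB : ln (1 + del n * f (t i)) <= del n * f (t i) by apply: le_ln1Dx; lra.
  have : t i.+1 - t i = del n by rewrite tS; ring.
  move=> tE; rewrite tE in U V; rewrite ler_norml; apply/andP; split; nra.
have kM : `|(Phi (t (k n)) - Phi 0) - L n| <= (s + 1) * (del n * M ^+ 2 + eta).
  have -> : Phi (t (k n)) - Phi 0 = \sum_(i < k n) (Phi (t i.+1) - Phi (t i)).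
    rewrite -(big_mkord xpredT (fun i => Phi (t i.+1) - Phi (t i))) telescope_sumr//.
    by rewrite /t mul0r.
  rewrite /L -sumrB; apply: (le_trans (ler_norm_sum _ _ _)).
  apply: (@le_trans _ _ (\sum_(i < k n) del n * (del n * M ^+ 2 + eta))).
    by apply: ler_sum => i _; apply: step.
  rewrite sumr_const card_ord -mulr_natl mulrA ler_wpM2r//.
    by rewrite addr_ge0 ?(ltW eta0)// mulr_ge0 ?sqr_ge0// ltW.
  by have := tk; rewrite /t; lra.
have Phi0 : Phi 0 = 0 by rewrite /Phi set_itv1 Rintegral_set1.
have UB : Phi (t (k n)) - Phi s <= (t (k n) - s) * M.
  apply: PhiE => //; first exact: ltW.
  by move=> x /andP[sx xt]; apply: fM; lra.
have LB : (t (k n) - s) * 0 <= Phi (t (k n)) - Phi s.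
  by apply: PhiG => //; exact: ltW.
have tks : (t (k n) - s) * M <= del n * M by rewrite ler_pM2r//; lra.
rewrite Phi0 subr0 mulr0 in kM LB.
rewrite -/(Phi s).
have := ler_distD (Phi (t (k n))) (Phi s) (L n).
rewrite (distrC (Phi s) (Phi (t (k n)))) (ger0_norm LB).
rewrite (_ : (s + 1) * (del n * M ^+ 2 + eta) =
  del n * (M ^+ 2 * (s + 1)) + (s + 1) * eta) in kM; last by ring.
rewrite mulrDr in ne; lra.
Unshelve. all: by end_near. Qed.

End riemann_products.

(** * Independence and regular Brownian motion *)

Section independence.
Context d (T : measurableType d) (R : realType) (Pr : probability T R).

Definition indep_fun (U W : T -> R) := forall A C : set R,
  measurable A -> measurable C ->
  Pr (U @^-1` A `&` W @^-1` C) = (Pr (U @^-1` A) * Pr (W @^-1` C))%E.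

Lemma indep_fun_comp (U W : T -> R) (u v : R -> R) :
  measurable_fun setT u -> measurable_fun setT v ->
  indep_fun U W -> indep_fun (u \o U) (v \o W).
Proof.
move=> mu mv UW A C mA mC; apply: (UW (u @^-1` A) (v @^-1` C)).
- by rewrite -[X in measurable X]setTI; exact: mu.
- by rewrite -[X in measurable X]setTI; exact: mv.
Qed.

(** Independence makes the joint law the product of the marginal laws, and Tonelli's theorem splits
    the integral. The absolute value in [f] keeps the integrand nonnegative on the whole plane. *)
Lemma ge0_integral_indepM (U W : T -> R) :
  measurable_fun setT U -> measurable_fun setT W ->
  (forall w, 0 <= U w) -> (forall w, 0 <= W w) -> indep_fun U W ->
  (\int[Pr]_w (U w * W w)%:E = \int[Pr]_w (U w)%:E * \int[Pr]_w (W w)%:E)%E.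
Proof.
move=> mU mW U0 W0 UW.
have mUW : measurable_fun setT (fun w => (U w, W w)) by exact: measurable_fun_pair.
pose X := HB.pack_for {mfun T >-> R} U
  (isMeasurableFun.Build _ _ _ _ _ mU).
pose Y := HB.pack_for {mfun T >-> R} W
  (isMeasurableFun.Build _ _ _ _ _ mW).
pose Z := HB.pack_for {mfun T >-> (R * R)%type}
  (fun w => (U w, W w)) (isMeasurableFun.Build _ _ _ _ _ mUW).
pose f (z : R * R) : \bar R := `|z.1 * z.2|%:E.
have mf : measurable_fun setT f.
  apply/measurable_EFinP/measurableT_comp => //.
  by apply: measurable_funM; [exact: measurable_fst|exact: measurable_snd].
have mabs : measurable_fun setT (fun x : R => `|x|%:E : \bar R).
  by apply/measurable_EFinP; exact: normr_measurable.
transitivity (\int[distribution Pr Z]_z f z)%E.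
  rewrite ge0_integral_distribution//.
    by apply: eq_integral => w _; rewrite /f/= ger0_norm// mulr_ge0.
  by move=> z; rewrite lee_fin.
transitivity (\int[distribution Pr X \x distribution Pr Y]_z f z)%E.
  apply: eq_measure_integral => D mD _; apply/esym.
  by apply: product_measure_unique => //= A C mA mC; exact: UW.
rewrite fubini_tonelli1//; last by move=> z; rewrite lee_fin.
rewrite /fubini_F /f /=.
under eq_integral => x _.
  under eq_integral do rewrite normrM EFinM.
  rewrite ge0_integralZl_EFin//.
  rewrite ge0_integral_distribution//.
  rewrite (_ : (\int[Pr]_x0 _)%E = \int[Pr]_w (W w)%:E)%E; last first.
    by apply: eq_integral => w _ /=; rewrite ger0_norm.
  over.
rewrite ge0_integralZr//; last by apply: integral_ge0 => w _; rewrite lee_fin.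
congr (_ * _)%E; rewrite ge0_integral_distribution//.
by apply: eq_integral => w _ /=; rewrite ger0_norm.
Qed.

Lemma bounded_integrable (V : T -> R) (M : R) : measurable_fun setT V ->
  (forall w, `|V w| <= M) -> Pr.-integrable setT (EFin \o V).
Proof.
move=> mV VM; apply: measurable_bounded_integrable => //.
  by rewrite [X in (X < _)%E](@probability_setT _ _ _ Pr) ltry.
exists M; split; first exact: num_real.
by move=> x Mx w _; apply: (le_trans (VM w)); exact: ltW.
Qed.

Lemma integrable_boundedM (V W : T -> R) (M : R) : measurable_fun setT V ->
  (forall w, `|V w| <= M) -> Pr.-integrable setT (EFin \o W) ->
  Pr.-integrable setT (EFin \o (fun w => V w * W w)).
Proof.
move=> mV VM iW; apply: (@integrableMr _ _ _ Pr setT measurableT V (EFin \o W)) => //.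
exists M; split; first exact: num_real.
by move=> x Mx w _; apply: (le_trans (VM w)); exact: ltW.
Qed.

Lemma bounded_convergence (u : nat -> T -> R) (v : T -> R) (M : R) :
  (forall n, measurable_fun setT (u n)) -> (forall n w, `|u n w| <= M) ->
  (forall w, u n w @[n --> \oo] --> v w) ->
  measurable_fun setT v /\ \int[Pr]_w u n w @[n --> \oo] --> \int[Pr]_w v w.
Proof.
move=> mu uM uv; have mv : measurable_fun setT v.
  by apply: (measurable_fun_cvg mu) => w _; exact: uv.
split => //; have M0 : 0 <= M by exact: le_trans (uM 0%N point).
have vM w : `|v w| <= M.
  have nv : `|u n w| @[n --> \oo] --> `|v w| by apply: cvg_norm; exact: uv.
  rewrite -(cvg_lim _ nv)//; apply: limr_le; first by apply/cvg_ex; exists `|v w|.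
  by apply: nearW => n; exact: uM.
apply: fine_cvg.
rewrite fineK; last by apply: integrable_fin_num => //; exact: bounded_integrable vM.
apply: (@dominated_cvg _ _ _ Pr setT measurableT _ _ (EFin \o cst M)) => //.
- by move=> n; exact/measurable_EFinP.
- by move=> w _; apply: cvg_EFin; [exact: nearW|exact: uv].
- by apply: (@bounded_integrable _ M) => // w; rewrite ger0_norm.
- by move=> n w _; rewrite lee_fin.
Qed.

Let ge0_Rintegral_indepM (U W : T -> R) (M : R) :
  measurable_fun setT U -> (forall w, 0 <= U w) -> (forall w, `|U w| <= M) ->
  Pr.-integrable setT (EFin \o W) -> (forall w, 0 <= W w) -> indep_fun U W ->
  \int[Pr]_w (U w * W w) = (\int[Pr]_w U w) * \int[Pr]_w W w.
Proof.
move=> mU U0 UM iW W0 UW; rewrite /Rintegral -fineM; last 2 first.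
- by apply: integrable_fin_num => //; exact: bounded_integrable UM.
- exact: integrable_fin_num.
congr fine; apply: ge0_integral_indepM => //.
by have /integrableP[/measurable_EFinP] := iW.
Qed.

(** Reduction to nonnegative factors: [W] is split into its positive and negative parts, and [U] is
    shifted by its bound [M], which adds [M] times the mean of [W] to both sides. *)
Lemma Rintegral_indepM (U W : T -> R) (M : R) :
  measurable_fun setT U -> (forall w, `|U w| <= M) ->
  Pr.-integrable setT (EFin \o W) -> indep_fun U W ->
  \int[Pr]_w (U w * W w) = (\int[Pr]_w U w) * \int[Pr]_w W w.
Proof.
move=> mU UM iW UW.
have mW : measurable_fun setT W by have /integrableP[/measurable_EFinP] := iW.
have iU : Pr.-integrable setT (EFin \o U) by exact: bounded_integrable UM.
have M0 w : - M <= U w <= M by rewrite -ler_norml.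
wlog W0 : W iW UW mW / forall w, 0 <= W w.
  move=> h.
  pose Wp w := Num.max (W w) 0; pose Wn w := Num.max (- W w) 0.
  have mp : measurable_fun setT (fun x : R => Num.max x 0) by exact: measurable_maxr.
  have mn : measurable_fun setT (fun x : R => Num.max (- x) 0).
    by apply: measurable_maxr => //; exact: oppr_measurable.
  have iWp : Pr.-integrable setT (EFin \o Wp).
    apply: le_integrable iW => //; first by apply/measurable_EFinP; exact: measurableT_comp mp mW.
    move=> w _; rewrite lee_fin /Wp ger0_norm ?le_max ?lexx ?orbT//.
    by rewrite ge_max normr_ge0 andbT ler_norm.
  have iWn : Pr.-integrable setT (EFin \o Wn).
    apply: le_integrable iW => //; first by apply/measurable_EFinP; exact: measurableT_comp mn mW.
    move=> w _; rewrite lee_fin /Wn ger0_norm ?le_max ?lexx ?orbT//.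
    by rewrite ge_max normr_ge0 andbT -normrN ler_norm.
  have E w : W w = Wp w - Wn w.
    by rewrite /Wp /Wn; case: (leP (W w) 0); case: (leP (- W w) 0); lra.
  have hp : \int[Pr]_w (U w * Wp w) = (\int[Pr]_w U w) * \int[Pr]_w Wp w.
    apply: h => //; last by move=> w; rewrite le_max lexx orbT.
      move=> A C mA mC; apply: (UW A ((fun x : R => Num.max x 0) @^-1` C)) => //.
      by rewrite -[X in measurable X]setTI; exact: mp.
    by have /integrableP[/measurable_EFinP] := iWp.
  have hn : \int[Pr]_w (U w * Wn w) = (\int[Pr]_w U w) * \int[Pr]_w Wn w.
    apply: h => //; last by move=> w; rewrite le_max lexx orbT.
      move=> A C mA mC; apply: (UW A ((fun x : R => Num.max (- x) 0) @^-1` C)) => //.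
      by rewrite -[X in measurable X]setTI; exact: mn.
    by have /integrableP[/measurable_EFinP] := iWn.
  under eq_Rintegral do rewrite E mulrBr.
  rewrite RintegralB//; [|exact: integrable_boundedM UM iWp|exact: integrable_boundedM UM iWn].
  rewrite [X in _ = _ * X](_ : _ = \int[Pr]_w (Wp w - Wn w)); last first.
    by apply: eq_Rintegral => w _; exact: E.
  by rewrite [\int[Pr]_w (Wp w - Wn w)]RintegralB// mulrBr hp hn.
have iM : Pr.-integrable setT (EFin \o cst M).
  by apply: (@bounded_integrable _ `|M|) => //.
have E1 : \int[Pr]_w (U w + M) = \int[Pr]_w U w + M.
  rewrite RintegralD// Rintegral_cst//.
  rewrite [X in _ + M * X](_ : _ = 1) ?mulr1//.
  exact: (congr1 fine (@probability_setT _ _ _ Pr)).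
have E2 : \int[Pr]_w ((U w + M) * W w) = \int[Pr]_w (U w * W w) + M * \int[Pr]_w W w.
  under eq_Rintegral do rewrite mulrDl.
  rewrite RintegralD//; last 2 first.
  - exact: integrable_boundedM UM iW.
  - by apply: (@integrable_boundedM (cst M) W `|M|).
  by rewrite RintegralZl.
have : \int[Pr]_w ((U w + M) * W w) = (\int[Pr]_w (U w + M)) * \int[Pr]_w W w.
  apply: (@ge0_Rintegral_indepM _ _ (M + M)) => //.
  - exact: measurable_funD.
  - by move=> w; have /andP[] := M0 w; lra.
  - by move=> w; rewrite ler_norml; have /andP[] := M0 w; lra.
  - apply: (@indep_fun_comp U W (fun x => x + M) idfun) => //; last exact: measurable_id.
    exact: measurable_funD.
by rewrite E1 E2 mulrDl => /addIr.
Qed.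

End independence.

Section regular_brownian_motion.
Context {R : realType} {d : measure_display} {T : measurableType d}.
Variable Pr : probability T R.
Implicit Types (F : R -> set (set T)) (B : R -> T -> R).

(** A Brownian motion whose path properties hold for every sample point, with paths continuous on
    the whole real line. Such a version of the given motion is built at the end. *)
Record regular_bm F B : Prop := RegularBM {
  rbm_adapted : forall t : R, 0 <= t ->
    forall S : set R, measurable S -> F t (B t @^-1` S) ;
  rbm_start : forall w, B 0 w = 0 ;
  rbm_increment : forall s t : R, 0 <= s -> s < t ->
    forall S : set R, measurable S ->
    Pr (increment B s t @^-1` S) = normal_prob 0 (Num.sqrt (t - s)) S ;
  rbm_independent : forall s t : R, 0 <= s -> s < t ->
    forall (A : set T) (S : set R), F s A -> measurable S ->
    Pr (A `&` increment B s t @^-1` S) =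
      (Pr A * Pr (increment B s t @^-1` S))%E ;
  rbm_continuous : forall w, continuous (fun t => B t w) }.

Definition optional_time F (sigma : T -> R) : Prop :=
  forall u : R, 0 < u -> F u [set w | sigma w < u].

(** Measurability for the generated sigma-algebra, so that the closure properties of measurable
    functions apply to adapted variables. *)
Definition adapted_at F (t : R) (V : T -> R) : Prop :=
  measurable_fun setT (V : g_sigma_algebraType (F t) -> R).

End regular_brownian_motion.

Section increments.
Context {R : realType} {d : measure_display} {T : measurableType d}.
Variables (Pr : probability T R) (F : R -> set (set T)) (B : R -> T -> R).
Hypothesis uF : usual_filtration Pr F.
Hypothesis bm : regular_bm Pr F B.

Lemma filtration_setT t : 0 <= t -> F t setT.
Proof.
move=> t0; have [F0 FC _] := filtration_sigma_algebra uF t0.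
by rewrite -[setT](setD0 setT); apply: FC.
Qed.

Lemma filtrationC t A : 0 <= t -> F t A -> F t (~` A).
Proof.
move=> t0; have [F0 FC _] := filtration_sigma_algebra uF t0.
by rewrite -setTD; apply: FC.
Qed.

Lemma filtration_bigcup t (A : nat -> set T) :
  0 <= t -> (forall n, F t (A n)) -> F t (\bigcup_n A n).
Proof. by move=> t0; have [_ _] := filtration_sigma_algebra uF t0; apply. Qed.

Lemma measurable_filtrationE t (A : set T) : 0 <= t ->
  measurable (A : set (g_sigma_algebraType (F t))) = F t A.
Proof.
move=> t0; rewrite /measurable/=.
by rewrite (sigma_algebra_id (filtration_sigma_algebra uF t0)).
Qed.

Lemma adapted_atP t (V : T -> R) : 0 <= t ->
  adapted_at F t V <-> forall S, measurable S -> F t (V @^-1` S).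
Proof.
move=> t0; split.
- move=> mV S mS; rewrite -measurable_filtrationE// -[X in measurable X]setTI.
  exact: mV.
- move=> h _ S mS; rewrite setTI measurable_filtrationE//; exact: h.
Qed.

Lemma adapted_at_le s t (V : T -> R) : 0 <= s -> s <= t ->
  adapted_at F s V -> adapted_at F t V.
Proof.
move=> s0 st /(adapted_atP _ s0) h; apply/(adapted_atP _ (le_trans s0 st)) => S mS.
by apply: (filtration_nondecreasing uF s0 st); exact: h.
Qed.

Lemma adapted_at_measurable t (V : T -> R) : 0 <= t ->
  adapted_at F t V -> measurable_fun setT V.
Proof.
move=> t0 /(adapted_atP _ t0) h _ S mS; rewrite setTI.
by apply: (filtration_measurable uF t0); exact: h.
Qed.

Lemma adapted_bm t : 0 <= t -> adapted_at F t (B t).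
Proof. by move=> t0; apply/(adapted_atP _ t0); exact: rbm_adapted bm _ t0. Qed.

Lemma measurable_bm t : 0 <= t -> measurable_fun setT (B t).
Proof. by move=> t0; exact: adapted_at_measurable (adapted_bm t0). Qed.

Lemma adapted_at_indic t (A : set T) : 0 <= t -> F t A -> adapted_at F t (\1_A : T -> R).
Proof.
move=> t0 FA; apply: measurable_indic.
by rewrite measurable_filtrationE.
Qed.

Section one_increment.
Variables (s t : R).
Hypotheses (s0 : 0 <= s) (st : s < t).
Let D := increment B s t.

Lemma measurable_increment : measurable_fun setT D.
Proof.
apply: measurable_funB; apply: measurable_bm => //.
by apply: (le_trans s0); exact: ltW.
Qed.

Lemma increment_indep (V : T -> R) : adapted_at F s V -> indep_fun Pr V D.
Proof.
move=> /(adapted_atP _ s0) mV A C mA mC.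
by apply: (rbm_independent bm s0 st) => //; exact: mV.
Qed.

Lemma ge0_integral_increment (f : R -> R) : measurable_fun setT f ->
  (forall x, 0 <= f x) ->
  (\int[Pr]_w (f (D w))%:E = \int[normal_prob 0 (Num.sqrt (t - s))]_x (f x)%:E)%E.
Proof.
move=> mf f0.
pose D' : T -> measurableTypeR R := D.
have mD' : measurable_fun setT D' := measurable_increment.
rewrite -(@ge0_integral_pushforward _ _ _ _ _ D' mD' Pr setT (EFin \o f))//.
- apply: eq_measure_integral => A mA _.
  exact: (rbm_increment bm s0 st mA).
- exact/measurable_EFinP.
- by move=> y _; rewrite lee_fin.
Qed.

Let sq0 : 0 < Num.sqrt (t - s). Proof. by rewrite sqrtr_gt0 subr_gt0. Qed.

Lemma integrable_increment : Pr.-integrable setT (EFin \o D).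
Proof.
apply/integrableP; split; first by apply/measurable_EFinP; exact: measurable_increment.
rewrite (@ge0_integral_increment (fun x => `|x|)); last 2 first.
- exact: normr_measurable.
- by [].
by have /integrableP[] := normal_first_moment_integrable sq0.
Qed.

Lemma mean_increment : \int[Pr]_w D w = 0.
Proof.
pose D' : T -> measurableTypeR R := D.
have mD' : measurable_fun setT D' := measurable_increment.
rewrite /Rintegral -(@integral_pushforward _ _ _ _ _ D' mD' Pr setT EFin)//.
- rewrite (eq_measure_integral (normal_prob 0 (Num.sqrt (t - s))))/=.
    by rewrite normal_first_moment.
  by move=> A mA _; exact: (rbm_increment bm s0 st mA).
- exact: integrable_increment.
Qed.

Let Rintegral_sqr : (\int[Pr]_w (D w ^+ 2)%:E = (t - s)%:E)%E.
Proof.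
rewrite (@ge0_integral_increment (fun x => x ^+ 2)).
- by rewrite normal_second_moment// sqr_sqrtr// subr_ge0 ltW.
- exact: measurable_funX.
- by move=> x; exact: sqr_ge0.
Qed.

Lemma integrable_increment_sqr : Pr.-integrable setT (fun w => (D w ^+ 2)%:E).
Proof.
apply/integrableP; split.
  by apply/measurable_EFinP/measurable_funX; exact: measurable_increment.
under eq_integral do rewrite gee0_abs ?lee_fin ?sqr_ge0//.
by rewrite Rintegral_sqr ltry.
Qed.

Lemma variance_increment : \int[Pr]_w (D w ^+ 2) = t - s.
Proof. by rewrite /Rintegral Rintegral_sqr. Qed.

Let third : (\int[Pr]_w (`|D w| ^+ 3)%:E <= (4 * Num.sqrt (t - s) ^+ 3)%:E)%E.
Proof.
rewrite (@ge0_integral_increment (fun x => `|x| ^+ 3)).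
- exact: normal_third_moment.
- by apply: measurable_funX; exact: normr_measurable.
- by move=> x; rewrite exprn_ge0.
Qed.

Lemma integrable_increment_cube : Pr.-integrable setT (fun w => (`|D w| ^+ 3)%:E).
Proof.
apply/integrableP; split.
  apply/measurable_EFinP/measurable_funX.
  by apply: measurableT_comp; [exact: normr_measurable|exact: measurable_increment].
under eq_integral do rewrite gee0_abs ?lee_fin ?exprn_ge0//.
by apply: le_lt_trans third _; rewrite ltry.
Qed.

Lemma third_moment_increment :
  \int[Pr]_w (`|D w| ^+ 3) <= 4 * Num.sqrt (t - s) ^+ 3.
Proof.
rewrite /Rintegral -lee_fin fineK; first exact: third.
exact: integrable_fin_num integrable_increment_cube.
Qed.

End one_increment.
End increments.

(** * Exponential martingales of Brownian motion *)

Section exponential_martingale.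
Context {R : realType} {d : measure_display} {T : measurableType d}.
Variables (Pr : probability T R) (F : R -> set (set T)) (B : R -> T -> R).
Hypothesis uF : usual_filtration Pr F.
Hypothesis bm : regular_bm Pr F B.
Notation mu := (@lebesgue_measure R).

Variables (c G G1 : R -> R) (a b C MG M1 : R).
Hypothesis cc : continuous c.
Hypothesis c0 : forall x, 0 <= c x.
Hypothesis mG : measurable_fun setT G.
Hypothesis mG1 : measurable_fun setT G1.
Hypothesis GM : forall x, `|G x| <= MG.
Hypothesis G1M : forall x, a <= x <= b -> `|G1 x| <= M1.
(* Third order Taylor formula for a solution of G'' / 2 = c G on [a, b]. *)
Hypothesis taylorG : forall x y, a <= x <= b ->
  `|G (x + y) - G x - G1 x * y - c x * G x * y ^+ 2| <= C * `|y| ^+ 3.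

Variables (sigma : T -> R) (h : nat).
Hypothesis osigma : optional_time F sigma.
Hypothesis sigma_ge0 : forall w, 0 <= sigma w.
Hypothesis sigma_leh : forall w, sigma w <= h%:R.
Hypothesis Bab : forall w s, 0 <= s <= sigma w -> a <= B s w <= b.

Let C0 : 0 <= C.
Proof.
have ab : a <= B 0 point <= b by apply: Bab; rewrite lexx sigma_ge0.
have := taylorG 1 ab; rewrite normr1 !expr1n !mulr1.
exact: le_trans.
Qed.

(** Continuity of [G] at points of [[a, b]] comes from the Taylor hypothesis: the increment of [G]
    over [y] is at most [K y], and [K] is continuous and vanishes at 0. *)
Let GB_cvg (w : T) (u : nat -> R) : u n @[n --> \oo] --> sigma w ->
  G (B (u n) w) @[n --> \oo] --> G (B (sigma w) w).
Proof.
move=> us.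
have Bu : B (u n) w - B (sigma w) w @[n --> \oo] --> 0.
  rewrite -(subrr (B (sigma w) w)); apply: cvgB; last exact: cvg_cst.
  apply: (@continuous_cvg_seq _ (fun t => B t w)) => //.
  exact: rbm_continuous bm w (sigma w).
have ab : a <= B (sigma w) w <= b by apply: Bab; rewrite lexx sigma_ge0.
set x := B (sigma w) w in Bu ab *.
pose y n := B (u n) w - x.
pose K y := `|G1 x * y| + `|c x * G x * y ^+ 2| + C * `|y| ^+ 3.
have cK : K (y n) @[n --> \oo] --> 0.
  have -> : 0 = K 0 by rewrite /K mulr0 normr0 expr0n/= mulr0 normr0 expr0n/= mulr0 !addr0.
  apply: continuous_cvg_seq => //.
  have c3 : continuous (fun z : R => `|z| ^+ 3).
    move=> z; apply: (@continuous_comp _ _ _ (fun x : R => `|x|) (fun x : R => x ^+ 3)).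
      exact: norm_continuous.
    exact: exprn_continuous.
  rewrite /K; apply: cvgD; first apply: cvgD.
  - by apply: cvg_norm; apply: cvgM; [exact: cvg_cst|exact: cvg_id].
  - by apply: cvg_norm; apply: cvgM; [exact: cvg_cst|exact: exprn_continuous].
  - by apply: cvgM; [exact: cvg_cst|exact: c3].
apply/cvgrPdist_le => e e0; have /cvgr0Pnorm_le/(_ _ e0) := cK.
apply: filterS => n; rewrite ger0_norm => [|]; last first.
  by rewrite /K !addr_ge0// mulr_ge0// exprn_ge0.
apply: le_trans.
have := taylorG (y n) ab; rewrite (_ : x + y n = B (u n) w); last first.
  by rewrite /y addrC subrK.
rewrite (distrC (G x)) /K; set p := G1 x * y n; set q := _ * y n ^+ 2; set v := C * _.
move=> tay; have := ler_normD (G (B (u n) w) - G x - p - q) (p + q).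
rewrite (_ : _ - _ - _ - _ + _ = G (B (u n) w) - G x); last by ring.
by have := ler_normD p q; lra.
Qed.

Let tk (n k : nat) : R := k%:R / n.+1%:R.
Let tk0 n k : 0 <= tk n k. Proof. by rewrite divr_ge0. Qed.
Let tkS n k : tk n k.+1 = tk n k + n.+1%:R^-1.
Proof. by rewrite /tk -natr1 mulrDl mul1r. Qed.

(** Discrete discount factor. The factor [(1 + delta * c)^-1] is preferred to [expR (- delta * c)]
    because one step of the discounted value is then exactly [wt n k.+1 w * (G y - G x - delta * c x
    * G x)]. The weight with index [k.+1] depends on the path up to grid time [k] only. *)
Let wt n k w : R := \prod_(i < k) (1 + n.+1%:R^-1 * c (B (tk n i) w))^-1.

Let fac_itv n k w : 0 < (1 + n.+1%:R^-1 * c (B (tk n k) w))^-1 <= 1.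
Proof.
have h0 : 0 <= n.+1%:R^-1 * c (B (tk n k) w) by rewrite mulr_ge0.
have h1 : 0 < 1 + n.+1%:R^-1 * c (B (tk n k) w) by rewrite ltr_wpDr.
by rewrite invr_gt0 h1 invf_le1 ?lerDl.
Qed.

Let wt_itv n k w : 0 < wt n k w <= 1.
Proof.
rewrite /wt; elim: k => [|k /andP[IH0 IH1]]; first by rewrite big_ord0 ltr01 lexx.
have /andP[f0 f1] := fac_itv n k w.
by rewrite big_ord_recr/= mulr_gt0//= mulr_ile1// ltW.
Qed.

Let alive n k w : R := (tk n k <= sigma w)%R%:R.

Let adapted_wt n k : adapted_at F (tk n k) (wt n k.+1).
Proof.
rewrite /adapted_at /wt; apply: measurable_prod => i _.
apply: (@adapted_at_le _ _ _ _ _ uF (tk n i)) => //.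
  by rewrite ler_pM2r ?invr_gt0// ler_nat -ltnS.
have cf : continuous (fun x : R => (1 + n.+1%:R^-1 * c x)^-1).
  move=> x; apply: cvgV.
    by rewrite gt_eqF// ltr_wpDr// mulr_ge0.
  by apply: cvgD; [exact: cvg_cst|apply: cvgM; [exact: cvg_cst|exact: cc]].
apply: (@measurableT_comp _ _ _ _ _ _ (fun x : R => (1 + n.+1%:R^-1 * c x)^-1)).
  exact: continuous_measurable_fun.
exact: (adapted_bm uF bm (tk0 n i)).
Qed.

Let adapted_alive n k : adapted_at F (tk n k) (alive n k).
Proof.
have E : alive n k = \1_(~` [set w | sigma w < tk n k]) :> (T -> R).
  apply/funext => w; rewrite /alive indicE in_setC; congr (_%:R).
  by rewrite mem_setE leNgt.
rewrite E; apply: (adapted_at_indic uF) => //; apply: (filtrationC uF) => //.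
case: k {E} => [|k].
  rewrite (_ : [set _ | _] = set0); last first.
    by apply/seteqP; split => w //=; rewrite /tk mul0r ltNge sigma_ge0.
  have [F0 _ _] := filtration_sigma_algebra uF (tk0 n 0); exact: F0.
by apply: osigma; rewrite divr_gt0.
Qed.

Let mart n k w := wt n k w * G (B (tk n k) w).
Let incr n k w := alive n k w * (mart n k.+1 w - mart n k w).

Let M10 : 0 <= M1.
Proof.
have ab : a <= B 0 point <= b by apply: Bab; rewrite lexx sigma_ge0.
exact: le_trans (G1M ab).
Qed.

Let MG0 : 0 <= MG. Proof. exact: le_trans (GM 0). Qed.

Let measurable_mart n k : measurable_fun setT (mart n k).
Proof.
apply: measurable_funM; last first.
  by apply: measurableT_comp => //; exact: (measurable_bm uF bm).
case: k => [|k].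
  rewrite (_ : wt n 0 = cst 1)//; apply/funext => w; by rewrite /wt big_ord0.
exact: (adapted_at_measurable uF (tk0 n k) (@adapted_wt n k)).
Qed.

Let measurable_incr n k : measurable_fun setT (incr n k).
Proof.
apply: measurable_funM; last by apply: measurable_funB; exact: measurable_mart.
exact: (adapted_at_measurable uF (tk0 n k) (@adapted_alive n k)).
Qed.

Let mart_bound n k w : `|mart n k w| <= MG.
Proof.
rewrite /mart normrM -[leRHS]mul1r ler_pM//.
by have /andP[/ltW w0 w1] := wt_itv n k w; rewrite ger0_norm.
Qed.

Let integrable_incr n k : Pr.-integrable setT (EFin \o incr n k).
Proof.
apply: (@bounded_integrable _ _ _ _ _ (MG + MG)).
  exact: measurable_incr.
move=> w; rewrite /incr /alive; case: (tk n k <= sigma w)%R => /=; last first.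
  by rewrite mul0r normr0 addr_ge0.
by rewrite mul1r; apply: (le_trans (ler_normB _ _)); rewrite lerD.
Qed.

(** In the Taylor expansion of one step the linear term is centred and the quadratic term is
    compensated by the discount, both by independence of the increment from the past. The remainder
    is at most [C * |D| ^ 3], and the third moment bound supplies the factor 4 and the power 3/2 of
    the step. *)
Let mean_incr n k : `|\int[Pr]_w incr n k w| <=
  4 * C * (n.+1%:R^-1 * Num.sqrt n.+1%:R^-1).
Proof.
have ab : a <= b.
  by have /andP[] : a <= B 0 point <= b; [apply: Bab; rewrite lexx sigma_ge0|exact: le_trans].
have [Mc Mc0 cMc] : exists2 Mc, 0 <= Mc & forall x, a <= x <= b -> c x <= Mc.
  have [x _ xc] := EVT_max ab (continuous_subspaceT cc).
  by exists (c x) => // y yab; apply: xc; rewrite in_itv.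
pose V w := alive n k w * wt n k.+1 w.
pose V1 w := V w * G1 (B (tk n k) w).
pose V2 w := V w * (c (B (tk n k) w) * G (B (tk n k) w)).
have aV : adapted_at F (tk n k) V.
  by apply: measurable_funM; [exact: adapted_alive|exact: adapted_wt].
have aB := adapted_bm uF bm (tk0 n k).
have aV1 : adapted_at F (tk n k) V1.
  by apply: measurable_funM => //; exact: (measurableT_comp mG1 aB).
have aV2 : adapted_at F (tk n k) V2.
  apply: measurable_funM => //; apply: measurable_funM.
    exact: (measurableT_comp (continuous_measurable_fun cc) aB).
  exact: (measurableT_comp mG aB).
have V_itv w : 0 <= V w <= 1.
  have /andP[/ltW w0 w1] := wt_itv n k.+1 w.
  by rewrite /V /alive; case: (tk n k <= sigma w)%R => /=;
    rewrite ?mul0r ?mul1r ?lexx ?ler01 ?w0.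
have Vdead w : ~~ (tk n k <= sigma w) -> V w = 0.
  by rewrite /V /alive => /negbTE ->; rewrite mul0r.
have Balive w : tk n k <= sigma w -> a <= B (tk n k) w <= b.
  by move=> tks; apply: Bab; rewrite tk0.
have V1M w : `|V1 w| <= M1.
  have /andP[v0 v1] := V_itv w.
  have [tks|tks] := boolP (tk n k <= sigma w); last first.
    by rewrite /V1 Vdead// mul0r normr0.
  rewrite /V1 normrM -[leRHS]mul1r; apply: ler_pM => //; first by rewrite ger0_norm.
  by apply: G1M; exact: Balive.
have V2M w : `|V2 w| <= Mc * MG.
  have /andP[v0 v1] := V_itv w.
  have [tks|tks] := boolP (tk n k <= sigma w); last first.
    by rewrite /V2 Vdead// mul0r normr0 mulr_ge0.
  rewrite /V2 normrM -[leRHS]mul1r; apply: ler_pM => //; first by rewrite ger0_norm.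
  rewrite normrM; apply: ler_pM => //.
  by rewrite ger0_norm//; apply: cMc; exact: Balive.
have t0 := tk0 n k; have tt : tk n k < tk n k.+1 by rewrite tkS ltrDl invr_gt0.
have tB : tk n k.+1 - tk n k = n.+1%:R^-1 by rewrite tkS addrAC subrr add0r.
pose D := increment B (tk n k) (tk n k.+1).
have iD := integrable_increment uF bm t0 tt.
have iD2 := integrable_increment_sqr uF bm t0 tt.
have iD3 := integrable_increment_cube uF bm t0 tt.
have mV1 := adapted_at_measurable uF t0 aV1.
have mV2 := adapted_at_measurable uF t0 aV2.
have mD := measurable_increment uF bm t0 tt.
have E1 : \int[Pr]_w (V1 w * D w) = 0.
  rewrite (Rintegral_indepM mV1 V1M iD); last exact: (increment_indep uF bm).
  by rewrite (mean_increment uF bm t0 tt) mulr0.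
have E2 : \int[Pr]_w (V2 w * D w ^+ 2) = (\int[Pr]_w V2 w) * n.+1%:R^-1.
  rewrite (Rintegral_indepM mV2 V2M iD2).
    by rewrite (variance_increment uF bm)// tB.
  have mid : measurable_fun setT (idfun : R -> R) by exact: measurable_id.
  have mX : measurable_fun setT (fun x : R => x ^+ 2) by exact: measurable_funX.
  exact: (indep_fun_comp mid mX (increment_indep uF bm t0 tt aV2)).
have iV2 : Pr.-integrable setT (EFin \o V2) by exact: bounded_integrable V2M.
have i1 := integrable_boundedM mV1 V1M iD.
have i2 := integrable_boundedM mV2 V2M iD2.
have i3 : Pr.-integrable setT (EFin \o (fun w => n.+1%:R^-1 * V2 w)).
  by apply: (@integrable_boundedM _ _ _ _ (cst n.+1%:R^-1) V2 `|n.+1%:R^-1|).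
(* Both subtracted terms have mean zero, since [D] is centred and [D ^+ 2] has the grid step as its
   mean. *)
pose rem w := incr n k w - V1 w * D w - (V2 w * D w ^+ 2 - n.+1%:R^-1 * V2 w).
have iA := @integrableB _ _ _ Pr setT measurableT _ _ (integrable_incr n k) i1.
have iBB := @integrableB _ _ _ Pr setT measurableT _ _ i2 i3.
have -> : \int[Pr]_w incr n k w = \int[Pr]_w rem w.
  rewrite /rem RintegralB// RintegralB// [in RHS]RintegralB// E1 E2 RintegralZl//.
  ring.
have remE w : `|rem w| <= C * `|D w| ^+ 3.
  rewrite /rem /incr /V1 /V2.
  have [tks|tks] := boolP (tk n k <= sigma w); last first.
    rewrite (Vdead _ tks) /alive (negbTE tks) !mul0r mulr0 !subr0 normr0.
    by rewrite mulr_ge0// exprn_ge0.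
  have /andP[v0 v1] := V_itv w.
  have tay := taylorG (D w) (Balive w tks).
  have BD : B (tk n k) w + D w = B (tk n k.+1) w.
    by rewrite /D /increment addrC subrK.
  rewrite BD in tay; apply: (le_trans _ tay).
  set x := B (tk n k) w in tay *; set y := B _ w in tay *.
  have f0 : 1 + n.+1%:R^-1 * c x != 0.
    by rewrite gt_eqF// ltr_wpDr// mulr_ge0.
  have wS : wt n k w = wt n k.+1 w * (1 + n.+1%:R^-1 * c x).
    by rewrite /wt big_ord_recr/= mulfVK.
  rewrite -[leRHS]mul1r.
  apply: (@le_trans _ _ (V w * `|G y - G x - G1 x * D w - c x * G x * D w ^+ 2|)); last first.
    by rewrite ler_wpM2r.
  rewrite -[X in X * _ <= _]ger0_norm// || rewrite -[X in _ <= X * _](ger0_norm v0).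
  rewrite -normrM /mart wS /V /alive tks mul1r -/x -/y.
  set W := wt n k.+1 w; rewrite le_eqVlt; apply/orP; left; apply/eqP; congr `| _ |.
  by rewrite (_ : true%:R = 1 :> R)//; ring.
apply: (le_trans (le_normr_Rintegral _ _)) => //.
  exact: (@integrableB _ _ _ Pr setT measurableT _ _ iA iBB).
have iC3 : Pr.-integrable setT (EFin \o (fun w => C * `|D w| ^+ 3)).
  by apply: (@integrable_boundedM _ _ _ _ (cst C) (fun w => `|D w| ^+ 3) `|C|).
apply: (@le_trans _ _ (\int[Pr]_w (C * `|D w| ^+ 3))).
  apply: le_Rintegral => //.
  apply: integrable_norm.
  exact: (@integrableB _ _ _ Pr setT measurableT _ _ iA iBB).
rewrite RintegralZl// [4 * C]mulrC -mulrA ler_wpM2l//.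
apply: (le_trans (third_moment_increment uF bm t0 tt)).
by rewrite tB exprS sqr_sqrtr// [X in 4 * X <= _]mulrC.
Qed.

Let stopped n w := G (B 0 w) + \sum_(k < h * n.+1 + 1) incr n k w.
(** The index of the first grid time strictly after [sigma]. Being strict makes [k < kappa] the
    event [tk n k <= sigma], which is known at time [tk n k] for an optional time. At that grid time
    B may have left [[a, b]], which is why [taylorG] restricts [x] but not [y]. *)
Let kappa n w := (Num.truncn (sigma w * n.+1%:R)).+1.

Let aliveE n k w : alive n k w = (k < kappa n w)%N%:R.
Proof.
rewrite /alive /kappa ltnS truncn_ge_nat ?mulr_ge0//.
by rewrite /tk ler_pdivrMr.
Qed.

Let stoppedE n w : stopped n w = mart n (kappa n w) w.
Proof.
have H m : G (B 0 w) + \sum_(k < m) incr n k w = mart n (minn m (kappa n w)) w.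
  elim: m => [|m IH].
    by rewrite big_ord0 addr0 min0n /mart /wt big_ord0 mul1r /tk mul0r.
  rewrite big_ord_recr/= addrA IH /incr aliveE.
  have [mk|km] := ltnP m (kappa n w).
    by rewrite (minn_idPl mk) mul1r addrC subrK.
  by rewrite (minn_idPr (leqW km)) mul0r addr0.
rewrite /stopped H (minn_idPr _)// addn1 /kappa ltnS truncn_le_nat.
apply: (@le_lt_trans _ _ (h%:R * n.+1%:R)); first by rewrite ler_wpM2r.
by rewrite -natrM ltr_nat.
Qed.

Let kappaP n w : sigma w < (kappa n w)%:R / n.+1%:R <= sigma w + n.+1%:R^-1.
Proof.
rewrite ltr_pdivlMr// truncnS_gt/= /kappa -natr1 mulrDl mul1r lerD2r.
by rewrite ler_pdivrMr// truncn_le mulr_ge0.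
Qed.

Let limit w := expR (- \int[mu]_(x in `[0, sigma w]) c (B x w)) * G (B (sigma w) w).

Let stopped_cvg w : stopped n w @[n --> \oo] --> limit w.
Proof.
under eq_fun do rewrite stoppedE.
rewrite /mart /limit; apply: cvgM; last first.
  apply: GB_cvg; apply: (@squeeze_cvgr _ _ _ _ (fun=> sigma w) (fun n => sigma w + n.+1%:R^-1)).
  - by apply: nearW => n; have /andP[/ltW -> ->] := kappaP n w.
  - exact: cvg_cst.
  - rewrite -[X in _ --> X]addr0; apply: cvgD; first exact: cvg_cst.
    exact: cvg_harmonic.
apply: (@riemann_product_cvg _ (fun x => c (B x w)) (sigma w) (fun n => kappa n w)) => //.
move=> x; apply: (@continuous_comp _ _ _ (fun t => B t w) c); last exact: cc.
exact: rbm_continuous bm w x.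
Qed.

Let measurable_stopped n : measurable_fun setT (stopped n).
Proof.
apply: measurable_funD.
  by apply: measurableT_comp => //; exact: (measurable_bm uF bm).
by apply: measurable_sum => k; exact: measurable_incr.
Qed.

Let stopped_bound n w : `|stopped n w| <= MG.
Proof. by rewrite stoppedE. Qed.

Lemma measurable_exponential_bm : measurable_fun setT (fun w =>
  expR (- \int[mu]_(x in `[0, sigma w]) c (B x w)) * G (B (sigma w) w)).
Proof. by have [] := bounded_convergence Pr measurable_stopped stopped_bound stopped_cvg. Qed.

(** There are of the order of [h * n] steps, each with a mean error of order [n ^ (- 3 / 2)], so the
    total error is of order [n ^ (- 1 / 2)]. *)
Theorem exponential_bm_mean :
  \int[Pr]_w (expR (- \int[mu]_(x in `[0, sigma w]) c (B x w)) * G (B (sigma w) w))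
  = G 0.
Proof.
have [_ S] := bounded_convergence Pr measurable_stopped stopped_bound stopped_cvg.
suff S2 : \int[Pr]_w stopped n w @[n --> \oo] --> G 0 by exact: (cvg_unique _ S S2).
have isum n m : Pr.-integrable setT (EFin \o (fun w => \sum_(k < m) incr n k w)).
  have -> : EFin \o (fun w => \sum_(k < m) incr n k w) =
      (fun w => \sum_(k < m) (incr n k w)%:E)%E.
    by apply/funext => w; rewrite /= sumEFin.
  by apply: integrable_sum => // k _; exact: integrable_incr.
have E n : \int[Pr]_w stopped n w = G 0 + \sum_(k < h * n.+1 + 1) \int[Pr]_w incr n k w.
  rewrite /stopped RintegralD//.
  - congr (_ + _).
      under eq_Rintegral do rewrite (rbm_start bm).
      rewrite Rintegral_cst// [X in _ * X](_ : _ = 1) ?mulr1//.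
      exact: (congr1 fine (@probability_setT _ _ _ Pr)).
    elim: (h * n.+1 + 1)%N => [|m IH].
      by rewrite big_ord0; under eq_Rintegral do rewrite big_ord0; rewrite Rintegral_cst// mul0r.
    rewrite big_ord_recr/= -IH -RintegralD//.
      by apply: eq_Rintegral => w _; rewrite big_ord_recr.
  - apply: (@bounded_integrable _ _ _ Pr (fun x => G (B 0 x)) MG) => //.
    by apply: measurableT_comp => //; exact: (measurable_bm uF bm).
rewrite -[X in _ --> X]addr0 (_ : (fun n => \int[Pr]_w stopped n w) =
  (fun n => G 0 + \sum_(k < h * n.+1 + 1) \int[Pr]_w incr n k w)); last exact/funext.
apply: cvgD; first exact: cvg_cst.
apply/cvgr0Pnorm_le => e e0.
pose K := (h%:R + 1) * (4 * C).
have K0 : 0 <= K by rewrite !mulr_ge0// addr_ge0.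
near=> n.
apply: (@le_trans _ _ (K * Num.sqrt n.+1%:R^-1)).
  apply: (le_trans (ler_norm_sum _ _ _)).
  apply: (@le_trans _ _ (\sum_(k < h * n.+1 + 1) 4 * C * (n.+1%:R^-1 * Num.sqrt n.+1%:R^-1))).
    by apply: ler_sum => k _; exact: mean_incr.
  rewrite sumr_const card_ord -[X in X <= _]mulr_natl natrD natrM.
  have -> : (h%:R * n.+1%:R + 1) * (4 * C * (n.+1%:R^-1 * Num.sqrt n.+1%:R^-1)) =
    (h%:R + n.+1%:R^-1) * (4 * C) * Num.sqrt n.+1%:R^-1 :> R.
    by field.
  rewrite ler_wpM2r ?sqrtr_ge0// ler_wpM2r ?mulr_ge0// lerD2l.
  by rewrite invf_le1 ?ler1n.
apply: (@le_trans _ _ ((K + 1) * (e / (K + 1)))); last by rewrite mulrCA divff ?mulr1// gt_eqF// ltr_wpDl.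
have K10 : 0 < K + 1 by rewrite ltr_wpDl.
apply: ler_pM => //; first by rewrite lerDl.
have q0 : 0 < e / (K + 1) by rewrite divr_gt0.
rewrite -[leRHS]ger0_norm ?(ltW q0)// -sqrtr_sqr ler_wsqrtr//.
near: n.
have q20 : 0 < (e / (K + 1)) ^+ 2 by rewrite exprn_gt0// divr_gt0// ltr_wpDl.
by have := near_infty_natSinv_lt (PosNum q20); apply: filterS => n /ltW.
Unshelve. all: by end_near. Qed.

End exponential_martingale.

(** * Mollification *)

Section taylor_estimates.
Context {R : realType}.

(** A quadratic error bound gives the derivative without computing a limit. It serves at the edge of
    the bump and for differentiation under the integral sign. *)
Lemma is_derive_sqbound (f : R -> R) (x l C : R) :
  (forall t, `|f (x + t) - f x - l * t| <= C * t ^+ 2) -> is_derive x 1 f l.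
Proof.
move=> fC; have C0 : 0 <= C.
  by have := fC 1; rewrite expr1n !mulr1; exact: le_trans.
have H : (fun h => h^-1 *: ((f \o shift x) (h *: (1 : R)) - f x)) @ 0^' --> l.
  apply/cvgrPdist_le => e e0.
  have e1 : 0 < e / (C + 1) by rewrite divr_gt0// ltr_wpDl.
  near=> t; have t0 : t != 0 by near: t; exact: nbhs_dnbhs_neq.
  have te : `|t| <= e / (C + 1).
    by near: t; apply: dnbhs0_le.
  rewrite /= /GRing.scale/= mulr1 [t + x]addrC.
  have -> : l - t^-1 * (f (x + t) - f x) = - (t^-1 * (f (x + t) - f x - l * t)).
    by field.
  rewrite normrN normrM normfV.
  rewrite ler_pdivrMl ?normr_gt0//; apply: (le_trans (fC t)).
  rewrite -real_normK ?num_real// expr2 mulrA mulrC ler_pM2l ?normr_gt0//.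
  apply: (@le_trans _ _ (C * (e / (C + 1)))); first by rewrite ler_wpM2l.
  rewrite mulrCA -[leRHS]mulr1 ler_pM2l// ler_pdivrMr ?mul1r ?lerDl//.
  by rewrite ltr_wpDl.
apply: DeriveDef; first by apply/cvg_ex; exists l.
exact: cvg_lim.
Unshelve. all: by end_near. Qed.

Lemma is_derive_continuous (f : R -> R) (x l : R) :
  is_derive x 1 f l -> {for x, continuous f}.
Proof.
by move=> df; apply: differentiable_continuous; apply/derivable1_diffP; have [] := df.
Qed.

Lemma is_derive_congr (f g : R -> R) (x a b : R) :
  is_derive x 1 f a -> (forall y, f y = g y) -> a = b -> is_derive x 1 g b.
Proof. by move=> df /funext <- <-. Qed.

Lemma is_derive_scale (f : R -> R) (x l c : R) :
  is_derive x 1 f l -> is_derive x 1 (fun y => c * f y) (c * l).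
Proof. by move=> df; exact: (is_derive_congr (@is_deriveZ _ _ _ f c x 1 l df)). Qed.

Lemma is_derive_affine (f : R -> R) (x l k c : R) :
  is_derive (k * x + c) 1 f l -> is_derive x 1 (fun y => f (k * y + c)) (k * l).
Proof.
move=> df; have da : is_derive x 1 (fun y : R => k * y + c) k.
  apply: (is_derive_congr (is_deriveD (is_derive_scale k (is_derive_id x 1))
    (is_derive_cst c x 1))) => //.
  by rewrite mulr1 addr0.
have H := @is_derive1_comp _ f (fun y : R => k * y + c) x l k df da.
by apply: (is_derive_congr H) => //; rewrite mulrC.
Qed.

Let is_derive_integral_vanishing (u : R -> R) (x : R) : continuous u ->
  (forall y, y <= 0 -> u y = 0) ->
  is_derive x 1 (fun y => \int[lebesgue_measure]_(t in `[(-1)%R, y]) u t) (u x).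
Proof.
move=> cu u0; have [x0|x0] := ltP x 0.
  rewrite u0; last exact: ltW.
  have d0 : is_derive x 1 (fun=> 0 : R) (0 : R) by exact: (is_derive_cst (0 : R) x (1 : R)).
  apply: (near_eq_is_derive _ d0).
  have : \forall y \near x, y < 0 by exact: lt_nbhsl.
  apply: filterS => y y0; rewrite /Rintegral integral0_eq// => t /=.
  by rewrite in_itv/= => /andP[_ ty]; rewrite u0// (le_trans ty)// ltW.
have x1 : x < x + 1 by rewrite ltrDl.
have [//||//|dF F1] := @continuous_FTC1_closed _ u (-1) x (x + 1) x1.
- exact: (@continuous_itv_integrable _ _ _ (-1) (x + 1)).
- by rewrite (lt_le_trans _ x0)// ltrN10.
- exact: cu.
by apply: DeriveDef; [exact: dF|rewrite -derive1E].
Qed.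

(** [u] carries the right half of [f - f 0] and [v] its reflected left half. Both vanish on the
    negative half line, so their integrals from the fixed endpoint -1 are differentiable everywhere
    and combine to a primitive on the whole line. *)
Lemma continuous_antiderivative (f : R -> R) : continuous f ->
  exists2 F : R -> R, F 0 = 0 & forall x : R, is_derive x 1 F (f x).
Proof.
move=> cf.
pose u (y : R) := f (Num.max y 0) - f 0; pose v (y : R) := f (- Num.max y 0) - f 0.
have cm : continuous (fun y : R => Num.max y 0).
  by move=> y; apply: (@continuous_max _ _ id (cst 0)); [exact: cvg_id|exact: cvg_cst].
have cu : continuous u.
  by move=> y; apply: cvgB; [exact: (continuous_comp (cm y) (cf _))|exact: cvg_cst].
have cv : continuous v.
  move=> y; apply: cvgB; last exact: cvg_cst.
  by apply: (continuous_comp (cvgN (cm y)) (cf _)).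
have u0 y : y <= 0 -> u y = 0.
  by move=> y0; rewrite /u (_ : Num.max y 0 = 0) ?subrr//; apply/max_idPr.
have v0 y : y <= 0 -> v y = 0.
  by move=> y0; rewrite /v (_ : Num.max y 0 = 0) ?oppr0 ?subrr//; apply/max_idPr.
pose F (x : R) := \int[lebesgue_measure]_(t in `[(-1)%R, x]) u t + f 0 * x -
   \int[lebesgue_measure]_(t in `[(-1)%R, (-1) * x + 0]) v t.
have dF (x : R) : is_derive x 1 F (f x).
  have d1 := is_derive_integral_vanishing x cu u0.
  have d2 := is_derive_affine (is_derive_integral_vanishing ((-1) * x + 0) cv v0).
  have d3 := is_derive_scale (f 0) (is_derive_id x 1).
  apply: (is_derive_congr (is_deriveB (is_deriveD d1 d3) d2)) => //.
  rewrite mulr1 addr0 /u /v !mulN1r opprK.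
  have [x0|x0] := leP 0 x.
    rewrite (_ : Num.max (- x) 0 = 0); last by apply/max_idPr; rewrite oppr_le0.
    by rewrite oppr0; ring.
  rewrite (_ : Num.max (- x) 0 = - x); last by apply/max_idPl; rewrite oppr_ge0 ltW.
  by rewrite opprK; ring.
exists (fun x => F x - F 0); first by rewrite subrr.
by move=> x; apply: (is_derive_congr (is_deriveB (dF x) (is_derive_cst (F 0) x 1))) => //; rewrite subr0.
Qed.

(** One rung of Taylor's formula: a derivative that vanishes to order [k] at [x] gives an increment
    of order [k.+1]. The factor [1 / (k + 1)] is dropped. *)
Lemma mvt_bound (f f1 : R -> R) (x t D : R) (k : nat) : 0 <= D ->
  (forall y, Num.min x (x + t) <= y <= Num.max x (x + t) -> is_derive y 1 f (f1 y)) ->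
  (forall y, Num.min x (x + t) <= y <= Num.max x (x + t) -> `|f1 y| <= D * `|y - x| ^+ k) ->
  `|f (x + t) - f x| <= D * `|t| ^+ k.+1.
Proof.
move=> D0 df f1D.
have key y : Num.min x (x + t) <= y <= Num.max x (x + t) -> `|f1 y * t| <= D * `|t| ^+ k.+1.
  move=> yI; rewrite normrM exprSr mulrA ler_wpM2r//.
  apply: (le_trans (f1D y yI)); rewrite ler_wpM2l// lerXn2r ?nnegrE//.
  move: yI; have [t0|t0] := leP 0 t.
    have -> : Num.min x (x + t) = x by apply/min_idPl; rewrite lerDl.
    have -> : Num.max x (x + t) = x + t by apply/max_idPr; rewrite lerDl.
    by move=> /andP[? ?]; rewrite !ger0_norm; lra.
  have -> : Num.min x (x + t) = x + t by apply/min_idPr; rewrite gerDl ltW.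
  have -> : Num.max x (x + t) = x by apply/max_idPl; rewrite gerDl ltW.
  by move=> /andP[? ?]; rewrite (ltr0_norm t0) ler0_norm; lra.
have [t0|t0|<-] := ltgtP 0 t; last first.
- by rewrite addr0 subrr normr0 exprS mul0r mulr0.
- have E1 : Num.min x (x + t) = x + t by apply/min_idPr; rewrite gerDl ltW.
  have E2 : Num.max x (x + t) = x by apply/max_idPl; rewrite gerDl ltW.
  rewrite E1 E2 in df key.
  have xt : x + t < x by rewrite gtrDl.
  have [y||y yI yE] := @MVT _ f f1 _ _ xt.
  + by rewrite in_itv/= => /andP[y1 y2]; apply: df; rewrite !ltW.
  + apply: continuous_in_subspaceT => y; rewrite inE/= in_itv/= => yI.
    exact: is_derive_continuous (df y yI).
  + rewrite distrC yE opprD addrA subrr add0r mulrN normrN; apply: key.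
    by move: yI; rewrite in_itv/= => /andP[y1 y2]; rewrite !ltW.
- have E1 : Num.min x (x + t) = x by apply/min_idPl; rewrite lerDl ltW.
  have E2 : Num.max x (x + t) = x + t by apply/max_idPr; rewrite lerDl ltW.
  rewrite E1 E2 in df key.
  have xt : x < x + t by rewrite ltrDl.
  have [y||y yI yE] := @MVT _ f f1 _ _ xt.
  + by rewrite in_itv/= => /andP[y1 y2]; apply: df; rewrite !ltW.
  + apply: continuous_in_subspaceT => y; rewrite inE/= in_itv/= => yI.
    exact: is_derive_continuous (df y yI).
  + rewrite yE [x + t - x]addrAC subrr add0r; apply: key.
    by move: yI; rewrite in_itv/= => /andP[y1 y2]; rewrite !ltW.
Qed.

Let between (p q x t y : R) : p <= x <= q -> p <= x + t <= q ->
  Num.min x (x + t) <= y <= Num.max x (x + t) -> p <= y <= q.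
Proof.
move=> /andP[px xq] /andP[pt tq] /andP[my yM].
rewrite (le_trans _ my) ?le_min ?px//=; apply: (le_trans yM).
by rewrite ge_max xq.
Qed.

Lemma taylor_first (f f1 : R -> R) (p q D x t : R) : 0 <= D ->
  (forall y, p <= y <= q -> is_derive y 1 f (f1 y)) ->
  (forall y z, p <= y <= q -> p <= z <= q -> `|f1 y - f1 z| <= D * `|y - z|) ->
  p <= x <= q -> p <= x + t <= q ->
  `|f (x + t) - f x - f1 x * t| <= D * t ^+ 2.
Proof.
move=> D0 df f1L xI xtI.
rewrite -real_normK ?num_real//.
have := @mvt_bound (fun y => f y - f1 x * y) (fun y => f1 y - f1 x) x t D 1 D0.
rewrite (_ : _ - _ - (_ - _) = f (x + t) - f x - f1 x * t); last by ring.
apply.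
- move=> y yI; have dfy := df y (between xI xtI yI).
  have -> : f1 y - f1 x = f1 y - f1 x *: 1 by rewrite /GRing.scale/= mulr1.
  by apply: is_deriveB; apply: is_deriveZ.
- by move=> y yI; rewrite expr1; apply: f1L => //; exact: (between xI xtI yI).
Qed.

Lemma taylor_second (f f1 f2 : R -> R) (p q D x t : R) : 0 <= D ->
  (forall y, p <= y <= q -> is_derive y 1 f (f1 y)) ->
  (forall y, p <= y <= q -> is_derive y 1 f1 (f2 y)) ->
  (forall y z, p <= y <= q -> p <= z <= q -> `|f2 y - f2 z| <= D * `|y - z|) ->
  p <= x <= q -> p <= x + t <= q ->
  `|f (x + t) - f x - f1 x * t - f2 x / 2 * t ^+ 2| <= D * `|t| ^+ 3.
Proof.
move=> D0 df df1 f2L xI xtI.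
have := @mvt_bound (fun y => f y - f1 x * y - f2 x / 2 * (y - x) ^+ 2)
  (fun y => f1 y - f1 x - f2 x * (y - x)) x t D 2 D0.
rewrite (_ : _ - _ - _ - (_ - _ - _) =
   f (x + t) - f x - f1 x * t - f2 x / 2 * t ^+ 2); last by field.
apply.
- move=> y yI; have dfy := df y (between xI xtI yI).
  have d2 : is_derive y 1 (fun y => (y - x) ^+ 2) (2 * (y - x)).
    by apply: is_derive_eq; rewrite /GRing.scale/= subr0; ring.
  have -> : f1 y - f1 x - f2 x * (y - x) = f1 y - f1 x *: 1 - (f2 x / 2) *: (2 * (y - x)).
    by rewrite /GRing.scale/= mulr1; field.
  by apply: is_deriveB.
- move=> y yI; have yJ := between xI xtI yI.
  rewrite (_ : f1 y = f1 (x + (y - x))); last by rewrite addrC subrK.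
  rewrite real_normK ?num_real//.
  apply: (@taylor_first f1 f2 p q) => //; by rewrite addrC subrK.
Qed.

End taylor_estimates.

(** * A smooth kernel with compact support *)

Section bump.
Context {R : realType}.

(** The functions of this shape are closed under differentiation: [p] becomes [bump_deriv p k] and
    [k] grows by 2. A single derivative lemma thus covers all orders. *)
Definition bump (p : {poly R}) (k : nat) (x : R) : R :=
  if `|x| < 1 then p.[x] * (1 - x ^+ 2) ^- k * expR (- (1 - x ^+ 2)^-1) else 0.

Definition bump_deriv (p : {poly R}) (k : nat) : {poly R} :=
  p^`() * (1 - 'X ^+ 2) ^+ 2 + 2%:P * k%:R%:P * 'X * p * (1 - 'X ^+ 2)
  - 2%:P * 'X * p.

(** One term of the exponential series at [v^-1], of order [k + 2], absorbs the pole of order [k]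
    and leaves a double zero; this makes the bump differentiable at the edge. *)
Let inv_expR_bound (k : nat) (v : R) : 0 < v ->
  v ^- k * expR (- v^-1) <= k.+2`!%:R * v ^+ 2.
Proof.
move=> v0; have := @expR_ge1Dxn R v^-1 k.+1.
rewrite invr_ge0 => /(_ (ltW v0)) E.
have f0 : 0 < k.+2`!%:R :> R by rewrite ltr0n fact_gt0.
rewrite expRN ler_pdivrMr ?expR_gt0//.
apply: (@le_trans _ _ (k.+2`!%:R * v ^+ 2 * (v^-1 ^+ k.+2 / k.+2`!%:R))).
  rewrite le_eqVlt; apply/orP; left; apply/eqP.
  rewrite exprVn (_ : k.+2 = (2 + k)%N)// exprD; field.
  by rewrite !gt_eqF// ?exprn_gt0.
rewrite ler_wpM2l ?mulr_ge0 ?ltW ?exprn_gt0//.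
by move: E; lra.
Qed.

Let unit_sqr (x : R) : `|x| < 1 -> 0 < 1 - x ^+ 2.
Proof.
move=> x1; rewrite subr_gt0 -real_normK ?num_real//.
by rewrite expr_lt1.
Qed.

Let bump_small (p : {poly R}) (k : nat) : exists2 M, 0 <= M &
  forall x, `|x| < 1 -> `|bump p k x| <= M * (1 - x ^+ 2) ^+ 2.
Proof.
have N11 : -1 <= 1 :> R by lra.
have cp : {within `[(-1)%R, 1], continuous (fun x => `|p.[x]|)}.
  apply: continuous_subspaceT => x; apply: (@continuous_comp _ _ _ (horner p) Num.norm).
    exact: continuous_horner.
  exact: norm_continuous.
have [z _ pz] := EVT_max N11 cp.
exists (`|p.[z]| * k.+2`!%:R); first by rewrite mulr_ge0.
move=> x x1; rewrite /bump x1; have v0 := unit_sqr x1.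
rewrite -mulrA normrM -mulrA ler_pM//.
  by apply: pz; rewrite in_itv/= -ler_norml ltW.
rewrite ger0_norm; first exact: inv_expR_bound.
by rewrite mulr_ge0 ?expR_ge0// invr_ge0 exprn_ge0// ltW.
Qed.

Lemma bump_eq0 p k x : 1 <= `|x| -> bump p k x = 0.
Proof. by rewrite /bump ltNge => ->. Qed.

Lemma bump_bounded p k : exists2 M, 0 <= M & forall x, `|bump p k x| <= M.
Proof.
have [M M0 bM] := bump_small p k; exists M => // x.
have [x1|x1] := ltP `|x| 1; last by rewrite bump_eq0// normr0.
apply: (le_trans (bM _ x1)); rewrite -[leRHS]mulr1 ler_wpM2l//.
have v0 := unit_sqr x1.
have w1 : 1 - x ^+ 2 <= 1 by have := sqr_ge0 x; lra.
by move: (1 - x ^+ 2) v0 w1 => v ? ?; nra.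
Qed.

Lemma is_derive_bump p k (x : R) :
  is_derive x 1 (bump p k) (bump (bump_deriv p k) k.+2 x).
Proof.
have [x1|x1] := ltP `|x| 1; last first.
  rewrite [X in is_derive _ _ _ X]bump_eq0//.
  have [M M0 bM] := bump_small p k.
  (* From a point outside the unit interval, [1 - (x + t) ^+ 2 <= 2 * |t|]; its square gives the
     factor 4. *)
  apply: (@is_derive_sqbound _ _ _ _ (M * 4)) => t.
  rewrite (bump_eq0 _ _ x1) mul0r !subr0.
  have [xt1|xt1] := ltP `|x + t| 1; last first.
    by rewrite bump_eq0// normr0 mulr_ge0 ?sqr_ge0// mulr_ge0.
  apply: (le_trans (bM _ xt1)); rewrite -mulrA ler_wpM2l//.
  have v0 := unit_sqr xt1.
  have vt : 1 - (x + t) ^+ 2 <= 2 * `|t|.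
    rewrite -real_normK ?num_real//.
    have : `|x| <= `|x + t| + `|t|.
      by rewrite -{1}[x](addrK t); exact: ler_normB.
    have := normr_ge0 (x + t); have := normr_ge0 t.
    by move: `|x + t| `|x| `|t| x1 xt1 => ? ? ? ? ? ? ?; nra.
  rewrite -[X in _ <= _ * X]real_normK ?num_real//.
  by have := normr_ge0 t; nra.
apply: (@near_eq_is_derive _ _ _
  (fun x => p.[x] * (1 - x ^+ 2) ^- k * expR (- (1 - x ^+ 2)^-1))).
  have /cvgr_lt : Num.norm y @[y --> x] --> `|x| by exact: norm_continuous.
  by move=> /(_ _ x1); apply: filterS => y y1; rewrite /bump y1.
have v0 := unit_sqr x1.
have vn0 : 1 - x ^+ 2 != 0 by rewrite gt_eqF.
have dv : is_derive x 1 (fun x : R => 1 - x ^+ 2) (- (2 * x)).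
  by apply: is_derive_eq; rewrite /GRing.scale/=; ring.
have dvi : is_derive x 1 (fun x : R => (1 - x ^+ 2)^-1) (2 * x * (1 - x ^+ 2) ^- 2).
  apply: (is_derive_congr (@is_deriveV _ (fun x => 1 - x ^+ 2) x _ 1 vn0 dv)) => //.
  by rewrite /GRing.scale/= mulrNN mulrC.
have dvk : is_derive x 1 (fun x : R => (1 - x ^+ 2) ^- k) (k%:R * (2 * x) * (1 - x ^+ 2) ^- k.+1).
  case: k => [|k].
    by rewrite !mul0r; under eq_fun do rewrite expr0 invr1; exact: is_derive_cst.
  have vk0 : (1 - x ^+ 2) ^+ k.+1 != 0 by rewrite expf_neq0.
  have dk := @is_deriveX _ _ (fun x : R => 1 - x ^+ 2) k.+1 x 1 _ dv.
  have dk1 : is_derive x 1 (fun x : R => (1 - x ^+ 2) ^+ k.+1)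
      (k.+1%:R * (1 - x ^+ 2) ^+ k * - (2 * x)).
    by apply: (is_derive_congr dk) => // y; rewrite exprfctE.
  apply: (is_derive_congr (@is_deriveV _ (fun x : R => (1 - x ^+ 2) ^+ k.+1) x _ 1 vk0 dk1)) => //.
  rewrite /GRing.scale/=; set w := 1 - x ^+ 2 in vn0 *.
  have uk0 : w ^+ k != 0 by rewrite expf_neq0.
  rewrite (exprS w k.+1) !(exprS w k).
  by move: (w ^+ k) uk0 => u u0; field; rewrite vn0 u0.
have dp : is_derive x 1 (fun x : R => p.[x]) (p^`().[x]) by exact: is_derive_poly.
have de : is_derive x 1 (fun x : R => expR (- (1 - x ^+ 2)^-1))
    (- (2 * x * (1 - x ^+ 2) ^- 2) * expR (- (1 - x ^+ 2)^-1)).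
  apply: (is_derive_congr (@is_derive1_comp _ expR _ _ _ _ (is_derive_expR _)
    (is_deriveN dvi))) => //.
  by rewrite mulrC.
have dpk : is_derive x 1 (fun x : R => p.[x] * (1 - x ^+ 2) ^- k)
    (p.[x] * (k%:R * (2 * x) * (1 - x ^+ 2) ^- k.+1) + (1 - x ^+ 2) ^- k * p^`().[x]).
  exact: (is_derive_congr (is_deriveM dp dvk)).
have pE : (bump_deriv p k).[x] = p^`().[x] * (1 - x ^+ 2) ^+ 2 +
    2 * k%:R * x * p.[x] * (1 - x ^+ 2) - 2 * x * p.[x].
  rewrite /bump_deriv hornerD hornerN hornerD !hornerM !hornerC hornerX.
  by rewrite !hornerD hornerN hornerC hornerXn; ring.
apply: (is_derive_congr (is_deriveM dpk de)) => //.
rewrite /bump x1 pE /GRing.scale/=.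
set v := 1 - x ^+ 2 in vn0 *; move: (expR _) => E.
have uk0 : v ^+ k != 0 by rewrite expf_neq0.
rewrite (exprS v k.+1) !(exprS v k).
by move: (v ^+ k) uk0 => u u0; field; rewrite vn0 u0.
Qed.

Fixpoint bumpn (n : nat) : {poly R} * nat :=
  if n is n.+1 then (bump_deriv (bumpn n).1 (bumpn n).2, (bumpn n).2.+2)
  else (1, 0%N).

Let bumpf n (x : R) := bump (bumpn n).1 (bumpn n).2 x.

(* [mollifier e n] is the n-th derivative of a kernel of mass 1 supported in [-e, e]. *)
Definition bump_mass : R := \int[lebesgue_measure]_(x in `[(-1)%R, 1]) bump 1 0 x.

Definition mollifier (e : R) (n : nat) (x : R) : R :=
  (bump_mass * e ^+ n.+1)^-1 * bumpf n (x / e).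

Lemma is_derive_mollifier e n (x : R) : e != 0 ->
  is_derive x 1 (mollifier e n) (mollifier e n.+1 x).
Proof.
move=> e0.
have d := is_derive_bump (bumpn n).1 (bumpn n).2 (e^-1 * x + 0).
apply: (is_derive_congr (is_derive_scale (bump_mass * e ^+ n.+1)^-1 (is_derive_affine d))).
  by move=> y; rewrite /mollifier /bumpf addr0 mulrC [e^-1 * _]mulrC mulrC.
rewrite addr0 [e^-1 * x]mulrC /mollifier /bumpf [in RHS](exprS _ n.+1) !invfM /=.
by ring.
Qed.

Lemma continuous_mollifier e n : e != 0 -> continuous (mollifier e n).
Proof. by move=> e0 x; exact: is_derive_continuous (is_derive_mollifier n x e0). Qed.

Lemma mollifier_eq0 e n (x : R) : 0 < e -> e <= `|x| -> mollifier e n x = 0.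
Proof.
move=> e0 ex; rewrite /mollifier /bumpf bump_eq0 ?mulr0//.
by rewrite normrM normfV (gtr0_norm e0) ler_pdivlMr// mul1r.
Qed.

Lemma mollifier_bounded e n : exists2 M, 0 <= M & forall x, `|mollifier e n x| <= M.
Proof.
have [M M0 bM] := bump_bounded (bumpn n).1 (bumpn n).2.
exists (`|(bump_mass * e ^+ n.+1)^-1| * M); first by rewrite mulr_ge0.
by move=> x; rewrite /mollifier normrM; apply: ler_wpM2l => //; exact: bM.
Qed.

Lemma mollifier_lipschitz e n : e != 0 -> exists2 M, 0 <= M &
  forall x y, `|mollifier e n x - mollifier e n y| <= M * `|x - y|.
Proof.
move=> e0; have [M M0 bM] := mollifier_bounded e n.+1.
exists M => // x y.
have := @mvt_bound _ (mollifier e n) (mollifier e n.+1) y (x - y) M 0 M0.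
rewrite addrC subrK expr1; apply => z _; first exact: is_derive_mollifier.
by rewrite expr0 mulr1.
Qed.

Let bump_ge0 (x : R) : 0 <= bump 1 0 x.
Proof.
rewrite /bump; case: ifP => // _.
by rewrite hornerE expr0 invr1 !mul1r expR_ge0.
Qed.

Let cbump : continuous (bump 1 0 : R -> R).
Proof. by move=> x; exact: is_derive_continuous (is_derive_bump _ _ x). Qed.

Lemma bump_mass_gt0 : 0 < bump_mass.
Proof.
have [F _ dF] := continuous_antiderivative cbump.
have ltN11 : -1 < 1 :> R by lra.
have mE : bump_mass = F 1 - F (-1).
  by rewrite /bump_mass /Rintegral (is_derive_FTC2 ltN11 cbump dF).
(* On [[0, 1/2]] the bump is at least [expR (-2)], because [1 - z ^+ 2] is at least 1/2 there.
   Elsewhere it is enough that the primitive is nondecreasing. *)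
have Fmono (x y : R) : x < y -> F x <= F y /\
    (0 <= x -> y <= 2^-1 -> (y - x) * expR (-2) <= F y - F x).
  move=> xy; have [|z zI zE] := @MVT _ F (bump 1 0) _ _ xy (fun z _ => dF z).
    by apply: continuous_subspaceT => z; exact: is_derive_continuous (dF z).
  have yx0 : 0 <= y - x by rewrite subr_ge0 ltW.
  split; first by rewrite -subr_ge0 zE mulr_ge0.
  move=> x0 y1; move: zI; rewrite in_itv/= => /andP[z0 z1].
  rewrite zE mulrC ler_wpM2r//.
  have nz1 : `|z| < 1 by rewrite ger0_norm; lra.
  rewrite /bump nz1 hornerE expr0 invr1 !mul1r ler_expR lerN2.
  have z2 : z ^+ 2 <= 2^-1 by nra.
  rewrite -[leRHS]invrK lef_pV2 ?posrE ?invr_gt0//; last lra.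
  by lra.
have /Fmono[F1 _] : -1 < 0 :> R by lra.
have /Fmono[F2 _] : 2^-1 < 1 :> R by lra.
have /Fmono[_] : 0 < 2^-1 :> R by lra.
rewrite subr0 => /(_ (lexx _) (lexx _)); have := @expR_gt0 R (-2).
by rewrite mE; lra.
Qed.

Lemma mollifier_ge0 e (x : R) : 0 < e -> 0 <= mollifier e 0 x.
Proof.
move=> e0; rewrite /mollifier /bumpf /= mulr_ge0// invr_ge0 mulr_ge0//.
  by rewrite ltW// bump_mass_gt0.
by rewrite expr1 ltW.
Qed.

Lemma mollifier_even e (x : R) : mollifier e 0 (- x) = mollifier e 0 x.
Proof. by rewrite /mollifier /bumpf mulNr /bump normrN sqrrN !hornerE. Qed.

Lemma mollifier_mass e (x : R) : 0 < e ->
  (\int[lebesgue_measure]_(y in `[(x - e)%R, (x + e)%R]) (mollifier e 0 (x - y))%:E = 1)%E.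
Proof.
move=> e0; have xe : x - e < x + e by lra.
have [F _ dF] := continuous_antiderivative cbump.
have ltN11 : -1 < 1 :> R by lra.
have mE : bump_mass = F 1 - F (-1).
  by rewrite /bump_mass /Rintegral (is_derive_FTC2 ltN11 cbump dF).
have m0 := bump_mass_gt0; have en0 : e != 0 by rewrite gt_eqF.
pose G (y : R) := - bump_mass^-1 * F (- e^-1 * y + x / e).
have dG (y : R) : is_derive y 1 G (mollifier e 0 (x - y)).
  apply: (is_derive_congr (is_derive_scale (- bump_mass^-1)
    (is_derive_affine (dF (- e^-1 * y + x / e))))) => //.
  rewrite /mollifier /bumpf/= expr1 invfM.
  rewrite (_ : - e^-1 * y + x / e = (x - y) / e); last by field.
  by field; rewrite en0 gt_eqF.
rewrite (is_derive_FTC2 xe _ dG); last first.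
  move=> y; apply: (@continuous_comp _ _ _ (fun y : R => x - y) (mollifier e 0)).
    by apply: cvgB; [exact: cvg_cst|exact: cvg_id].
  exact: continuous_mollifier.
congr EFin; rewrite /G.
rewrite (_ : - e^-1 * (x + e) + x / e = -1); last by field.
rewrite (_ : - e^-1 * (x - e) + x / e = 1); last by field.
by rewrite mE; field; rewrite -mE gt_eqF.
Qed.

(** Reflection multiplies the n-th derivative by [(-1) ^+ n], and the sign disappears at order
    two. *)
Lemma mollifier_smooth e (z : R) : e != 0 ->
  (forall n (x : R),
    derivable (derive1n n (fun y => mollifier e 0 (z - y)) : R -> R^o) x 1) /\
  forall x : R, derive1n 2 (fun y => mollifier e 0 (z - y)) x = mollifier e 2 (z - x).
Proof.
move=> e0.
have d m (y : R) : is_derive y 1 (fun y => (-1) ^+ m * mollifier e m (z - y))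
    ((-1) ^+ m.+1 * mollifier e m.+1 (z - y)).
  have c := is_derive_affine (is_derive_mollifier m ((-1) * y + z) e0).
  apply: (is_derive_congr (is_derive_scale ((-1) ^+ m) c)).
    by move=> u; rewrite mulN1r addrC.
  by rewrite mulN1r [- y + z]addrC exprS; ring.
have E m : derive1n m (fun y => mollifier e 0 (z - y)) =
    (fun y => (-1) ^+ m * mollifier e m (z - y)).
  elim: m => [|m IH]; first by apply/funext => y; rewrite /= expr0 mul1r.
  rewrite derive1nS IH; apply/funext => y.
  by rewrite derive1E; have [] := d m y.
split => [n x|x]; rewrite E; first by have [] := d n x.
by rewrite sqrrN expr1n mul1r.
Qed.

End bump.

Section clamping.
Context {R : realType}.
Implicit Types (a b x : R).

(** Composition with [clamp a b] turns a function continuous on the segment into one continuous on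
    the line. *)
Definition clamp a b x := Num.max a (Num.min b x).

Lemma clamp_itv a b x : a <= b -> a <= clamp a b x <= b.
Proof. by move=> ab; rewrite /clamp le_max lexx/= ge_max ab ge_min lexx. Qed.

Lemma clamp_id a b x : a <= x <= b -> clamp a b x = x.
Proof.
move=> /andP[ax xb]; rewrite /clamp.
by rewrite (_ : Num.min b x = x); [apply/max_idPr|apply/min_idPr].
Qed.

Lemma continuous_clamp a b : continuous (clamp a b).
Proof.
move=> x; apply: (@continuous_max _ _ (cst a) (fun x => Num.min b x)); first exact: cvg_cst.
by apply: (@continuous_min _ _ (cst b) id); [exact: cvg_cst|exact: cvg_id].
Qed.

Lemma continuous_comp_clamp (f : R -> R) a b : a <= b ->
  (forall x, a <= x <= b -> {for x, continuous f}) -> continuous (f \o clamp a b).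
Proof.
move=> ab cf x; apply: continuous_comp; first exact: continuous_clamp.
by apply: cf; exact: clamp_itv.
Qed.

Lemma segment_bounded (f : R -> R) a b : 
  (forall x, a <= x <= b -> {for x, continuous f}) ->
  exists2 M, 0 <= M & forall x, a <= x <= b -> `|f x| <= M.
Proof.
have [ab cf|ba _] := leP a b; last first.
  by exists 0 => // x /andP[ax xb]; move: (le_trans ax xb); rewrite leNgt ba.
have cn : {within `[a, b], continuous (fun x => `|f (clamp a b x)|)}.
  apply: continuous_subspaceT => x; apply: (@continuous_comp _ _ _ (f \o clamp a b) Num.norm).
    exact: continuous_comp_clamp.
  exact: norm_continuous.
have [z _ pz] := EVT_max ab cn.
exists `|f (clamp a b z)| => // x xab.
by have := pz x; rewrite in_itv/= xab clamp_id//; apply.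
Qed.

End clamping.

Section exponential_martingale_smooth.
Context {R : realType} {d : measure_display} {T : measurableType d}.
Context {Pr : probability T R} {F : R -> set (set T)} {B : R -> T -> R}.
Hypotheses (uF : usual_filtration Pr F) (bm : regular_bm Pr F B).
Context {c f f1 f2 : R -> R} {a b eta D : R}.
Hypotheses (ab : a <= b) (eta0 : 0 < eta) (D0 : 0 <= D).
Hypothesis df : forall x, a - eta <= x <= b + eta -> is_derive x 1 f (f1 x).
Hypothesis df1 : forall x, a - eta <= x <= b + eta -> is_derive x 1 f1 (f2 x).
Hypothesis f2L : forall x y, a - eta <= x <= b + eta -> a - eta <= y <= b + eta ->
  `|f2 x - f2 y| <= D * `|x - y|.
Hypotheses (cc : continuous c) (c0 : forall x, 0 <= c x).
Hypothesis cf : forall x, a <= x <= b -> f2 x = 2 * c x * f x.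

Let cl := clamp (a - eta) (b + eta).

Let aebe : a - eta <= b + eta. Proof. by move: ab eta0; lra. Qed.

Let cf0 x : a - eta <= x <= b + eta -> {for x, continuous f}.
Proof. by move=> /df; exact: is_derive_continuous. Qed.

Let cf1 x : a - eta <= x <= b + eta -> {for x, continuous f1}.
Proof. by move=> /df1; exact: is_derive_continuous. Qed.

Let subitv x : a <= x <= b -> a - eta <= x <= b + eta.
Proof. by move: eta0 => ? /andP[? ?]; apply/andP; split; lra. Qed.

(** If [x + y] stays in the enlarged segment this is Taylor's formula. Otherwise [eta <= |y|], and
    the crude bound [2 * M + M1 * |y| + N * M * |y| ^ 2] is turned into a multiple of [|y| ^ 3] by
    powers of [|y| / eta]; this is the origin of the three extra terms of the constant. *)
Let taylor : exists M M1 C : R, [/\ forall x, `|f (cl x)| <= M,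
  forall x, a <= x <= b -> `|f1 (cl x)| <= M1 &
  forall x y, a <= x <= b ->
  `|f (cl (x + y)) - f (cl x) - f1 (cl x) * y - c x * f (cl x) * y ^+ 2| <= C * `|y| ^+ 3].
Proof.
have [M M0 fM] := segment_bounded cf0.
have [M1 M10 f1M] := segment_bounded cf1.
have [N N0 cN] := @segment_bounded _ c a b ltac:(by move=> x _; exact: cc).
exists M, M1, (D + (2 * M / eta ^+ 3 + M1 / eta ^+ 2 + N * M / eta)); split.
- by move=> x; apply: fM; exact: clamp_itv.
- by move=> x _; apply: f1M; exact: clamp_itv.
move=> x y xab; have xJ := subitv xab.
rewrite /cl (clamp_id xJ).
have K0 : 0 <= 2 * M / eta ^+ 3 + M1 / eta ^+ 2 + N * M / eta.
  by rewrite !addr_ge0// divr_ge0 ?mulr_ge0 ?exprn_ge0// ltW.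
have y30 : 0 <= `|y| ^+ 3 by rewrite exprn_ge0.
have [xyJ|xyJ] := boolP (a - eta <= x + y <= b + eta).
  rewrite (clamp_id xyJ) (_ : c x * f x = f2 x / 2); last by rewrite cf//; field.
  apply: (le_trans (taylor_second D0 df df1 f2L xJ xyJ)).
  by rewrite mulrDl lerDl mulr_ge0.
have ey : eta <= `|y|.
  move: xyJ; rewrite negb_and -!ltNge => /orP[] h.
    by rewrite ler0_norm; move: xab => /andP[? ?]; lra.
  by rewrite ger0_norm; move: xab => /andP[? ?]; lra.
apply: (@le_trans _ _ (2 * M + M1 * `|y| + N * M * `|y| ^+ 2)).
  have h1 := fM _ (clamp_itv (x + y) aebe); have h2 := fM _ xJ; have h3 := f1M _ xJ.
  have h4 := cN _ xab.
  have k3 : `|f1 x * y| <= M1 * `|y| by rewrite normrM ler_wpM2r.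
  have k4 : `|c x * f x * y ^+ 2| <= N * M * `|y| ^+ 2.
    by rewrite !normrM -expr2 ler_wpM2r ?exprn_ge0// ler_pM.
  apply: (le_trans (ler_normB _ _)); apply: lerD => //.
  apply: (le_trans (ler_normB _ _)); apply: lerD => //.
  apply: (le_trans (ler_normB _ _)); lra.
rewrite mulrDl; have Dy := mulr_ge0 D0 y30.
suff : 2 * M + M1 * `|y| + N * M * `|y| ^+ 2 <=
    (2 * M / eta ^+ 3 + M1 / eta ^+ 2 + N * M / eta) * `|y| ^+ 3 by move: Dy; lra.
have t1 : 1 <= `|y| / eta by rewrite ler_pdivlMr ?mul1r.
have -> : (2 * M / eta ^+ 3 + M1 / eta ^+ 2 + N * M / eta) * `|y| ^+ 3 =
   2 * M * (`|y| / eta) ^+ 3 + M1 * `|y| * (`|y| / eta) ^+ 2 + N * M * `|y| ^+ 2 * (`|y| / eta).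
  by field; rewrite gt_eqF.
have l k : 1 <= (`|y| / eta) ^+ k by rewrite exprn_ege1.
apply: lerD; [apply: lerD|]; rewrite ler_peMr ?l ?mulr_ge0 ?exprn_ge0//.
Qed.

Context {sigma : T -> R} {h : nat}.
Hypothesis osigma : optional_time F sigma.
Hypothesis sigma_ge0 : forall w, 0 <= sigma w.
Hypothesis sigma_leh : forall w, sigma w <= h%:R.
Hypothesis Bab : forall w s, 0 <= s <= sigma w -> a <= B s w <= b.

Let Y w := expR (- \int[lebesgue_measure]_(x in `[0, sigma w]) c (B x w)) * f (B (sigma w) w).

Let YE : Y = fun w => expR (- \int[lebesgue_measure]_(x in `[0, sigma w]) c (B x w)) *
  f (cl (B (sigma w) w)).
Proof. apply/funext => w; rewrite /Y; by rewrite /cl clamp_id//; apply/subitv/Bab; rewrite sigma_ge0/=. Qed.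

Let mcomp (u : R -> R) : (forall x, a - eta <= x <= b + eta -> {for x, continuous u}) ->
  measurable_fun setT (fun x => u (cl x)).
Proof. by move=> cu; apply: continuous_measurable_fun; exact: continuous_comp_clamp. Qed.

Lemma measurable_smooth_exponential_bm : measurable_fun setT Y.
Proof.
have [M [M1 [C [fM f1M tay]]]] := taylor.
rewrite YE.
exact: (measurable_exponential_bm uF bm cc c0 (mcomp cf0) fM tay osigma sigma_ge0 sigma_leh Bab).
Qed.

Lemma smooth_exponential_bm_mean : \int[Pr]_w Y w = f 0.
Proof.
have [M [M1 [C [fM f1M tay]]]] := taylor.
rewrite YE (exponential_bm_mean uF bm cc c0 (mcomp cf0) (mcomp cf1) fM f1M tay osigma
  sigma_ge0 sigma_leh Bab) /cl clamp_id//.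
(* The position of 0 in [[a, b]] is known only through the starting point of a path, so a sample
   point is needed; the total mass 1 provides one. *)
have [w _] : exists w : T, True.
  apply/not_existsP => h0; have := @probability_setT _ _ _ Pr.
  rewrite (_ : setT = set0) ?measure0; first by move=> /eqP; rewrite eq_sym onee_eq0.
  by apply/seteqP; split => // w _; exact: (h0 w).
by apply: subitv; rewrite -(rbm_start bm w); apply: Bab; rewrite lexx/=.
Qed.

End exponential_martingale_smooth.

Lemma eq_integral_support {d} {T : measurableType d} {R : realType}
    (m : {measure set T -> \bar R}) (A D : set T) (f : T -> \bar R) :
  A `<=` D -> (forall x, D x -> ~ A x -> f x = 0%E) ->
  (\int[m]_(x in D) f x = \int[m]_(x in A) f x)%E.
Proof.
move=> AD f0; rewrite [LHS]integral_mkcond [RHS]integral_mkcond.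
apply: eq_integral => x _; rewrite !patchE.
case: ifPn => [xD|/negP xD]; case: ifPn => [xA|/negP xA] //.
- by apply: f0; [exact: set_mem|move=> /mem_set].
- by exfalso; apply: xD; apply/mem_set/AD/set_mem.
Qed.

Section mollification.
Context {R : realType}.
Notation mu := (@lebesgue_measure R).
Context {k : R -> R} {p q : R}.
Hypotheses (ck : continuous k) (pq : p <= q).

Definition mollified e n (z : R) : R :=
  \int[mu]_(y in `[p, q]) (k y * mollifier e n (z - y)).

Let cint e n z : e != 0 -> continuous (fun y => k y * mollifier e n (z - y)).
Proof.
move=> e0 y; apply: cvgM; first exact: ck.
apply: (@continuous_comp _ _ _ (fun y : R => z - y) (mollifier e n)).
  by apply: cvgB; [exact: cvg_cst|exact: cvg_id].
exact: continuous_mollifier.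
Qed.

Let iint e n z : e != 0 -> mu.-integrable `[p, q] (EFin \o (fun y => k y * mollifier e n (z - y))).
Proof. by move=> e0; apply: (@continuous_itv_integrable _ _ _ p q) => //; exact: cint. Qed.

Lemma mollifiedE e n z : e != 0 ->
  (mollified e n z)%:E = (\int[mu]_(y in `[p, q]) (k y * mollifier e n (z - y))%:E)%E.
Proof. by move=> e0; rewrite fineK//; apply: integrable_fin_num => //; exact: iint. Qed.

Let convolution_bound (u : R -> R) (D : R) :
  mu.-integrable `[p, q] (EFin \o (fun y => k y * u y)) ->
  (forall y, `|u y| <= D) ->
  `|\int[mu]_(y in `[p, q]) (k y * u y)| <= \int[mu]_(y in `[p, q]) `|k y| * D.
Proof.
move=> iu uD; have ik : mu.-integrable `[p, q] (EFin \o (fun y => `|k y|)).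
  apply: (@continuous_itv_integrable _ _ _ p q) => //.
  by move=> y; apply: (@continuous_comp _ _ _ k Num.norm); [exact: ck|exact: norm_continuous].
apply: (le_trans (le_normr_Rintegral _ iu)) => //.
rewrite -RintegralZr//; apply: le_Rintegral => //.
- exact: (integrable_norm iu).
- exact: (integrableZr _ D ik).
- by move=> y _; rewrite normrM ler_wpM2l.
Qed.

Let mass := \int[mu]_(y in `[p, q]) `|k y|.

Let mass_ge0 : 0 <= mass.
Proof. by apply: Rintegral_ge0 => y _. Qed.

(** Differentiation under the integral: the first order Taylor error of the kernel is quadratic in
    [t] uniformly in [y], hence still quadratic after integration against [|k|]. *)
Lemma is_derive_mollified e n (z : R) : e != 0 ->
  is_derive z 1 (mollified e n) (mollified e n.+1 z).
Proof.
move=> e0; have [D D0 mD] := mollifier_lipschitz n.+1 e0.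
apply: (@is_derive_sqbound _ _ _ _ (mass * D)) => t.
rewrite /mollified -RintegralB//; [|exact: iint..].
rewrite -RintegralZr//; last exact: iint.
rewrite -RintegralB//; last 2 first.
- exact: (integrableB _ (iint _ _ e0) (iint _ _ e0)).
- exact: (integrableZr _ t (iint _ _ e0)).
pose u y := mollifier e n (z + t - y) - mollifier e n (z - y) - mollifier e n.+1 (z - y) * t.
under eq_Rintegral => y _.
  rewrite (_ : _ - _ = k y * u y); last by rewrite /u; ring.
  over.
rewrite -mulrA; apply: convolution_bound.
- apply: (@continuous_itv_integrable _ _ _ p q) => // y.
  rewrite (_ : (fun _ => _) = (fun y => k y * mollifier e n (z + t - y) -
    k y * mollifier e n (z - y) - k y * mollifier e n.+1 (z - y) * t)).
    apply: cvgB; first by apply: cvgB; exact: cint.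
    by apply: cvgM; [exact: cint|exact: cvg_cst].
  by apply/funext => y'; rewrite /u; ring.
- move=> y; rewrite /u (_ : z + t - y = (z - y) + t); last by ring.
  apply: (@taylor_first _ _ _ (z - y - `|t|) (z - y + `|t|)) => //.
  + by move=> v _; exact: is_derive_mollifier.
  + by have := normr_ge0 t; move=> ?; apply/andP; split; lra.
  + by have := ler_norm t; have := ler_norm (- t); rewrite normrN => ? ?; apply/andP; split; lra.
Qed.

Lemma mollified_lipschitz e n : e != 0 -> exists2 D, 0 <= D &
  forall x y, `|mollified e n x - mollified e n y| <= D * `|x - y|.
Proof.
move=> e0; have [M M0 mM] := mollifier_bounded e n.+1.
exists (mass * M); first exact: mulr_ge0.
move=> x y.
have := @mvt_bound _ (mollified e n) (mollified e n.+1) y (x - y) (mass * M) 0.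
rewrite addrC subrK expr1; apply => [|z _|z _]; first exact: mulr_ge0.
  exact: is_derive_mollified.
by rewrite expr0 mulr1; apply: convolution_bound => //; exact: iint.
Qed.

Hypothesis k0 : forall y, 0 <= k y.

Lemma mollified_itv e z lo hi : 0 < e -> p <= z - e -> z + e <= q -> 0 <= lo ->
  (forall y, z - e <= y <= z + e -> lo <= k y <= hi) -> lo <= mollified e 0 z <= hi.
Proof.
move=> e0 pz zq lo0 lok.
have hi0 : 0 <= hi.
  have /lok/andP[] : z - e <= z <= z + e by apply/andP; split; lra.
  by move=> h1 h2; exact: (le_trans lo0 (le_trans h1 h2)).
have en0 : e != 0 by rewrite gt_eqF.
have sub : (`[z - e, z + e]%classic : set R) `<=` `[p, q]%classic.
  by move=> y /=; rewrite !in_itv/= => /andP[? ?]; apply/andP; split; lra.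
have mk : measurable_fun (setT : set R) (fun y => (k y * mollifier e 0 (z - y))%:E).
  by apply/measurable_EFinP; apply: continuous_measurable_fun; exact: cint.
have mr : measurable_fun (setT : set R) (fun y => (mollifier e 0 (z - y))%:E).
  apply/measurable_EFinP; apply: continuous_measurable_fun => y.
  apply: (@continuous_comp _ _ _ (fun y : R => z - y) (mollifier e 0)).
    by apply: cvgB; [exact: cvg_cst|exact: cvg_id].
  exact: continuous_mollifier.
have r0 y : (0 <= (mollifier e 0 (z - y))%:E)%E by rewrite lee_fin mollifier_ge0.
have mass1 := mollifier_mass z e0.
have mm c : (c%:E * (\int[mu]_(y in `[(z - e)%R, (z + e)%R]) (mollifier e 0 (z - y))%:E) = c%:E)%E.
  by rewrite mass1 mule1.
have near_or y : `[z - e, z + e]%classic y \/ mollifier e 0 (z - y) = 0.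
  have [h|h] := boolP (z - e <= y <= z + e); [left|right] => //.
  apply: mollifier_eq0 => //; move: h; rewrite negb_and -!ltNge => /orP[] h.
    by rewrite ger0_norm; lra.
  by rewrite ler0_norm; lra.
have restr : (\int[mu]_(y in `[p, q]) (k y * mollifier e 0 (z - y))%:E =
    \int[mu]_(y in `[(z - e)%R, (z + e)%R]) (k y * mollifier e 0 (z - y))%:E)%E.
  apply: eq_integral_support => // y _.
  by have [yz /(_ yz)|->] := near_or y; last rewrite mulr0.
have mz (f : R -> \bar R) : measurable_fun (setT : set R) f -> measurable_fun (`[z - e, z + e]%classic : set R) f.
  exact: measurable_funTS.
have zl c : 0 <= c -> (\int[mu]_(y in `[(z - e)%R, (z + e)%R])
    (c%:E * (mollifier e 0 (z - y))%:E) = c%:E)%E.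
  move=> c0; rewrite -[RHS]mm ge0_integralZl//; exact: mz.
have kr0 y : (0 <= (k y * mollifier e 0 (z - y))%:E)%E.
  by rewrite lee_fin mulr_ge0// mollifier_ge0.
have cr0 c y : 0 <= c -> (0 <= c%:E * (mollifier e 0 (z - y))%:E)%E.
  by move=> c0; rewrite mule_ge0.
rewrite -!lee_fin mollifiedE// restr -(zl lo)// -(zl hi)//.
apply/andP; split; apply: ge0_le_integral => //.
- by move=> y _; exact: cr0.
- by apply: mz; apply: measurable_funeM.
- exact: mz.
- move=> y /=; rewrite in_itv/= => /lok/andP[y1 _].
  by rewrite -EFinM lee_fin ler_wpM2r ?mollifier_ge0.
- exact: mz.
- by apply: mz; apply: measurable_funeM.
- move=> y /=; rewrite in_itv/= => /lok/andP[_ y1].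
  by rewrite -EFinM lee_fin ler_wpM2r ?mollifier_ge0.
Qed.

End mollification.
Arguments mollified {R} k p q e n z.

(** * Killing at the rate of an additive functional *)

Section fubini_restricted.
Context {R : realType} {d1 d2 : measure_display}.
Context {T1 : measurableType d1} {T2 : measurableType d2}.

Lemma ge0_integral_mrestr (m : {measure set T2 -> \bar R}) (E : set T2) (mE : measurable E)
    (f : T2 -> \bar R) : measurable_fun setT f -> (forall x, (0 <= f x)%E) ->
  (\int[mrestr m mE]_x f x = \int[m]_(x in E) f x)%E.
Proof.
move=> mf f0.
rewrite (@ge0_integral_density _ _ _ (mrestr m mE) m setT (\1_E) f)//.
  rewrite [RHS]integral_mkcond; apply: eq_integral => x _.
  by rewrite patchE indicE; case: (x \in E); rewrite ?mule1 ?mule0.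
move=> S mS _; rewrite integral_indic//.
by rewrite /mrestr setIC.
Qed.

(** The second derivative measure is known to be finite only on segments inside I; restricted to
    such a segment it is a finite measure, for which Tonelli's theorem is available. *)
Lemma fubini_tonelli_restr (m1 : {sigma_finite_measure set T1 -> \bar R})
    (m2 : {measure set T2 -> \bar R}) (E : set T2) (f : T1 * T2 -> \bar R) :
  measurable E -> (m2 E < +oo)%E -> measurable_fun setT f -> (forall x, (0 <= f x)%E) ->
  (\int[m1]_x \int[m2]_(y in E) f (x, y) = \int[m2]_(y in E) \int[m1]_x f (x, y))%E.
Proof.
move=> mE m2E mf f0.
have mfx x : measurable_fun setT (fun y => f (x, y)).
  by apply: (measurableT_comp mf); exact: measurable_pair1.
pose m := mfrestr mE m2E.
transitivity (\int[m1]_x \int[m]_y f (x, y))%E.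
  by apply: eq_integral => x _; rewrite /m /mfrestr ge0_integral_mrestr.
rewrite (@fubini_tonelli _ _ _ _ _ m1 m f mf f0).
rewrite /m /mfrestr ge0_integral_mrestr//.
- exact: (@measurable_fun_fubini_tonelli_G _ _ _ _ _ m1 f mf f0).
- by move=> y; apply: integral_ge0 => x _.
Qed.

End fubini_restricted.

(** * The mollified second derivative and the killing rates *)

Section second_derivative_measure.
Context {R : realType} {s0 s1 : \bar R} {g : R -> R} {g2 : {measure set R -> \bar R}}.
Notation mu := (@lebesgue_measure R).
Hypothesis g2D : is_second_distributional_derivative s0 s1 g g2.
Context {k : R -> R} {p q : R}.
Hypotheses (s0p : (s0 < p%:E)%E) (qs1 : (q%:E < s1)%E).
Hypotheses (ck : continuous k) (kg : forall y, p <= y <= q -> k y = g y).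

(** The distributional derivative tested against [y |-> mollifier e 0 (z - y)]: two derivatives move
    from the kernel to the measure. The kernel is supported in [[p, q]], where [k] and [g] agree. *)
Lemma mollified_second e z : 0 < e -> p <= z - e -> z + e <= q ->
  (mollified k p q e 2 z)%:E = (\int[g2]_(y in `[p, q]) (mollifier e 0 (z - y))%:E)%E.
Proof.
move=> e0 pz zq; have en0 : e != 0 by rewrite gt_eqF.
have m0 n y : ~ p <= y <= q -> mollifier e n (z - y) = 0.
  move=> /negP; rewrite negb_and -!ltNge => h; apply: mollifier_eq0 => //.
  case/orP: h => h; first by rewrite ger0_norm; lra.
  by rewrite ler0_norm; lra.
have pqI : `[p, q]%classic `<=` [set y : R | (s0 < y%:E < s1)%E].
  move=> y /=; rewrite in_itv/= => /andP[py yq].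
  by rewrite (lt_le_trans s0p) ?lee_fin//= (le_lt_trans _ qs1) ?lee_fin.
have [sm sm2] := mollifier_smooth z en0.
have tf : test_function s0 s1 (fun y => mollifier e 0 (z - y)).
  split; first exact: sm.
  by exists p, q; split => // y; exact: m0.
have [_ /(_ _ tf)] := g2D.
rewrite (eq_integral_support _ pqI); last first.
  by move=> y _; rewrite /= in_itv/= => /m0 ->.
move=> ->; transitivity (\int[mu]_(y in [set y : R | (s0 < y%:E < s1)%E])
    (g y * mollifier e 2 (z - y))%:E)%E; last first.
  by apply: eq_integral => y _; rewrite -(sm2 y).
transitivity (\int[mu]_(y in `[p, q]) (g y * mollifier e 2 (z - y))%:E)%E; last first.
  apply/esym/eq_integral_support => // y _.
  by rewrite /= in_itv/= => /m0 ->; rewrite mulr0.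
rewrite mollifiedE//; apply: eq_integral => y; rewrite inE/= in_itv/= => ypq.
by rewrite kg.
Qed.

End second_derivative_measure.

Section killing.
Context {R : realType} {s0 s1 : \bar R} {g : R -> R} {g2 : {measure set R -> \bar R}}.
Notation mu := (@lebesgue_measure R).
Hypothesis g2D : is_second_distributional_derivative s0 s1 g g2.
Context {k : R -> R} {a b eta : R}.
Hypotheses (ab : a <= b) (eta0 : 0 < eta).
Notation p := (a - 2 * eta).
Notation q := (b + 2 * eta).
Hypotheses (s0p : (s0 < p%:E)%E) (qs1 : (q%:E < s1)%E).
Hypotheses (ck : continuous k) (kg : forall y, p <= y <= q -> k y = g y).
Hypotheses (k_gt0 : forall y, 0 < k y) (k_nd : {homo k : x y / x <= y}).

Notation mol := (mollified k p q).

Definition mollifier_width n : R := eta / n.+1%:R.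
Notation e := mollifier_width.

(** The rate [c] for which the mollified [g] solves [G'' = 2 * c * G] on [[a, b]]. It is nonnegative
    because [g2] is a measure; clamping makes it continuous on the line. *)
Definition killing_rate n z : R :=
  mol (e n) 2 (clamp a b z) / (2 * mol (e n) 0 (clamp a b z)).

Lemma mollifier_width_gt0 n : 0 < e n.
Proof. by rewrite divr_gt0. Qed.

Lemma mollifier_width_le n : e n <= eta.
Proof. by rewrite ler_pdivrMr// ler_peMr ?ler1n// ltW. Qed.

Lemma mollifier_width_cvg0 (t : R) : 0 < t -> \forall n \near \oo, e n < t.
Proof.
move=> t0; have : e n @[n --> \oo] --> (eta * 0 : R).
  by apply: cvgMr; exact: cvg_harmonic.
by rewrite mulr0 => /cvgr_lt; exact.
Qed.

Let en0 n : e n != 0. Proof. by rewrite gt_eqF ?mollifier_width_gt0. Qed.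

Let pq : p <= q. Proof. by move: ab eta0; lra. Qed.

Let inside n z : a - eta <= z <= b + eta -> p <= z - e n /\ z + e n <= q.
Proof.
by move=> /andP[? ?]; have := mollifier_width_le n; have := mollifier_width_gt0 n; lra.
Qed.

Lemma mollified_between n z : a - eta <= z <= b + eta ->
  k (z - e n) <= mol (e n) 0 z <= k (z + e n).
Proof.
move=> /(inside n)[h1 h2]; apply: mollified_itv => //.
- by move=> y; exact: ltW.
- exact: mollifier_width_gt0.
- exact: ltW.
- by move=> y /andP[? ?]; rewrite !k_nd.
Qed.

Lemma mollified_gt0 n z : a - eta <= z <= b + eta -> 0 < mol (e n) 0 z.
Proof. by move=> /(mollified_between n)/andP[+ _]; exact: lt_le_trans. Qed.

Let clI z : a - eta <= clamp a b z <= b + eta.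
Proof. by have /andP[? ?] := clamp_itv z ab; apply/andP; split; move: eta0; lra. Qed.

Lemma killing_rate_ge0 n z : 0 <= killing_rate n z.
Proof.
rewrite divr_ge0//; last by rewrite mulr_ge0// ltW// mollified_gt0.
have [h1 h2] := inside n (clI z).
rewrite -lee_fin (mollified_second g2D s0p qs1 ck kg (mollifier_width_gt0 n) h1 h2).
by apply: integral_ge0 => y _; rewrite lee_fin mollifier_ge0// mollifier_width_gt0.
Qed.

Let cmol n m : continuous (mol (e n) m).
Proof. by move=> z; apply: is_derive_continuous; exact: is_derive_mollified. Qed.

Let cmolcl n m : continuous (fun z => mol (e n) m (clamp a b z)).
Proof. by move=> z; apply: continuous_comp; [exact: continuous_clamp|exact: cmol]. Qed.

Lemma continuous_killing_rate n : continuous (killing_rate n).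
Proof.
move=> z; apply: cvgM; first exact: cmolcl.
apply: cvgV; first by rewrite gt_eqF// mulr_gt0// mollified_gt0.
by apply: cvgMr; exact: cmolcl.
Qed.

(* |mol - k| is uniformly small because k is squeezed between its shifts. *)
Lemma mollified_unif (t : R) : 0 < t ->
  \forall n \near \oo, forall z, a - eta <= z <= b + eta -> `|mol (e n) 0 z - k z| < t.
Proof.
move=> t0; have [dl dl0 kd] := segment_unif_continuous (a - eta) (b + eta) ck t0.
have : \forall n \near \oo, e n < dl by exact: mollifier_width_cvg0.
apply: filterS => n end_ z zI.
have /andP[h1 h2] := mollified_between n zI; have ep := mollifier_width_gt0 n.
have := kd z (z - e n) zI; have := kd z (z + e n) zI.
rewrite (_ : z + e n - z = e n); last by ring.
rewrite (_ : z - e n - z = - e n); last by ring.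
rewrite normrN gtr0_norm// => /(_ end_) + /(_ end_).
by rewrite !ltr_norml => /andP[? ?] /andP[? ?]; apply/andP; split; lra.
Qed.

Section against_a_continuous_function.
Context {l : R -> R}.
Hypotheses (cl : continuous l) (l0 : forall z, 0 <= l z).
Hypothesis lab : forall z, ~ a <= z <= b -> l z = 0.

(** [l] will be a local time as a function of the level. [u] is the limiting density with respect to
    [g2], and [v n] has the mollified denominator, so that the killing rate times [l] is the second
    derivative of the mollified [g] times [v n]. *)
Let u y := l y / (2 * k y).
Let v n z := l z / (2 * mol (e n) 0 (clamp a b z)).

Let cu : continuous u.
Proof.
move=> z; apply: cvgM; first exact: cl.
apply: cvgV; first by rewrite gt_eqF// mulr_gt0.
by apply: cvgMr; exact: ck.
Qed.

Let u0 z : 0 <= u z. Proof. by rewrite divr_ge0// mulr_ge0// ltW. Qed.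

Let cv n : continuous (v n).
Proof.
move=> z; apply: cvgM; first exact: cl.
apply: cvgV; first by rewrite gt_eqF// mulr_gt0// mollified_gt0.
by apply: cvgMr; exact: cmolcl.
Qed.

Let v0 n z : 0 <= v n z.
Proof. by rewrite divr_ge0// mulr_ge0// ltW// mollified_gt0. Qed.

Let vab n z : ~ a <= z <= b -> v n z = 0. Proof. by move=> /lab; rewrite /v => ->; rewrite mul0r. Qed.

Let vu (t : R) : 0 < t -> \forall n \near \oo, forall z, `|v n z - u z| < t.
Proof.
move=> t0.
have [N N0 lN] := @segment_bounded _ l a b ltac:(by move=> x _; exact: cl).
have kp : 0 < k p by [].
have t1 : 0 < t * (k p) ^+ 2 / (N + 1) by rewrite divr_gt0 ?mulr_gt0 ?exprn_gt0// ltr_wpDl.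
have := mollified_unif t1; apply: filterS => n H z.
have [zab|zab] := boolP (a <= z <= b); last first.
  by rewrite /v /u lab ?mul0r ?subrr ?normr0//; exact/negP.
rewrite /v /u clamp_id//.
have zI : a - eta <= z <= b + eta by move: zab => /andP[? ?]; apply/andP; split; move: eta0; lra.
have m0 := mollified_gt0 n zI; have kz := k_gt0 z.
have kpz : k p <= k z by apply: k_nd; move: zab eta0 => /andP[? ?] ?; lra.
have kpm : k p <= mol (e n) 0 z.
  have /andP[h _] := mollified_between n zI; apply: le_trans h; apply: k_nd.
  by have [] := inside n zI.
rewrite (_ : _ - _ = l z / 2 * ((k z - mol (e n) 0 z) / (mol (e n) 0 z * k z))); last first.
  by field; rewrite !gt_eqF.
have mk0 : 0 < mol (e n) 0 z * k z by rewrite mulr_gt0.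
rewrite normrM [X in _ * X]normrM normfV (gtr0_norm mk0) distrC.
have Hz := H z zI.
have l1 : `|l z / 2| <= N.
  rewrite normrM [X in _ * X]ger0_norm ?invr_ge0//.
  by have := lN _ zab; have := normr_ge0 (l z); lra.
have l2 : `|mol (e n) 0 z - k z| / (mol (e n) 0 z * k z) <= t / (N + 1).
  rewrite ler_pdivrMr ?mulr_gt0//; apply: (le_trans (ltW Hz)).
  rewrite mulrAC; apply: ler_wpM2l; first by rewrite divr_ge0 ?ltW// ltr_wpDl.
  by rewrite expr2 ler_pM// ltW.
apply: (@le_lt_trans _ _ (N * (t / (N + 1)))).
  by apply: ler_pM => //; rewrite divr_ge0// mulr_ge0// ltW.
rewrite mulrCA -[ltRHS]mulr1 ltr_pM2l// ltr_pdivrMr ?mul1r ?ltrDl//.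
by rewrite ltr_wpDl.
Qed.

Let J n y := mollified (v n) (p - eta) (q + eta) (e n) 0 y.

Let cJ n : continuous (J n).
Proof.
by move=> z; apply: is_derive_continuous; apply: is_derive_mollified; [exact: cv|exact: en0].
Qed.

Let Ju (t : R) : 0 < t ->
  \forall n \near \oo, forall y, p <= y <= q -> u y - t <= J n y <= u y + t.
Proof.
move=> t0; have t2 : 0 < t / 2 by rewrite divr_gt0.
have [dl dl0 ud] := segment_unif_continuous p q cu t2.
have H1 := vu t2; have H2 := mollifier_width_cvg0 dl0.
near=> n; move=> y ypq.
have ed : e n < dl by near: n.
have vun : forall z, `|v n z - u z| < t / 2 by near: n.
have ep := mollifier_width_gt0 n; have el := mollifier_width_le n.
have key z : y - e n <= z <= y + e n -> u y - t <= v n z <= u y + t.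
  move=> /andP[z1 z2]; have := vun z; have := ud y z ypq.
  have zy : `|z - y| < dl.
    by apply: (le_lt_trans _ ed); rewrite ler_norml; apply/andP; split; lra.
  by move=> /(_ zy); rewrite !ltr_norml => /andP[? ?] /andP[? ?]; apply/andP; split; lra.
have h1 : p - eta <= y - e n by move: ypq => /andP[? ?]; lra.
have h2 : y + e n <= q + eta by move: ypq => /andP[? ?]; lra.
(* [mollified_itv] asks for a nonnegative lower bound, hence the truncation at 0. *)
have m0 : 0 <= Num.max 0 (u y - t) by rewrite le_max lexx.
have := @mollified_itv _ (v n) _ _ (cv (n := n)) (v0 n) (e n) y _ (u y + t) ep h1 h2 m0.
case/(_ _)/andP => [z /key/andP[z1 z2]|j1 j2].
  by rewrite ge_max v0 z1 z2.
by rewrite j2 andbT; apply: le_trans j1; rewrite le_max lexx orbT.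
Unshelve. all: by end_near. Qed.

Let g2pq : (g2 `[p, q]%classic < +oo)%E. Proof. by have [h _] := g2D; exact: h. Qed.

(** The mollifier is moved from the measure [g2] to the continuous function [v n] by Tonelli's
    theorem, using that the kernel is even. What has to converge is then a function and no longer a
    measure. *)
Let killing_fubini n :
  (\int[mu]_z (killing_rate n z * l z)%:E = \int[g2]_(y in `[p, q]) (J n y)%:E)%E.
Proof.
pose f (zy : R * R) := (v n zy.1 * mollifier (e n) 0 (zy.1 - zy.2))%:E.
have r0 y : 0 <= mollifier (e n) 0 y by rewrite mollifier_ge0// mollifier_width_gt0.
have mm : measurable_fun (setT : set R) (mollifier (e n) 0).
  by apply: continuous_measurable_fun; exact: continuous_mollifier.
have mf : measurable_fun setT f.
  apply/measurable_EFinP; apply: measurable_funM.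
    apply: measurableT_comp; last exact: measurable_fst.
    by apply: continuous_measurable_fun; exact: cv.
  by apply: measurableT_comp => //; apply: measurable_funB; [exact: measurable_fst|exact: measurable_snd].
have f0 zy : (0 <= f zy)%E by rewrite lee_fin mulr_ge0.
transitivity (\int[mu]_z \int[g2]_(y in `[p, q]) f (z, y))%E.
  apply: eq_integral => z _; rewrite /f/=.
  under eq_integral do rewrite EFinM.
  have mz : measurable_fun `[p, q]%classic (fun y => (mollifier (e n) 0 (z - y))%:E).
    apply: measurable_funTS; apply/measurable_EFinP; apply: measurableT_comp => //.
    exact: measurable_funB.
  have rz y : `[p, q]%classic y -> (0 <= (mollifier (e n) 0 (z - y))%:E)%E.
    by rewrite lee_fin.
  have vz : (0 <= (v n z)%:E)%E by rewrite lee_fin.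
  rewrite ge0_integralZl//.
  have [zab|/negP zab] := boolP (a <= z <= b); last first.
    by rewrite vab// lab// mulr0 mul0e.
  have zI : a - eta <= z <= b + eta by move: zab => /andP[? ?]; apply/andP; split; move: eta0; lra.
  have [h1 h2] := inside n zI.
  rewrite -(mollified_second g2D s0p qs1 ck kg (mollifier_width_gt0 n) h1 h2) -EFinM.
  congr EFin; rewrite /killing_rate /v clamp_id//.
  by field; rewrite gt_eqF// mollified_gt0.
rewrite fubini_tonelli_restr//; apply: eq_integral => y; rewrite inE/= in_itv/= => ypq.
rewrite mollifiedE; [|by []..].
transitivity (\int[mu]_(z in `[(p - eta)%R, (q + eta)%R]) f (z, y))%E; last first.
  by apply: eq_integral => z _; rewrite /f/= -mollifier_even opprB.
apply: eq_integral_support => // z _; rewrite /= in_itv/= => zpq; rewrite /f/= vab ?mul0r//.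
by move=> zab; apply: zpq; move: zab eta0 => /andP[? ?] ?; apply/andP; split; lra.
Qed.

Let icont (f : R -> R) : continuous f -> g2.-integrable `[p, q] (EFin \o f).
Proof.
move=> cf; have [M M0 fM] := @segment_bounded _ f p q ltac:(by move=> x _; exact: cf).
apply: (@le_integrable _ _ _ g2 `[p, q] _ _ (cst M%:E)) => //.
- by apply: measurable_funTS; apply/measurable_EFinP; exact: continuous_measurable_fun.
- by move=> x /=; rewrite in_itv/= => xpq; rewrite lee_fin (ger0_norm M0) fM.
- apply/integrableP; split; first exact: measurable_cst.
  under eq_integral do rewrite /= ger0_norm//.
  by rewrite integral_cst//= lte_mul_pinfty// lee_fin.
Qed.

(** [J n] tends to [u] uniformly on [[p, q]], which has finite mass for [g2]. *)
Lemma killing_cvg :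
  fine (\int[mu]_z (killing_rate n z * l z)%:E)%E @[n --> \oo] -->
    \int[g2]_(y in `[p, q]) (l y / (2 * k y)).
Proof.
pose m := fine (g2 `[p, q]%classic).
have m0 : 0 <= m by apply: fine_ge0.
apply/cvgrPdist_le => t t0.
have t1 : 0 < t / (m + 1) by rewrite divr_gt0// ltr_wpDl.
have := Ju t1; apply: filterS => n H.
rewrite killing_fubini -[X in `|_ - X|]/(\int[g2]_(y in `[p, q]) J n y).
rewrite -RintegralB//; [|exact: icont|exact: icont].
have iB : g2.-integrable `[p, q] (EFin \o (fun y => u y - J n y)).
  by apply: icont => y; apply: cvgB; [exact: cu|exact: cJ].
apply: (le_trans (le_normr_Rintegral _ iB)) => //.
apply: (@le_trans _ _ (\int[g2]_(y in `[p, q]) (t / (m + 1)))).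
  apply: le_Rintegral => //.
  - exact: (integrable_norm iB).
  - by apply: icont => y; exact: cvg_cst.
  - move=> y /=; rewrite in_itv/= => /H/andP[? ?].
    by rewrite ler_norml; apply/andP; split; lra.
rewrite Rintegral_cst// -/m mulrAC ler_pdivrMr ?ltr_wpDl//.
by rewrite ler_wpM2l ?ltW// ltrDl.
Qed.

Lemma killing_limit_integrable : g2.-integrable `[p, q] (EFin \o (fun y => l y / (2 * k y))).
Proof. exact: icont. Qed.

End against_a_continuous_function.

End killing.

(** * Properties of local times read off from the occupation formula *)

Section path_local_time.
Context {R : realType}.
Notation mu := (@lebesgue_measure R).

(** The occupation formula speaks of integrals over sets of levels only; comparing averages over
    small intervals around [x] transfers its consequences to each single level, by continuity. *)
Lemma le_of_le_integral (f1 f2 : R -> R) (x e0 : R) : continuous f1 -> continuous f2 ->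
  0 < e0 ->
  (forall e, 0 < e -> e < e0 ->
    (\int[mu]_(y in `[(x - e)%R, (x + e)%R]) (f1 y)%:E <=
     \int[mu]_(y in `[(x - e)%R, (x + e)%R]) (f2 y)%:E)%E) ->
  f1 x <= f2 x.
Proof.
move=> c1 c2 e00 H; rewrite leNgt; apply/negP => lt21.
pose t := (f1 x - f2 x) / 3; have t0 : 0 < t by rewrite divr_gt0// subr_gt0.
have [e1 e10 u1] := segment_unif_continuous x x c1 t0.
have [e2 e20 u2] := segment_unif_continuous x x c2 t0.
have xx : x <= x <= x by rewrite lexx.
pose e := Num.min (e0 / 2) (Num.min (e1 / 2) (e2 / 2)).
have e_gt0 : 0 < e by rewrite !lt_min !divr_gt0.
have [ee0 [ee1 ee2]] : e <= e0 / 2 /\ e <= e1 / 2 /\ e <= e2 / 2.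
  by rewrite /e !ge_min !lexx !orbT.
have i1 : mu.-integrable `[x - e, x + e] (EFin \o f1).
  by apply: (@continuous_itv_integrable _ _ _ (x - e) (x + e)).
have i2 : mu.-integrable `[x - e, x + e] (EFin \o f2).
  by apply: (@continuous_itv_integrable _ _ _ (x - e) (x + e)).
have ic (c : R) : mu.-integrable `[x - e, x + e] (EFin \o cst c).
  by apply: (@continuous_itv_integrable _ _ _ (x - e) (x + e)) => //; exact: cst_continuous.
have close y : `[x - e, x + e]%classic y -> `|f1 y - f1 x| < t /\ `|f2 y - f2 x| < t.
  move=> /=; rewrite in_itv/= => /andP[y1 y2].
  by split; [apply: u1|apply: u2] => //; rewrite ltr_norml; apply/andP; split; lra.
have : \int[mu]_(y in `[x - e, x + e]) f1 y <= \int[mu]_(y in `[x - e, x + e]) f2 y.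
  by apply: fine_le; [exact: integrable_fin_num..|apply: H => //; lra].
apply/negP; rewrite -ltNge.
have L : fine (mu `[x - e, x + e]%classic) = 2 * e.
  by rewrite lebesgue_measure_itv/= lte_fin ltrD2l gtrN//=; ring.
have h1 : (f1 x - t) * (2 * e) <= \int[mu]_(y in `[x - e, x + e]) f1 y.
  rewrite -L -Rintegral_cst//; apply: le_Rintegral => //; first exact: ic.
  by move=> y /close[]; rewrite ltr_norml => /andP[? _] _; lra.
have h2 : \int[mu]_(y in `[x - e, x + e]) f2 y <= (f2 x + t) * (2 * e).
  rewrite -L -Rintegral_cst//; apply: le_Rintegral => //; first exact: ic.
  by move=> y /close[_]; rewrite ltr_norml => /andP[_ ?]; lra.
apply: (le_lt_trans h2); apply: (lt_le_trans _ h1).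
by rewrite ltr_pM2r ?mulr_gt0// /t; lra.
Qed.

Context {b : R -> R} {l : R -> R -> R}.
Hypothesis cb : continuous b.
Hypothesis cl : {within [set zu : R * R | 0 <= zu.2], continuous (fun zu => l zu.1 zu.2)}.
Hypothesis occ : forall (u : R) (S : set R), 0 <= u -> measurable S ->
  mu [set s : R | 0 <= s <= u /\ S (b s)] = (\int[mu]_(z in S) (l z u)%:E)%E.

Lemma local_time_cvg {X : Type} {G : set_system X} {FG : Filter G} (zf uf : X -> R) (z u : R) :
  0 <= u -> (forall x, 0 <= uf x) -> zf x @[x --> G] --> z -> uf x @[x --> G] --> u ->
  l (zf x) (uf x) @[x --> G] --> l z u.
Proof.
move=> u0 uf0 zfz ufu.
have /subspace_continuousP h := cl; have hz := h (z, u) u0.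
apply: (@cvg_comp _ _ _ (fun x => (zf x, uf x)) (fun zu => l zu.1 zu.2) G
  (within [set zu : R * R | 0 <= zu.2] (nbhs (z, u)))) => // S.
rewrite /within/= => H.
have c : (zf x, uf x) @[x --> G] --> (z, u) by exact: (cvg_pair zfz ufu).
have cS : G [set x | 0 <= uf x -> S (zf x, uf x)] by exact: (c _ H).
by apply: filterS cS => x /=; apply; exact: uf0.
Qed.

Lemma local_time_continuous u : 0 <= u -> continuous (fun z => l z u).
Proof. by move=> u0 z; apply: (local_time_cvg (uf := fun=> u)) => //; exact: cvg_cst. Qed.

Let c0 : continuous (fun _ : R => 0 : R). Proof. exact: cst_continuous. Qed.

Let occ_itv u x e : 0 <= u ->
  mu [set s : R | 0 <= s <= u /\ `[x - e, x + e]%classic (b s)] =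
  (\int[mu]_(z in `[(x - e)%R, (x + e)%R]) (l z u)%:E)%E.
Proof. by move=> u0; exact: occ. Qed.

Lemma local_time_ge0 z u : 0 <= u -> 0 <= l z u.
Proof.
move=> u0; apply: (@le_of_le_integral (fun=> 0) (l^~ u) z 1) => //.
  exact: local_time_continuous.
by move=> e _ _; rewrite -occ_itv// integral0.
Qed.

(** A level outside [[p, q]] has a neighbourhood in which the path spends no time. *)
Lemma local_time_eq0 z u (p q : R) : 0 <= u -> (forall s, 0 <= s <= u -> p <= b s <= q) ->
  ~ p <= z <= q -> l z u = 0.
Proof.
move=> u0 bpq /negP; rewrite negb_and -!ltNge => zpq.
apply/eqP; rewrite eq_le local_time_ge0// andbT.
have [e0 e00 he] : exists2 e0 : R, 0 < e0 & forall y, `|y - z| < e0 -> ~ p <= y <= q.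
  case/orP: zpq => h; [exists (p - z)|exists (z - q)]; rewrite ?subr_gt0// => y.
    by rewrite ltr_norml => /andP[_ ?] /andP[? _]; lra.
  by rewrite ltr_norml => /andP[? _] /andP[_ ?]; lra.
apply: (@le_of_le_integral (l^~ u) (fun=> 0) z e0) => //.
  exact: local_time_continuous.
move=> e e_gt0 ee0; rewrite -occ_itv// integral0 (_ : [set _ | _] = set0) ?measure0//.
apply/seteqP; split => // s [/bpq bs] /=; rewrite in_itv/= => /andP[? ?].
by apply: (he (b s)) => //; rewrite ltr_norml; apply/andP; split; lra.
Qed.

Let meas_occ u S : measurable S -> measurable [set s : R | 0 <= s <= u /\ S (b s)].
Proof.
move=> mS; rewrite (_ : [set _ | _] = `[0, u]%classic `&` b @^-1` S); last first.
  by apply/seteqP; split => s [h1 h2]; split => //; move: h1; rewrite /= in_itv.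
apply: measurableI => //; rewrite -[X in measurable X]setTI.
by apply: continuous_measurable_fun.
Qed.

Lemma local_time_le z u u' : 0 <= u -> u <= u' -> l z u <= l z u'.
Proof.
move=> u0 uu'; have u'0 := le_trans u0 uu'.
apply: (@le_of_le_integral (l^~ u) (l^~ u') z 1) => //; [exact: local_time_continuous..|].
move=> e _ _; rewrite -!occ_itv//; apply: le_measure; rewrite ?inE; [exact: meas_occ..|].
by move=> s [/andP[s0 su] h]; split => //; rewrite s0 (le_trans su).
Qed.

Lemma local_time_0 z : l z 0 = 0.
Proof.
apply/eqP; rewrite eq_le local_time_ge0// andbT.
apply: (@le_of_le_integral (l^~ 0) (fun=> 0) z 1) => //.
  exact: local_time_continuous.
move=> e _ _; rewrite -occ_itv// integral0.
apply: (@le_trans _ _ (mu [set (0 : R)])); last by rewrite lebesgue_measure_set1.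
apply: le_measure; rewrite ?inE//; first exact: meas_occ.
by move=> s [h _] /=; apply/eqP; rewrite eq_le andbC.
Qed.

Lemma occupation_integral (c : R -> R) u : 0 <= u -> continuous c -> (forall z, 0 <= c z) ->
  (\int[mu]_(x in `[0%R, u]) (c (b x))%:E = \int[mu]_z (c z * l z u)%:E)%E.
Proof.
move=> u0 cc c_ge0.
have mb : measurable_fun setT (b : R -> measurableTypeR R) by exact: continuous_measurable_fun.
have mc : measurable_fun setT (fun z => (c z)%:E).
  by apply/measurable_EFinP; exact: continuous_measurable_fun.
have mI : measurable (`[0, u]%classic : set R) by [].
pose m := pushforward (mrestr mu mI) (b : R -> measurableTypeR R).
transitivity (\int[m]_z (c z)%:E)%E.
  rewrite /m ge0_integral_pushforward//; last by move=> z _; rewrite lee_fin.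
  rewrite ge0_integral_mrestr//; last by move=> z; rewrite lee_fin.
  by apply: measurableT_comp.
rewrite (@ge0_integral_density _ _ _ m mu setT (l^~ u) (EFin \o c))//.
- by apply: continuous_measurable_fun; exact: local_time_continuous.
- by move=> z _; exact: local_time_ge0.
- move=> S mS _; rewrite -occ// /m /pushforward /mrestr; congr (mu _).
  by apply/seteqP; split => s; rewrite /= in_itv/= => -[].
- by move=> z _; rewrite lee_fin.
Qed.

End path_local_time.

Section regular_local_time.
Context {R : realType} {d : measure_display} {T : measurableType d}.
Notation mu := (@lebesgue_measure R).

Definition regular_local_time (B : R -> T -> R) (L : R -> R -> T -> R) : Prop := forall w,
  {within [set zu : R * R | 0 <= zu.2], continuous (fun zu => L zu.1 zu.2 w)} /\
  forall (u : R) (S : set R), 0 <= u -> measurable S ->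
    mu [set s : R | 0 <= s <= u /\ S (B s w)] = (\int[mu]_(z in S) (L z u w)%:E)%E.

Context {B : R -> T -> R} {L : R -> R -> T -> R}.
Hypothesis rL : regular_local_time B L.

Lemma rlt_cvg {X : Type} {G : set_system X} {FG : Filter G} (uf : X -> R) (z u : R) w :
  0 <= u -> (forall x, 0 <= uf x) -> uf x @[x --> G] --> u ->
  L z (uf x) w @[x --> G] --> L z u w.
Proof.
move=> u0 uf0; apply: (local_time_cvg (l := fun z u => L z u w) (rL w).1 (zf := fun=> z)) => //.
exact: cvg_cst.
Qed.

Lemma rlt_continuous w u : 0 <= u -> continuous (fun z => L z u w).
Proof. exact: (local_time_continuous (l := fun z u => L z u w) (rL w).1). Qed.

Lemma rlt_ge0 z u w : 0 <= u -> 0 <= L z u w.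
Proof. exact: (local_time_ge0 (l := fun z u => L z u w) (rL w).1 (rL w).2). Qed.

Lemma rlt_eq0 z u w (p q : R) : 0 <= u -> (forall s, 0 <= s <= u -> p <= B s w <= q) ->
  ~ p <= z <= q -> L z u w = 0.
Proof. exact: (local_time_eq0 (l := fun z u => L z u w) (rL w).1 (rL w).2). Qed.

Hypothesis cB : forall w, continuous (B^~ w).

Lemma rlt_le z u u' w : 0 <= u -> u <= u' -> L z u w <= L z u' w.
Proof. by have [cl occ] := rL w; exact: (local_time_le (l := fun z u => L z u w) (@cB w) cl occ). Qed.

Lemma rlt_0 z w : L z 0 w = 0.
Proof. by have [cl occ] := rL w; exact: (local_time_0 (l := fun z u => L z u w) (@cB w) cl occ). Qed.

Lemma rlt_occupation_integral (c : R -> R) u w : 0 <= u -> continuous c ->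
  (forall z, 0 <= c z) ->
  (\int[mu]_(x in `[0%R, u]) (c (B x w))%:E = \int[mu]_z (c z * L z u w)%:E)%E.
Proof.
have [cl occ] := rL w.
by move=> u0 cc c0; exact: (occupation_integral (l := fun z u => L z u w) (@cB w) cl occ u0 cc c0).
Qed.

End regular_local_time.

(** * Harmonic functions of the speed measure *)

Section speed_martingales.
Context {R : realType} {d : measure_display} {T : measurableType d}.
Notation mu := (@lebesgue_measure R).

(* The harmonic functions of the time-changed process are combinations of g
   and of g q with q' = - 1 / g^2 (reduction of order). *)
Record speed_harmonic (r : R) (s0 s1 : \bar R) (g q : R -> R)
    (nu : {measure set R -> \bar R}) : Prop := SpeedHarmonic {
  sh_speed : exists2 g2 : {measure set R -> \bar R},
    is_second_distributional_derivative s0 s1 g g2 &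
    forall S : set R, measurable S -> S `<=` [set y : R | (s0 < y%:E < s1)%E] ->
      nu S = (((2 * r)^-1)%:E * \int[g2]_(y in S) ((g y)^-1)%:E)%E ;
  sh_continuous : forall y, (s0 < y%:E < s1)%E -> {for y, continuous g} ;
  sh_gt0 : forall y, (s0 < y%:E < s1)%E -> 0 < g y ;
  sh_nondecreasing : forall y y', (s0 < y%:E)%E -> y <= y' -> (y'%:E < s1)%E -> g y <= g y' ;
  sh_derive : forall y, (s0 < y%:E < s1)%E -> is_derive y 1 q (- (g y ^+ 2)^-1) }.

Lemma open_interval_margin (s0 s1 : \bar R) (a b : R) : (s0 < a%:E)%E -> (b%:E < s1)%E ->
  exists2 eta : R, 0 < eta & (s0 < (a - 2 * eta)%:E)%E /\ ((b + 2 * eta)%:E < s1)%E.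
Proof.
move=> s0a bs1.
have [e1 e10 h1] : exists2 e : R, 0 < e & (s0 < (a - 2 * e)%:E)%E.
  case: s0 s0a => [t| |] //=; last by exists 1 => //; rewrite ltNyr.
  by rewrite lte_fin => ta; exists ((a - t) / 4); [lra|rewrite lte_fin; lra].
have [e2 e20 h2] : exists2 e : R, 0 < e & ((b + 2 * e)%:E < s1)%E.
  case: s1 bs1 => [t| |] //=; last by exists 1 => //; rewrite ltry.
  by rewrite lte_fin => ta; exists ((t - b) / 4); [lra|rewrite lte_fin; lra].
exists (Num.min e1 e2); first by rewrite lt_min e10.
have m1 : Num.min e1 e2 <= e1 by rewrite ge_min lexx.
have m2 : Num.min e1 e2 <= e2 by rewrite ge_min lexx orbT.
by split; [apply: (lt_le_trans h1)|apply: (le_lt_trans _ h2)]; rewrite lee_fin; lra.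
Qed.

Context {Pr : probability T R} {F : R -> set (set T)} {B : R -> T -> R}.
Context {L : R -> R -> T -> R}.
Hypotheses (uF : usual_filtration Pr F) (bm : regular_bm Pr F B).
Hypothesis rL : regular_local_time B L.
Context {r : R} {s0 s1 : \bar R} {g q : R -> R} {nu : {measure set R -> \bar R}}.
Hypothesis r0 : 0 < r.
Hypothesis sh : speed_harmonic r s0 s1 g q nu.

Section bounded_range.
Context {a b eta : R}.
Hypotheses (eta0 : 0 < eta) (ab : a <= b).
Hypotheses (s0p : (s0 < (a - 2 * eta)%:E)%E) (qs1 : ((b + 2 * eta)%:E < s1)%E).

Notation k := (g \o clamp (a - 2 * eta) (b + 2 * eta)).

Let pq : a - 2 * eta <= b + 2 * eta. Proof. by move: ab eta0; lra. Qed.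

Let inI y : a - 2 * eta <= y <= b + 2 * eta -> (s0 < y%:E < s1)%E.
Proof.
move=> /andP[h1 h2]; rewrite (lt_le_trans s0p) ?lee_fin//=.
by rewrite (le_lt_trans _ qs1)// lee_fin.
Qed.

Let ck : continuous k.
Proof. by apply: continuous_comp_clamp => // y /inI; exact: (sh_continuous sh). Qed.

Let kg y : a - 2 * eta <= y <= b + 2 * eta -> k y = g y.
Proof. by move=> h; rewrite /= clamp_id. Qed.

Let k_gt0 y : 0 < k y.
Proof. by apply: (sh_gt0 sh); apply: inI; exact: clamp_itv. Qed.

Let k_nd : {homo k : x y / x <= y}.
Proof.
move=> x y xy /=; have /andP[h1 h2] := inI (clamp_itv x pq).
have /andP[h3 h4] := inI (clamp_itv y pq); apply: (sh_nondecreasing sh) => //.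
by rewrite /clamp ge_max !le_max lexx/= orbC le_min !ge_min lexx xy !orbT.
Qed.

(** Levels outside [[a, b]] carry no local time, and inside I the measure [nu] has density
    [1 / (2 * r * g)] with respect to [g2]. The integrand is written with the factor 1/2 inside to
    match the limit in [killing_cvg]. *)
Lemma additive_functional_bounded_range (g2 : {measure set R -> \bar R}) w u :
  is_second_distributional_derivative s0 s1 g g2 ->
  (forall S : set R, measurable S -> S `<=` [set y : R | (s0 < y%:E < s1)%E] ->
      nu S = (((2 * r)^-1)%:E * \int[g2]_(y in S) ((g y)^-1)%:E)%E) ->
  0 <= u -> (forall s, 0 <= s <= u -> a <= B s w <= b) ->
  additive_functional nu L u w = (r^-1 *
    \int[g2]_(y in `[a - 2 * eta, b + 2 * eta]) (L y u w / (2 * k y)))%:E.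
Proof.
move=> g2D nuE u0 Bab.
have cl : continuous (fun z => L z u w) := rlt_continuous rL u0.
have L0 z : 0 <= L z u w := rlt_ge0 rL z w u0.
have Lab z : ~ a <= z <= b -> L z u w = 0 := rlt_eq0 rL u0 Bab.
pose J : set R := `[a - 2 * eta, b + 2 * eta]%classic; rewrite -/J.
have JI : J `<=` [set y : R | (s0 < y%:E < s1)%E].
  by move=> y; rewrite /J/= in_itv/=; exact: inI.
have mJ : measurable J by exact: measurable_itv.
rewrite /additive_functional (@eq_integral_support _ _ _ _ J setT)//; last first.
  move=> y _; rewrite /J/= in_itv/= => yJ; rewrite Lab// => yab; apply: yJ.
  by move: yab eta0 => /andP[? ?] ?; apply/andP; split; lra.
have mk : measurable_fun J (fun y => (2 * r)^-1 * (k y)^-1).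
  apply: measurable_funTS; apply: continuous_measurable_fun => y.
  by apply: cvgMr; apply: cvgV; [rewrite gt_eqF|exact: ck].
have r2 : 0 <= (2 * r)^-1 by rewrite invr_ge0 mulr_ge0// ltW.
rewrite (@ge0_integral_density _ _ _ nu g2 J (fun y => (2 * r)^-1 * (k y)^-1))//.
- rewrite (_ : _%:E = ((r^-1)%:E * \int[g2]_(y in J) (L y u w / (2 * k y))%:E)%E); last first.
    rewrite EFinM; congr (_ * _)%E; rewrite fineK//; apply: integrable_fin_num => //.
    exact: (killing_limit_integrable g2D s0p qs1 ck k_gt0).
  rewrite -ge0_integralZl//.
  + apply: eq_integral => y _; rewrite -!EFinM; congr EFin.
    by field; rewrite !gt_eqF// k_gt0.
  + apply/measurable_EFinP; apply: measurable_funTS; apply: continuous_measurable_fun => y.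
    apply: cvgM; first exact: cl.
    by apply: cvgV; [rewrite gt_eqF// mulr_gt0|apply: cvgMr; exact: ck].
  + by move=> y _; rewrite lee_fin divr_ge0// mulr_ge0// ltW// k_gt0.
  + by rewrite lee_fin invr_ge0 ltW.
- by move=> y _; rewrite mulr_ge0// invr_ge0 ltW// k_gt0.
- move=> S mS SJ; rewrite nuE//; last exact: (subset_trans SJ).
  under [RHS]eq_integral do rewrite EFinM.
  rewrite [RHS]ge0_integralZl//.
  + congr (_ * _)%E; apply: eq_integral => y /set_mem /SJ; rewrite /J/= in_itv/= => yJ.
    by rewrite clamp_id.
  + apply/measurable_EFinP; apply: measurable_funTS; apply: continuous_measurable_fun => y.
    by apply: cvgV; [rewrite gt_eqF|exact: ck].
  + by move=> y _; rewrite lee_fin invr_ge0 ltW// k_gt0.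
- by apply: measurable_funTS; apply/measurable_EFinP; exact: continuous_measurable_fun.
- by move=> y _; rewrite lee_fin.
Qed.

Notation rate := (killing_rate (k := k) (a := a) (b := b) (eta := eta)).

(** The occupation formula turns the time integral into an integral of the killing rate against the
    local time, to which [killing_cvg] applies; the [1 / (2 * r)] in [nu] leaves the factor [r]. *)
Lemma killing_rate_cvg w u : 0 <= u -> (forall s, 0 <= s <= u -> a <= B s w <= b) ->
  \int[mu]_(x in `[0, u]) rate n (B x w) @[n --> \oo] -->
    r * fine (additive_functional nu L u w).
Proof.
move=> u0 Bab; have [g2 g2D nuE] := sh_speed sh.
rewrite (additive_functional_bounded_range g2D nuE u0 Bab)/=.
rewrite mulrA divff ?gt_eqF// mul1r.
rewrite (_ : (fun n => _) = (fun n => fine (\int[mu]_z (rate n z * L z u w)%:E)%E)).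
  apply: (killing_cvg g2D ab eta0 s0p qs1 ck kg k_gt0 k_nd).
  - exact: (rlt_continuous rL).
  - by move=> z; exact: (rlt_ge0 rL).
  - by move=> z; exact: (rlt_eq0 rL).
apply/funext => n; rewrite /Rintegral; congr fine.
apply: (rlt_occupation_integral rL (rbm_continuous bm)) => //.
  exact: (continuous_killing_rate ab eta0 ck k_gt0 k_nd).
exact: (killing_rate_ge0 g2D ab eta0 s0p qs1 ck kg k_gt0 k_nd).
Qed.

Section martingale.
Context {sigma : T -> R} {N : nat}.
Hypotheses (osigma : optional_time F sigma) (sigma_ge0 : forall w, 0 <= sigma w).
Hypothesis sigma_leN : forall w, sigma w <= N%:R.
Hypothesis Bab : forall w s, 0 <= s <= sigma w -> a <= B s w <= b.
Hypothesis ab0 : a <= 0 <= b.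

Notation mol n := (mollified k (a - 2 * eta) (b + 2 * eta) (mollifier_width (eta := eta) n)).

Let G n z := mol n 0 (clamp (a - eta) (b + eta) z).

Let aebe : a - eta <= b + eta. Proof. by move: ab eta0; lra. Qed.

Let kp := k (a - 2 * eta).

Let en0 n : mollifier_width (eta := eta) n != 0.
Proof. by rewrite gt_eqF// mollifier_width_gt0. Qed.

Let mol_ge n z : a - eta <= z <= b + eta -> kp <= mol n 0 z <= k (b + 2 * eta).
Proof.
move=> zI; have /andP[h1 h2] := mollified_between eta0 ck k_gt0 k_nd n zI.
have e1 := mollifier_width_le eta0 n; have e2 := mollifier_width_gt0 eta0 n.
rewrite (le_trans _ h1)/=; last by apply: k_nd; move: zI => /andP[? _]; lra.
by apply: (le_trans h2); apply: k_nd; move: zI => /andP[_ ?]; lra.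
Qed.

Let GI n z : kp <= G n z <= k (b + 2 * eta).
Proof. by apply: mol_ge; exact: clamp_itv. Qed.

Let cG n : continuous (fun z => (G n z ^+ 2)^-1).
Proof.
move=> z; have G0 : 0 < G n z by have /andP[+ _] := GI n z; apply: lt_le_trans; exact: k_gt0.
apply: cvgV; first by rewrite gt_eqF// exprn_gt0.
apply: (@continuous_comp _ _ _ (G n) (fun x => x ^+ 2)); last exact: exprn_continuous.
apply: continuous_comp; first exact: continuous_clamp.
by apply: is_derive_continuous; exact: is_derive_mollified.
Qed.

Let subI z : a <= z <= b -> a - eta <= z <= b + eta.
Proof. by move: eta0 => ? /andP[? ?]; apply/andP; split; lra. Qed.

Let G_invsq n z : 0 <= (G n z ^+ 2)^-1 <= (kp ^+ 2)^-1.
Proof.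
have /andP[Gk _] := GI n z; have G0 : 0 < G n z by apply: lt_le_trans Gk; exact: k_gt0.
have kp0 : 0 < kp by exact: k_gt0.
rewrite invr_ge0 exprn_ge0 ?(ltW G0)//= lef_pV2 ?posrE ?exprn_gt0//.
by rewrite ler_sqr ?nnegrE ?(ltW G0) ?(ltW kp0).
Qed.

Let primitive_bound (H : R -> R) n x y : (forall z : R, is_derive z 1 H ((G n z ^+ 2)^-1)) ->
  `|H x - H y| <= (kp ^+ 2)^-1 * `|x - y|.
Proof.
move=> dH; have k2 : 0 <= (kp ^+ 2)^-1 by rewrite invr_ge0 exprn_ge0// ltW// k_gt0.
have := @mvt_bound _ H (fun z => (G n z ^+ 2)^-1) y (x - y) (kp ^+ 2)^-1 0 k2.
rewrite addrC subrK expr1; apply=> z _.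
by rewrite expr0 mulr1; have /andP[? ?] := G_invsq n z; rewrite ger0_norm.
Qed.

(** For every [n] the smooth result applies to the mollified pair. The variables [u n] are bounded
    uniformly in [n], so their constant means pass to the limit. *)
Lemma bounded_range_martingale (alpha beta : R) :
  let f y := g y * (alpha + beta * (q y - q 0)) in
  let Y w := expR (- (r * fine (additive_functional nu L (sigma w) w))) * f (B (sigma w) w) in
  measurable_fun setT Y /\ \int[Pr]_w Y w = f 0.
Proof.
move=> f Y; have [g2 g2D nuE] := sh_speed sh.
(* Reduction of order for the mollified equation: [H n] is a primitive of [1 / G n ^+ 2], of sign
   opposite to [q]. The terms in the first derivative of the mollified [g] cancel, so [fn n] solves
   the equation exactly for each [n]. *)
have /choice[H HP] : forall n, exists Hn : R -> R,
    Hn 0 = 0 /\ forall z : R, is_derive z 1 Hn ((G n z ^+ 2)^-1).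
  by move=> n; have [Hn H0 dH] := continuous_antiderivative (@cG n); exists Hn.
have H0 n : H n 0 = 0 by have [] := HP n.
have dH n (z : R) : is_derive z 1 (H n) ((G n z ^+ 2)^-1) by have [_] := HP n.
have [M M0 HM] : exists2 M, 0 <= M & forall n z, a - eta <= z <= b + eta ->
    `|alpha - beta * H n z| <= M.
  have [M M0 zM] := @segment_bounded _ (fun x : R => x) (a - eta) (b + eta) ltac:(by move=> x _; exact: cvg_id).
  have k2 : 0 <= (kp ^+ 2)^-1 by rewrite invr_ge0 exprn_ge0// ltW// k_gt0.
  exists (`|alpha| + `|beta| * ((kp ^+ 2)^-1 * M)); first by rewrite addr_ge0// !mulr_ge0.
  move=> n z zI; apply: (le_trans (ler_normB _ _)); rewrite lerD2l normrM ler_wpM2l//.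
  rewrite -[H n z]subr0 -(H0 n); apply: (le_trans (primitive_bound z 0 (dH n))).
  by rewrite subr0 ler_wpM2l//; exact: zM.
have m0 n z : a - eta <= z <= b + eta -> 0 < mol n 0 z.
  by move=> /(mol_ge n)/andP[+ _]; apply: lt_le_trans; exact: k_gt0.
have Gm n z : a - eta <= z <= b + eta -> G n z = mol n 0 z.
  by move=> zI; rewrite /G clamp_id.
pose fn n z := mol n 0 z * (alpha - beta * H n z).
pose f1 n z := mol n 1 z * (alpha - beta * H n z) - beta * (mol n 0 z)^-1.
pose f2 n z := mol n 2 z * (alpha - beta * H n z).
have dmol n m (z : R) : is_derive z 1 (mol n m) (mol n m.+1 z) by exact: is_derive_mollified.
have dq n (z : R) : is_derive z 1 (fun z => alpha - beta * H n z) (- (beta * (G n z ^+ 2)^-1)).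
  apply: (is_derive_congr (is_deriveB (is_derive_cst alpha z 1) (is_derive_scale beta (dH n z)))) => //.
  by rewrite sub0r.
have df n (z : R) : a - eta <= z <= b + eta -> is_derive z 1 (fn n) (f1 n z).
  move=> zI; apply: (is_derive_congr (is_deriveM (dmol n 0 z) (dq n z))) => //.
  rewrite /f1 /GRing.scale/= (Gm _ _ zI); have := m0 n z zI.
  by move=> h0; field; rewrite gt_eqF.
have df1 n (z : R) : a - eta <= z <= b + eta -> is_derive z 1 (f1 n) (f2 n z).
  move=> zI; have h0 := m0 n z zI; have hn0 : mol n 0 z != 0 by rewrite gt_eqF.
  have dV : is_derive z 1 (fun z => (mol n 0 z)^-1) (- (mol n 0 z) ^- 2 * mol n 1 z).
    exact: (is_derive_congr (@is_deriveV _ (mol n 0) z _ 1 hn0 (dmol n 0 z))).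
  apply: (is_derive_congr (is_deriveB (is_deriveM (dmol n 1 z) (dq n z))
    (is_derive_scale beta dV))) => //.
  rewrite /f2 /GRing.scale/= (Gm _ _ zI).
  by field.
have f2L n : exists2 D, 0 <= D & forall x y, a - eta <= x <= b + eta ->
    a - eta <= y <= b + eta -> `|f2 n x - f2 n y| <= D * `|x - y|.
  have [D D0 mD] := @mollified_lipschitz _ k (a - 2 * eta) (b + 2 * eta) ck _ 2 (en0 n).
  have [M2 M20 mM] := @segment_bounded _ (mol n 2) (a - eta) (b + eta)
    ltac:(by move=> x _; apply: is_derive_continuous; exact: dmol).
  have k2 : 0 <= (kp ^+ 2)^-1 by rewrite invr_ge0 exprn_ge0// ltW// k_gt0.
  exists (M2 * (`|beta| * (kp ^+ 2)^-1) + D * M); first by rewrite addr_ge0// !mulr_ge0.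
  move=> x y xI yI.
  rewrite (_ : f2 n x - f2 n y = mol n 2 x * (- beta * (H n x - H n y)) +
    (mol n 2 x - mol n 2 y) * (alpha - beta * H n y)); last by rewrite /f2; ring.
  apply: (le_trans (ler_normD _ _)); rewrite [leRHS]mulrDl; apply: lerD.
    rewrite normrM -mulrA ler_pM//; first exact: mM.
    by rewrite normrM normrN -mulrA ler_wpM2l// primitive_bound.
  rewrite normrM mulrAC; apply: ler_pM => //; exact: HM.
have cE n z : a <= z <= b -> f2 n z = 2 * rate n z * fn n z.
  move=> zab; rewrite /killing_rate clamp_id// /f2 /fn.
  have h0 := m0 n z (subI zab); have hn0 : mol n 0 z != 0 by rewrite gt_eqF.
  by field.
have cc n : continuous (rate n) := continuous_killing_rate ab eta0 ck k_gt0 k_nd (n := n).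
have c0 n z : 0 <= rate n z := killing_rate_ge0 g2D ab eta0 s0p qs1 ck kg k_gt0 k_nd n z.
pose u n w := expR (- \int[mu]_(x in `[0, sigma w]) rate n (B x w)) * fn n (B (sigma w) w).
have mu_ n : measurable_fun setT (u n).
  have [D D0 fD] := f2L n.
  exact: (measurable_smooth_exponential_bm uF bm ab eta0 D0 (df n) (df1 n) fD (cc n) (c0 n)
    (cE n) osigma sigma_ge0 sigma_leN Bab).
have Eu n : \int[Pr]_w u n w = fn n 0.
  have [D D0 fD] := f2L n.
  exact: (smooth_exponential_bm_mean uF bm ab eta0 D0 (df n) (df1 n) fD (cc n) (c0 n)
    (cE n) osigma sigma_ge0 sigma_leN Bab).
have Bs w : a <= B (sigma w) w <= b by apply: Bab; rewrite sigma_ge0/=.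
have C_ge0 n w : 0 <= \int[mu]_(x in `[0, sigma w]) rate n (B x w).
  by apply: Rintegral_ge0 => x _; exact: c0.
have uM n w : `|u n w| <= k (b + 2 * eta) * M.
  have BI := subI (Bs w).
  rewrite /u normrM ger0_norm ?expR_ge0//.
  apply: (@le_trans _ _ (1 * `|fn n (B (sigma w) w)|)).
    rewrite ler_wpM2r// -[leRHS]expR0 ler_expR oppr_le0.
    exact: C_ge0.
  rewrite mul1r normrM ler_pM//; last exact: HM.
  by rewrite ger0_norm; [have /andP[] := mol_ge n BI|exact/ltW/m0].
have molcvg z : a <= z <= b -> mol n 0 z @[n --> \oo] --> g z.
  move=> zab; apply/cvgrPdist_lt => t t0.
  have zI := subI zab.
  have := mollified_unif eta0 ck k_gt0 k_nd t0 (a := a) (b := b).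
  apply: filterS => n Hn; have := Hn z zI.
  by rewrite distrC kg//; move: zab eta0 => /andP[? ?] ?; apply/andP; split; lra.
have Hcvg z : a <= z <= b -> H n z @[n --> \oo] --> - (q z - q 0).
  move=> zab.
  have kp0 : 0 < kp by exact: k_gt0.
  (* With [m] the mollified value, [1 / m ^+ 2 - 1 / k ^+ 2] is
     [(k - m) * (k + m) / (m ^+ 2 * k ^+ 2)], where both values lie between [kp] and
     [k (b + 2 * eta)]. *)
  pose C := 2 * k (b + 2 * eta) / kp ^+ 4.
  have C0 : 0 <= C by rewrite divr_ge0 ?exprn_ge0 ?mulr_ge0// ltW.
  apply/cvgrPdist_le => t t0.
  have t1 : 0 < t / (C * `|z| + 1) by rewrite divr_gt0// ltr_wpDl// mulr_ge0.
  have := mollified_unif eta0 ck k_gt0 k_nd t1 (a := a) (b := b).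
  apply: filterS => n Hn.
  have t2 : 0 <= C * (t / (C * `|z| + 1)) by rewrite mulr_ge0// ltW.
  have yabP y : Num.min 0 (0 + z) <= y <= Num.max 0 (0 + z) -> a <= y <= b.
    rewrite add0r; move: zab ab0 => /andP[? ?] /andP[? ?] /andP[].
    by rewrite ge_min le_max => /orP[h1|h1] /orP[h2|h2]; apply/andP; split; lra.
  have Hz : `|(H n (0 + z) + q (0 + z)) - (H n 0 + q 0)| <=
      C * (t / (C * `|z| + 1)) * `|z| ^+ 1.
    apply: (@mvt_bound _ (fun y => H n y + q y)
      (fun y => (G n y ^+ 2)^-1 - (g y ^+ 2)^-1) 0 z _ 0 t2) => y /yabP yab.
      have yI : a - 2 * eta <= y <= b + 2 * eta by move: yab eta0 => /andP[? ?] ?; apply/andP; split; lra.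
      exact: (is_deriveD (dH n y) (sh_derive sh (inI yI))).
    have yJ := subI yab.
    have yI : a - 2 * eta <= y <= b + 2 * eta by move: yab eta0 => /andP[? ?] ?; apply/andP; split; lra.
    rewrite expr0 mulr1 Gm// -(kg yI); have hy := Hn _ yJ; have /andP[p1 p2] := mol_ge n yJ.
    have ky1 : kp <= k y by apply: k_nd; move: yI => /andP[].
    have ky2 : k y <= k (b + 2 * eta) by apply: k_nd; move: yI => /andP[].
    have := m0 n y yJ; have := k_gt0 y.
    move: (mol n 0 y) (k y) hy p1 p2 ky1 ky2 => m ky hy p1 p2 ky1 ky2 ky0 m0'.
    rewrite (_ : _ - _ = (ky - m) * ((ky + m) * (m ^+ 2 * ky ^+ 2)^-1)); last first.
      by field; rewrite !gt_eqF.
    rewrite normrM distrC [leLHS]mulrC; apply: ler_pM; [by []|by []| |exact: ltW hy].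
    rewrite /C ger0_norm; last by rewrite mulr_ge0 ?invr_ge0 ?mulr_ge0 ?exprn_ge0 ?addr_ge0// ltW.
    apply: ler_pM; [by rewrite addr_ge0 ?ltW| |by lra|].
      by rewrite invr_ge0 mulr_ge0// exprn_ge0// ltW.
    rewrite lef_pV2 ?posrE ?mulr_gt0 ?exprn_gt0// (_ : kp ^+ 4 = kp ^+ 2 * kp ^+ 2); last by ring.
    apply: ler_pM; rewrite ?exprn_ge0 ?(ltW kp0)//;
      by rewrite lerXn2r ?nnegrE ?(ltW kp0) ?(ltW ky0) ?(ltW m0').
  rewrite !add0r H0 add0r expr1 in Hz.
  rewrite (_ : _ - _ = - (H n z + q z - q 0)); last by ring.
  rewrite normrN; apply: (le_trans Hz).
  have z1 : 0 < C * `|z| + 1 by rewrite ltr_wpDl// mulr_ge0.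
  rewrite (_ : C * _ * _ = t * (C * `|z|) / (C * `|z| + 1)); last by field; rewrite gt_eqF.
  by rewrite ler_pdivrMr// ler_wpM2l ?(ltW t0)// lerDl.
have uY w : u n w @[n --> \oo] --> Y w.
  apply: cvgM.
    apply: (continuous_cvg_seq (f := expR)); first exact: continuous_expR.
    exact: (cvgN (killing_rate_cvg (sigma_ge0 w) (Bab (w := w)))).
  apply: cvgM; first exact: molcvg.
  rewrite -[X in _ + X]opprK -mulrN.
  by apply: cvgB; [exact: cvg_cst|apply: cvgMr; exact: Hcvg].
have [mY cY] := bounded_convergence Pr mu_ uM uY.
split => //; apply: (@cvg_unique _ _ (\int[Pr]_w u n w @[n --> \oo])) => //.
rewrite (_ : (fun n => _) = (fun n => mol n 0 0 * alpha)).
  by rewrite /f subrr mulr0 addr0; apply: cvgMl; exact: molcvg.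
by apply/funext => n; rewrite Eu /fn H0 mulr0 subr0.
Qed.

End martingale.

End bounded_range.

Lemma additive_functional_fin (a b : R) w u : (s0 < a%:E)%E -> (b%:E < s1)%E ->
  0 <= u -> (forall s, 0 <= s <= u -> a <= B s w <= b) ->
  additive_functional nu L u w = (fine (additive_functional nu L u w))%:E.
Proof.
move=> s0a bs1 u0 Bab; have [eta eta0 [h1 h2]] := open_interval_margin s0a bs1.
have [g2 g2D nuE] := sh_speed sh.
have /Bab/andP[h3 h4] : 0 <= (0 : R) <= u by apply/andP; split.
have ab := le_trans h3 h4.
by rewrite (additive_functional_bounded_range eta0 ab h1 h2 g2D nuE u0 Bab).
Qed.

(** Presents [r * Gamma] as a limit of time integrals along the path; this is how Gamma will be
    shown to be adapted. *)
Lemma killing_approximation (a b : R) : (s0 < a%:E)%E -> (b%:E < s1)%E -> a <= b ->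
  exists c : nat -> R -> R, [/\ forall n, continuous (c n), forall n z, 0 <= c n z &
    forall w u, 0 <= u -> (forall s, 0 <= s <= u -> a <= B s w <= b) ->
      \int[mu]_(x in `[0, u]) c n (B x w) @[n --> \oo] -->
      r * fine (additive_functional nu L u w)].
Proof.
move=> s0a bs1 ab; have [eta eta0 [h1 h2]] := open_interval_margin s0a bs1.
have pq : a - 2 * eta <= b + 2 * eta by lra.
have inI y : a - 2 * eta <= y <= b + 2 * eta -> (s0 < y%:E < s1)%E.
  move=> /andP[y1 y2]; rewrite (lt_le_trans h1) ?lee_fin//=.
  by rewrite (le_lt_trans _ h2)// lee_fin.
have ck : continuous (g \o clamp (a - 2 * eta) (b + 2 * eta)).
  by apply: continuous_comp_clamp => // y /inI; exact: (sh_continuous sh).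
have kg y : a - 2 * eta <= y <= b + 2 * eta ->
    (g \o clamp (a - 2 * eta) (b + 2 * eta)) y = g y.
  by move=> h; rewrite /= clamp_id.
have k0 y : 0 < (g \o clamp (a - 2 * eta) (b + 2 * eta)) y.
  by apply: (sh_gt0 sh); apply: inI; exact: clamp_itv.
have knd : {homo (g \o clamp (a - 2 * eta) (b + 2 * eta)) : x y / x <= y}.
  move=> x y xy /=; have /andP[x1 x2] := inI _ (clamp_itv x pq).
  have /andP[x3 x4] := inI _ (clamp_itv y pq); apply: (sh_nondecreasing sh) => //.
  by rewrite /clamp ge_max !le_max lexx/= orbC le_min !ge_min lexx xy !orbT.
have [g2 g2D nuE] := sh_speed sh.
exists (killing_rate (k := g \o clamp (a - 2 * eta) (b + 2 * eta)) (a := a) (b := b) (eta := eta)).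
split.
- by move=> n; exact: (continuous_killing_rate ab eta0 ck k0 knd).
- exact: (killing_rate_ge0 g2D ab eta0 h1 h2 ck kg k0 knd).
- by move=> w u u0 Bab; exact: killing_rate_cvg.
Qed.

Lemma speed_martingale (a b : R) (sigma : T -> R) (N : nat) (alpha beta : R) :
  (s0 < a%:E)%E -> (b%:E < s1)%E -> optional_time F sigma ->
  (forall w, 0 <= sigma w) -> (forall w, sigma w <= N%:R) ->
  (forall w s, 0 <= s <= sigma w -> a <= B s w <= b) ->
  let f y := g y * (alpha + beta * (q y - q 0)) in
  let Y w := expR (- (r * fine (additive_functional nu L (sigma w) w))) * f (B (sigma w) w) in
  measurable_fun setT Y /\ \int[Pr]_w Y w = f 0.
Proof.
move=> s0a bs1 os si0 siN Bab; have [eta eta0 [h1 h2]] := open_interval_margin s0a bs1.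
have [w _] : exists w : T, True.
  apply/not_existsP => h0; have := @probability_setT _ _ _ Pr.
  rewrite (_ : setT = set0) ?measure0; first by move=> /eqP; rewrite eq_sym onee_eq0.
  by apply/seteqP; split => // w _; exact: (h0 w).
have ab0 : a <= 0 <= b by rewrite -(rbm_start bm w); apply: Bab; rewrite lexx/=.
have ab : a <= b by have /andP[] := ab0; exact: le_trans.
exact: (bounded_range_martingale eta0 ab h1 h2 os si0 siN Bab ab0).
Qed.

End speed_martingales.

(** * Entrance times and the explosion of the additive functional *)

Section optional_times.
Context {R : realType} {d : measure_display} {T : measurableType d}.
Context {Pr : probability T R} {F : R -> set (set T)}.
Hypothesis uF : usual_filtration Pr F.
Implicit Types (u v s t : R).

Lemma filtration_le s t A : 0 <= s -> s <= t -> F s A -> F t A.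
Proof. by move=> s0 st; exact: (filtration_nondecreasing uF s0 st). Qed.

Lemma filtration0 t : 0 <= t -> F t set0.
Proof. by move=> t0; have [] := filtration_sigma_algebra uF t0. Qed.

Lemma filtrationU t A A' : 0 <= t -> F t A -> F t A' -> F t (A `|` A').
Proof.
move=> t0 FA FA'; rewrite -bigcup2E; apply: (filtration_bigcup uF) => // -[|[|n]]//=.
exact: filtration0.
Qed.

Lemma filtrationI t A A' : 0 <= t -> F t A -> F t A' -> F t (A `&` A').
Proof.
move=> t0 FA FA'; rewrite -[A `&` A']setCK setCI.
by apply: (filtrationC uF) => //; apply: filtrationU => //; exact: (filtrationC uF).
Qed.

Lemma filtration_bigcap t (A : nat -> set T) :
  0 <= t -> (forall n, F t (A n)) -> F t (\bigcap_n A n).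
Proof.
move=> t0 FA; rewrite -[\bigcap_n A n]setCK setC_bigcap.
apply: (filtrationC uF) => //; apply: (filtration_bigcup uF) => // n.
exact: (filtrationC uF).
Qed.

Lemma filtration_bigcup_rat t (D : set rat) (A : rat -> set T) :
  0 <= t -> (forall x, D x -> F t (A x)) -> F t (\bigcup_(x in D) A x).
Proof.
move=> t0 FA.
rewrite (_ : \bigcup_(x in D) A x = \bigcup_n
    (if unpickle n is Some x then if `[< D x >] then A x else set0 else set0)); last first.
  apply/seteqP; split => w.
    by move=> [x Dx Axw]; exists (pickle x); [exact: I|rewrite pickleK asboolT].
  move=> [n _]; case: unpickle => [x|]//; case: asboolP => // Dx Axw.
  by exists x.
apply: (filtration_bigcup uF) => // n; case: unpickle => [x|]; last exact: filtration0.
by case: asboolP => [/FA//|_]; exact: filtration0.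
Qed.

Lemma filtration_negligible t N : 0 <= t -> Pr.-negligible N -> F t N.
Proof.
by move=> t0 /(filtration_complete uF); exact: filtration_le.
Qed.

(** Completeness and monotonicity of the filtration put the exceptional set, and all its subsets, in
    [F t]. *)
Lemma filtration_almost_eq t N A A' : 0 <= t -> Pr.-negligible N -> F t A ->
  (forall w, ~ N w -> A w <-> A' w) -> F t A'.
Proof.
move=> t0 N0 FA AA'.
have FN : F t N by exact: filtration_negligible.
have -> : A' = (A `&` ~` N) `|` (A' `&` N).
  apply/seteqP; split => w.
    move=> A'w; have [Nw|Nw] := pselect (N w); first by right.
    by left; split => //; exact/(AA' _ Nw).
  by move=> [[Aw /AA']|[]//]; tauto.
apply: filtrationU => //; first by apply: filtrationI => //; exact: (filtrationC uF).
apply: filtration_negligible => //; apply: negligibleS N0.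
by move=> w [].
Qed.

(* The usual conditions make optional times stopping times. *)
Lemma optional_le (sigma : T -> \bar R) t : 0 <= t ->
  (forall u, 0 < u -> F u [set w | (sigma w < u%:E)%E]) ->
  F t [set w | (sigma w <= t%:E)%E].
Proof.
move=> t0 os; apply: (filtration_right_continuous uF) => // s /= ts.
have d0 : 0 < s - t by rewrite subr_gt0.
pose e n : R := t + (s - t) / n.+1%:R.
have et n : t < e n by rewrite ltrDl divr_gt0.
have es n : e n <= s.
  by rewrite -lerBrDl ler_pdivrMr// ler_peMr ?ler1n// ltW.
rewrite (_ : [set w | _] = \bigcap_n [set w | (sigma w < (e n)%:E)%E]); last first.
  apply/seteqP; split => w /=.
    by move=> h n _; apply: (le_lt_trans h); rewrite lte_fin.
  move=> h; apply/lee_addgt0Pr => x x0.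
  have [n nx] : exists n : nat, (s - t) / n.+1%:R < x.
    exists (Num.truncn ((s - t) / x)); rewrite ltr_pdivrMr// mulrC -ltr_pdivrMr//.
    exact: truncnS_gt.
  apply/ltW/(lt_le_trans (h n I)); rewrite -EFinD lee_fin lerD2l.
  exact: ltW.
apply: filtration_bigcap; first exact: le_trans (ltW ts).
move=> n; apply: (@filtration_le (e n)) => //.
  by apply: (le_trans t0); exact: ltW.
by apply: os; exact: le_lt_trans (et n).
Qed.

Lemma optional_min (s1 s2 : T -> R) : optional_time F s1 -> optional_time F s2 ->
  optional_time F (fun w => Num.min (s1 w) (s2 w)).
Proof.
move=> o1 o2 u u0; rewrite (_ : [set w | _] = [set w | s1 w < u] `|` [set w | s2 w < u]).
  by apply: filtrationU; [exact: ltW|exact: o1|exact: o2].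
apply/seteqP; split => w /=; rewrite gt_min; first by move=> /orP.
by move=> [->|->]//; rewrite orbT.
Qed.

(** Adding [N%:R] to the set makes the infimum a real number and caps it at [N]; without a visit
    before [N] the value is [N]. *)
Definition entrance (V : R -> set T) (N : nat) (w : T) : R :=
  inf ([set N%:R] `|` [set u | 0 <= u /\ V u w]).

Section entrance.
Context {V : R -> set T} {N : nat}.

Let S w := [set N%:R : R] `|` [set u | 0 <= u /\ V u w].

Let has_infS w : has_inf (S w).
Proof.
split; first by exists N%:R; left.
by exists 0 => u /= [->|[]//].
Qed.

Lemma entrance_le w : entrance V N w <= N%:R.
Proof. by apply: ge_inf; [have [] := has_infS w|left]. Qed.

Lemma entrance_ge0 w : 0 <= entrance V N w.
Proof. by apply: lb_le_inf; [have [] := has_infS w|move=> u /= [->|[]//]]. Qed.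

Lemma entrance_lb w u : 0 <= u -> V u w -> entrance V N w <= u.
Proof. by move=> u0 Vu; apply: ge_inf; [have [] := has_infS w|right]. Qed.

Lemma entrance_lt w u : entrance V N w < u -> N%:R < u \/ exists2 v, 0 <= v < u & V v w.
Proof.
move=> /(inf_lt (has_infS w).1) [v [->|[v0 Vv]] vu]; first by left.
by right; exists v => //; rewrite v0.
Qed.

Lemma before_entrance w u : 0 <= u -> u < entrance V N w -> ~ V u w.
Proof. by move=> u0 + Vu; apply/negP; rewrite -leNgt; exact: entrance_lb. Qed.

Hypothesis FV : forall u, 0 <= u -> F u (V u).
Hypothesis V_open : forall w u, 0 <= u -> V u w ->
  exists2 e : R, 0 < e & forall v, u <= v -> v < u + e -> V v w.

(** A visit persists for a while to the right, so a rational time detects it. The infimum may fail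
    to be a visit, which is why only the strict inequality is an event at time [u]. *)
Lemma optional_entrance : optional_time F (entrance V N).
Proof.
move=> u u0.
rewrite (_ : [set w | _] = [set w : T | N%:R < u] `|`
  \bigcup_(x in [set x : rat | 0 <= (ratr x : R) < u]) V (ratr x)); last first.
  apply/seteqP; split => w /=.
    move=> /entrance_lt[|[v /andP[v0 vu] Vv]]; first by left.
    right; have [e e0 Ve] := V_open v0 Vv.
    have vm : v < Num.min u (v + e) by rewrite lt_min vu ltrDl.
    have [x] := rat_in_itvoo vm; rewrite in_itv/= lt_min => /andP[vx /andP[xu xe]].
    exists x; first by rewrite /= xu (le_trans v0)// ltW.
    by apply: Ve => //; exact: ltW.
  move=> [Nu|[x /andP[x0 xu] Vx]]; first exact: (le_lt_trans (entrance_le w)).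
  by apply: (le_lt_trans _ xu); exact: entrance_lb.
apply: filtrationU; first exact: ltW.
- have [Nu|Nu] := boolP (N%:R < u).
    rewrite (_ : [set w | _] = setT); first by apply: (filtration_setT uF); exact: ltW.
    by apply/seteqP; split.
  rewrite (_ : [set w | _] = set0); first by apply: filtration0; exact: ltW.
  by apply/seteqP; split.
- apply: filtration_bigcup_rat; first exact: ltW.
  move=> x /= /andP[x0 xu]; apply: (filtration_le x0); first exact: ltW.
  exact: FV.
Qed.

End entrance.

Context {B : R -> T -> R}.
Hypothesis bm : regular_bm Pr F B.

Lemma bm_open_right (O : set R) w u : open O -> O (B u w) ->
  exists2 e : R, 0 < e & forall v, u <= v -> v < u + e -> O (B v w).
Proof.
move=> oO Ou.
have nO : nbhs (B u w) O by exact: open_nbhs_nbhs.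
have : \forall v \near u, O (B v w) by exact: (rbm_continuous bm nO).
move=> /nbhs_ballP[e /= e0 He]; exists e => // v uv ve.
by apply: He; rewrite /ball/= ltr_distlC; apply/andP; split; lra.
Qed.

Lemma optional_bm_entrance (O : set R) N : open O ->
  optional_time F (entrance (fun u => [set w | O (B u w)]) N).
Proof.
move=> oO; apply: optional_entrance.
- by move=> u u0; exact: (rbm_adapted bm u0 (open_measurable oO)).
- by move=> w u _; exact: bm_open_right.
Qed.

(** A path inside an open set at a positive time was already there slightly earlier; time 0 is
    excluded by [~ O 0]. *)
Lemma bm_at_entrance (O : set R) N w s : open O -> ~ O 0 ->
  0 <= s <= entrance (fun u => [set w | O (B u w)]) N w -> ~ O (B s w).
Proof.
move=> oO O0 /andP[s0 sE] Os.
have [s0'|s0'] := eqVneq s 0; first by move: Os; rewrite s0' (rbm_start bm).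
have {}s0 : 0 < s by rewrite lt_neqAle eq_sym s0'.
have nO : nbhs (B s w) O by exact: open_nbhs_nbhs.
have : \forall v \near s, O (B v w) by exact: (rbm_continuous bm nO).
move=> /nbhs_ballP[e /= e0 He].
pose v := Num.max (s / 2) (s - e / 2).
have v0 : 0 <= v by rewrite le_max divr_ge0// ltW.
have vs : v < s by rewrite gt_max; apply/andP; split; lra.
have Ov : O (B v w).
  apply: He; rewrite /ball/= ltr_distlC.
  have : s - e / 2 <= v by rewrite le_max lexx orbT.
  by move=> ?; apply/andP; split; lra.
exact: (before_entrance v0 (lt_le_trans vs sE) Ov).
Qed.

Let closed_exit_set (a b : R) : set R := [set y | y < a \/ b < y].

Lemma open_closed_exit_set a b : open (closed_exit_set a b).
Proof. by apply: openU; [exact: open_lt|exact: open_gt]. Qed.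

Definition exit_time (a b : R) : nat -> T -> R :=
  entrance (fun u => [set w | B u w < a \/ b < B u w]).

Lemma optional_exit_time a b N : optional_time F (exit_time a b N).
Proof. exact: (optional_bm_entrance N (@open_closed_exit_set a b)). Qed.

Lemma bm_before_exit a b N w s : a <= 0 <= b -> 0 <= s <= exit_time a b N w -> a <= B s w <= b.
Proof.
move=> /andP[a0 b0] sE.
have n0 : ~ closed_exit_set a b 0 by move=> [|]; rewrite ltNge ?a0 ?b0.
have := bm_at_entrance (@open_closed_exit_set a b) n0 sE.
by move=> /not_orP[/negP + /negP]; rewrite -!leNgt => -> ->.
Qed.

Lemma exit_time_ge a b N w u : u <= N%:R -> (forall s, 0 <= s < u -> a <= B s w <= b) ->
  u <= exit_time a b N w.
Proof.
move=> uN Bab; rewrite leNgt; apply/negP => /entrance_lt[|[v vu]].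
  by rewrite ltNge uN.
move: (Bab v vu) => /andP[h1 h2] /=.
by move=> [|]; rewrite ltNge ?h1 ?h2.
Qed.

(* exp (- int_0^v c (B)) is a limit of Riemann products over grid points <= v. *)
Lemma adapted_exp_integral (c : R -> R) v : 0 <= v -> continuous c -> (forall x, 0 <= c x) ->
  adapted_at F v (fun w => expR (- \int[lebesgue_measure]_(x in `[0, v]) c (B x w))).
Proof.
move=> v0 cc c0.
pose k n := (Num.truncn (v * n.+1%:R)).+1.
have kv n : v < (k n)%:R / n.+1%:R <= v + n.+1%:R^-1.
  have vn0 : 0 <= v * n.+1%:R by rewrite mulr_ge0.
  apply/andP; split; first by rewrite ltr_pdivlMr// truncnS_gt.
  rewrite ler_pdivrMr// mulrDl mulVf ?pnatr_eq0// /k -natr1 lerD2r.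
  by have /andP[] := truncn_itv vn0.
apply: (@measurable_fun_cvg _ (g_sigma_algebraType (F v)) _ _
  (fun n w => \prod_(i < k n) (1 + n.+1%:R^-1 * c (B (i%:R / n.+1%:R) w))^-1)).
- move=> n; apply: measurable_prod => i _.
  have i0 : 0 <= (i%:R / n.+1%:R : R) by rewrite divr_ge0.
  have iv : (i%:R / n.+1%:R : R) <= v.
    have vn0 : 0 <= v * n.+1%:R by rewrite mulr_ge0.
    rewrite ler_pdivrMr//; have /andP[+ _] := truncn_itv vn0.
    by apply: le_trans; rewrite ler_nat -ltnS.
  apply: (adapted_at_le uF i0 iv).
  have cf : continuous (fun x : R => (1 + n.+1%:R^-1 * c x)^-1).
    move=> x; apply: cvgV; first by rewrite gt_eqF// ltr_wpDr// mulr_ge0.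
    by apply: cvgD; [exact: cvg_cst|apply: cvgM; [exact: cvg_cst|exact: cc]].
  apply: (@measurableT_comp _ _ _ _ _ _ (fun x : R => (1 + n.+1%:R^-1 * c x)^-1)).
    exact: continuous_measurable_fun.
  exact: (adapted_bm uF bm i0).
- move=> w _; apply: (riemann_product_cvg (f := fun x => c (B x w))) => //.
  move=> x; apply: continuous_comp; [exact: (rbm_continuous bm)|exact: cc].
Qed.

(** Exits before [v] are detected at rational times up to [v]. The endpoint needs its own condition,
    since rational times after [v] lie in the future. *)
Lemma filtration_stay (a b v : R) : 0 <= v ->
  F v [set w | forall s, 0 <= s <= v -> a <= B s w <= b].
Proof.
move=> v0.
rewrite (_ : [set w | _] = ~` (\bigcup_(x in [set x : rat | 0 <= (ratr x : R) <= v])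
   [set w | ~ a <= B (ratr x) w <= b]) `&` [set w | a <= B v w <= b]); last first.
  apply/seteqP; split => w /=.
    move=> Bab; split; last by apply: Bab; rewrite v0 lexx.
    by move=> [x /= xv]; apply; exact: Bab.
  move=> [Bab Bv] s /andP[s0 sv]; have [->//|svn] := eqVneq s v.
  have {}sv : s < v by rewrite lt_neqAle svn.
  apply/negPn/negP; rewrite negb_and -!ltNge => Bs; apply: Bab.
  have [e e0 Ve] := bm_open_right (@open_closed_exit_set a b) (orP Bs).
  have vm : s < Num.min v (s + e) by rewrite lt_min sv ltrDl.
  have [x] := rat_in_itvoo vm; rewrite in_itv/= lt_min => /andP[sx /andP[xv xe]].
  exists x; first by rewrite /= (ltW xv) (le_trans s0)// ltW.
  move=> /= /andP[h1 h2]; have [|] := Ve (ratr x) (ltW sx) xe.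
    by rewrite ltNge h1.
  by rewrite ltNge h2.
apply: filtrationI => //.
  apply: (filtrationC uF) => //; apply: filtration_bigcup_rat => // x /= /andP[x0 xv].
  apply: (filtration_le x0 xv).
  rewrite (_ : [set w | _] = B (ratr x) @^-1` (~` `[a, b]%classic)).
    by apply: (rbm_adapted bm x0); exact: measurableC.
  by apply/seteqP; split => w; rewrite /= in_itv.
rewrite (_ : [set w | _] = B v @^-1` `[a, b]%classic).
  exact: (rbm_adapted bm v0).
by apply/seteqP; split => w; rewrite /= in_itv.
Qed.

End optional_times.

(** * Path properties of the additive functional *)

Section additive_functional_paths.
Context {R : realType} {d : measure_display} {T : measurableType d}.
Notation mu := (@lebesgue_measure R).
Context {B : R -> T -> R} {L : R -> R -> T -> R} {nu : {measure set R -> \bar R}}.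
Hypotheses (rL : regular_local_time B L) (cB : forall w, continuous (B^~ w)).
Notation Gam := (additive_functional nu L).
Implicit Types (u v : R) (w : T).

Let mL u w : 0 <= u -> measurable_fun setT (fun z => (L z u w)%:E).
Proof.
move=> u0; apply/measurable_EFinP; apply: continuous_measurable_fun.
exact: (rlt_continuous rL u0).
Qed.

Lemma additive_functional_ge0 u w : 0 <= u -> (0 <= Gam u w)%E.
Proof.
by move=> u0; apply: integral_ge0 => z _; rewrite lee_fin; exact: (rlt_ge0 rL z w u0).
Qed.

Lemma additive_functional_le u v w : 0 <= u -> u <= v -> (Gam u w <= Gam v w)%E.
Proof.
move=> u0 uv; have v0 := le_trans u0 uv; apply: ge0_le_integral => //.
- by move=> z _; rewrite lee_fin; exact: (rlt_ge0 rL z w u0).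
- exact: mL.
- exact: mL.
- by move=> z _; rewrite lee_fin; exact: (rlt_le rL cB).
Qed.

Lemma additive_functional0 w : Gam 0 w = 0%E.
Proof.
by rewrite /additive_functional integral0_eq// => z _; rewrite (rlt_0 rL cB).
Qed.

(** Left continuity, by monotone convergence along [u - u / (n + 1)], in the form in which it is
    used: an upper bound before [u] persists at [u]. *)
Lemma additive_functional_left u w (t : \bar R) : 0 <= u -> (0 <= t)%E ->
  (forall v, 0 <= v < u -> (Gam v w <= t)%E) -> (Gam u w <= t)%E.
Proof.
move=> u0 t0 H; have [u00|u00] := eqVneq u 0; first by rewrite u00 additive_functional0.
have {}u0 : 0 < u by rewrite lt_neqAle eq_sym u00.
pose un n : R := u - u / n.+1%:R.
have un0 n : 0 <= un n.
  by rewrite subr_ge0 ler_pdivrMr// ler_peMr ?ler1n// ltW.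
have unu n : un n < u by rewrite ltrBlDr ltrDl divr_gt0.
have und n m : (n <= m)%N -> un n <= un m.
  move=> nm; rewrite lerD2l lerN2 ler_pM2l// lef_pV2 ?posrE//.
  by rewrite ler_nat ltnS.
have unc : un n @[n --> \oo] --> u.
  rewrite -[X in _ --> X]subr0 -[X in _ - X](mulr0 u).
  by apply: cvgB; [exact: cvg_cst|apply: cvgMr; exact: cvg_harmonic].
have cv : (\int[nu]_z (L z (un n) w)%:E)%E @[n --> \oo] --> Gam u w.
  have := @cvg_monotone_convergence _ R R nu setT measurableT
    (fun n z => (L z (un n) w)%:E) (fun n => mL w (un0 n)) _ _.
  rewrite (_ : (fun x => limn _) = (fun z => (L z u w)%:E)).
    apply.
    - by move=> n z _; rewrite lee_fin; exact: (rlt_ge0 rL z w (un0 n)).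
    - by move=> z _ n m nm; rewrite lee_fin; apply: (rlt_le rL cB) => //; exact: und.
  apply/funext => z; apply/cvg_lim => //; apply: cvg_EFin; first exact: nearW.
  by apply: (rlt_cvg rL); [exact: ltW|exact: un0|exact: unc].
rewrite -(cvg_lim _ cv)//; apply: lime_le; first by apply/cvg_ex; exists (Gam u w).
by apply: nearW => n; apply: H; rewrite un0 unu.
Qed.

(** After time [s] the path spends positive time in [O]; by the occupation formula the local time
    cannot vanish on all of [O]. *)
Lemma local_time_gt0_open (O : set R) u s w : open O -> 0 <= s < u -> O (B s w) ->
  exists2 z, O z & 0 < L z u w.
Proof.
move=> oO /andP[s0 su] Os; have u0 : 0 <= u by apply: (le_trans s0); exact: ltW.
apply: contrapT => H.
have [_ occ] := rL w.
have := occ u O u0 (open_measurable oO).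
rewrite [RHS]integral0_eq; last first.
  move=> z Oz; congr EFin; apply/eqP; rewrite eq_le (rlt_ge0 rL z w u0) andbT leNgt.
  by apply/negP => Lz; apply: H; exists z.
have nO : nbhs (B s w) O by exact: open_nbhs_nbhs.
have : \forall v \near s, O (B v w) by exact: (cB nO).
move=> /nbhs_ballP[e /= e0 He].
pose v := Num.min u (s + e / 2).
have sv : s < v by rewrite lt_min su ltrDl divr_gt0.
move=> mu0; suff : (0 < mu [set s | (0 <= s <= u)%R /\ O (B s w)])%E by rewrite mu0 ltxx.
apply: (@lt_le_trans _ _ (mu `[s, v]%classic)).
  by rewrite lebesgue_measure_itv/= lte_fin sv -EFinD lte_fin subr_gt0.
apply: le_measure; rewrite ?inE//.
  rewrite (_ : [set _ | _] = `[0, u]%classic `&` (B^~ w) @^-1` O); last first.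
    by apply/seteqP; split => x [h1 h2]; split => //; move: h1; rewrite /= in_itv.
  apply: measurableI => //; rewrite -[X in measurable X]setTI.
  by apply: (continuous_measurable_fun (cB (w := w))) => //; exact: open_measurable.
move=> x /=; rewrite in_itv/= => /andP[sx]; rewrite le_min => /andP[xu xe].
rewrite (le_trans s0 sx) xu; split => //; apply: He.
by rewrite /ball/= ltr_distlC; apply/andP; split; lra.
Qed.

Lemma additive_functional_infinite z u w : 0 <= u -> nu [set z] = +oo%E -> 0 < L z u w ->
  Gam u w = +oo%E.
Proof.
move=> u0 nuz Lz; apply/eqP; rewrite -leye_eq.
apply: (@le_trans _ _ (\int[nu]_(x in [set z]) (L x u w)%:E)%E); last first.
  apply: ge0_subset_integral => //; first exact: mL.
  by move=> x _; rewrite lee_fin; exact: (rlt_ge0 rL x w u0).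
rewrite (eq_integral (cst (L z u w)%:E)); last by move=> x /set_mem ->.
by rewrite integral_cst//= nuz gt0_muley ?lte_fin.
Qed.

End additive_functional_paths.

(** * A path that reaches a level goes strictly beyond it *)

Section crossing.
Context {R : realType} {d : measure_display} {T : measurableType d}.
Notation mu := (@lebesgue_measure R).
Context {Pr : probability T R} {F : R -> set (set T)} {B : R -> T -> R}.
Context {L : R -> R -> T -> R}.
Hypotheses (uF : usual_filtration Pr F) (bm : regular_bm Pr F B).
Hypothesis rL : regular_local_time B L.
Implicit Types (u v : R) (w : T).

(** The case of rate 0 and the identity function of the exponential martingale. *)
Lemma bounded_optional_bm_mean (a b : R) (sigma : T -> R) (N : nat) : a <= b ->
  optional_time F sigma -> (forall w, 0 <= sigma w) -> (forall w, sigma w <= N%:R) ->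
  (forall w s, 0 <= s <= sigma w -> a <= B s w <= b) ->
  measurable_fun setT (fun w => B (sigma w) w) /\ \int[Pr]_w B (sigma w) w = 0.
Proof.
move=> ab os s0 sN Bab.
have d1 (x : R) : a - 1 <= x <= b + 1 -> is_derive x 1 (fun y : R => y) (1 : R).
  by move=> _; exact: is_derive_id.
have d2 (x : R) : a - 1 <= x <= b + 1 -> is_derive x 1 (fun=> 1 : R) (0 : R).
  by move=> _; exact: is_derive_cst.
have lip (x y : R) : a - 1 <= x <= b + 1 -> a - 1 <= y <= b + 1 ->
  `|(fun=> 0 : R) x - (fun=> 0 : R) y| <= 0 * `|x - y| by rewrite subrr normr0 mul0r.
have cc : continuous (fun _ : R => 0 : R) by exact: cst_continuous.
have cf (x : R) : a <= x <= b -> (fun=> 0 : R) x = 2 * (fun=> 0 : R) x * x.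
  by rewrite mulr0 mul0r.
have E w : expR (- \int[mu]_(x in `[0, sigma w]) (fun=> 0 : R) (B x w)) * B (sigma w) w =
    B (sigma w) w.
  by rewrite /Rintegral integral0 oppr0 expR0 mul1r.
have m := measurable_smooth_exponential_bm uF bm ab ltr01 (lexx 0) d1 d2 lip cc
  (fun=> lexx 0) cf os s0 sN Bab.
have := smooth_exponential_bm_mean uF bm ab ltr01 (lexx 0) d1 d2 lip cc
  (fun=> lexx 0) cf os s0 sN Bab.
by move: m; rewrite (_ : (fun w => _) = (fun w => B (sigma w) w)) //; apply/funext.
Qed.

Section one_side.
(* X = B or - B *)
Context {e m : R}.
Hypotheses (e1 : e = 1 \/ e = -1) (m0 : 0 < m).
Notation X u w := (e * B u w).

Let cX w : continuous (fun u => X u w).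
Proof. by move=> u; apply: cvgMr; exact: (rbm_continuous bm). Qed.

Let X0 w : X 0 w = 0. Proof. by rewrite (rbm_start bm) mulr0. Qed.

Let cX_ge (x u : R) w : (forall t, 0 < t -> exists2 v, u <= v < u + t & x <= X v w) ->
  x <= X u w.
Proof.
move=> H; rewrite leNgt; apply/negP => Xx.
have : \forall v \near u, X v w < x.
  have h : X v w @[v --> u] --> X u w by exact: cX.
  by move/cvgr_lt : h; exact.
move=> /nbhs_ballP[t /= t0 Ht]; have [v /andP[uv vt] xX] := H _ t0.
have /Ht : ball u t v by rewrite /ball/= ltr_distlC; apply/andP; split; lra.
by rewrite ltNge xX.
Qed.

Let cX_le (x u : R) w : (forall t, 0 < t -> exists2 v, u <= v < u + t & X v w <= x) ->
  X u w <= x.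
Proof.
move=> H; rewrite leNgt; apply/negP => Xx.
have : \forall v \near u, x < X v w.
  have h : X v w @[v --> u] --> X u w by exact: cX.
  by move/cvgr_gt : h; exact.
move=> /nbhs_ballP[t /= t0 Ht]; have [v /andP[uv vt] xX] := H _ t0.
have /Ht : ball u t v by rewrite /ball/= ltr_distlC; apply/andP; split; lra.
by rewrite ltNge xX.
Qed.

Let entrance_close (V : R -> set T) N w t : 0 < t -> entrance V N w < N%:R ->
  exists2 v, entrance V N w <= v < entrance V N w + t & V v w.
Proof.
move=> t0 eN.
have : entrance V N w < Num.min N%:R (entrance V N w + t) by rewrite lt_min eN ltrDl.
move=> /entrance_lt[|[v /andP[v0 vm] Vv]]; first by rewrite ltNge ge_min lexx.
exists v => //; rewrite (entrance_lb v0 Vv)/=.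
by apply: (lt_le_trans vm); rewrite ge_min lexx orbT.
Qed.

Section bad_event.
Context {c C : R} {N : nat} {eta : R}.
Hypotheses (cm : c < m) (C0 : 0 <= C) (eta0 : 0 < eta) (etam : eta < m).

Let H1 := entrance (fun u => [set w | m - eta < X u w]) N.
Let theta := entrance (fun u => [set w | X u w < - C \/ m < X u w]) N.
Let H2 := entrance (fun u => [set w | H1 w < u /\ X u w < c]) N.
Let sig w := Num.min (theta w) (H1 w).
Let sig' w := Num.min (theta w) (H2 w).

Let openX (O : set R) : open O -> open [set y | O (e * y)].
Proof.
move=> oO; apply: (open_comp (f := fun y => e * y)) => // y _.
by apply: cvgMr; exact: cvg_id.
Qed.

Let o1 : optional_time F H1.
Proof. exact: (optional_bm_entrance uF bm N (openX (@open_gt _ (m - eta)))). Qed.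

Let ot : optional_time F theta.
Proof. exact: (optional_bm_entrance uF bm N (openX (@open_closed_exit_set _ (- C) m))). Qed.

Let o2 : optional_time F H2.
Proof.
apply: (optional_entrance uF).
- move=> u u0; have [->|un0] := eqVneq u 0.
    rewrite (_ : [set w | _] = set0); first exact: (filtration0 uF).
    by apply/seteqP; split => w //= [+ _]; rewrite ltNge entrance_ge0.
  apply: (filtrationI uF u0) => //; first by apply: o1; rewrite lt_neqAle eq_sym un0.
  exact: (rbm_adapted bm u0 (open_measurable (openX (@open_lt _ c)))).
- move=> w u u0 [Hu Xu].
  have [t t0 Ht] := bm_open_right bm (openX (@open_lt _ c)) Xu.
  by exists t => // v uv vt; split; [exact: (lt_le_trans Hu)|exact: Ht].
Qed.

Let theta_range w s : 0 <= s <= theta w -> - C <= X s w <= m.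
Proof.
move=> sE.
have n0 : ~ [set y | e * y < - C \/ m < e * y] 0.
  by rewrite /= mulr0 => -[|]; [rewrite ltNge oppr_le0 C0|rewrite ltNge ltW].
have oO : open [set y | e * y < - C \/ m < e * y].
  exact: (openX (@open_closed_exit_set _ (- C) m)).
have := bm_at_entrance bm oO n0 sE.
by move=> /not_orP[/negP + /negP]; rewrite -!leNgt => -> ->.
Qed.

Let rangeB (s : T -> R) : (forall w, s w <= theta w) ->
  forall w v, 0 <= v <= s w -> - Num.max C m <= B v w <= Num.max C m.
Proof.
move=> st w v /andP[v0 vs].
have /andP[h1 h2] : - C <= X v w <= m by apply: theta_range; rewrite v0 (le_trans vs).
rewrite -ler_norml.
have -> : `|B v w| = `|X v w|.
  by case: e1 => ->; rewrite normrM ?normrN normr1 mul1r.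
rewrite ler_norml; apply/andP; split.
  by apply: le_trans h1; rewrite lerN2 le_max lexx.
by apply: (le_trans h2); rewrite le_max lexx orbT.
Qed.

Let stop_mean (s : T -> R) : optional_time F s -> (forall w, 0 <= s w <= theta w) ->
  [/\ measurable_fun setT (fun w => X (s w) w), Pr.-integrable setT (EFin \o (fun w => X (s w) w))
   & \int[Pr]_w (X (s w) w) = 0].
Proof.
move=> os s0t.
have s0 w : 0 <= s w by have /andP[] := s0t w.
have st w : s w <= theta w by have /andP[] := s0t w.
have sN w : s w <= N%:R by apply: (le_trans (st w)); exact: entrance_le.
have MM : - Num.max C m <= Num.max C m.
  by rewrite -subr_ge0 opprK addr_ge0// le_max C0.
have [mB EB] := bounded_optional_bm_mean MM os s0 sN (rangeB st).
have iB : Pr.-integrable setT (EFin \o (fun w => B (s w) w)).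
  apply: (@bounded_integrable _ _ _ Pr _ (Num.max C m)) => // w.
  by rewrite ler_norml; apply: (rangeB st); rewrite s0/=.
split; first exact: measurable_funM.
  exact: (integrableZl _ e iB).
by rewrite RintegralZl// EB mulr0.
Qed.

Let Y w := X (sig w) w - X (sig' w) w + eta.

Let sigt w : 0 <= sig w <= theta w.
Proof. by rewrite le_min !entrance_ge0 ge_min lexx. Qed.

Let sigt' w : 0 <= sig' w <= theta w.
Proof. by rewrite le_min !entrance_ge0 ge_min lexx. Qed.

Let H12 w : H1 w <= H2 w.
Proof.
apply: lb_le_inf; first by exists N%:R; left.
by move=> u /= [->|[_ [/ltW//]]]; exact: entrance_le.
Qed.

Let X_sig w : H1 w < theta w -> m - eta <= X (sig w) w.
Proof.
move=> Ht; rewrite /sig (_ : Num.min _ _ = H1 w); last by apply/min_idPr; exact: ltW.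
have HN : H1 w < N%:R by apply: (lt_le_trans Ht); exact: entrance_le.
apply: cX_ge => t t0; have [v vI Vv] := entrance_close t0 HN.
by exists v => //; exact: ltW.
Qed.

Let Y_ge0 w : 0 <= Y w.
Proof.
have [Ht|tH] := ltP (H1 w) (theta w).
  have h1 := X_sig Ht; have /andP[_ h2] := theta_range (sigt' w).
  by rewrite /Y; move: h1 h2; rewrite /= ; lra.
rewrite /Y (_ : sig w = theta w); last exact/min_idPl.
rewrite (_ : sig' w = theta w) ?subrr ?add0r ?ltW//.
by apply/min_idPl; exact: le_trans (H12 w).
Qed.

(** [sig] stops within [eta] of the top [m], and [sig'] waits for a later descent below [c]; both
    stop on leaving [[- C, m]]. The two stopped values are centred, so the defect has mean [eta]. It
    is nonnegative, and it is at least [m - c] on a path that touches [m], does not exceed it, and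
    then falls below [c]. *)
Definition crossing_defect (w : T) : R := Y w.

(** Markov's inequality for a nonnegative variable of mean [eta]. *)
Lemma crossing_defect_bound :
  d.-measurable [set w | m - c <= crossing_defect w] /\
  (Pr [set w | (m - c <= crossing_defect w)%R] <= (eta / (m - c))%:E)%E.
Proof.
have mc0 : 0 < m - c by rewrite subr_gt0.
have [m1 i1 E1] := stop_mean (optional_min uF ot o1) sigt.
have [m2 i2 E2] := stop_mean (optional_min uF ot o2) sigt'.
have mY : measurable_fun setT Y.
  by apply: measurable_funD => //; apply: measurable_funB.
have iD : Pr.-integrable setT (EFin \o (fun w => X (sig w) w - X (sig' w) w)).
  exact: (integrableB _ i1 i2).
have ie : Pr.-integrable setT (EFin \o (fun=> eta) : T -> \bar R).
  by apply: (@bounded_integrable _ _ _ Pr _ `|eta|).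
have EY : (\int[Pr]_w (Y w)%:E = eta%:E)%E.
  have iY : Pr.-integrable setT (EFin \o Y) by exact: (integrableD _ iD ie).
  rewrite -[LHS]fineK; last exact: integrable_fin_num.
  congr EFin; rewrite -/(Rintegral Pr setT Y) /Y RintegralD// RintegralB// E1 E2.
  by rewrite Rintegral_cst// subrr add0r (congr1 fine (@probability_setT _ _ _ Pr)) mulr1.
have mA : d.-measurable [set w | m - c <= Y w].
  rewrite (_ : [set w | _] = Y @^-1` `[m - c, +oo[%classic).
    by rewrite -[Z in measurable Z]setTI; exact: mY.
  by apply/seteqP; split => w; rewrite /= in_itv/= andbT.
split => //.
rewrite EFinM lee_pdivlMr// muleC -integral_cst// -EY.
apply: (@le_trans _ _ (\int[Pr]_(w in [set w | (m - c <= Y w)%R]) (Y w)%:E)%E).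
  apply: ge0_le_integral => //.
  - by move=> w _; rewrite lee_fin ltW.
  - by apply: measurable_funTS; exact/measurable_EFinP.
apply: ge0_subset_integral => //; first exact/measurable_EFinP.
by move=> w _; rewrite lee_fin.
Qed.

Lemma crossing_defect_ge w u v : 0 <= u -> u < v -> v <= N%:R ->
  (forall s, 0 <= s <= v -> - C <= X s w <= m) -> m <= X u w -> X v w < c ->
  m - c <= crossing_defect w.
Proof.
move=> u0 uv vN Xr Xu Xv.
have v0 : 0 <= v by apply: (le_trans u0); exact: ltW.
have vt : v <= theta w.
  rewrite leNgt; apply/negP => /entrance_lt[|[s /andP[s0 sv] /= Vs]].
    by rewrite ltNge vN.
  have /andP[h1 h2] : - C <= X s w <= m by apply: Xr; rewrite s0 ltW.
  by move: Vs => [|]; rewrite ltNge ?h1 ?h2.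
have H1u : H1 w <= u by apply: entrance_lb => //=; rewrite (lt_le_trans _ Xu)// gtrBl.
have h1 := X_sig (le_lt_trans H1u (lt_le_trans uv vt)).
have H2v : H2 w <= v.
  by apply: entrance_lb => //; split => //; exact: le_lt_trans uv.
(* [H2] is capped at [N]. When the cap is reached, [v] equals [N], and the value at [v] is below [c]
   by hypothesis. *)
have [H2N|] := ltP (H2 w) N%:R; last first.
  move=> NH; have vN' : v = N%:R by apply/eqP; rewrite eq_le vN (le_trans NH).
  have E2 : H2 w = v by apply/eqP; rewrite eq_le H2v vN'.
  have : sig' w = v by rewrite /sig' E2; exact/min_idPr.
  by rewrite /crossing_defect /Y => ->; move: h1 Xv; rewrite /=; lra.
have E2 : sig' w = H2 w by apply/min_idPr; exact: le_trans vt.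
have : X (sig' w) w <= c.
  rewrite E2; apply: cX_le => t t0; have [s sI [_ Vs]] := entrance_close t0 H2N.
  by exists s => //; exact: ltW.
by rewrite /crossing_defect /Y; move: h1; rewrite /=; lra.
Qed.

End bad_event.

End one_side.

End crossing.

Section almost_sure_crossing.
Context {R : realType} {d : measure_display} {T : measurableType d}.
Notation mu := (@lebesgue_measure R).
Context {Pr : probability T R} {F : R -> set (set T)} {B : R -> T -> R}.
Context {L : R -> R -> T -> R}.
Hypotheses (uF : usual_filtration Pr F) (bm : regular_bm Pr F B).
Hypothesis rL : regular_local_time B L.

Lemma negligible_bigcup_countable (J : countType) (D : set J) (A : J -> set T) :
  (forall j, D j -> Pr.-negligible (A j)) -> Pr.-negligible (\bigcup_(j in D) A j).
Proof.
move=> A0; apply: (negligibleS (A := \bigcup_n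
    (if unpickle n is Some j then if `[< D j >] then A j else set0 else set0))).
  move=> w [j Dj Aj]; exists (pickle j); first exact: I.
  by rewrite pickleK asboolT.
apply: negligible_bigcup => n; case: unpickle => [j|]; last exact: negligible_set0.
by case: asboolP => [/A0//|_]; exact: negligible_set0.
Qed.

Lemma small_negligible (A : set T) :
  (forall t : R, 0 < t -> exists2 A' : set T, A `<=` A' & measurable A' /\ (Pr A' <= t%:E)%E) ->
  Pr.-negligible A.
Proof.
move=> H; have /choice[A' HA'] : forall n : nat, exists A' : set T,
    [/\ A `<=` A', measurable A' & (Pr A' <= (n.+1%:R^-1)%:E)%E].
  move=> n; have n0 : 0 < (n.+1%:R^-1 : R) by [].
  by have [A' h1 [h2 h3]] := H _ n0; exists A'.
have mA' : measurable (\bigcap_n A' n) by apply: bigcapT_measurable => n; have [] := HA' n.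
exists (\bigcap_n A' n); split => //; last by move=> w Aw n _; have [h _ _] := HA' n; exact: h.
apply/eqP; rewrite eq_le measure_ge0 andbT; apply/lee_addgt0Pr => t t0; rewrite add0e.
have [n nt] : exists n : nat, (n.+1%:R^-1 : R) < t.
  exists (Num.truncn t^-1); rewrite invf_plt ?posrE//; exact: truncnS_gt.
have [_ m1 m2] := HA' n.
apply: (@le_trans _ _ (Pr (A' n))); first by apply: le_measure; rewrite ?inE// => w; exact.
by apply: (le_trans m2); rewrite lee_fin ltW.
Qed.

(** A path in this event falls below some rational [c < m] after touching [m]. For fixed [c] and
    integer bounds on the path and on time, it then lies in events of probability at most
    [m / (j + 2) / (m - c)] for all [j]; the union over these parameters is countable. *)
Lemma crossing_strict (e m : R) : e = 1 \/ e = -1 -> 0 < m ->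
  Pr.-negligible [set w | exists u u' : R, [/\ 0 <= u, u < u', m <= e * B u w &
    forall v, 0 <= v < u' -> e * B v w <= m]].
Proof.
move=> e1 m0.
pose A (k : rat * (nat * nat)) := \bigcap_j [set w | m - ratr k.1 <=
  @crossing_defect R d T B e m (ratr k.1) k.2.1%:R k.2.2 (m / j.+2%:R) w].
apply: (negligibleS (A := \bigcup_(k in [set k | (ratr k.1 : R) < m]) A k)); last first.
  apply: negligible_bigcup_countable => -[c [C N]] /= cm.
  apply: small_negligible => t t0.
  have mc0 : 0 < m - ratr c by rewrite subr_gt0.
  have ej j : 0 < m / j.+2%:R by rewrite divr_gt0.
  pose j := Num.truncn (m / (t * (m - ratr c))).
  have [m1 m2] := crossing_defect_bound uF bm e1 m0 (N := N) cm (ler0n R C) (ej j).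
  exists [set w | m - ratr c <= @crossing_defect R d T B e m (ratr c) C%:R N (m / j.+2%:R) w].
    by move=> w /(_ j I).
  split => //; apply: (le_trans m2); rewrite lee_fin.
  have h : m / (t * (m - ratr c)) < j.+2%:R.
    apply: (lt_trans (truncnS_gt _)); by rewrite ltr_nat.
  rewrite ler_pdivrMr// ler_pdivrMr// mulrC -ler_pdivrMr ?mulr_gt0//.
  exact: ltW.
move=> w [u [u' [u0 uu' Xu Xm]]].
have cX : continuous (fun u => e * B u w) by move=> v; apply: cvgMr; exact: (rbm_continuous bm).
have u'0 : 0 <= u' by apply: (le_trans u0); exact: ltW.
have em z : e * z = m <-> z = e * m.
  by case: e1 => ->; rewrite ?mul1r// !mulN1r; split => [<-|->]; rewrite opprK.
(* X cannot stay equal to m on [u, u'[, by the occupation formula. *)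
have [v uv Xv] : exists2 v, u < v < u' & e * B v w < m.
  apply: contrapT => H.
  have [_ occ] := rL w.
  have := occ u' [set e * m] u'0 (measurable_set1 _).
  have -> : (\int[mu]_(z in [set (e * m)%R]) (L z u' w)%:E = 0)%E.
    by exact: integral_set1.
  move=> mu0; suff : (0 < mu [set s | (0 <= s <= u')%R /\ [set (e * m)%R] (B s w)])%E.
    by rewrite mu0 ltxx.
  apply: (@lt_le_trans _ _ (mu `]u, u'[%classic)).
    by rewrite lebesgue_measure_itv/= lte_fin uu' -EFinD lte_fin subr_gt0.
  apply: le_measure; rewrite ?inE//.
    rewrite (_ : [set _ | _] = `[0, u']%classic `&` (B^~ w) @^-1` [set e * m]); last first.
      by apply/seteqP; split => x [h1 h2]; split => //; move: h1; rewrite /= in_itv.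
    apply: measurableI => //; rewrite -[Z in measurable Z]setTI.
    have cBw : continuous (B^~ w) by exact: (rbm_continuous bm).
    by apply: (continuous_measurable_fun cBw) => //; exact: measurable_set1.
  move=> x /=; rewrite in_itv/= => /andP[ux xu'].
  have x0 : 0 <= x by apply: (le_trans u0); exact: ltW.
  rewrite x0 (ltW xu'); split => //; apply/em/eqP; rewrite eq_le Xm ?x0//= leNgt.
  by apply/negP => Xx; apply: H; exists x => //; rewrite ux.
have /andP[uv1 vu'] := uv.
have v0 : 0 <= v by apply: (le_trans u0); exact: ltW.
have [c] := rat_in_itvoo Xv; rewrite in_itv/= => /andP[Xc cm].
have [M M0 XM] := @segment_bounded _ (fun u => e * B u w) 0 v ltac:(by move=> x _; exact: cX).
exists (c, ((Num.truncn M).+1, (Num.truncn v).+1)) => //= j _ /=.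
have ej : 0 < m / j.+2%:R by rewrite divr_gt0.
apply: (crossing_defect_ge bm ej u0 uv1) => //; first exact/ltW/truncnS_gt.
move=> s /andP[s0 sv]; apply/andP; split.
  have : `|e * B s w| <= M by apply: XM; rewrite s0.
  rewrite ler_norml => /andP[h _]; apply: le_trans h.
  by rewrite lerN2; exact/ltW/truncnS_gt.
by apply: Xm; rewrite s0 (le_lt_trans sv).
Qed.

Lemma bm_small_ball (t C : R) : 0 < t -> 0 <= C ->
  (Pr [set w | (- C <= B t w <= C)%R] <= (normal_peak (Num.sqrt t) * (2 * C))%:E)%E.
Proof.
move=> t0 C0.
have -> : [set w | - C <= B t w <= C] = increment B 0 t @^-1` `[- C, C]%classic.
  by apply/seteqP; split => w; rewrite /increment /= in_itv/= (rbm_start bm) subr0.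
rewrite (rbm_increment bm (lexx 0) t0)// subr0 /normal_prob.
have s0 : Num.sqrt t != 0 by rewrite gt_eqF// sqrtr_gt0.
apply: (@le_trans _ _ (\int[mu]_(x in `[(- C)%R, C]) (normal_peak (Num.sqrt t))%:E)%E).
  apply: ge0_le_integral => //.
  - by move=> x _; rewrite lee_fin normal_pdf_ge0.
  - by apply: measurable_funTS; apply/measurable_EFinP; exact: measurable_normal_pdf.
  - by move=> x _; rewrite lee_fin normal_pdf_ub.
rewrite integral_cst//= EFinM lee_wpmul2l ?lee_fin//.
  by rewrite ltW// normal_peak_gt0.
rewrite lebesgue_measure_itv/= lte_fin; case: ifP => _; last by rewrite lee_fin mulr_ge0.
by rewrite -EFinB lee_fin; lra.
Qed.

Lemma bm_hits_negligible (t m : R) : 0 < t -> Pr.-negligible [set w | B t w = m].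
Proof.
move=> t0; exists [set w | B t w = m]; split => //.
  have := measurable_bm uF bm (ltW t0); move=> /(_ measurableT [set m] (measurable_set1 _)).
  by rewrite setTI.
have -> : [set w | B t w = m] = increment B 0 t @^-1` [set m].
  by apply/seteqP; split => w; rewrite /increment /= (rbm_start bm) subr0.
rewrite (rbm_increment bm (lexx 0) t0)// /normal_prob.
by exact: integral_set1.
Qed.

End almost_sure_crossing.

Section exhaustion.
Context {R : realType}.

Record exhaustion (s0 s1 : \bar R) (a b : nat -> R) : Prop := Exhaustion {
  exh_l : forall n, (s0 < (a n)%:E)%E ; exh_r : forall n, ((b n)%:E < s1)%E ;
  exh_a0 : forall n, a n < 0 ; exh_b0 : forall n, 0 < b n ;
  exh_a : forall n m, (n <= m)%N -> a m <= a n ;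
  exh_b : forall n m, (n <= m)%N -> b n <= b m ;
  exh_al : forall y : R, (s0 < y%:E)%E -> exists n, a n < y ;
  exh_br : forall y : R, (y%:E < s1)%E -> exists n, y < b n }.

Let half_exhaustion (s : \bar R) : (0 < s)%E -> exists b : nat -> R,
  [/\ forall n, ((b n)%:E < s)%E, forall n, 0 < b n, forall n m, (n <= m)%N -> b n <= b m &
    forall y : R, (y%:E < s)%E -> exists n, y < b n].
Proof.
case: s => [m| |]// m0.
  (* The shift by 2 keeps the first bound positive. *)
  rewrite lte_fin in m0; exists (fun n => m - m / n.+2%:R); split => [n|n|n k nk|y].
  - by rewrite lte_fin ltrBlDr ltrDl divr_gt0.
  - by rewrite subr_gt0 ltr_pdivrMr// ltr_pMr// ltr1n.
  - by rewrite lerD2l lerN2 ler_pM2l// lef_pV2 ?posrE// ler_nat !ltnS.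
  - rewrite lte_fin => ym; have my : 0 < m - y by rewrite subr_gt0.
    exists (Num.truncn (m / (m - y))).
    rewrite ltrBrDr addrC -ltrBrDr ltr_pdivrMr// mulrC -ltr_pdivrMr//.
    by apply: (lt_trans (truncnS_gt _)); rewrite ltr_nat.
exists (fun n => n.+1%:R); split => [n|n|n k nk|y _].
- by rewrite ltry.
- by [].
- by rewrite ler_nat.
- by exists (Num.truncn y); exact: truncnS_gt.
Qed.

Lemma exhaustion_exists (s0 s1 : \bar R) : (s0 < 0)%E -> (0 < s1)%E ->
  exists a b, exhaustion s0 s1 a b.
Proof.
move=> s00 s10; have [b [b1 b2 b3 b4]] := half_exhaustion s10.
have s00' : (0 < - s0)%E by rewrite oppe_gt0.
have [a [a1 a2 a3 a4]] := half_exhaustion s00'.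
exists (fun n => - a n), b; split => //.
- by move=> n; rewrite EFinN lteNr.
- by move=> n; rewrite oppr_lt0.
- by move=> n m nm; rewrite lerN2 a3.
- move=> y s0y; have [|n yn] := a4 (- y); first by rewrite EFinN lteNl oppeK.
  by exists n; rewrite ltrNl.
Qed.

Lemma exhaustion_itv s0 s1 a b (p q : R) : exhaustion s0 s1 a b ->
  (s0 < p%:E)%E -> (q%:E < s1)%E -> exists n, forall m, (n <= m)%N -> a m < p /\ q < b m.
Proof.
move=> ex s0p qs1; have [i ip] := exh_al ex s0p; have [j jq] := exh_br ex qs1.
exists (maxn i j) => m; rewrite geq_max => /andP[im jm]; split.
  exact: (le_lt_trans (exh_a ex im)).
exact: (lt_le_trans jq (exh_b ex jm)).
Qed.

End exhaustion.

(** * Explosion at the exit from the state interval, and adaptedness of Gamma *)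

Section explosion.
Context {R : realType} {d : measure_display} {T : measurableType d}.
Notation mu := (@lebesgue_measure R).
Context {Pr : probability T R} {F : R -> set (set T)} {B : R -> T -> R}.
Context {L : R -> R -> T -> R}.
Hypotheses (uF : usual_filtration Pr F) (bm : regular_bm Pr F B).
Hypothesis rL : regular_local_time B L.
Context {r : R} {s0 s1 : \bar R} {g q : R -> R} {nu : {measure set R -> \bar R}}.
Hypotheses (r0 : 0 < r) (sh : speed_harmonic r s0 s1 g q nu).
Hypotheses (s00 : (s0 < 0)%E) (s10 : (0 < s1)%E).
Hypothesis nu_out : forall y : R, (y%:E <= s0 \/ s1 <= y%:E)%E -> nu [set y] = +oo%E.
Context {a b : nat -> R}.
Hypothesis ex : exhaustion s0 s1 a b.
Notation Gam := (additive_functional nu L).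
Notation I y := ((s0 < y%:E)%E /\ (y%:E < s1)%E).
Implicit Types (u v : R) (w : T).

Let cB w : continuous (B^~ w). Proof. exact: (rbm_continuous bm). Qed.

(** Once the path is strictly beyond an endpoint, it has positive local time at some level there,
    and [nu] gives that point infinite mass. A finite Gamma at [u'] thus confines the path to the
    endpoint's side before [u'], although it has reached the endpoint; [crossing_strict] makes this
    negligible. *)
Lemma explosion_at_exit : Pr.-negligible [set w | exists u u' : R,
  [/\ 0 <= u, u < u', ~ I (B u w) & Gam u' w <> +oo%E]].
Proof.
have inf_right m w u u' : s1 = m%:E -> 0 <= u -> u < u' ->
    (exists2 v, 0 <= v < u' & m < B v w) -> Gam u' w = +oo%E.
  move=> s1m u0 uu' [v vI mB].
  have [z /= mz Lz] := local_time_gt0_open rL cB (@open_gt _ m) vI mB.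
  apply: (additive_functional_infinite rL _ _ Lz).
    by apply: (le_trans u0); exact: ltW.
  by apply: nu_out; right; rewrite s1m lee_fin ltW.
have inf_left m w u u' : s0 = m%:E -> 0 <= u -> u < u' ->
    (exists2 v, 0 <= v < u' & B v w < m) -> Gam u' w = +oo%E.
  move=> s0m u0 uu' [v vI mB].
  have [z /= mz Lz] := local_time_gt0_open rL cB (@open_lt _ m) vI mB.
  apply: (additive_functional_infinite rL _ _ Lz).
    by apply: (le_trans u0); exact: ltW.
  by apply: nu_out; left; rewrite s0m lee_fin ltW.
pose A m e := [set w | exists u u' : R, [/\ 0 <= u, u < u', m <= e * B u w &
    forall v, 0 <= v < u' -> e * B v w <= m]].
apply: (negligibleS (A :=
  (if s1 is m%:E then A m 1 else set0) `|` (if s0 is m%:E then A (- m) (-1) else set0))).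
  move=> w [u [u' [u0 uu' /not_andP[s0B|Bs1] G]]].
  - right; case: s0 s00 s0B inf_left => [m| |]//= m0 s0B; last by rewrite ltNyr in s0B.
    move=> il; exists u, u'; split => //.
      by rewrite mulN1r lerN2; move/negP: s0B; rewrite lte_fin -leNgt.
    move=> v vI; rewrite mulN1r lerN2 leNgt; apply/negP => Bv.
    by apply: G; apply: (il m w u) => //; exists v.
  - left; case: s1 s10 Bs1 inf_right => [m| |]//= m0 Bs1; last by rewrite ltry in Bs1.
    move=> ir; exists u, u'; split => //.
      by rewrite mul1r; move/negP: Bs1; rewrite lte_fin -leNgt.
    move=> v vI; rewrite mul1r leNgt; apply/negP => Bv.
    by apply: G; apply: (ir m w u) => //; exists v.
apply: negligibleU.
- case: s1 s10 => [m| |] // m0; try exact: negligible_set0.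
  by apply: (crossing_strict uF bm rL) => //; left.
- case: s0 s00 => [m| |] // m0; try exact: negligible_set0.
  apply: (crossing_strict uF bm rL); first by right.
  by rewrite oppr_gt0.
Qed.

Definition stay n v := [set w | forall s, 0 <= s <= v -> a n <= B s w <= b n].

Lemma stay_exists w v : 0 <= v -> (forall s, 0 <= s <= v -> I (B s w)) ->
  exists n, forall m, (n <= m)%N -> stay m v w.
Proof.
move=> v0 BI.
have cw : {within `[0, v], continuous (B^~ w)} by apply: continuous_subspaceT; exact: cB.
have [x xI Bx] := EVT_max v0 cw.
have [y yI By] := EVT_min v0 cw.
have [_ Ix] := BI x ltac:(by move: xI; rewrite in_itv).
have [Iy _] := BI y ltac:(by move: yI; rewrite in_itv).
have [n Hn] := exhaustion_itv ex Iy Ix.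
exists n => m nm s sI; have [h1 h2] := Hn m nm.
have sI' : s \in `[0, v] by rewrite in_itv.
by rewrite (le_trans (ltW h1)) ?By//= (le_trans _ (ltW h2))// Bx.
Qed.

Lemma stay_fin n w v s : stay n v w -> 0 <= s <= v -> Gam s w = (fine (Gam s w))%:E.
Proof.
move=> st /andP[s0' sv].
apply: (additive_functional_fin rL r0 sh (exh_l ex n) (exh_r ex n) s0').
by move=> x /andP[x0 xs]; apply: st; rewrite x0 (le_trans xs).
Qed.

(** On the paths staying in one of the exhausting segments, [expR (- r * Gamma)] is a limit of
    adapted exponentials. On the remaining paths Gamma is infinite almost surely, and the
    exceptional paths are absorbed by completeness. *)
Lemma filtration_additive_functional (v t : R) : 0 <= v -> F v [set w | (t%:E < Gam v w)%E].
Proof.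
move=> v0.
have FE n : F v (stay n v) := filtration_stay uF bm (a n) (b n) v0.
have FA n : F v ([set w | (t%:E < Gam v w)%E] `&` stay n v).
  have ab : a n <= b n.
    by have := exh_a0 ex n; have := exh_b0 ex n; move=> ? ?; rewrite ltW// (lt_trans (exh_a0 ex n)).
  have [c [cc c0 cvg]] := killing_approximation bm rL r0 sh (exh_l ex n) (exh_r ex n) ab.
  pose W w : R := expR (- (r * fine (Gam v w))) * \1_(stay n v) w.
  have aW : adapted_at F v W.
    apply: (@measurable_fun_cvg _ (g_sigma_algebraType (F v)) _ _
      (fun k w => expR (- \int[mu]_(x in `[0, v]) c k (B x w)) * \1_(stay n v) w)).
    - move=> k; apply: measurable_funM.
        exact: (adapted_exp_integral uF bm v0 (cc k) (c0 k)).
      exact: (adapted_at_indic uF v0 (FE n)).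
    - move=> w _; rewrite /W indicE; case: (boolP (w \in stay n v)) => [/set_mem st|_].
        rewrite mulr1; under eq_fun do rewrite mulr1.
        apply: (continuous_cvg_seq (f := expR)); first exact: continuous_expR.
        exact: (cvgN (cvg w v v0 st)).
      by rewrite mulr0; under eq_fun do rewrite mulr0; exact: cvg_cst.
  have -> : [set w | (t%:E < Gam v w)%E] `&` stay n v =
      stay n v `&` W @^-1` `]-oo, expR (- (r * t))[%classic.
    apply/seteqP; split => w [h1 h2].
      split => //; move: h1; rewrite /= in_itv/= /W indicE (mem_set h2) mulr1.
      rewrite (stay_fin h2 (s := v)) ?v0 ?lexx// lte_fin => h.
      by rewrite ltr_expR ltrN2 ltr_pM2l.
    split => //; move: h2; rewrite /= in_itv/= /W indicE (mem_set h1) mulr1.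
    rewrite ltr_expR ltrN2 ltr_pM2l// => h.
    by rewrite (stay_fin h1 (s := v)) ?v0 ?lexx// lte_fin.
  apply: (filtrationI uF v0 (FE n)).
  by apply: (adapted_atP uF W v0).1.
have FU : F v (\bigcup_n stay n v) by exact: (filtration_bigcup uF v0).
have FAU : F v (\bigcup_n ([set w | (t%:E < Gam v w)%E] `&` stay n v)).
  exact: (filtration_bigcup uF v0).
have FC := filtrationU uF v0 FAU (filtrationC uF v0 FU).
(* At time 0 the position is deterministic and the hitting events below need not be null; there
   Gamma vanishes. *)
have [v00|vn0] := eqVneq v 0.
  rewrite (_ : [set w | _] = (if 0 <= t then set0 else setT)); last first.
    apply/seteqP; split => w; rewrite v00 /= (additive_functional0 rL cB) lte_fin; case: leP => //.
  by case: ifP => _; [exact: (filtration0 uF)|exact: (filtration_setT uF)].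
have vp : 0 < v by rewrite lt_neqAle eq_sym vn0.
(* The first event handles exits before [v]. A path that reaches an endpoint exactly at time [v] has
   had no time to explode; it is removed because the Gaussian law has no atoms. For an infinite
   endpoint [fine] gives 0, which is hit at time [v] with probability zero as well. *)
pose N := [set w | exists u u' : R, [/\ 0 <= u, u < u', ~ I (B u w) & Gam u' w <> +oo%E]] `|`
  ([set w | B v w = fine s0] `|` [set w | B v w = fine s1]).
apply: (filtration_almost_eq uF (N := N) v0 _ FC).
  apply: negligibleU; first exact: explosion_at_exit.
  by apply: negligibleU; exact: (bm_hits_negligible uF bm).
move=> w Nw; split => [[[n _ []//]|nst]|Gw].
- have [|] := pselect (exists2 s, 0 <= s < v & ~ I (B s w)).
    move=> [s /andP[s0' sv] sI] /=.
    have [->|Gv] := pselect (Gam v w = +oo%E); first by rewrite ltry.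
    by exfalso; apply: Nw; left; exists s, v.
  move=> sI; exfalso; apply: nst.
  suff : forall s, 0 <= s <= v -> I (B s w).
    by move=> /(stay_exists v0)[n Hn]; exists n => //; exact: Hn.
  have sI' s : 0 <= s < v -> I (B s w).
    by move=> sv; apply: contrapT => Is; apply: sI; exists s.
  move=> s /andP[s0' sv]; have [->|svn] := eqVneq s v; last first.
    by apply: sI'; rewrite s0' lt_neqAle svn.
  have out (O : set R) : open O -> (forall y, O y -> ~ I y) -> ~ O (B v w).
    move=> oO OI OB; have nO : nbhs (B v w) O by exact: open_nbhs_nbhs.
    have : \forall x \near v, O (B x w) by exact: (cB nO).
    move=> /nbhs_ballP[e /= e0 He].
    pose x := Num.max 0 (v - e / 2).
    have xv : 0 <= x < v.
      rewrite le_max lexx/= gt_max vp/=.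
      by rewrite ltrBlDr ltrDl divr_gt0.
    apply: (OI (B x w)); last exact: sI'.
    apply: He; rewrite /ball/= ltr_distlC.
    have : v - e / 2 <= x by rewrite le_max lexx orbT.
    by move: xv => /andP[? ?] ?; apply/andP; split; lra.
  split.
  + rewrite ltNge; apply/negP => le; have [m s0m] : exists m, s0 = m%:E.
      by move: s00 le; clear; case: s0 => [m| |]//; exists m.
    move: le; rewrite s0m lee_fin le_eqVlt => /orP[/eqP mB|].
      by apply: Nw; right; left; rewrite /= s0m.
    apply: (out [set y | y < m]); first exact: open_lt.
    by move=> y /= ym [+ _]; rewrite s0m lte_fin ltNge ltW.
  + rewrite ltNge; apply/negP => le; have [m s1m] : exists m, s1 = m%:E.
      by move: s10 le; clear; case: s1 => [m| |]//; exists m.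
    move: le; rewrite s1m lee_fin le_eqVlt => /orP[/eqP mB|].
      by apply: Nw; right; right; rewrite /= s1m.
    apply: (out [set y | m < y]); first exact: open_gt.
    by move=> y /= ym [_ +]; rewrite s1m lte_fin ltNge ltW.
- have [[n _ st]|nst] := pselect ((\bigcup_n stay n v) w); last by right.
  by left; exists n.
Qed.

Lemma measurable_additive_functional (v t : R) : 0 <= v ->
  measurable [set w | (t%:E < Gam v w)%E].
Proof.
by move=> v0; apply: (filtration_measurable uF v0); exact: filtration_additive_functional.
Qed.

End explosion.

(** * Optional stopping *)

Section fatou_bounds.
Context {R : realType} {d : measure_display} {T : measurableType d}.
Variable Pr : probability T R.

Lemma cvg_le_bound (u : nat -> \bar R) (l c : \bar R) :
  u n @[n --> \oo] --> l -> (forall n, (u n <= c)%E) -> (l <= c)%E.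
Proof.
move=> ul uc; rewrite -(cvg_lim _ ul)//; apply: lime_le; last exact: nearW.
by apply/cvg_ex; exists l.
Qed.

Lemma limn_einf_ge (u : nat -> \bar R) (c : R) :
  (forall t : R, 0 < t -> \forall n \near \oo, ((c - t)%:E <= u n)%E) ->
  (c%:E <= limn_einf u)%E.
Proof.
move=> H; apply/lee_subgt0Pr => t t0; rewrite limn_einf_lim.
apply: lime_ge; first exact: is_cvg_einfs.
have [N _ HN] := H t t0; exists N => // n /= Nn.
apply: le_ereal_inf_tmp => _ [k /= nk <-]; rewrite -EFinB.
by apply: HN; exact: leq_trans nk.
Qed.

(** [V] stands for a payoff, possibly nonmeasurable: it is compared almost surely with the lower
    limit of the measurable [M n], to which Fatou's lemma applies. *)
Lemma fatou_bound (V : T -> R) (M : nat -> T -> R) (N : set T) (c : R) :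
  Pr.-negligible N -> (forall w, 0 <= V w) ->
  (forall n, measurable_fun setT (M n)) -> (forall n w, 0 <= M n w) ->
  (forall n, (\int[Pr]_w (M n w)%:E <= c%:E)%E) ->
  (forall w, ~ N w -> forall t : R, 0 < t -> \forall n \near \oo, V w <= M n w + t) ->
  (\int[Pr]_w (V w)%:E <= c%:E)%E.
Proof.
move=> N0 V0 mM M0 Mc VM.
have mME n : measurable_fun setT (fun w => (M n w)%:E) by exact/measurable_EFinP.
apply: (@le_trans _ _ (\int[Pr]_w limn_einf (fun n => (M n w)%:E))%E).
  apply: ge0_ae_le_integral_nonmeasurable.
  - by move=> w; rewrite lee_fin.
  - move=> w; apply: limn_einf_ge => t t0; apply: nearW => n.
    by rewrite lee_fin sub0r (le_trans _ (M0 n w))// oppr_le0 ltW.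
  - apply: (negligibleS _ N0) => w /= H; apply: contrapT => Nw; apply: H.
    apply: limn_einf_ge => t t0; apply: filterS (VM w Nw t t0) => n.
    by rewrite lee_fin; lra.
apply: (le_trans (fatou Pr measurableT mME _)); first by move=> n w _; rewrite lee_fin.
rewrite limn_einf_lim; apply: lime_le; first exact: is_cvg_einfs.
apply: nearW => n; apply: (le_trans _ (Mc n)).
by apply: ereal_inf_lbound; exists n => /=.
Qed.

(** The lower limit has a finite integral by Fatou's lemma, hence is finite almost surely. *)
Lemma fatou_finite (M : nat -> T -> R) (c : R) :
  (forall n, measurable_fun setT (M n)) -> (forall n w, 0 <= M n w) ->
  (forall n, (\int[Pr]_w (M n w)%:E <= c%:E)%E) ->
  Pr.-negligible [set w | forall K : R, \forall n \near \oo, K <= M n w].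
Proof.
move=> mM M0 Mc.
have mME n : measurable_fun setT (fun w => (M n w)%:E) by exact/measurable_EFinP.
pose f w := limn_einf (fun n => (M n w)%:E).
have f0 w : (0 <= f w)%E.
  apply: limn_einf_ge => t t0; apply: nearW => n.
  by rewrite lee_fin sub0r (le_trans _ (M0 n w))// oppr_le0 ltW.
have fc : (\int[Pr]_w f w <= c%:E)%E.
  apply: (le_trans (fatou Pr measurableT mME _)); first by move=> n w _; rewrite lee_fin.
  rewrite limn_einf_lim; apply: lime_le; first exact: is_cvg_einfs.
  apply: nearW => n; apply: (le_trans _ (Mc n)).
  by apply: ereal_inf_lbound; exists n => /=.
have mf : measurable_fun setT f.
  apply: measurableT_comp; first exact: oppe_measurable.
  by apply: measurable_fun_limn_esup => n; apply: measurableT_comp => //; exact: oppe_measurable.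
have fi : Pr.-integrable setT f.
  apply/integrableP; split => //.
  under eq_integral do rewrite gee0_abs//.
  by apply: (le_lt_trans fc); rewrite ltry.
have := integrable_ae measurableT fi.
apply: negligibleS => w /= H ffin; have {}ffin := ffin I.
have : (f w = +oo)%E.
  apply/eqyP => K _; apply: limn_einf_ge => t t0; apply: filterS (H K) => n.
  by rewrite lee_fin; lra.
by move=> fy; rewrite fy in ffin.
Qed.

End fatou_bounds.

Section stopped_means.
Context {R : realType} {d : measure_display} {T : measurableType d}.
Notation mu := (@lebesgue_measure R).
Context {Pr : probability T R} {F : R -> set (set T)} {B : R -> T -> R}.
Context {L : R -> R -> T -> R}.
Hypotheses (uF : usual_filtration Pr F) (bm : regular_bm Pr F B).
Hypothesis rL : regular_local_time B L.
Context {r : R} {s0 s1 : \bar R} {g q : R -> R} {nu : {measure set R -> \bar R}}.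
Hypotheses (r0 : 0 < r) (sh : speed_harmonic r s0 s1 g q nu).
Hypotheses (s00 : (s0 < 0)%E) (s10 : (0 < s1)%E).
Hypothesis nu_out : forall y : R, (y%:E <= s0 \/ s1 <= y%:E)%E -> nu [set y] = +oo%E.
Context {a b : nat -> R}.
Hypothesis ex : exhaustion s0 s1 a b.
Hypothesis q_ge0 : forall y : R, (s0 < y%:E < s1)%E -> 0 <= q y.
Notation Gam := (additive_functional nu L).
Notation exit n N := (@exit_time R d T B (a n) (b n) N).
Implicit Types (u v : R) (w : T).

Definition discounted_value (f : R -> R) u w : R := expR (- (r * fine (Gam u w))) * f (B u w).

Let f (al be : R) y := g y * (al + be * q y).

Let stop (sigma : T -> R) n N w := Num.min (sigma w) (exit n N w).

Let I0 n : a n <= 0 <= b n.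
Proof. by rewrite !ltW ?(exh_a0 ex) ?(exh_b0 ex). Qed.

Lemma stopped_range (sigma : T -> R) n N w s :
  0 <= s <= stop sigma n N w -> a n <= B s w <= b n.
Proof.
move=> /andP[s0' sE]; apply: (bm_before_exit bm (N := N) (I0 n)).
by rewrite s0' (le_trans sE)// ge_min lexx orbT.
Qed.

Lemma in_exhaustion n y : a n <= y <= b n -> (s0 < y%:E < s1)%E.
Proof.
move=> /andP[h1 h2]; rewrite (lt_le_trans (exh_l ex n)) ?lee_fin//=.
by rewrite (le_lt_trans _ (exh_r ex n))// lee_fin.
Qed.

Lemma stopped_mean (al be : R) (sigma : T -> R) n N : 0 <= al -> 0 <= be -> 0 < f al be 0 ->
  optional_time F sigma -> (forall w, 0 <= sigma w) ->
  [/\ measurable_fun setT (fun w => discounted_value (f al be) (stop sigma n N w) w),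
     forall w, 0 <= discounted_value (f al be) (stop sigma n N w) w &
    (\int[Pr]_w (discounted_value (f al be) (stop sigma n N w) w)%:E = (f al be 0)%:E)%E].
Proof.
move=> al0 be0 f0 os si0.
have ss0 w : 0 <= stop sigma n N w by rewrite le_min si0 entrance_ge0.
have ssN w : stop sigma n N w <= N%:R by rewrite ge_min entrance_le orbT.
have oss : optional_time F (stop sigma n N).
  by apply: (optional_min uF os); exact: (optional_exit_time uF bm).
have := speed_martingale uF bm rL r0 sh (al + be * q 0) be (exh_l ex n) (exh_r ex n)
  oss ss0 ssN (@stopped_range sigma n N).
rewrite (_ : (fun y => g y * (al + be * q 0 + be * (q y - q 0))) = f al be); last first.
  by apply/funext => y; rewrite /f; ring.
move=> [m E]; have p0 w : 0 <= discounted_value (f al be) (stop sigma n N w) w.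
  have BI := in_exhaustion (stopped_range (s := stop sigma n N w) (sigma := sigma) (N := N)
    (w := w) ltac:(by rewrite ss0/=)).
  rewrite /discounted_value mulr_ge0 ?expR_ge0// /f mulr_ge0//.
    exact/ltW/(sh_gt0 sh).
  by rewrite addr_ge0// mulr_ge0// q_ge0.
split => //.
have i0 : (0 <= \int[Pr]_w (discounted_value (f al be) (stop sigma n N w) w)%:E)%E.
  by apply: integral_ge0 => w _; rewrite lee_fin.
rewrite -E -[LHS]fineK// fin_numE; apply/andP; split.
  by apply: contraTN i0 => /eqP ->.
(* The mean is known as a real number, and [fine] sends an infinite integral to 0; positivity of
   [f al be 0] excludes this default. *)
apply/eqP => iy; move: f0; rewrite -E /Rintegral.
by rewrite [X in fine X](_ : _ = +oo%E)//= ltxx.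
Qed.

Let fg : f 1 0 = g.
Proof. by apply/funext => y; rewrite /f mul0r addr0 mulr1. Qed.

Let fh : f 0 1 = (fun y => g y * q y).
Proof. by apply/funext => y; rewrite /f mul1r add0r. Qed.

Hypothesis q0 : 0 < q 0.

Let I00 : (s0 < (0 : R)%:E < s1)%E. Proof. by rewrite s00. Qed.

Lemma stopped_mean_g (sigma : T -> R) n N : optional_time F sigma -> (forall w, 0 <= sigma w) ->
  [/\ measurable_fun setT (fun w => discounted_value g (stop sigma n N w) w),
     forall w, 0 <= discounted_value g (stop sigma n N w) w &
    (\int[Pr]_w (discounted_value g (stop sigma n N w) w)%:E = (g 0)%:E)%E].
Proof.
move=> os si0; have := @stopped_mean 1 0 sigma n N ler01 (lexx 0) _ os si0.
by rewrite fg; apply; exact: (sh_gt0 sh).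
Qed.

Lemma stopped_mean_h (sigma : T -> R) n N : optional_time F sigma -> (forall w, 0 <= sigma w) ->
  [/\ measurable_fun setT (fun w => discounted_value (fun y => g y * q y) (stop sigma n N w) w),
     forall w, 0 <= discounted_value (fun y => g y * q y) (stop sigma n N w) w &
    (\int[Pr]_w (discounted_value (fun y => g y * q y) (stop sigma n N w) w)%:E =
      (g 0 * q 0)%:E)%E].
Proof.
move=> os si0; have := @stopped_mean 0 1 sigma n N (lexx 0) ler01 _ os si0.
by rewrite fh; apply; rewrite mulr_gt0// (sh_gt0 sh).
Qed.

Definition exit_level n w : R := exit n n w.

Lemma exit_level_le n m w : (n <= m)%N -> exit_level n w <= exit_level m w.
Proof.
move=> nm; apply: exit_time_ge; first by apply: (le_trans (entrance_le _)); rewrite ler_nat.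
move=> s /andP[s0' sE].
have /andP[h1 h2] := bm_before_exit bm (I0 n) (s := s) (w := w) (N := n)
  ltac:(by rewrite s0' ltW).
by rewrite (le_trans (exh_a ex nm) h1) (le_trans h2 (exh_b ex nm)).
Qed.

(** It will show that a finite right end of I where [g] is unbounded is not reached while Gamma is
    finite: the discounted [g] would tend to infinity along the exit levels. *)
Lemma discounted_g_bounded : Pr.-negligible [set w | forall K : R, \forall n \near \oo,
  K <= discounted_value g (exit_level n w) w].
Proof.
have os n : optional_time F (exit n n) by exact: (optional_exit_time uF bm).
have e0 n w : 0 <= exit n n w by exact: entrance_ge0.
have E n w : stop (exit n n) n n w = exit_level n w by rewrite /stop minxx.
apply: (@fatou_finite _ _ _ _ (fun n w => discounted_value g (exit_level n w) w) (g 0)).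
- move=> n; have [+ _ _] := stopped_mean_g n n (os n) (e0 n).
  by rewrite (_ : (fun w => _) = (fun w => discounted_value g (exit_level n w) w))//;
    apply/funext => w; rewrite E.
- by move=> n w; have [_ + _] := stopped_mean_g n n (os n) (e0 n); move=> /(_ w); rewrite E.
- move=> n; have [_ _ <-] := stopped_mean_g n n (os n) (e0 n).
  by under [X in (_ <= X)%E]eq_integral do rewrite E.
Qed.

Lemma normal_peak_small (t : R) : 0 < t -> exists N : nat, forall n, (N < n)%N ->
  normal_peak (Num.sqrt (n%:R : R)) <= t.
Proof.
move=> t0; exists (Num.truncn (t^-1 ^+ 2)) => n Nn.
have n0 : 0 < (n%:R : R) by rewrite ltr0n (leq_ltn_trans _ Nn).
have nt : t^-1 ^+ 2 <= n%:R.
  by apply/ltW/(lt_le_trans (truncnS_gt _)); rewrite ler_nat.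
rewrite /normal_peak sqr_sqrtr; last exact: ltW.
rewrite -[leRHS]invrK lef_pV2 ?posrE ?invr_gt0//; last first.
  by rewrite sqrtr_gt0 -mulr_natr !mulr_gt0// pi_gt0.
have -> : t^-1 = Num.sqrt (t^-1 ^+ 2) by rewrite sqrtr_sqr ger0_norm// invr_ge0 ltW.
rewrite ler_wsqrtr//.
apply: (le_trans nt); rewrite (_ : _ *+ 2 = n%:R * (pi * 2)); last by rewrite mulr2n; ring.
rewrite ler_peMr ?(ltW n0)//.
by have := @pi_ge2 R; lra.
Qed.

Hypothesis growth : forall m : R, exists C : R, forall y : R,
  (s0 < y%:E < s1)%E -> C < `|y| -> m <= g y + g y * q y.

(** While Gamma is at most [k], the martingale of [g + h] is at least [expR (- r * k) * (g + h)].
    Its mean is fixed, whereas at a late time [|B|] is large with probability close to 1, and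
    [g + h] is then large by [growth]. *)
Lemma additive_functional_diverges : Pr.-negligible [set w |
  (forall u, 0 <= u -> (s0 < (B u w)%:E < s1)%E) /\
  exists t : R, forall u, 0 <= u -> (Gam u w <= t%:E)%E].
Proof.
apply: (negligibleS (A := \bigcup_k [set w | (forall u, 0 <= u -> (s0 < (B u w)%:E < s1)%E) /\
   forall u, 0 <= u -> (Gam u w <= k%:R%:E)%E])).
  move=> w [BI [t Gt]]; exists (Num.truncn t).+1 => //; split => // u u0.
  by apply: (le_trans (Gt u u0)); rewrite lee_fin; exact/ltW/truncnS_gt.
apply: negligible_bigcup => k; apply: small_negligible => t t0.
pose psi := g 0 + g 0 * q 0.
have g0 : 0 < g 0 by exact: (sh_gt0 sh).
have psi0 : 0 < psi by rewrite addr_gt0// mulr_gt0.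
(* With this [m], Markov's inequality for the martingale of mean [psi] yields the probability
   [t / 2]. The other half of [t] bounds the probability that B is still in [[- C, C]] at the late
   time [n]. *)
pose m := psi * expR (r * k%:R) / (t / 2).
have t20 : 0 < t / 2 by rewrite divr_gt0.
have m0 : 0 < m by rewrite divr_gt0// mulr_gt0// expR_gt0.
have [C' growC] := growth m.
pose C := Num.max C' 1.
have C0 : 0 < C by rewrite lt_max ltr01 orbT.
have [n1 peakn1] := normal_peak_small (divr_gt0 t20 (mulr_gt0 (@ltr0n R 2) C0)).
pose n := n1.+1; have n0 : (0 < n)%N by [].
have peakn := peakn1 n (ltnSn n1).
have nr0 : 0 < (n%:R : R) by rewrite ltr0n.
pose D j := @stay R d T B a b j n%:R `&` ~` [set w | (k%:R%:E < Gam n%:R w)%E] `&`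
  ~` [set w | - C <= B n%:R w <= C].
have mball : measurable [set w | - C <= B n%:R w <= C].
  have := measurable_bm uF bm (ltW nr0); move=> /(_ measurableT `[- C, C]%classic (measurable_itv _)).
  by rewrite setTI; congr (measurable _); apply/seteqP; split => w; rewrite /= in_itv.
have mstay j : measurable (@stay R d T B a b j n%:R).
  apply: (filtration_measurable uF (ltW nr0)).
  exact: (filtration_stay uF bm (a j) (b j) (ltW nr0)).
have mD j : measurable (D j).
  apply: measurableI; last exact: measurableC.
  apply: measurableI => //; apply: measurableC.
  exact: (measurable_additive_functional uF bm rL r0 sh s00 s10 nu_out ex).
have PD j : (Pr (D j) <= (t / 2)%:E)%E.
  have f11 : 0 < f 1 1 0 by rewrite /f mulr_gt0// addr_gt0// mul1r.
  have os := optional_exit_time uF bm (a j) (b j) n.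
  have [mM M0 EM] := @stopped_mean 1 1 (exit j n) j n ler01 ler01 f11 os (fun w => entrance_ge0 w).
  have c0 : 0 < m * expR (- (r * k%:R)) by rewrite mulr_gt0// expR_gt0.
  have -> : t / 2 = f 1 1 0 / (m * expR (- (r * k%:R))).
    rewrite /m /f expRN; have := expR_gt0 (r * k%:R); move: (expR _) => E E0.
    by rewrite -/psi; rewrite (_ : g 0 * (1 + 1 * q 0) = psi); [field; rewrite !gt_eqF|rewrite /psi; ring].
  rewrite EFinM lee_pdivlMr// muleC -integral_cst// -EM.
  apply: (@le_trans _ _ (\int[Pr]_(w in D j)
      (discounted_value (f 1 1) (stop (exit j n) j n w) w)%:E)%E).
    apply: ge0_le_integral => //.
    - by move=> w _; rewrite lee_fin ltW.
    - by apply: measurable_funTS; exact/measurable_EFinP.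
    - move=> w [[st Gk] Bn]; rewrite lee_fin.
      have E : stop (exit j n) j n w = n%:R.
        rewrite /stop minxx; apply/eqP; rewrite eq_le entrance_le/=.
        by apply: exit_time_ge => // s /andP[s0' sn]; apply: st; rewrite s0' ltW.
      rewrite E /discounted_value mulrC ler_pM//; first by exact: ltW.
        rewrite ler_expR lerN2 ler_pM2l// -lee_fin.
        have nn : 0 <= (n%:R : R) <= n%:R by rewrite lexx ltW.
        rewrite -(stay_fin rL r0 sh ex st nn).
        by rewrite leNgt; apply/negP.
      rewrite (_ : f 1 1 _ = g (B n%:R w) + g (B n%:R w) * q (B n%:R w)); last by rewrite /f; ring.
      apply: growC; first by apply: (in_exhaustion (n := j)); apply: st; rewrite lexx ltW.
      apply: (@le_lt_trans _ _ C); first by rewrite le_max lexx.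
      by rewrite ltNge; apply/negP; rewrite ler_norml.
  apply: ge0_subset_integral => //; first exact/measurable_EFinP.
  by move=> w _; rewrite lee_fin.
have mU : measurable (\bigcup_j D j) by exact: bigcupT_measurable.
exists ([set w | - C <= B n%:R w <= C] `|` \bigcup_j D j).
  move=> w [BI Gk]; have [Bn|Bn] := pselect (- C <= B n%:R w <= C); [by left|right].
  have [j Hj] := stay_exists bm ex (ltW nr0) (w := w) (fun s sI => andP (BI s (andP sI).1)).
  exists j => //; split => //; split; first exact: Hj.
  by apply/negP; rewrite -leNgt; apply: Gk; exact: ltW.
split; first exact: measurableU.
apply: (le_trans (measureU2 _ mball mU)).
rewrite [X in (_ <= X%:E)%E](splitr t) EFinD; apply: leeD.
  apply: (le_trans (bm_small_ball bm nr0 (ltW C0))); rewrite lee_fin.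
  by rewrite -ler_pdivlMr ?mulr_gt0.
have cU : Pr (D j) @[j --> \oo] --> Pr (\bigcup_j D j).
  apply: nondecreasing_cvg_mu => // i j ij; apply/subsetPset => w [[st h1] h2].
  split => //; split => // s /st/andP[h3 h4].
  by rewrite (le_trans (exh_a ex ij) h3) (le_trans h4 (exh_b ex ij)).
exact: (cvg_le_bound cU PD).
Qed.

End stopped_means.

(** * Price paths *)

Section real_limits.
Context {R : realType}.

Lemma cvg_le_real (u : nat -> R) (l c : R) :
  u n @[n --> \oo] --> l -> (forall n, u n <= c) -> l <= c.
Proof.
move=> ul uc; rewrite -(cvg_lim _ ul)//; apply: limr_le; last exact: nearW.
by apply/cvg_ex; exists l.
Qed.

Lemma cvg_ge_real (u : nat -> R) (l c : R) :
  u n @[n --> \oo] --> l -> (forall n, c <= u n) -> c <= l.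
Proof.
move=> ul uc; rewrite -(cvg_lim _ ul)//; apply: limr_ge; last exact: nearW.
by apply/cvg_ex; exists l.
Qed.

End real_limits.

Section price_paths.
Context {R : realType} {d : measure_display} {T : measurableType d}.
Context {Pr : probability T R} {F : R -> set (set T)} {B : R -> T -> R}.
Context {L : R -> R -> T -> R}.
Hypotheses (uF : usual_filtration Pr F) (bm : regular_bm Pr F B).
Hypothesis rL : regular_local_time B L.
Context {r : R} {s0 s1 : \bar R} {g q : R -> R} {nu : {measure set R -> \bar R}}.
Hypotheses (r0 : 0 < r) (sh : speed_harmonic r s0 s1 g q nu).
Hypotheses (s00 : (s0 < 0)%E) (s10 : (0 < s1)%E).
Hypothesis nu_out : forall y : R, (y%:E <= s0 \/ s1 <= y%:E)%E -> nu [set y] = +oo%E.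
Context {a b : nat -> R}.
Hypothesis ex : exhaustion s0 s1 a b.
Hypothesis q_ge0 : forall y : R, (s0 < y%:E < s1)%E -> 0 <= q y.
Hypothesis q0 : 0 < q 0.
Hypothesis growth : forall m : R, exists C : R, forall y : R,
  (s0 < y%:E < s1)%E -> C < `|y| -> m <= g y + g y * q y.
Context {gbar : \bar R}.
Hypothesis gbar_ub : forall y : R, (s0 < y%:E < s1)%E -> ((g y)%:E <= gbar)%E.
Hypothesis g_left : forall m t : R, s0 = m%:E -> 0 < t ->
  exists2 e : R, 0 < e & forall y, m < y < m + e -> g y < t.
Hypothesis g_right : forall m K : R, s1 = m%:E -> (K%:E < gbar)%E ->
  exists2 e : R, 0 < e & forall y, m - e < y < m -> K < g y.
Notation Gam := (additive_functional nu L).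
Notation disc := (discounted_value (B := B) (L := L) (r := r) (nu := nu)).
Notation level := (exit_level (B := B) (a := a) (b := b)).
Notation I y := (s0 < y%:E < s1)%E.
Implicit Types (u v t : R) (w : T).

Let cB w : continuous (B^~ w). Proof. exact: (rbm_continuous bm). Qed.

(** All that the comparison needs of a path: Gamma explodes right after an exit, it grows without
    bound if there is no exit, and the discounted [g] does not tend to infinity along the exit
    levels. *)
Definition good_path w : Prop := [/\
  forall u u', 0 <= u -> u < u' -> ~~ I (B u w) -> Gam u' w = +oo%E,
  (forall u, 0 <= u -> I (B u w)) -> forall t, exists2 u, 0 <= u & (t%:E < Gam u w)%E &
  exists K : R, forall N, exists2 n, (N <= n)%N & disc g (level n w) w < K ].

Lemma almost_every_path_good : Pr.-negligible [set w | ~ good_path w].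
Proof.
have N1 := explosion_at_exit uF bm rL s00 s10 nu_out.
have N2 := additive_functional_diverges uF bm rL r0 sh s00 s10 nu_out ex q_ge0 q0 growth.
have N3 := discounted_g_bounded uF bm rL r0 sh s00 s10 ex q_ge0.
apply: (negligibleS _ (negligibleU N1 (negligibleU N2 N3))) => w /= ng.
apply: contrapT => /not_orP[n1 /not_orP[n2 n3]]; apply: ng; split.
- move=> u u' u0 uu' /negP Bu; apply: contrapT => G; apply: n1.
  by exists u, u'; split => // -[h1 h2]; apply: Bu; rewrite h1 h2.
- move=> BI t; apply: contrapT => H; apply: n2; split => //; exists t => u u0.
  by rewrite leNgt; apply/negP => tG; apply: H; exists u.
- apply: contrapT => H; apply: n3 => K; apply: contrapT => nK; apply: H; exists K => N.
  apply: contrapT => HN; apply: nK; exists N => // n /= Nn.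
  by rewrite leNgt; apply/negP => dK; apply: HN; exists n.
Qed.

Lemma ereal_inf_gtr (S : set R) (z : R) : (forall u, S u -> z <= u) ->
  (forall u, z < u -> S u) -> ereal_inf [set u%:E | u in S] = z%:E.
Proof.
move=> lbz Sz; apply/eqP; rewrite eq_le; apply/andP; split.
  apply/lee_addgt0Pr => t t0; rewrite -EFinD.
  by apply: ereal_inf_lbound; exists (z + t) => //; apply: Sz; rewrite ltrDl.
by apply: le_ereal_inf_tmp => _ [u Su <-]; rewrite lee_fin lbz.
Qed.

Section one_path.
Context {w : T} {t : R}.
Hypotheses (good : good_path w) (t0 : 0 < t).

Lemma open_state_interval : open [set y : R | I y].
Proof.
rewrite (_ : [set y : R | I y] = [set y : R | (s0 < y%:E)%E] `&` [set y : R | (y%:E < s1)%E]).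
  apply: openI.
  - case: s0 => [m| |].
    + rewrite (_ : [set _ | _] = [set y | m < y]); first exact: open_gt.
      by apply/seteqP; split => y; rewrite /= lte_fin.
    + by rewrite (_ : [set _ | _] = set0); [exact: open0|apply/seteqP; split].
    + rewrite (_ : [set _ | _] = setT); first exact: openT.
      by apply/seteqP; split => // y _ /=; rewrite ltNyr.
  - case: s1 => [m| |].
    + rewrite (_ : [set _ | _] = [set y | y < m]); first exact: open_lt.
      by apply/seteqP; split => y; rewrite /= lte_fin.
    + rewrite (_ : [set _ | _] = setT); first exact: openT.
      by apply/seteqP; split => // y _ /=; rewrite ltry.
    + by rewrite (_ : [set _ | _] = set0); [exact: open0|apply/seteqP; split].
by apply/seteqP; split => y /=; [move=> /andP[]|move=> [-> ->]].
Qed.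

Let level_ge v : 0 <= v -> (forall s, 0 <= s <= v -> I (B s w)) ->
  \forall n \near \oo, v <= level n w.
Proof.
move=> v0 BI.
have [n Hn] := stay_exists bm ex v0 (w := w) (fun s sI => andP (BI s sI)).
exists (maxn n (Num.truncn v).+1) => // m /=; rewrite geq_max => /andP[nm vm].
apply: exit_time_ge.
  by apply: ltW; apply: (lt_le_trans (truncnS_gt _)); rewrite ler_nat.
by move=> s /andP[s0' sv]; apply: (Hn m nm); rewrite s0' ltW.
Qed.

Let Gfin u v : 0 <= u -> u <= v -> (forall s, 0 <= s <= v -> I (B s w)) ->
  Gam u w = (fine (Gam u w))%:E.
Proof.
move=> u0 uv BI; have v0 := le_trans u0 uv.
have [n Hn] := stay_exists bm ex v0 (w := w) (fun s sI => andP (BI s sI)).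
apply: (stay_fin rL r0 sh ex (Hn n (leqnn _))).
by rewrite u0.
Qed.

(** The infimum of the times at which Gamma exceeds [t] need not be one of them; left continuity
    gives [Gam al w <= t] there, the direction needed to compare the discount at [t] with the one at
    Gamma. *)
Lemma time_change_inside u : 0 <= u -> (forall s, 0 <= s <= u -> I (B s w)) ->
  (t%:E < Gam u w)%E ->
  exists al : R, [/\ 0 <= al, time_change nu L t w = al%:E,
    (Gam al w <= t%:E)%E /\ Gam al w = (fine (Gam al w))%:E,
    (\forall n \near \oo, al <= level n w) &
    I (B al w) /\ (t%:E < additive_functional_at_explosion nu L w)%E].
Proof.
move=> u0 BI tG.
pose S := [set v | 0 <= v /\ (t%:E < Gam v w)%E].
have Su : S u by [].
have hS : has_inf S by split; [exists u|exists 0 => v []].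
exists (inf S).
have al0 : 0 <= inf S by apply: lb_le_inf; [exists u|move=> v []].
have alu : inf S <= u by apply: ge_inf => //; have [] := hS.
have below v : 0 <= v < inf S -> (Gam v w <= t%:E)%E.
  move=> /andP[v0 vi]; rewrite leNgt; apply/negP => tv.
  by move: vi; rewrite ltNge ge_inf//; have [] := hS.
split => //.
- by rewrite /time_change ereal_inf_EFin//; have [] := hS.
- split; last exact: (Gfin al0 alu BI).
  by apply: (additive_functional_left rL cB al0) => //; rewrite lee_fin ltW.
- apply: level_ge => // s /andP[s0' sa]; apply: BI; rewrite s0'.
  exact: le_trans alu.
- split; first by apply: BI; rewrite al0.
rewrite /additive_functional_at_explosion.
have expl : (u%:E <= explosion_time nu L w)%E.
  apply: le_ereal_inf_tmp => _ [v [v0 Gv] <-]; rewrite lee_fin leNgt; apply/negP => vu.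
  by have := Gfin v0 (ltW vu) BI; rewrite Gv.
case: explosion_time expl => [e| |]//.
  by rewrite lee_fin => ue; apply: (lt_le_trans tG); exact: (additive_functional_le rL cB).
move=> _; pose G' v := Gam (Num.max v u) w.
have nd : nondecreasing_fun G'.
  move=> x y xy; apply: (additive_functional_le rL cB).
    by rewrite le_max u0 orbT.
  by rewrite ge_max !le_max xy lexx/= orbT.
have cv : Gam v w @[v --> +oo] --> ereal_sup (range G').
  apply: cvg_trans (nondecreasing_cvge nd); apply: near_eq_cvg.
  near=> v; rewrite /G' (_ : Num.max v u = v)//.
  by apply/max_idPl; near: v; apply: nbhs_pinfty_ge; exact: num_real.
rewrite (cvg_lim _ cv)//; apply: (lt_le_trans tG); apply: ereal_sup_ubound.
by exists u => //; rewrite /G' maxxx.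
Unshelve. all: by end_near. Qed.

(** Here [z] is the exit time of B. Gamma is at most [t] up to [z] by left continuity and infinite
    right after it, so the time change at [t] and the explosion time both equal [z]. *)
Lemma time_change_exit : (forall u, 0 <= u -> (forall s, 0 <= s <= u -> I (B s w)) ->
    (Gam u w <= t%:E)%E) ->
  exists z : R, [/\ 0 <= z, time_change nu L t w = z%:E, explosion_time nu L w = z%:E,
    (Gam z w <= t%:E)%E /\ Gam z w = (fine (Gam z w))%:E & ~~ I (B z w) /\
    (forall n, level n w <= z) /\ level n w @[n --> \oo] --> z].
Proof.
move=> H; have [g1 g2 _] := good.
have [u0 u00 Bu0] : exists2 u, 0 <= u & ~~ I (B u w).
  apply: contrapT => N; have BI u : 0 <= u -> I (B u w).
    by move=> u0; apply/negPn/negP => Bu; apply: N; exists u.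
  have [u u0 tG] := g2 BI t.
  by move: tG; rewrite ltNge H// => s /andP[s0' _]; exact: BI.
pose S := [set v | 0 <= v /\ ~~ I (B v w)].
have Su : S u0 by [].
have hS : has_inf S by split; [exists u0|exists 0 => v []].
set z := inf S.
have z0 : 0 <= z by apply: lb_le_inf; [exists u0|move=> v []].
have below s : 0 <= s < z -> I (B s w).
  move=> /andP[s0' sz]; apply/negPn/negP => Bs.
  by move: sz; rewrite ltNge ge_inf//; have [] := hS.
have Bz : ~~ I (B z w).
  apply/negP => IB.
  have nO : nbhs (B z w) [set y : R | I y] by apply: open_nbhs_nbhs; split => //; exact: open_state_interval.
  have : \forall x \near z, I (B x w) by exact: (cB nO).
  move=> /nbhs_ballP[e /= e0 He].
  have [v [v0 Bv] vz] := inf_lt hS.1 (ltr_pwDr e0 (lexx z)).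
  move/negP: Bv; apply; have [vz'|zv] := ltP v z; first by apply: below; rewrite v0.
  by apply: He; rewrite /ball/= ltr_distlC; apply/andP; split => //; rewrite /z in zv vz *; lra.
have Gz : (Gam z w <= t%:E)%E.
  apply: (additive_functional_left rL cB z0); first by rewrite lee_fin ltW.
  move=> v /andP[v0 vz]; apply: H => // s /andP[s0' sv].
  by apply: below; rewrite s0' (le_lt_trans sv).
have Gz0 : (0 <= Gam z w)%E := additive_functional_ge0 (nu := nu) rL w z0.
have Gafter u : z < u -> Gam u w = +oo%E by move=> zu; exact: (g1 z u z0 zu Bz).
have before u : 0 <= u -> (t%:E < Gam u w)%E -> z <= u.
  move=> u_ge0 tu; rewrite leNgt; apply/negP => uz.
  have := additive_functional_le (nu := nu) rL cB w u_ge0 (ltW uz).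
  by rewrite leNgt (le_lt_trans Gz).
exists z; split => //.
- apply: ereal_inf_gtr => [u [u_ge0 tu]|u zu]; first exact: before.
  by split; [apply: (le_trans z0); exact: ltW|rewrite Gafter// ltry].
- apply: ereal_inf_gtr => [u [u_ge0 Gu]|u zu]; first by apply: before; rewrite // Gu ltry.
  by split; [apply: (le_trans z0); exact: ltW|exact: Gafter].
- split => //; rewrite fineK// fin_numE; apply/andP; split.
    by apply: contraTN Gz0 => /eqP ->.
  by apply: contraTN Gz => /eqP ->.
have lz n : level n w <= z.
  apply: entrance_lb => //=; move/negP: Bz => Bz.
  apply: contrapT => /not_orP[/negP + /negP]; rewrite -!leNgt => h1 h2; apply: Bz.
  by apply: (in_exhaustion ex (n := n)); rewrite h1 h2.
split => //; split => //.
apply/cvgrPdist_le => e e0.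
have [ze|ez] := leP z e.
  apply: nearW => n; rewrite ger0_norm ?subr_ge0//.
  have l0 : 0 <= level n w by exact: entrance_ge0.
  by lra.
have : \forall n \near \oo, z - e <= level n w.
  apply: level_ge; first by rewrite subr_ge0 ltW.
  by move=> s /andP[s0' se]; apply: below; rewrite s0' (le_lt_trans se)// gtrBl.
by apply: filterS => n h; rewrite ger0_norm ?subr_ge0//; lra.
Qed.

Definition capped (sigma : T -> \bar R) (n : nat) (w : T) : R :=
  fine (mine (sigma w) n%:R%:E).

Lemma capped_fin sigma n w' (x : R) : sigma w' = x%:E -> capped sigma n w' = Num.min x n%:R.
Proof. by rewrite /capped => ->; rewrite -EFin_min. Qed.

Context {x0 : R}.

(* [stock] for abstract g, s0 and gbar. *)
Definition stock_path (t : R) (w : T) : R :=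
  let G := additive_functional_at_explosion nu L w in
  if t <= 0 then x0
  else if (t%:E < G)%E then g (time_changed_bm nu L B t w)
  else if (B (fine (explosion_time nu L w)) w)%:E == s0 then 0
  else expR (r * (t - fine G)) * fine gbar.

Let stopped (sigma : T -> \bar R) n w := Num.min (capped sigma n w) (level n w).

Let exprt_le (x y : R) : x <= y -> expR (- (r * y)) <= expR (- (r * x)).
Proof. by move=> xy; rewrite ler_expR lerN2 ler_pM2l. Qed.

(** Moving from the clock of the price to that of B can only increase the discounted value, since
    Gamma is at most [t]. The slack [e] serves paths that have left I, where the functions at the
    exit are replaced by their values along the exit levels. The first bound controls the price in
    the lower estimate, the second the payoff in the upper one. *)
Lemma price_path_bounds (sigma : T -> \bar R) (K PK : R) : sigma w = time_change nu L t w ->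
  0 <= K -> 0 <= PK -> (forall y, I y -> K - g y <= PK * (g y * q y)) ->
  (forall e, 0 < e -> \forall n \near \oo,
    expR (- (r * t)) * stock_path t w <= disc g (stopped sigma n w) w + e) /\
  (forall e, 0 < e -> \forall n \near \oo,
    expR (- (r * t)) * Num.max (K - stock_path t w) 0 <=
      PK * disc (fun y => g y * q y) (stopped sigma n w) w + e).
Proof.
move=> sE K0 PK0 Kh.
have h0 y : I y -> 0 <= g y * q y.
  by move=> yI; rewrite mulr_ge0 ?q_ge0// ltW// (sh_gt0 sh).
have t00 : (t <= 0) = false by apply/negbTE; rewrite -ltNge.
have maxh y : I y -> Num.max (K - g y) 0 <= PK * (g y * q y).
  by move=> yI; rewrite ge_max Kh//= mulr_ge0// h0.
(* Either Gamma passes [t] while B is still inside, and the stopped clock eventually equals the time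
   change; or B leaves first, and the stopped clock follows the exit levels up to the exit. *)
have [[u u0 [BI tG]]|N] := pselect (exists2 u, 0 <= u &
    (forall s, 0 <= s <= u -> I (B s w)) /\ (t%:E < Gam u w)%E).
  have [al [al0 aE [Ga Gf] lev [BaI tGx]]] := time_change_inside u0 BI tG.
  have XE : stock_path t w = g (B al w).
    by rewrite /stock_path t00 tGx /time_changed_bm t00 aE.
  have st : \forall n \near \oo, stopped sigma n w = al.
    apply: filterS2 lev (nbhs_infty_ger al) => n h1 h2.
    rewrite /stopped (capped_fin n (etrans sE aE)).
    by rewrite (_ : Num.min al n%:R = al); [apply/min_idPl|apply/min_idPl].
  have el : expR (- (r * t)) <= expR (- (r * fine (Gam al w))).
    by apply: exprt_le; rewrite -lee_fin -Gf.
  rewrite XE; split => e e0; apply: filterS st => n ->; rewrite /discounted_value.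
    rewrite ler_wpDr ?(ltW e0)// ler_wpM2r//.
    by apply/ltW/(sh_gt0 sh).
  rewrite ler_wpDr ?(ltW e0)// mulrCA ler_pM ?expR_ge0 ?maxh//.
  by rewrite le_max lexx orbT.
have [|z [z0 zE xE [Gz Gf] [nB [lz lcv]]]] := time_change_exit.
  move=> u u0 BI; rewrite leNgt; apply/negP => tG; apply: N; exists u => //.
have GE : additive_functional_at_explosion nu L w = Gam z w.
  by rewrite /additive_functional_at_explosion xE.
have st n : stopped sigma n w = level n w.
  rewrite /stopped (capped_fin n (etrans sE zE)); apply/min_idPr.
  by rewrite le_min lz entrance_le.
have lI n : I (B (level n w) w).
  have l0 : 0 <= level n w by exact: entrance_ge0.
  have an : a n <= 0 <= b n by rewrite !ltW ?(exh_a0 ex) ?(exh_b0 ex).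
  apply: (in_exhaustion ex (n := n)); apply: (bm_before_exit bm an (N := n)).
  by rewrite l0/=.
have Gl n : fine (Gam (level n w) w) <= fine (Gam z w).
  have l0 : 0 <= level n w by exact: entrance_ge0.
  have GG := additive_functional_le (nu := nu) rL cB w l0 (lz n).
  apply: fine_le => //; last by rewrite Gf.
  rewrite fin_numE; apply/andP; split.
    by have := additive_functional_ge0 (nu := nu) rL w l0; apply: contraTN => /eqP ->.
  by move: GG; rewrite Gf; apply: contraTN => /eqP ->.
have Gzt : fine (Gam z w) <= t by rewrite -lee_fin -Gf.
have lBcv : B (level n w) w @[n --> \oo] --> B z w.
  by apply: (continuous_cvg_seq (f := B^~ w)) => //; exact: cB.
have tX : (t%:E < Gam z w)%E = false by apply/negbTE; rewrite -leNgt.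
have el n : expR (- (r * t)) <= expR (- (r * fine (Gam (level n w) w))).
  by apply: exprt_le; exact: le_trans (Gl n) _.
(* Absorption at 0: the payoff is [K], and [Kh] bounds it by [PK * h + g], where [g] tends to 0
   along the exit levels. *)
have [Bs0|Bs0] := eqVneq (B z w)%:E s0.
  have XE : stock_path t w = 0.
    by rewrite /stock_path t00 GE tX xE/= Bs0 eqxx.
  rewrite XE mulr0 subr0 (_ : Num.max K 0 = K); last exact/max_idPl.
  split => e e0.
    apply: nearW => n; rewrite st addr_ge0 ?(ltW e0)// mulr_ge0 ?expR_ge0//.
    by apply/ltW/(sh_gt0 sh).
  have [x xpos gx] := g_left (esym Bs0) e0.
  have : \forall n \near \oo, B (level n w) w < B z w + x.
    by move/cvgr_lt : lBcv; apply; rewrite ltrDl.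
  apply: filterS => n Bx; rewrite st.
  have gn : g (B (level n w) w) < e.
    by apply: gx; rewrite Bx andbT -lte_fin Bs0; have /andP[] := lI n.
  have Kn := Kh _ (lI n).
  have e1 : expR (- (r * fine (Gam (level n w) w))) <= 1.
    rewrite -[leRHS]expR0 ler_expR oppr_le0 mulr_ge0 ?(ltW r0)//.
    by apply: fine_ge0; apply: (additive_functional_ge0 (nu := nu) rL w); exact: entrance_ge0.
  rewrite /discounted_value mulrCA.
  apply: (@le_trans _ _ (expR (- (r * fine (Gam (level n w) w))) *
      (PK * (g (B (level n w) w) * q (B (level n w) w)) + g (B (level n w) w)))).
    by apply: ler_pM; rewrite ?expR_ge0//; move: Kn; lra.
  rewrite mulrDr lerD2l; apply: (le_trans _ (ltW gn)); rewrite -[leRHS]mul1r.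
  by rewrite ler_wpM2r// ltW// (sh_gt0 sh).
have [m s1m Bm] : exists2 m, s1 = m%:E & B z w = m.
  have nIl n : (s0 < (B (level n w) w)%:E)%E by have /andP[] := lI n.
  have nIr n : ((B (level n w) w)%:E < s1)%E by have /andP[] := lI n.
  have s0B : (s0 < (B z w)%:E)%E.
    move: nIl Bs0; case: s0 => [m| |] nIl Bm; last by rewrite ltNyr.
      rewrite lte_fin lt_neqAle eq_sym; apply/andP; split; first by apply: contraNN Bm => /eqP ->.
      by apply: (cvg_ge_real lBcv) => n; rewrite ltW// -lte_fin.
    by have := nIl 0%N.
  move: nB nIr; rewrite s0B/= -leNgt; case: s1 => [m| |] sB nIr.
  - exists m => //; apply/eqP; rewrite eq_le -[in X in _ && X]lee_fin sB andbT.
    by apply: (cvg_le_real lBcv) => n; rewrite ltW// -lte_fin.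
  - by [].
  - by have := nIr 0%N.
(* If [gbar] were infinite, [g] would tend to infinity along the exit levels while Gamma stays below
   [t], against the third property of a good path. *)
have [c gc] : exists c, gbar = c%:E.
  have := gbar_ub (lI 0%N); case gE : gbar => [c| |]// _; first by exists c.
  have [_ _ [K1 HK]] := good.
  have [x xpos gx] := g_right (K := K1 * expR (r * t)) s1m ltac:(by rewrite gE ltry).
  have : \forall n \near \oo, m - x < B (level n w) w.
    by move/cvgr_gt : lBcv; apply; rewrite Bm gtrBl.
  move=> [N' _ HN']; have [n nN] := HK N'; rewrite ltNge => /negP[].
  have gn : K1 * expR (r * t) < g (B (level n w) w).
    by apply: gx; rewrite HN'//= -lte_fin -s1m; have /andP[] := lI n.
  rewrite /discounted_value; apply: (@le_trans _ _ (expR (- (r * t)) * g (B (level n w) w))).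
    by rewrite expRN mulrC ler_pdivlMr ?expR_gt0// ltW.
  by rewrite ler_wpM2r ?el//; apply/ltW/(sh_gt0 sh).
(* Growth at rate [r] after the explosion offsets the discounting from Gamma at the exit to [t]. *)
have XE : expR (- (r * t)) * stock_path t w = expR (- (r * fine (Gam z w))) * c.
  rewrite /stock_path t00 GE tX xE/= (negbTE Bs0) gc/= mulrA -expRD.
  by congr (expR _ * _); ring.
have Xc : c <= stock_path t w.
  rewrite /stock_path t00 GE tX xE/= (negbTE Bs0) gc/=.
  rewrite ler_peMl//.
    by rewrite -lee_fin -gc; apply: le_trans (gbar_ub (lI 0%N)); rewrite lee_fin ltW// (sh_gt0 sh).
  by rewrite -expR0 ler_expR mulr_ge0 ?(ltW r0)// subr_ge0.
split => e e0.
  rewrite XE.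
  have [x xpos gx] := g_right (K := c - e) s1m ltac:(by rewrite gc lte_fin gtrBl).
  have : \forall n \near \oo, m - x < B (level n w) w.
    by move/cvgr_gt : lBcv; apply; rewrite Bm gtrBl.
  apply: filterS => n Bx; rewrite st.
  have gn : c - e < g (B (level n w) w).
    by apply: gx; rewrite Bx/= -lte_fin -s1m; have /andP[] := lI n.
  have e1 : expR (- (r * fine (Gam z w))) <= 1.
    rewrite -[leRHS]expR0 ler_expR oppr_le0 mulr_ge0 ?(ltW r0)//.
    by apply: fine_ge0; exact: (additive_functional_ge0 (nu := nu) rL w z0).
  rewrite /discounted_value.
  apply: (@le_trans _ _ (expR (- (r * fine (Gam z w))) * g (B (level n w) w) + e)).
    have E0 := expR_ge0 (- (r * fine (Gam z w))).
    by move: (expR _) e1 E0 gn => E ? ? ?; nra.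
  rewrite lerD2r ler_wpM2r ?exprt_le//.
  by apply/ltW/(sh_gt0 sh).
apply: nearW => n; rewrite st ler_wpDr ?(ltW e0)// mulrCA ler_pM ?expR_ge0//.
  by rewrite le_max lexx orbT.
apply: le_trans (maxh _ (lI n)).
rewrite ge_max !le_max lexx orbT andbT lerD2l lerN2 (le_trans _ Xc) ?orbT//.
by rewrite -lee_fin -gc gbar_ub.
Qed.

End one_path.

End price_paths.

(** * The put price from above *)

Section upper_bound.
Context {R : realType} {d : measure_display} {T : measurableType d}.
Context {Pr : probability T R} {F : R -> set (set T)} {B : R -> T -> R}.
Context {L : R -> R -> T -> R}.
Hypotheses (uF : usual_filtration Pr F) (bm : regular_bm Pr F B).
Hypothesis rL : regular_local_time B L.
Context {r : R} {s0 s1 : \bar R} {g q : R -> R} {nu : {measure set R -> \bar R}}.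
Hypotheses (r0 : 0 < r) (sh : speed_harmonic r s0 s1 g q nu).
Hypotheses (s00 : (s0 < 0)%E) (s10 : (0 < s1)%E).
Hypothesis nu_out : forall y : R, (y%:E <= s0 \/ s1 <= y%:E)%E -> nu [set y] = +oo%E.
Context {a b : nat -> R}.
Hypothesis ex : exhaustion s0 s1 a b.
Notation Gam := (additive_functional nu L).
Notation A := (time_change nu L).
Notation FZ := (time_changed_filtration nu L F).
Implicit Types (u v t : R) (w : T).

Let cB w : continuous (B^~ w). Proof. exact: (rbm_continuous bm). Qed.

Let FG v t : 0 <= v -> F v [set w | (t%:E < Gam v w)%E].
Proof. exact: (filtration_additive_functional uF bm rL r0 sh s00 s10 nu_out ex). Qed.

Lemma time_change_ge0 t w : (0 <= A t w)%E.
Proof. by apply: le_ereal_inf_tmp => _ [u [u0 _] <-]; rewrite lee_fin. Qed.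

Lemma time_change_le t w u : 0 <= u -> (t%:E < Gam u w)%E -> (A t w <= u%:E)%E.
Proof. by move=> u0 tG; apply: ereal_inf_lbound; exists u. Qed.

Lemma time_change_lt t w u : (A t w < u%:E)%E ->
  exists x : rat, 0 <= (ratr x : R) < u /\ (t%:E < Gam (ratr x) w)%E.
Proof.
move=> /ereal_inf_lt[_ [v [v0 tG] <-]]; rewrite lte_fin => vu.
have [x] := rat_in_itvoo vu; rewrite in_itv/= => /andP[vx xu].
exists x; rewrite xu (le_trans v0 (ltW vx)); split => //.
by apply: (lt_le_trans tG); apply: (additive_functional_le rL cB) => //; exact: ltW.
Qed.

Lemma optional_time_change t u : 0 < u -> F u [set w | (A t w < u%:E)%E].
Proof.
move=> u0.
rewrite (_ : [set w | _] = \bigcup_(x in [set x : rat | 0 <= (ratr x : R) < u])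
  [set w | (t%:E < Gam (ratr x) w)%E]).
  apply: (filtration_bigcup_rat uF) => [|x /= /andP[x0 xu]]; first exact: ltW.
  by apply: (filtration_le uF x0) (FG _ x0); exact: ltW.
apply/seteqP; split => w /=.
  by move=> /time_change_lt[x [xI tG]]; exists x.
move=> [x /= /andP[x0 xu] tG]; apply: (le_lt_trans (time_change_le x0 tG)).
by rewrite lte_fin.
Qed.

Lemma stopping_time_change t u : 0 <= u -> F u [set w | (A t w <= u%:E)%E].
Proof. by move=> u0; apply: (optional_le uF u0) => v v0; exact: optional_time_change. Qed.

Lemma optional_capped (sigma : T -> \bar R) n : (forall w, (0 <= sigma w)%E) ->
  (forall u, 0 < u -> F u [set w | (sigma w < u%:E)%E]) ->
  optional_time F (capped sigma n) /\ forall w, 0 <= capped sigma n w.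
Proof.
move=> si0 os.
have cE w : (capped sigma n w)%:E = mine (sigma w) n%:R%:E.
  rewrite /capped; have := si0 w; case: (sigma w) => [x| |]//.
  by rewrite -EFin_min.
split => [u u0|w].
  rewrite (_ : [set w | _] = [set w : T | n%:R < u] `|` [set w | (sigma w < u%:E)%E]).
    apply: (filtrationU uF (ltW u0)); last exact: os.
    have [nu'|nu'] := boolP (n%:R < u).
      rewrite (_ : [set w | _] = setT); last by apply/seteqP; split.
      exact: (filtration_setT uF (ltW u0)).
    rewrite (_ : [set w | _] = set0); last by apply/seteqP; split.
    exact: (filtration0 uF (ltW u0)).
  apply/seteqP; split => w /=.
    by rewrite -lte_fin cE gt_min lte_fin => /orP[|]; [right|left].
  by move=> [h|h]; rewrite -lte_fin cE gt_min lte_fin ?h ?orbT.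
by rewrite -lee_fin cE le_min si0 lee_fin/=.
Qed.

(* The time of the Brownian motion at which the option is exercised. *)
Definition exercise_clock (tau : T -> \bar R) (w : T) : \bar R :=
  if tau w is t%:E then (if t <= 0 then 0%E else A t w) else +oo%E.

Lemma exercise_clock_ge0 tau w : (0 <= exercise_clock tau w)%E.
Proof.
rewrite /exercise_clock; case: (tau w) => [t| |]//.
by case: ifP => // _; exact: time_change_ge0.
Qed.

(** For a positive [tau], the clock is below [u] when rationals [p] and [x < u] satisfy
    [tau <= p < Gamma_x]. Then the time change at [p] is at most [x], so the definition of the
    stopped sigma-algebra at [p] makes the event known at time [x]. *)
Lemma optional_exercise_clock tau : stopping_time FZ tau ->
  forall u, 0 < u -> F u [set w | (exercise_clock tau w < u%:E)%E].
Proof.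
move=> [tau0 Ftau] u u0.
have F0 : F u [set w | (tau w <= 0%:E)%E].
  apply: (filtration_le uF (lexx 0) (ltW u0)).
  by have := Ftau 0 (lexx 0); rewrite /time_changed_filtration lexx.
pose D := [set xp : rat * rat | 0 <= (ratr xp.1 : R) < u /\ 0 < (ratr xp.2 : R)].
rewrite (_ : [set w | _] = [set w | (tau w <= 0%:E)%E] `|`
  \bigcup_(p in [set p : rat | 0 < (ratr p : R)])
  \bigcup_(x in [set x : rat | 0 <= (ratr x : R) < u])
  ([set w | (tau w <= (ratr p)%:E)%E] `&` [set w | ((ratr p)%:E < Gam (ratr x) w)%E])).
  apply: (filtrationU uF (ltW u0) F0).
  apply: (filtration_bigcup_rat uF (ltW u0)) => p /= p0.
  apply: (filtration_bigcup_rat uF (ltW u0)) => x /= /andP[x0 xu].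
  apply: (filtration_le uF x0 (ltW xu)).
  have := Ftau _ (ltW p0); rewrite /time_changed_filtration leNgt p0/= => -[_ /(_ _ x0) H].
  rewrite (_ : _ `&` _ = ([set w | (tau w <= (ratr p)%:E)%E] `&`
     [set w | (A (ratr p) w <= (ratr x)%:E)%E]) `&` [set w | ((ratr p)%:E < Gam (ratr x) w)%E]).
    exact: (filtrationI uF x0 H (FG _ x0)).
  apply/seteqP; split => w /=; last by move=> [[? _] ?].
  by move=> [h1 h2]; split => //; split => //; exact: time_change_le.
apply/seteqP; split => w /=; rewrite /exercise_clock; have := tau0 w.
  case tE : (tau w) => [t| |]//; rewrite lee_fin => t0.
  case: ifPn => [t00 _|]; first by left; rewrite lee_fin.
  rewrite -ltNge => tp /time_change_lt[x [xI tG]]; right.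
  have [p tp' pG] : exists2 p : rat, t <= ratr p & ((ratr p)%:E < Gam (ratr x) w)%E.
    move: tG; case: (Gam (ratr x) w) => [G| |]//.
      rewrite lte_fin => /rat_in_itvoo[p]; rewrite in_itv/= => /andP[tp1 pG].
      by exists p; [exact: ltW|rewrite lte_fin].
    have tt : t < t + 1 by rewrite ltrDl.
    have [p] := rat_in_itvoo tt; rewrite in_itv/= => /andP[tp1 _] _.
    by exists p; [exact: ltW|rewrite ltry].
  exists p; first exact: lt_le_trans tp'.
  by exists x => //; split => //=; rewrite tE lee_fin.
case tE : (tau w) => [t| |] // t0.
- move=> [|[p /= p0 [x /= /andP[x0 xu] []]]]; rewrite /= ?tE lee_fin.
    by move=> ->; rewrite lte_fin.
  move=> tp pG; case: ifPn => _; first by rewrite lte_fin.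
  apply: (le_lt_trans (time_change_le x0 _)); last by rewrite lte_fin; exact: xu.
  by apply: (le_lt_trans _ pG); rewrite lee_fin.
- by move=> [|[p _ [x _ []]]]; rewrite /= ?tE ?leye_eq.
Qed.

Hypothesis q_ge0 : forall y : R, (s0 < y%:E < s1)%E -> 0 <= q y.
Hypothesis q0 : 0 < q 0.
Hypothesis growth : forall m : R, exists C : R, forall y : R,
  (s0 < y%:E < s1)%E -> C < `|y| -> m <= g y + g y * q y.
Context {gbar : \bar R} {x0 : R}.
Hypothesis gbar_ub : forall y : R, (s0 < y%:E < s1)%E -> ((g y)%:E <= gbar)%E.
Hypothesis g_left : forall m t : R, s0 = m%:E -> 0 < t ->
  exists2 e : R, 0 < e & forall y, m < y < m + e -> g y < t.
Hypothesis g_right : forall m K : R, s1 = m%:E -> (K%:E < gbar)%E ->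
  exists2 e : R, 0 < e & forall y, m - e < y < m -> K < g y.
Hypothesis gx0 : g 0 = x0.
Notation X := (stock_path (B := B) (L := L) (r := r) (s0 := s0) (g := g) (nu := nu)
  (gbar := gbar) (x0 := x0)).
Notation disc := (discounted_value (B := B) (L := L) (r := r) (nu := nu)).

Let I0 : (s0 < (0 : R)%:E < s1)%E. Proof. by rewrite s00. Qed.

Lemma discounted_put_ge0 (K : R) (Y : R -> T -> R) tau w : 0 <= discounted_put r K Y tau w.
Proof.
rewrite /discounted_put; case: (tau w) => // t.
by rewrite mulr_ge0 ?expR_ge0// le_max lexx orbT.
Qed.

(** The surplus [c] raises the strike: the payoff grows by at most [c] and is discounted by at most
    1. It later carries the bound from strikes below the threshold to those above it. *)
Lemma put_price_le (tau : T -> \bar R) (K PK c : R) :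
  stopping_time FZ tau -> 0 <= K -> 0 <= PK -> 0 <= c ->
  (forall y, (s0 < y%:E < s1)%E -> K - g y <= PK * (g y * q y)) ->
  (\int[Pr]_w (discounted_put r (K + c) X tau w)%:E <= (PK * (g 0 * q 0) + c)%:E)%E.
Proof.
move=> st K0 PK0 c0 Kh.
pose sg := exercise_clock tau.
have os := optional_exercise_clock st.
have oc n := optional_capped n (exercise_clock_ge0 tau) os.
have SM n := stopped_mean_h uF bm rL r0 sh s00 s10 ex q_ge0 q0 n n (oc n).1 (oc n).2.
pose M n w := PK * disc (fun y => g y * q y)
  (Num.min (capped sg n w) (@exit_time R d T B (a n) (b n) n w)) w + c.
have N0 := almost_every_path_good uF bm rL r0 sh s00 s10 nu_out ex q_ge0 q0 growth.
have h0 y : (s0 < y%:E < s1)%E -> 0 <= g y * q y.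
  by move=> yI; rewrite mulr_ge0 ?q_ge0// ltW// (sh_gt0 sh).
apply: (fatou_bound (M := M) N0).
- by move=> w; exact: discounted_put_ge0.
- by move=> n; have [mM _ _] := SM n; apply: measurable_funD => //; exact: measurable_funM.
- by move=> n w; have [_ M0 _] := SM n; rewrite addr_ge0// mulr_ge0.
- move=> n; have [mM M0 EM] := SM n; move: EM; rewrite /M.
  set G := (fun w => discounted_value _ _ w) in mM M0 * => EM.
  have mG : measurable_fun setT (fun w => (G w)%:E) by exact/measurable_EFinP.
  have mPG : measurable_fun setT (fun w => (PK * G w)%:E).
    by apply/measurable_EFinP; exact: measurable_funM.
  under eq_integral do rewrite EFinD.
  rewrite ge0_integralD//=; last by move=> w _; rewrite lee_fin mulr_ge0.
  rewrite integral_cst//= probability_setT mule1 EFinD EFinM -EM.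
  under eq_integral do rewrite EFinM.
  by rewrite ge0_integralZl// => w _; rewrite lee_fin.
- move=> w /contrapT gw e e0; have [tau0 _] := st; have := tau0 w.
  have Mp n : 0 <= M n w by have [_ M0 _] := SM n; rewrite addr_ge0// mulr_ge0.
  rewrite /discounted_put; case tE : (tau w) => [t| |]//; last first.
    by move=> _; apply: nearW => n; rewrite addr_ge0// ltW.
  (* At time 0 the price is the spot even if the time change at 0 is positive; this is why
     [exercise_clock] is 0 there. *)
  rewrite lee_fin => t_ge0; have [t00|tp] := leP t 0.
    have t0 : t = 0 by apply/eqP; rewrite eq_le t00.
    apply: nearW => n; rewrite t0 mulr0 oppr0 expR0 mul1r /stock_path lexx.
    have sE : capped sg n w = 0.
      have E0 : sg w = 0%:E by rewrite /sg /exercise_clock tE t00.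
      by rewrite (capped_fin n E0); exact/min_idPl.
    rewrite ler_wpDr ?(ltW e0)// /M sE (_ : Num.min 0 _ = 0); last first.
      by apply/min_idPl; exact: entrance_ge0.
    rewrite /discounted_value (additive_functional0 rL cB)/= mulr0 oppr0 expR0 mul1r.
    rewrite (rbm_start bm) -gx0 ge_max; apply/andP; split.
      by have := Kh 0 I0; lra.
    by rewrite addr_ge0// mulr_ge0// h0.
  have sE : sg w = A t w by rewrite /sg /exercise_clock tE leNgt tp.
  have [_] := price_path_bounds bm rL r0 sh ex q_ge0 gbar_ub g_left g_right gw tp
    (x0 := x0) sE K0 PK0 Kh.
  move=> /(_ e e0); apply: filterS => n H; apply: (@le_trans _ _
    (expR (- (r * t)) * Num.max (K - X t w) 0 + c)); last by rewrite /M; lra.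
  have E1 : expR (- (r * t)) <= 1 by rewrite -[leRHS]expR0 ler_expR oppr_le0 mulr_ge0// ltW.
  have E0 := expR_gt0 (- (r * t)).
  apply: (@le_trans _ _ (expR (- (r * t)) * (Num.max (K - X t w) 0 + c))).
    rewrite ler_pM2l// ge_max; apply/andP; split; last by rewrite addr_ge0// le_max lexx orbT.
    by rewrite addrAC lerD2r le_max lexx.
  by rewrite mulrDr lerD2l ler_piMl.
Qed.

End upper_bound.

(** * The put price from below *)

Section passage.
Context {R : realType} {d : measure_display} {T : measurableType d}.
Context {Pr : probability T R} {F : R -> set (set T)} {B : R -> T -> R}.
Context {L : R -> R -> T -> R}.
Hypotheses (uF : usual_filtration Pr F) (bm : regular_bm Pr F B).
Hypothesis rL : regular_local_time B L.
Context {r : R} {s0 s1 : \bar R} {g q : R -> R} {nu : {measure set R -> \bar R}}.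
Hypotheses (r0 : 0 < r) (sh : speed_harmonic r s0 s1 g q nu).
Hypotheses (s00 : (s0 < 0)%E) (s10 : (0 < s1)%E).
Hypothesis nu_out : forall y : R, (y%:E <= s0 \/ s1 <= y%:E)%E -> nu [set y] = +oo%E.
Context {a b : nat -> R}.
Hypothesis ex : exhaustion s0 s1 a b.
Notation Gam := (additive_functional nu L).
Notation A := (time_change nu L).
Notation FZ := (time_changed_filtration nu L F).
Implicit Types (u v t : R) (w : T).

Let cB w : continuous (B^~ w). Proof. exact: (rbm_continuous bm). Qed.

Let FG v t : 0 <= v -> F v [set w | (t%:E < Gam v w)%E].
Proof. exact: (filtration_additive_functional uF bm rL r0 sh s00 s10 nu_out ex). Qed.

Variable y : R.
Hypothesis y0 : y <= 0.

Definition passage w : \bar R := ereal_inf [set u%:E | u in [set u | 0 <= u /\ B u w < y]].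

Lemma passage_ge0 w : (0 <= passage w)%E.
Proof. by apply: le_ereal_inf_tmp => _ [u [u0 _] <-]; rewrite lee_fin. Qed.

Lemma passage_ltP u w : (passage w < u%:E)%E <-> exists2 v, 0 <= v < u & B v w < y.
Proof.
split.
  move=> /ereal_inf_lt[_ [v [v0 vB] <-]]; rewrite lte_fin => vu.
  by exists v; rewrite ?v0.
move=> [v /andP[v0 vu] vB]; apply: (@le_lt_trans _ _ v%:E); last by rewrite lte_fin.
by apply: ereal_inf_lbound; exists v.
Qed.

Lemma optional_passage u : 0 < u -> F u [set w | (passage w < u%:E)%E].
Proof.
move=> u0; pose N := (Num.truncn u).+1.
have Nu : u < N%:R by exact: truncnS_gt.
rewrite (_ : [set w | _] = [set w | entrance (fun u => [set w | B u w < y]) N w < u]).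
  have oO : open [set z : R | z < y] by exact: open_lt.
  exact: (optional_bm_entrance uF bm N oO u0).
apply/seteqP; split => w /=.
  move=> /passage_ltP[v /andP[v0 vu] vB].
  by apply: (le_lt_trans _ vu); exact: entrance_lb.
move=> /entrance_lt[|[v vu vB]]; first by rewrite ltNge (ltW Nu).
by apply/passage_ltP; exists v.
Qed.

Lemma before_passage v w : 0 <= v -> (v%:E <= passage w)%E -> y <= B v w.
Proof.
move=> v0 vH; rewrite leNgt; apply/negP => vB.
have [vE|vn] := eqVneq v 0; first by move: vB; rewrite vE (rbm_start bm) ltNge y0.
have {}v0 : 0 < v by rewrite lt_neqAle eq_sym vn.
have : \forall v' \near v, B v' w < y by have h : B v' w @[v' --> v] --> B v w; [exact: cB|move/cvgr_lt : h; exact].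
move=> /nbhs_ballP[e /= e0 He].
pose v' := Num.max (v / 2) (v - e / 2).
have v'0 : 0 <= v' by rewrite le_max divr_ge0// ltW.
have v'v : v' < v by rewrite gt_max; apply/andP; split; lra.
have v'B : B v' w < y.
  apply: He; rewrite /ball/= ltr_distlC.
  have : v - e / 2 <= v' by rewrite le_max lexx orbT.
  by move=> ?; apply/andP; split; lra.
have : (passage w < v%:E)%E by apply/passage_ltP; exists v' => //; rewrite v'0.
by rewrite ltNge vH.
Qed.

Lemma at_passage u w : passage w = u%:E -> B u w = y.
Proof.
move=> HE; have u0 : 0 <= u by have := passage_ge0 w; rewrite HE lee_fin.
apply/eqP; rewrite eq_le before_passage ?HE// andbT leNgt; apply/negP => yB.
have [e e0 He] := bm_open_right bm (@open_gt _ y) yB.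
have : (passage w < (u + e)%:E)%E by rewrite HE lte_fin ltrDl.
move=> /passage_ltP[v /andP[v0 ve] vB].
have [uv|vu] := leP u v; first by have := He v uv ve; rewrite /= ltNge (ltW vB).
have : (passage w < u%:E)%E by apply/passage_ltP; exists v => //; rewrite v0.
by rewrite HE ltxx.
Qed.

Lemma passage_le_time_change u w t : passage w = u%:E -> (Gam u w <= t%:E)%E ->
  (u%:E <= A t w)%E.
Proof.
move=> HE Gt; apply: le_ereal_inf_tmp => _ [v [v0 tG] <-]; rewrite lee_fin leNgt.
apply/negP => vu; have := lt_le_trans tG (additive_functional_le rL cB w v0 (ltW vu)).
by rewrite ltNge Gt.
Qed.

(** Gamma at the passage exceeds [t] exactly when it does so at some rational time before the
    passage, by left continuity; such times up to [u] are observable. *)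
Lemma filtration_passage_clock u t : 0 <= u -> 0 <= t ->
  F u [set w | exists2 v, v <= u & passage w = v%:E /\ (Gam v w <= t%:E)%E].
Proof.
move=> u0 t0.
have FH p : 0 <= p -> F p [set w | (passage w <= p%:E)%E].
  by move=> p0; apply: (optional_le uF p0) => v; exact: optional_passage.
rewrite (_ : [set w | _] = [set w | (passage w <= u%:E)%E] `&` ~`
  \bigcup_(p in [set p : rat | 0 <= (ratr p : R) <= u])
    ([set w | (t%:E < Gam (ratr p) w)%E] `&` ~` [set w | (passage w <= (ratr p)%:E)%E])).
  apply: (filtrationI uF u0 (FH u u0)); apply: (filtrationC uF u0).
  apply: (filtration_bigcup_rat uF u0) => p /= /andP[p0 pu].
  apply: (filtration_le uF p0 pu); apply: (filtrationI uF p0); first exact: FG.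
  by apply: (filtrationC uF p0); exact: FH.
apply/seteqP; split => w /=.
  move=> [v vu [HE Gt]]; rewrite HE lee_fin vu; split => // -[p /= /andP[p0 pu] [tG]].
  apply; rewrite HE lee_fin leNgt; apply/negP => pv.
  have := lt_le_trans tG (additive_functional_le rL cB w p0 (ltW pv)).
  by rewrite ltNge Gt.
move=> [Hu N]; have H0 := passage_ge0 w.
case HE : (passage w) Hu H0 => [v| |]//; rewrite !lee_fin => vu v0.
exists v => //; split=> //; rewrite leNgt; apply/negP => tG; apply: N.
have [v' v'v tG'] : exists2 v', 0 <= v' < v & (t%:E < Gam v' w)%E.
  apply: contrapT => N; suff : (Gam v w <= t%:E)%E by rewrite leNgt tG.
  apply: (additive_functional_left rL cB) => // v' v'v.
  by rewrite leNgt; apply/negP => ?; apply: N; exists v'.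
move: v'v => /andP[v'0 v'v]; have [p] := rat_in_itvoo v'v.
rewrite in_itv/= => /andP[v'p pv].
exists p; first by rewrite /= (le_trans v'0 (ltW v'p)) (le_trans (ltW pv)).
split => /=; last by rewrite HE lee_fin; apply/negP; rewrite -ltNge.
apply: (lt_le_trans tG'); apply: (additive_functional_le rL cB) => //; exact: ltW.
Qed.

(* The floor e > 0 is needed because exercising at time 0 yields only K - x0. *)
Definition passage_clock (e : R) w : \bar R :=
  if passage w is u%:E then maxe e%:E (Gam u w) else +oo%E.

Lemma passage_clock_le e t w : e <= t ->
  (passage_clock e w <= t%:E)%E <-> exists v, passage w = v%:E /\ (Gam v w <= t%:E)%E.
Proof.
move=> et; rewrite /passage_clock; have := passage_ge0 w.
case HE : (passage w) => [v| |]// _; last by split => // -[v []].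
by rewrite ge_max lee_fin et/=; split => [?|[v' [[<-]]]//]; exists v.
Qed.

(** Gamma at the passage being at most [t] forces the passage to occur no later than the time change
    at [t], so the event can be tested on B up to that time. *)
Lemma stopping_passage_clock e : 0 < e -> stopping_time FZ (passage_clock e).
Proof.
move=> e0; split.
  move=> w; rewrite /passage_clock; case: (passage w) => // u.
  by rewrite le_max lee_fin ltW.
move=> t t0; have [te|et] := ltP t e.
  rewrite (_ : [set w | _] = set0).
    rewrite /time_changed_filtration; case: ifP => _; first exact: (filtration0 uF (lexx 0)).
    by split => // u u0; rewrite set0I; exact: (filtration0 uF u0).
  apply/seteqP; split => w //=; rewrite /passage_clock.
  by case: (passage w) => [u| |]; rewrite ?leye_eq// ge_max !lee_fin [e <= t]leNgt te.
have t0' : 0 < t by exact: lt_le_trans et.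
pose Q u := [set w | exists2 v, v <= u & passage w = v%:E /\ (Gam v w <= t%:E)%E].
have FQ u : 0 <= u -> F u (Q u) by move=> u0; exact: filtration_passage_clock.
rewrite /time_changed_filtration leNgt t0'/=; split.
  rewrite (_ : [set w | _] = \bigcup_(n : nat) Q n%:R).
    apply: bigcup_measurable => n _.
    exact: (filtration_measurable uF (ler0n _ n) (FQ _ (ler0n _ n))).
  apply/seteqP; split => w /=.
    move=> /(passage_clock_le _ et)[v Hv]; exists (Num.truncn v).+1 => //.
    by exists v => //; exact/ltW/truncnS_gt.
  by move=> [n _ [v _ Hv]]; apply/(passage_clock_le _ et); exists v.
move=> u u0; rewrite (_ : _ `&` _ = Q u `&` [set w | (A t w <= u%:E)%E]).
  apply: (filtrationI uF u0 (FQ u u0)).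
  exact: (stopping_time_change uF bm rL r0 sh s00 s10 nu_out ex).
apply/seteqP; split => w /= [h Au]; split => //.
  move: h => /(passage_clock_le _ et)[v [HE Gt]]; exists v => //.
  by have := le_trans (passage_le_time_change HE Gt) Au; rewrite lee_fin.
by move: h => [v _ Hv]; apply/(passage_clock_le _ et); exists v.
Qed.

(** The inequality may be strict: the time change runs over flat stretches of Gamma following the
    passage, and the floor [e] may delay exercise further. *)
Lemma passage_le_exercise_clock e w : 0 < e ->
  (passage w <= exercise_clock (nu := nu) (L := L) (passage_clock e) w)%E.
Proof.
move=> e0; rewrite /exercise_clock; case tE : (passage_clock e w) => [t| |]; try exact: leey.
have et : e <= t.
  move: tE; rewrite /passage_clock; case: (passage w) => [u| |]// tE.
  by rewrite -lee_fin -tE le_max lexx.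
rewrite [(t <= 0)%R]leNgt (lt_le_trans e0 et)/=.
have /(passage_clock_le _ et)[v [HE Gt]] : (passage_clock e w <= t%:E)%E by rewrite tE.
by rewrite HE; exact: passage_le_time_change.
Qed.

Hypothesis q_ge0 : forall y : R, (s0 < y%:E < s1)%E -> 0 <= q y.
Hypothesis q0 : 0 < q 0.
Hypothesis h_nonincreasing : forall z z' : R, (s0 < z%:E)%E -> z <= z' -> (z'%:E < s1)%E ->
  g z' * q z' <= g z * q z.
Hypothesis h_small : forall e : R, 0 < e -> exists2 c : R, (c%:E < s1)%E &
  forall z : R, c <= z -> (z%:E < s1)%E -> g z * q z <= e.
Hypothesis sy : (s0 < y%:E)%E.
Notation level := (exit_level (B := B) (a := a) (b := b)).
Notation disc := (discounted_value (B := B) (L := L) (r := r) (nu := nu)).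
Notation h := (fun z => g z * q z).
Notation stopped sg n w := (Num.min (capped sg n w) (level n w)).

Let ys1 : (y%:E < s1)%E.
Proof. by apply: (le_lt_trans _ s10); rewrite lee_fin. Qed.

Let Iy : (s0 < y%:E < s1)%E. Proof. by rewrite sy. Qed.

Let early n := [set w | (passage w < (level n w)%:E)%E].

Let I0 n : a n <= 0 <= b n.
Proof. by rewrite !ltW ?(exh_a0 ex) ?(exh_b0 ex). Qed.

Let oc n : optional_time F (capped passage n) /\ forall w, 0 <= capped passage n w.
Proof. exact: (optional_capped uF n passage_ge0 optional_passage). Qed.

Let level_n n w : level n w <= n%:R. Proof. exact: entrance_le. Qed.

Let level0 n w : 0 <= level n w. Proof. exact: entrance_ge0. Qed.

Lemma measurable_early n : measurable (early n).
Proof.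
rewrite (_ : early n = \bigcup_(p : rat)
  ([set w | (passage w < (ratr p)%:E)%E] `&` ~` [set w | level n w < ratr p])).
  apply: bigcupT_measurable_rat => p; have [p0|p0] := ltP 0 (ratr p : R).
    have p0' := ltW p0; apply: (filtration_measurable uF p0').
    apply: (filtrationI uF p0'); first exact: optional_passage.
    by apply: (filtrationC uF p0'); exact: (optional_exit_time uF bm).
  rewrite (_ : _ `&` _ = set0); first exact: measurable0.
  apply/seteqP; split => w //= [] + _; apply/negP; rewrite -leNgt.
  by apply: (le_trans _ (passage_ge0 w)); rewrite lee_fin.
apply/seteqP; split => w /=; rewrite /early/=.
  have := passage_ge0 w; case HE : (passage w) => [u| |]//; rewrite lee_fin lte_fin => u0.
  move=> /rat_in_itvoo[p]; rewrite in_itv/= => /andP[up pl].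
  exists p => //=; rewrite HE lte_fin; split => //; apply/negP.
  by rewrite -leNgt ltW.
move=> [p _ [Hp /negP]]; rewrite -leNgt => pl; apply: (lt_le_trans Hp).
by rewrite lee_fin.
Qed.

Lemma early_stopped n w : early n w -> exists u, [/\ passage w = u%:E,
  0 <= u < level n w, stopped passage n w = u, Gam u w = (fine (Gam u w))%:E & B u w = y].
Proof.
rewrite /early/=; have := passage_ge0 w; case HE : (passage w) => [u| |]//.
rewrite lee_fin lte_fin => u0 ul; exists u; rewrite u0 ul; split => //.
- rewrite (capped_fin n HE) (_ : Num.min u n%:R = u); first exact/min_idPl/ltW.
  by apply/min_idPl; exact: (le_trans (ltW ul)).
- apply: (stay_fin rL r0 sh ex (n := n) (v := level n w)); last by rewrite u0 ltW.
  by move=> s sI; exact: (bm_before_exit bm (I0 n) sI).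
- exact: at_passage.
Qed.

Lemma late_stopped n (sg : T -> \bar R) w : ~ early n w -> (passage w <= sg w)%E ->
  stopped sg n w = level n w.
Proof.
move=> /negP; rewrite -leNgt => lH Hs; apply/min_idPr.
have ls := le_trans lH Hs; rewrite -lee_fin /capped.
case: (sg w) ls => [x| |]//; rewrite ?lee_fin => lx; last by rewrite minye/= level_n.
by rewrite -EFin_min/= le_min lx level_n.
Qed.

(** On an early path this is the discount factor at the passage times the constant [g y], written as
    a stopped value of the martingale of [g]. *)
Let D n w := disc g (stopped passage n w) w * \1_(early n) w.

Let sM n := stopped_mean_g uF bm rL r0 sh s00 s10 ex q_ge0 n n (oc n).1 (oc n).2.

Let mD n : measurable_fun setT (D n).
Proof.
apply: measurable_funM; first by have [m _ _] := sM n.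
exact: measurable_indic (measurable_early n).
Qed.

Let D0 n w : 0 <= D n w.
Proof. by have [_ M0 _] := sM n; rewrite mulr_ge0// indicE. Qed.

Let D_early n w u : passage w = u%:E -> u < level n w ->
  D n w = expR (- (r * fine (Gam u w))) * g y.
Proof.
move=> HE ul; have eA : early n w by rewrite /early/= HE lte_fin.
have [v [HE' _ sE _ By]] := early_stopped eA.
have {HE'}vu : v = u by move: HE'; rewrite HE => -[].
by rewrite /D sE vu indicE mem_set// mulr1 /discounted_value -vu By.
Qed.

Let fD n : exists2 z : R, (\int[Pr]_w (D n w)%:E = z%:E)%E & 0 <= z <= g 0.
Proof.
have [m M0 E] := sM n.
have i0 : (0 <= \int[Pr]_w (D n w)%:E)%E by apply: integral_ge0 => w _; rewrite lee_fin.
have ig : (\int[Pr]_w (D n w)%:E <= (g 0)%:E)%E.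
  rewrite -E; apply: ge0_le_integral => //.
  - by move=> w _; rewrite lee_fin.
  - exact/measurable_EFinP.
  - exact/measurable_EFinP.
  - by move=> w _; rewrite lee_fin ler_piMr// indicE lern1 leq_b1.
move: i0 ig; case: (integral _ _ _) => [z| |]//.
by rewrite !lee_fin => z0 zg; exists z; rewrite ?z0.
Qed.

Let h0 z : (s0 < z%:E < s1)%E -> 0 <= h z.
Proof. by move=> Iz; rewrite mulr_ge0 ?q_ge0// ltW// (sh_gt0 sh). Qed.

Let disc_le u w : 0 <= u -> (s0 < (B u w)%:E < s1)%E -> disc h u w <= h (B u w).
Proof.
move=> u0 IB; rewrite /discounted_value ler_piMl ?h0// -[leRHS]expR0 ler_expR.
rewrite oppr_le0 mulr_ge0 ?(ltW r0)//; apply: fine_ge0.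
exact: (additive_functional_ge0 rL).
Qed.

(** An exit before the cap [n], from a path that is still above [y > a n], can only be through the
    right end. *)
Let at_level n w : y <= B (level n w) w -> a n < y -> level n w < n%:R ->
  b n <= B (level n w) w.
Proof.
set l := level n w => yl an ln; rewrite leNgt; apply/negP => lb.
have oO : open (`]a n, b n[%classic : set R) by exact: interval_open.
have Bl : `]a n, b n[%classic (B l w) by rewrite /= in_itv/= (lt_le_trans an yl).
have [e e0 He] := bm_open_right bm oO Bl.
suff : Num.min n%:R (l + e) <= l by rewrite leNgt lt_min ln ltrDl e0.
apply: exit_time_ge; first by rewrite ge_min lexx.
move=> s /andP[s0' sl]; have [sl'|ls] := leP s l.
  by apply: (bm_before_exit bm (I0 n) (N := n)); rewrite s0'.
have : `]a n, b n[%classic (B s w).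
  by apply: He; [exact: ltW|apply: (lt_le_trans sl); rewrite ge_min lexx orbT].
by rewrite /= in_itv/= => /andP[/ltW-> /ltW->].
Qed.

(* Until the passage the discounted value of h is at most h y, and it is small when the path
   leaves to the right; the path stays bounded up to a late time with small probability only. *)
Lemma passage_value e : 0 < e -> \forall n \near \oo,
  ((h 0 - e)%:E <= ((h y / g y)%:E * \int[Pr]_w (D n w)%:E))%E.
Proof.
move=> e0; have e20 : 0 < e / 2 by rewrite divr_gt0.
have [c cs1 hc] := h_small e20.
pose C := Num.max `|c| `|y|.
have C0 : 0 <= C by rewrite le_max normr_ge0.
have cC : c <= C by rewrite le_max ler_norm.
have yC : - C <= y.
  have := ler_norm (- y); rewrite normrN => yy.
  by rewrite lerNl (le_trans yy)// le_max lexx orbT.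
have hy0 : 0 <= h y := h0 Iy.
have gy0 : 0 < g y := sh_gt0 sh Iy.
(* [t] will bound the Gaussian peak at a late time [n], so that the paths in [[- C, C]] at that time
   contribute at most [e / 2]. *)
have [t t0 tC] : exists2 t : R, 0 < t & h y * (t * (2 * C)) <= e / 2.
  have k0 : 0 <= h y * (2 * C) by rewrite mulr_ge0// mulr_ge0.
  have k1 : 0 < h y * (2 * C) + 1 by rewrite ltr_wpDl.
  exists (e / 2 / (h y * (2 * C) + 1)); first by rewrite divr_gt0.
  rewrite [h y * _](_ : _ = e / 2 * ((h y * (2 * C)) / (h y * (2 * C) + 1))); last by field; rewrite gt_eqF.
  by rewrite ler_piMr ?(ltW e20)// ler_pdivrMr// mul1r lerDl.
have [N1 HN1] := exhaustion_itv ex sy cs1.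
have [N2 HN2] := normal_peak_small t0.
exists (maxn N1 N2).+1 => // n /=; rewrite gtn_max => /andP[n1 n2].
have [an cb] := HN1 n (ltnW n1).
have n0 : 0 < (n%:R : R) by rewrite ltr0n (leq_ltn_trans _ n2).
pose S := [set w | - C <= B n%:R w <= C].
have mS : measurable S.
  rewrite (_ : S = B n%:R @^-1` `[- C, C]%classic).
    exact: (filtration_measurable uF (ltW n0) (rbm_adapted bm (ltW n0) _)).
  by apply/seteqP; split => w; rewrite /S/= in_itv.
have PS : (Pr S <= (t * (2 * C))%:E)%E.
  apply: (le_trans (bm_small_ball bm n0 C0)); rewrite lee_fin ler_wpM2r ?mulr_ge0//.
  exact: HN2.
have [mM M0 EM] := stopped_mean_h uF bm rL r0 sh s00 s10 ex q_ge0 q0 n n (oc n).1 (oc n).2.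
have key w : disc h (stopped passage n w) w <=
    h y / g y * D n w + (e / 2 + h y * \1_S w).
  have S0 : 0 <= h y * \1_S w by rewrite mulr_ge0// indicE.
  have k0 : 0 <= h y / g y * D n w by rewrite mulr_ge0// divr_ge0// ltW.
  have [eA|nA] := pselect (early n w).
    have [u [HE /andP[u0 ul] sE Gu Bu]] := early_stopped eA.
    rewrite (D_early HE ul) sE /discounted_value Bu.
    rewrite [h y / g y * _](_ : _ = expR (- (r * fine (Gam u w))) * h y).
      by rewrite lerDl addr_ge0// ltW.
    by field; rewrite gt_eqF.
  rewrite (late_stopped nA (lexx _)); set l := level n w.
  have l0 : 0 <= l := level0 n w.
  have lH : (l%:E <= passage w)%E by rewrite leNgt; apply/negP.
  have yl : y <= B l w by exact: before_passage.
  have Il : (s0 < (B l w)%:E < s1)%E.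
    apply: (in_exhaustion ex (n := n)); apply: (bm_before_exit bm (I0 n) (N := n)).
    by rewrite l0 lexx.
  have [_ Il1] := andP Il.
  apply: (le_trans (disc_le l0 Il)).
  have big : c <= B l w -> h (B l w) <= h y / g y * D n w + (e / 2 + h y * \1_S w).
    by move=> cB'; apply: (le_trans (hc _ cB' Il1)); rewrite ler_wpDl// lerDl.
  have [nl|ln] := leP n%:R l; last first.
    by apply: big; apply: (le_trans (ltW cb)); exact: at_level.
  have ln : l = n%:R by apply/eqP; rewrite eq_le nl level_n.
  have [lC|Cl] := leP (B l w) C; last by apply: big; rewrite ltW// (le_lt_trans cC).
  have wS : S w by rewrite /S/= -ln lC (le_trans yC yl).
  rewrite indicE mem_set// mulr1 ler_wpDl// ler_wpDl ?(ltW e20)//.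
  exact: h_nonincreasing.
have mI : measurable_fun setT (fun w => (\1_S w : R)%:E).
  by apply/measurable_EFinP; exact: measurable_indic.
have mDE : measurable_fun setT (fun w => (D n w)%:E) by exact/measurable_EFinP.
have k0 : 0 <= h y / g y by rewrite divr_ge0// ltW.
have E (k e2 m : R) : 0 <= k -> 0 <= e2 -> 0 <= m ->
    (\int[Pr]_w (k * D n w + (e2 + m * \1_S w))%:E =
     k%:E * \int[Pr]_w (D n w)%:E + (e2%:E + m%:E * Pr S))%E.
  move=> k00 e2k m0.
  have DE0 w : [set: T] w -> (0 <= (D n w)%:E)%E by rewrite lee_fin.
  have IE0 w : [set: T] w -> (0 <= (\1_S w : R)%:E)%E by rewrite lee_fin indicE.
  under eq_integral do rewrite !EFinD !EFinM.
  rewrite ge0_integralD//=.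
  - rewrite (ge0_integralZl _ measurableT mDE DE0 (k := k%:E)); last by rewrite lee_fin.
    congr (_ + _)%E; rewrite ge0_integralD//=.
    + congr (_ + _)%E; first by rewrite integral_cst//= probability_setT mule1.
      rewrite (ge0_integralZl _ measurableT mI IE0 (k := m%:E)); last by rewrite lee_fin.
      by rewrite integral_indic// setIT.
    + by move=> w _; rewrite -EFinM lee_fin mulr_ge0// indicE.
    + exact: measurable_funeM.
  - by move=> w wT; apply: mule_ge0; [rewrite lee_fin|exact: DE0].
  - exact: measurable_funeM.
  - by move=> w _; rewrite -EFinM -EFinD lee_fin addr_ge0// mulr_ge0// indicE.
  - by apply: emeasurable_funD; [exact: measurable_cst|exact: measurable_funeM].
have H : ((h 0)%:E <= (h y / g y)%:E * \int[Pr]_w (D n w)%:E + ((e / 2)%:E + (h y)%:E * Pr S))%E.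
  rewrite -(E _ _ _ k0 (ltW e20) hy0) -EM; apply: ge0_le_integral => //.
  - by move=> w _; rewrite lee_fin.
  - exact/measurable_EFinP.
  - apply/measurable_EFinP; apply: measurable_funD; first exact: measurable_funM.
    by apply: measurable_funD => //; apply: measurable_funM => //; exact: measurable_indic.
  - by move=> w _; rewrite lee_fin.
have [z zE _] := fD n; rewrite zE in H *.
have : ((h y)%:E * Pr S <= (e / 2)%:E)%E.
  by apply: (le_trans (lee_wpmul2l _ PS)); rewrite ?lee_fin// -EFinM lee_fin.
move=> PS'; have := le_trans H (leeD2l _ (leeD2l _ PS')).
by rewrite -!EFinM -!EFinD !lee_fin; lra.
Qed.

Hypothesis growth : forall m : R, exists C : R, forall z : R,
  (s0 < z%:E < s1)%E -> C < `|z| -> m <= g z + g z * q z.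
Context {gbar : \bar R} {x0 : R}.
Hypothesis gbar_ub : forall z : R, (s0 < z%:E < s1)%E -> ((g z)%:E <= gbar)%E.
Hypothesis g_left : forall m t : R, s0 = m%:E -> 0 < t ->
  exists2 e : R, 0 < e & forall z, m < z < m + e -> g z < t.
Hypothesis g_right : forall m K : R, s1 = m%:E -> (K%:E < gbar)%E ->
  exists2 e : R, 0 < e & forall z, m - e < z < m -> K < g z.
Notation X := (stock_path (B := B) (L := L) (r := r) (s0 := s0) (g := g) (nu := nu)
  (gbar := gbar) (x0 := x0)).

Variables (K e : R).
Hypotheses (K0 : 0 <= K) (e0 : 0 < e).
Let tau := passage_clock e.
Let sg := exercise_clock (nu := nu) (L := L) tau.

(** The same martingale read at the actual exercise, where the price may differ from [g y]. *)
Let D' n w := disc g (stopped sg n w) w * \1_(early n) w.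

Let oc' n := optional_capped uF n (exercise_clock_ge0 (nu := nu) (L := L) tau)
  (optional_exercise_clock uF bm rL r0 sh s00 s10 nu_out ex (stopping_passage_clock e0)).

Let sM' n := stopped_mean_g uF bm rL r0 sh s00 s10 ex q_ge0 n n (oc' n).1 (oc' n).2.

Let mD' n : measurable_fun setT (D' n).
Proof.
apply: measurable_funM; first by have [m _ _] := sM' n.
exact: measurable_indic (measurable_early n).
Qed.

Let D'0 n w : 0 <= D' n w.
Proof. by have [_ M0 _] := sM' n; rewrite mulr_ge0// indicE. Qed.

(** On late paths both clocks are stopped at the exit level and the values agree. The full stopped
    values both have mean [g 0], so the parts on the early paths have equal means: exercising after
    the passage does not change the mean discounted price. *)
Let D'E n : (\int[Pr]_w (D' n w)%:E = \int[Pr]_w (D n w)%:E)%E.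
Proof.
have [m M0 E] := sM n; have [m' M0' E'] := sM' n.
have ml : measurable_fun setT (\1_(~` early n) : T -> R).
  exact: measurable_indic (measurableC (measurable_early n)).
pose Z w := disc g (stopped passage n w) w * \1_(~` early n) w.
have i0 (A : set T) w : 0 <= (\1_A w : R) by rewrite indicE.
have sum1 w : disc g (stopped passage n w) w = D n w + Z w.
  rewrite /D /Z !indicE in_setC; case: (w \in early n);
    by rewrite /= ?mulr1 ?mulr0 ?addr0 ?add0r.
have sum2 w : disc g (stopped sg n w) w = D' n w + Z w.
  have [eA|nA] := pselect (early n w).
    by rewrite /D' /Z !indicE mem_set// memNset; [rewrite mulr0 mulr1 addr0|exact].
  rewrite /D' /Z !indicE memNset// mem_set// mulr0 mulr1 add0r.
  by rewrite (late_stopped nA (lexx _)) (late_stopped nA (passage_le_exercise_clock w e0)).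
have iS (H : T -> R) : measurable_fun setT H -> (forall w, 0 <= H w) ->
    (\int[Pr]_w (H w + Z w)%:E = \int[Pr]_w (H w)%:E + \int[Pr]_w (Z w)%:E)%E.
  move=> mH H0; under eq_integral do rewrite EFinD.
  rewrite ge0_integralD//.
  - by move=> w _; rewrite lee_fin.
  - exact/measurable_EFinP.
  - by move=> w _; rewrite lee_fin mulr_ge0.
  - by apply/measurable_EFinP; exact: measurable_funM.
have Z0 : (0 <= \int[Pr]_w (Z w)%:E)%E.
  by apply: integral_ge0 => w _; rewrite lee_fin mulr_ge0.
move: E E'; under eq_integral do rewrite sum1; rewrite (iS _ (mD n) (D0 n)) => E.
under eq_integral do rewrite sum2; rewrite (iS _ (mD' n) (D'0 n)) => E'.
have [z zE _] := fD n; rewrite zE in E *.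
have i'0 : (0 <= \int[Pr]_w (D' n w)%:E)%E by apply: integral_ge0 => w _; rewrite lee_fin.
move: E E' Z0 i'0; case: (\int[Pr]_w (Z w)%:E)%E => [c| |]//.
case: (\int[Pr]_w (D' n w)%:E)%E => [c'| |]// [E] [E'] _ _.
by congr EFin; lra.
Qed.

(** A measurable majorant, on early good paths, of the discounted price at exercise; Fatou's lemma
    controls its mean. *)
Let Y w := limn_einf (fun n => (D' n w)%:E).

Let Y0 w : (0 <= Y w)%E.
Proof.
apply: limn_einf_ge => t t0; apply: nearW => n.
by rewrite lee_fin sub0r (le_trans _ (D'0 n w))// oppr_le0 ltW.
Qed.

Let mY : measurable_fun setT Y.
Proof.
apply: measurableT_comp; first exact: oppe_measurable.
apply: measurable_fun_limn_esup => n; apply: measurableT_comp; first exact: oppe_measurable.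
exact/measurable_EFinP.
Qed.

Lemma passage_put_ge N w : good_path (L := L) (r := r) (s0 := s0) (s1 := s1) (g := g) (nu := nu)
    (B := B) (a := a) (b := b) w ->
  (maxe ((K * expR (- (r * e)) / g y * D N w)%:E - Y w) 0 <=
   (discounted_put r K X tau w)%:E)%E.
Proof.
move=> gw; have V0 := discounted_put_ge0 K X tau w.
have gy0 : 0 < g y := sh_gt0 sh Iy.
have Yn : Y w != -oo%E by rewrite gt_eqF// (lt_le_trans _ (Y0 w)).
rewrite ge_max lee_fin V0 andbT.
have [eA|nA] := pselect (early N w); last first.
  rewrite /D indicE memNset// !mulr0 sub0e; apply: (@le_trans _ _ 0%E); last by rewrite lee_fin.
  by rewrite leeNl oppe0.
have [u [HE /andP[u0 ul] _ Gu _]] := early_stopped eA.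
rewrite (D_early HE ul); set G := fine (Gam u w) in Gu *.
have tE : tau w = (Num.max e G)%:E by rewrite /tau /passage_clock HE Gu EFin_max.
set t := Num.max e G in tE.
have t0 : 0 < t by rewrite lt_max e0.
have G0 : 0 <= G by apply: fine_ge0; exact: (additive_functional_ge0 rL).
have tG : t <= e + G by rewrite ge_max lerDl lerDr G0 ltW.
have sE : sg w = A t w by rewrite /sg /exercise_clock tE leNgt t0.
have Kh z : (s0 < z%:E < s1)%E -> 0 - g z <= 0 * (g z * q z).
  by move=> Iz; rewrite mul0r sub0r oppr_le0 ltW// (sh_gt0 sh).
have [HX _] := price_path_bounds bm rL r0 sh ex q_ge0 gbar_ub g_left g_right gw t0
  (x0 := x0) sE (lexx 0) (lexx 0) Kh.
have XY : ((expR (- (r * t)) * X t w)%:E <= Y w)%E.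
  apply: limn_einf_ge => z z0; have [M _ HM] := HX z z0.
  exists (maxn N M) => // n /=; rewrite geq_max => /andP[Nn /HM/= H]; rewrite lee_fin /D' indicE mem_set ?mulr1; first by lra.
  by rewrite /early/= HE lte_fin (lt_le_trans ul)// (exit_level_le bm ex).
(* Exercise takes place at [maxe e G], hence by [e + G]; the floor costs at most the factor
   [expR (- (r * e))]. *)
have W : K * expR (- (r * e)) / g y * (expR (- (r * G)) * g y) <= K * expR (- (r * t)).
  rewrite [leLHS](_ : _ = K * (expR (- (r * e)) * expR (- (r * G)))); last by field; rewrite gt_eqF.
  rewrite -expRD ler_wpM2l// ler_expR -opprD -mulrDr lerN2 ler_pM2l//.
have V : K * expR (- (r * t)) - expR (- (r * t)) * X t w <= discounted_put r K X tau w.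
  rewrite /discounted_put tE mulrC -mulrBr ler_pM2l ?expR_gt0//.
  by rewrite le_max lexx.
move: XY Yn; case: (Y w) => [z| |]//; rewrite -?EFinB ?lee_fin => XY _; first by lra.
by rewrite leNye.
Qed.

(** Let [s] be the supremum of the means of [D n] and [c] the strike reduced by the floor. The mean
    discounted price at exercise is controlled by [s], so the payoff has mean at least
    [(c / g y - 1) * s], and [passage_value] gives [h 0 / h y <= s / g y]. *)
Lemma put_price_ge : 0 < q y -> g y <= K * expR (- (r * e)) ->
  exists2 tau, stopping_time FZ tau &
  (((K * expR (- (r * e)) - g y) * (h 0 / h y))%:E <=
    \int[Pr]_w (discounted_put r K X tau w)%:E)%E.
Proof.
move=> qy gK.
exists tau; first exact: stopping_passage_clock.
have gy0 : 0 < g y := sh_gt0 sh Iy.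
have hy0 : 0 < h y by rewrite mulr_gt0.
set c := K * expR (- (r * e)) in gK *.
have c0 : 0 < c := lt_le_trans gy0 gK.
have /choice[z zE] : forall n, exists z : R, (\int[Pr]_w (D n w)%:E = z%:E)%E /\ 0 <= z <= g 0.
  by move=> n; have [z] := fD n; exists z.
have V0 w : 0 <= discounted_put r K X tau w by exact: discounted_put_ge0.
have : (0 <= \int[Pr]_w (discounted_put r K X tau w)%:E)%E.
  by apply: integral_ge0 => w _; rewrite lee_fin.
case vE : (\int[Pr]_w (discounted_put r K X tau w)%:E)%E => [v| |]//; last by move=> _; rewrite leey.
rewrite !lee_fin => v0.
have hs : has_sup (range z).
  split; first by exists (z 0%N); exists 0%N.
  by exists (g 0) => _ [n _ <-]; have [_ /andP[]] := zE n.
pose s := sup (range z).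
have zs n : z n <= s by apply: ub_le_sup; [exact: hs.2|exists n].
have sh0 : h 0 <= h y / g y * s.
  apply/ler_addgt0Pr => t t0; have [N _ HN] := passage_value t0.
  have := HN N (leqnn N); rewrite (zE N).1 -EFinM lee_fin => H.
  have := zs N; rewrite -(ler_pM2l (divr_gt0 hy0 gy0)) => H'; lra.
have D'z n : (\int[Pr]_w (D' n w)%:E = (z n)%:E)%E by rewrite D'E; exact: (zE n).1.
have YS : (\int[Pr]_w Y w <= s%:E)%E.
  apply: (le_trans (fatou Pr measurableT _ _)).
  - by move=> n; apply/measurable_EFinP; exact: mD'.
  - by move=> n w _; rewrite lee_fin; exact: D'0.
  rewrite limn_einf_lim; apply: lime_le; first exact: is_cvg_einfs.
  apply: nearW => n; apply: (@le_trans _ _ (z n)%:E); last by rewrite lee_fin.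
  by apply: ereal_inf_lbound; exists n => //=; exact: D'z.
have zv N : c / g y * z N <= v + s.
  have k0 : 0 <= c / g y by rewrite divr_ge0// ltW.
  have N0 := almost_every_path_good uF bm rL r0 sh s00 s10 nu_out ex q_ge0 q0 growth.
  have DE0 w : [set: T] w -> (0 <= (D N w)%:E)%E by rewrite lee_fin.
  have mDE : measurable_fun setT (fun w => (D N w)%:E) by exact/measurable_EFinP.
  have mW : measurable_fun setT (fun w => (c / g y * D N w)%:E).
    by apply/measurable_EFinP; exact: measurable_funM.
  pose M w := maxe ((c / g y * D N w)%:E - Y w)%E 0%E.
  have mM : measurable_fun setT M.
    by apply: measurable_maxe => //; exact: emeasurable_funB.
  have M0 w : (0 <= M w)%E by rewrite le_max lexx orbT.
  have Mv : (\int[Pr]_w M w <= v%:E)%E.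
    rewrite -vE; apply: ge0_ae_le_integral_nonmeasurable => //.
    apply: (negligibleS _ N0) => w /= H gw; apply: H.
    by apply: passage_put_ge.
  rewrite -lee_fin EFinM -(zE N).1 EFinD.
  rewrite -(ge0_integralZl _ measurableT mDE DE0 (k := (c / g y)%:E)); last by rewrite lee_fin.
  apply: (le_trans _ (leeD Mv YS)); rewrite -ge0_integralD//.
  apply: ge0_le_integral => //.
  - by move=> w _; rewrite mule_ge0// lee_fin.
  - exact: emeasurable_funD.
  - move=> w _; rewrite -EFinM /M; have := Y0 w; case: (Y w) => [y'| |]//.
      move=> _; rewrite -EFinB -EFin_max -EFinD lee_fin -lerBlDr le_max lexx//.
    by rewrite addey ?leey// gt_eqF// (lt_le_trans (ltNyr 0))// le_max lexx orbT.
have sv : c / g y * s <= v + s.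
  rewrite mulrC -ler_pdivlMr ?divr_gt0//; apply: ge_sup; first exact: hs.1.
  by move=> _ [n _ <-]; rewrite ler_pdivlMr ?divr_gt0// mulrC.
have H : h 0 / h y <= s / g y.
  by rewrite ler_pdivrMr// (le_trans sh0)// [leRHS](_ : _ = h y / g y * s)//; field; rewrite gt_eqF.
apply: (le_trans (ler_wpM2l _ H)); first by rewrite subr_ge0.
rewrite [leLHS](_ : _ = c / g y * s - s); last by field; rewrite gt_eqF.
by rewrite lerBlDr.
Qed.

End passage.

(** * The functions P and phi *)

Section price_function_facts.
Context {R : realType} {x0 : R} {P : R -> R} {phi : R -> \bar R}.
Hypotheses (x00 : 0 < x0) (HP : hypothesis_H x0 P) (Hphi : admissible_phi x0 P phi).
Notation xl := (x_low x0 phi).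
Notation f x := (fine (phi x)).
Implicit Types (x y z K t : R).

Lemma price0 : P 0 = 0.
Proof.
have /andP[h1 h2] := H_bounds HP (lexx 0); apply/eqP; rewrite eq_le h2/=.
by apply: (le_trans _ h1); rewrite le_max lexx orbT.
Qed.

Lemma price_ge K : 0 <= K -> K - x0 <= P K.
Proof. by move=> K0; have /andP[+ _] := H_bounds HP K0; apply: le_trans; rewrite le_max lexx. Qed.

Lemma price_ge0 K : 0 <= K -> 0 <= P K.
Proof.
by move=> K0; have /andP[+ _] := H_bounds HP K0; apply: le_trans; rewrite le_max lexx orbT.
Qed.

Lemma price_le K K' : 0 <= K -> K <= K' -> P K <= P K'.
Proof.
by move=> K0 KK'; apply: (H_nondecreasing HP) => //; rewrite in_itv/= andbT// (le_trans K0).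
Qed.

Lemma price_chord x y z : 0 <= x -> x < y -> y < z ->
  (z - x) * P y <= (z - y) * P x + (y - x) * P z.
Proof.
move=> hx xy yz; have xz : 0 < z - x by rewrite subr_gt0 (lt_trans xy).
have t0 : 0 <= (z - y) / (z - x) by apply: divr_ge0; lra.
have t1 : (z - y) / (z - x) <= 1 by rewrite ler_pdivrMr// mul1r lerD2l lerN2 ltW.
have hy : 0 <= y by rewrite (le_trans hx) ?ltW.
have xD : x \in (`[0, +oo[%classic : set R^o) by rewrite inE /= in_itv/= hx.
have zD : z \in (`[0, +oo[%classic : set R^o) by rewrite inE /= in_itv/= (le_trans hy) ?ltW.
have E : conv (Itv01 t0 t1) (x : R^o) (z : R^o) = y.
  by rewrite convRE /unstable.onem /=; field; rewrite gt_eqF.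
have H : P y <= (z - y) / (z - x) * P x + (1 - (z - y) / (z - x)) * P z.
  by rewrite -[X in P X <= _]E; exact: (H_convex HP (Itv01 t0 t1) xD zD).
apply: (le_trans (ler_wpM2l (ltW xz) H)); rewrite le_eqVlt; apply/orP; left; apply/eqP.
by field; rewrite gt_eqF.
Qed.

(** The chord from [K] to a strike beyond the threshold has slope at most 1, because
    [K - x0 <= P K]; convexity passes this to all smaller increments from [K]. *)
Lemma price_lipschitz K K' : 0 <= K -> K <= K' -> P K' <= P K + (K' - K).
Proof.
move=> K0; rewrite le_eqVlt => /predU1P[<-|KK']; first by rewrite subrr addr0.
have [Ks [xKs PKs _]] := H_threshold HP.
pose K2 := Num.max Ks (K' + 1).
have K2s : Ks <= K2 by rewrite le_max lexx.
have K'2 : K' < K2 by rewrite lt_max ltrDl ltr01 orbT.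
have := price_chord K0 KK' K'2; rewrite (PKs _ K2s) => H.
have PK := price_ge K0; have d2 : 0 < K2 - K by lra.
by rewrite -(ler_pM2l d2); nra.
Qed.

Lemma phi_ge x K : 0 < x <= x0 -> x <= K -> (ediv0 (K - x) (P K) <= phi x)%E.
Proof. by move=> xI xK; rewrite (phi_sup Hphi xI); apply: ereal_sup_ubound; exists K. Qed.

Lemma phi_le x (c : R) : 0 < x <= x0 -> 0 <= c ->
  (forall K, x <= K -> K - x <= c * P K) -> (phi x <= c%:E)%E.
Proof.
move=> xI c0 H; rewrite (phi_sup Hphi xI); apply: ge_ereal_sup => _ [K /= xK <-].
have K0 : 0 <= K by have /andP[x0' _] := xI; rewrite (le_trans (ltW x0')).
rewrite /ediv0; have := H K xK; have [->|PK0] := eqVneq (P K) 0.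
  rewrite mulr0 subr_le0 => Kx; rewrite (_ : K - x = 0) ?eqxx ?lee_fin//.
  by apply/eqP; rewrite subr_eq0 eq_le Kx.
have PK : 0 < P K by rewrite lt_neqAle eq_sym PK0 price_ge0.
by move=> H'; rewrite lee_fin ler_pdivrMr.
Qed.

Lemma phi_at_spot : phi x0 = 1%E.
Proof.
have xI : 0 < x0 <= x0 by rewrite x00/=.
apply/eqP; rewrite eq_le; apply/andP; split.
  apply: phi_le => // K xK; rewrite mul1r price_ge// (le_trans (ltW x00))//.
have [Ks [xKs PKs _]] := H_threshold HP.
apply: (le_trans _ (phi_ge xI (ltW xKs))); rewrite /ediv0 PKs//.
by rewrite gt_eqF ?subr_gt0// divff ?gt_eqF ?subr_gt0.
Qed.

(* The gap at the spot persists slightly to the left, where P decreases with slope at most 1. *)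
Lemma phi_near_spot K z : 0 <= K -> 0 < P K -> 0 < z <= x0 ->
  x0 - z <= P K - (K - x0) -> (phi z <= (1 + (x0 - z) / P K)%:E)%E.
Proof.
move=> K0 PK zI gap; have /andP[z0 zx] := zI.
have d0 : 0 <= (x0 - z) / P K by rewrite divr_ge0 ?subr_ge0// ltW.
apply: phi_le => //; first by rewrite addr_ge0.
move=> K' zK'; have K'0 : 0 <= K' by rewrite (le_trans (ltW z0)).
have PK'0 := price_ge0 K'0.
have [KK'|K'K] := leP K K'.
  have PKK' := price_le K0 KK'; have := price_ge K'0.
  have : x0 - z <= (x0 - z) / P K * P K'.
    by rewrite mulrAC ler_pdivlMr// ler_wpM2l// subr_ge0.
  by lra.
have := price_lipschitz K'0 (ltW K'K) => H.
have : 0 <= (x0 - z) / P K * P K' by rewrite mulr_ge0.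
by lra.
Qed.

Lemma price_spot_gt0 : 0 < P x0.
Proof.
have [Ks [xKs _ gap]] := H_threshold HP.
by have := gap x0; rewrite lexx xKs subrr => /(_ isT).
Qed.

Let S : set R := [set x | 0 < x <= x0 /\ (phi x < +oo)%E].

Let S_lb : has_lbound S. Proof. by exists 0 => x [/andP[/ltW ? _] _]. Qed.

Let Sx0 : S x0. Proof. by split; [rewrite x00/=|rewrite phi_at_spot ltry]. Qed.

Lemma x_low_ge0 : 0 <= xl.
Proof. by apply: lb_le_inf; [exists x0|move=> x [/andP[/ltW ? _] _]]. Qed.

Lemma x_low_lt : xl < x0.
Proof.
have P0 := price_spot_gt0; pose z := Num.max (x0 / 2) (x0 - P x0).
have zx : z < x0.
  by rewrite gt_max ltrBlDr ltrDl P0 andbT ltr_pdivrMr// ltr_pMr// ltr1n.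
have z0 : 0 < z by rewrite lt_max divr_gt0.
have zI : 0 < z <= x0 by rewrite z0 ltW.
have zP : x0 - z <= P x0 - (x0 - x0).
  by have : x0 - P x0 <= z by [rewrite le_max lexx orbT]; lra.
apply: (le_lt_trans _ zx); apply: ge_inf => //; split => //.
by apply: (le_lt_trans (phi_near_spot (ltW x00) P0 zI zP)); rewrite ltry.
Qed.

Lemma fine_phiE x : xl < x -> phi x = (f x)%:E.
Proof.
move=> xlx; have x0' : 0 < x := le_lt_trans x_low_ge0 xlx.
have [z [/andP[z0 zx] zf] zlx] := inf_lt (ex_intro S x0 Sx0) xlx.
rewrite fineK// ge0_fin_numE; last exact: (phi_ge0 Hphi).
by apply: (le_lt_trans _ zf); apply: (phi_nonincreasing Hphi) => //; exact: ltW.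
Qed.

Lemma fine_phi_ge0 x : xl < x -> 0 <= f x.
Proof.
by move=> xlx; apply: fine_ge0; apply: (phi_ge0 Hphi); exact: le_lt_trans x_low_ge0 xlx.
Qed.

Lemma fine_phi_le x y : xl < x -> x <= y -> f y <= f x.
Proof.
move=> xlx xy; have xly := lt_le_trans xlx xy.
rewrite -lee_fin -(fine_phiE xlx) -(fine_phiE xly).
exact: (phi_nonincreasing Hphi (le_lt_trans x_low_ge0 xlx) xy).
Qed.

Lemma fine_phi_spot : f x0 = 1. Proof. by rewrite phi_at_spot. Qed.

Lemma fine_phi_chord x y z : xl < x -> x < y -> y < z ->
  (z - x) * f y <= (z - y) * f x + (y - x) * f z.
Proof.
move=> hx xy yz; have xz : 0 < z - x by rewrite subr_gt0 (lt_trans xy).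
have t0 : 0 <= (z - y) / (z - x) by apply: divr_ge0; lra.
have t1 : (z - y) / (z - x) <= 1 by rewrite ler_pdivrMr// mul1r lerD2l lerN2 ltW.
have xp : 0 < x := le_lt_trans x_low_ge0 hx.
have zp : 0 < z by apply: (lt_trans xp); rewrite (lt_trans xy).
have t01 : 0 <= (z - y) / (z - x) <= 1 by rewrite t0.
have := phi_convex Hphi t01 xp zp.
have -> : (z - y) / (z - x) * x + (1 - (z - y) / (z - x)) * z = y by field; rewrite gt_eqF.
have xly : xl < y := lt_trans hx xy.
rewrite (fine_phiE hx) (fine_phiE xly) (fine_phiE (lt_trans xly yz)).
rewrite -!EFinM -EFinD lee_fin /= => H.
apply: (le_trans (ler_wpM2l (ltW xz) H)); rewrite le_eqVlt; apply/orP; left; apply/eqP.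
by field; rewrite gt_eqF.
Qed.

(** By convexity phi is nowhere steeper to the right of [c] than its chord over [[c', c]]. *)
Lemma fine_phi_lipschitz c' c x y : xl < c' -> c' < c -> c <= x -> x <= y ->
  f x - f y <= (f c' - f c) / (c - c') * (y - x).
Proof.
move=> hc' c'c cx; rewrite le_eqVlt => /predU1P[<-|xy]; first by rewrite !subrr mulr0.
have H1 : (y - c') * f x <= (y - x) * f c' + (x - c') * f y.
  by apply: fine_phi_chord => //; exact: lt_le_trans cx.
have H2 : (x - c') * f c <= (x - c) * f c' + (c - c') * f x.
  move: cx; rewrite le_eqVlt => /predU1P[<-|cx]; first by lra.
  exact: fine_phi_chord.
have d1 : 0 < c - c' by lra.
have d2 : 0 < x - c' by lra.
rewrite mulrAC ler_pdivlMr// -(ler_pM2l d2).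
have d3 : 0 <= y - x by lra.
have d4 : 0 <= c - c' by lra.
have := ler_wpM2l d3 H2; have := ler_wpM2l d4 H1; lra.
Qed.

Lemma fine_phi_small e : 0 < e -> exists2 y, x0 < y & f y <= e.
Proof.
move=> e0; have /fine_cvgP[_] := phi_cvg0 Hphi.
move=> /cvgr0Pnorm_le/(_ e e0)[M [_ HM]].
exists (Num.max (M + 1) (x0 + 1)); first by rewrite lt_max ltrDl ltr01 orbT.
have := HM (Num.max (M + 1) (x0 + 1)); rewrite lt_max ltrDl ltr01 => /(_ isT) /=.
exact: (le_trans (ler_norm _)).
Qed.

(** Up to the spot this is the definition of phi. Beyond it phi is arbitrary but convex, hence above
    the line through the spot and a point [z] just to its left; by [phi_near_spot] that line has
    slope at least [- 1 / P K]. The argument uses the gap [K - x0 < P K], that is, a strike below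
    every threshold. *)
Lemma put_le K x : xl < x -> 0 <= K -> (forall Ks, (forall K', Ks <= K' -> P K' = K' - x0) -> K < Ks) ->
  K - x <= P K * f x.
Proof.
move=> xlx K0 KKs; have xp : 0 < x := le_lt_trans x_low_ge0 xlx.
have [Kx|xK] := leP K x.
  by apply: (@le_trans _ _ 0); [rewrite subr_le0|rewrite mulr_ge0 ?price_ge0 ?fine_phi_ge0].
have [xx0|x0x] := leP x x0.
  have := @phi_ge x K; rewrite xp xx0 => /(_ isT (ltW xK)); rewrite /ediv0 (fine_phiE xlx) /=.
  have [PK0|PK0] := eqVneq (P K) 0.
    by rewrite gt_eqF ?subr_gt0// leye_eq.
  have PK : 0 < P K by rewrite lt_neqAle eq_sym PK0 price_ge0.
  by rewrite lee_fin ler_pdivrMr// mulrC.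
have [Ks [xKs PKs gap]] := H_threshold HP.
have /gap : x0 <= K < Ks by rewrite (KKs _ PKs) (le_trans (ltW x0x)) ?ltW.
rewrite -subr_gt0; set p := P K - (K - x0) => p0.
have PK : 0 < P K by have := price_ge K0; lra.
have xl0 := x_low_lt.
(* Far enough right for phi to be finite, and close enough to the spot for the gap [p] at [K] to
   persist. *)
pose z := Num.max ((xl + x0) / 2) (x0 - p).
have zx0 : z < x0 by rewrite gt_max; apply/andP; split; lra.
have xlz : xl < z by rewrite lt_max; apply/orP; left; lra.
have z0 : 0 < z := le_lt_trans x_low_ge0 xlz.
have := @phi_near_spot K z K0 PK; rewrite z0 (ltW zx0) => /(_ isT).
have zp : x0 - z <= P K - (K - x0) by have : x0 - p <= z by [rewrite le_max lexx orbT]; rewrite /p; lra.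
move=> /(_ zp); rewrite (fine_phiE xlz) lee_fin => fz.
have := fine_phi_chord xlz zx0 x0x; rewrite fine_phi_spot => H.
have d1 : 0 < x0 - z by lra.
have H1 : 1 - (x - x0) / P K <= f x.
  have xz0 : 0 <= x - x0 by lra.
  by rewrite -(ler_pM2l d1); have := ler_wpM2l xz0 fz; lra.
have := ler_wpM2l (ltW PK) H1; rewrite mulrBr mulr1 mulrCA divff ?gt_eqF// mulr1.
by rewrite /p in p0; lra.
Qed.

(* Duality: a supporting line of P at K, with slope m, bounds phi by 1 / m to the right of the
   point where the line vanishes. *)
Lemma put_ge K Ks : 0 <= K -> K < Ks -> 0 < P K -> P Ks = Ks - x0 -> K - x0 < P K ->
  exists m, [/\ 0 < m < 1, 0 <= K - P K / m, K - P K / m < x0 &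
    forall x, K - P K / m < x -> x <= x0 -> (phi x <= (m^-1)%:E)%E].
Proof.
move=> K0 KKs PK PKs gap.
have Kp : 0 < K.
  by rewrite lt_neqAle K0 andbT; apply: contraTneq PK => <-; rewrite price0 ltxx.
(* [m] is the left derivative of [P] at [K], as a supremum of left difference quotients. It is below
   1 because the mean slope from [K] to [Ks] is. *)
pose Q := [set (P K - P K') / (K - K') | K' in [set K' | 0 <= K' < K]].
have Q0 : Q (P K / K) by exists 0; rewrite /= ?lexx// price0 !subr0.
have Qub K2 : K < K2 -> ubound Q ((P K2 - P K) / (K2 - K)).
  move=> KK2 _ [K' /= /andP[K'0 K'K] <-]; have := price_chord K'0 K'K KK2.
  rewrite ler_pdivrMr ?subr_gt0// mulrAC ler_pdivlMr ?subr_gt0//; lra.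
have hsQ : has_sup Q by split; [exists (P K / K)|exists ((P Ks - P K) / (Ks - K)); exact: Qub].
pose m := sup Q; have Qm q : Q q -> q <= m by move=> Qq; apply: ub_le_sup => //; exact: hsQ.2.
have m0 : 0 < m by apply: (lt_le_trans _ (Qm _ Q0)); rewrite divr_gt0.
have mub K2 : K < K2 -> m <= (P K2 - P K) / (K2 - K).
  by move=> KK2; apply: ge_sup; [exact: hsQ.1|exact: Qub].
have m1 : m < 1.
  apply: (le_lt_trans (mub _ KKs)); rewrite ltr_pdivrMr ?subr_gt0//; lra.
have line K' : 0 <= K' -> P K + m * (K' - K) <= P K'.
  move=> K'0; have [K'K|KK'|->] := ltgtP K' K; last by rewrite subrr mulr0 addr0.
    have /Qm : Q ((P K - P K') / (K - K')) by exists K' => //; rewrite /= K'0.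
    rewrite ler_pdivrMr ?subr_gt0//; lra.
  by have := mub _ KK'; rewrite ler_pdivlMr ?subr_gt0//; lra.
have PKm : m * (P K / m) = P K by rewrite mulrCA divff ?gt_eqF// mulr1.
exists m; rewrite m0 m1; split => //.
- rewrite subr_ge0 ler_pdivrMr//; have := line 0 (lexx 0); rewrite price0; lra.
- suff : P K <= P K / m by lra.
  by rewrite ler_pdivlMr// ler_piMr// ltW.
- move=> x xK xx0.
  have Kx : 0 <= K - P K / m.
    rewrite subr_ge0 ler_pdivrMr//; have := line 0 (lexx 0); rewrite price0; lra.
  apply: phi_le; [by rewrite (le_lt_trans Kx)|by rewrite invr_ge0 ltW|].
  move=> K' xK'; have K'0 : 0 <= K' by rewrite (le_trans Kx)// (le_trans (ltW xK)).
  rewrite mulrC ler_pdivlMr//; have := line _ K'0.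
  by have := ler_wpM2l (ltW m0) (ltW xK); rewrite mulrBr PKm; lra.
Qed.

End price_function_facts.

(** * The scale function and its inverse *)

Section lipschitz_segments.
Context {R : realType}.

Lemma lipschitz_within (u : R -> R) (a b k : R) :
  (forall x y, a <= x -> x <= y -> y <= b -> `|u y - u x| <= k * (y - x)) ->
  {within `[a, b], continuous u}.
Proof.
move=> H; apply/subspace_continuousP => x /=; rewrite in_itv/= => /andP[ax xb].
apply/cvgrPdist_le => e e0; rewrite near_withinE.
have k0 : 0 < `|k| + 1 by rewrite ltr_wpDl.
apply/nbhs_ballP; exists (e / (`|k| + 1)); first by rewrite /= divr_gt0.
move=> y; rewrite /ball/= => xy /=; rewrite in_itv/= => /andP[ay yb].
have kd : (`|k| + 1) * `|x - y| <= e.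
  by rewrite mulrC -ler_pdivlMr// ltW.
apply: (le_trans _ kd).
have kle z : 0 <= z -> k * z <= (`|k| + 1) * z.
  by move=> z0; rewrite ler_wpM2r// (le_trans (ler_norm k))// lerDl.
have [yx|xy'] := leP y x.
  have := H y x ay yx xb; rewrite [`|x - y|]ger0_norm ?subr_ge0// => h.
  by apply: (le_trans h); rewrite kle// subr_ge0.
have h := H x y ax (ltW xy') yb; rewrite distrC; apply: (le_trans h).
by rewrite distrC [`|y - x|]ger0_norm ?subr_ge0 ?(ltW xy')// kle// subr_ge0 ltW.
Qed.

End lipschitz_segments.

Section scale_function.
Context {R : realType} {x0 : R} {P : R -> R} {phi : R -> \bar R}.
Notation mu := (@lebesgue_measure R).
Hypotheses (x00 : 0 < x0) (HP : hypothesis_H x0 P) (Hphi : admissible_phi x0 P phi).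
Notation xl := (x_low x0 phi).
Notation f x := (fine (phi x)).
Notation s := (scale x0 phi).
Implicit Types (x y z K t : R).

Let fle := fine_phi_le x00 HP Hphi.
Let f0 := fine_phi_ge0 x00 HP Hphi.

Lemma fine_phi_within a b : xl < a -> {within `[a, b], continuous (fun x => f x)}.
Proof.
move=> xla; pose c := (xl + a) / 2.
have ca : c < a by rewrite /c; lra.
have xlc : xl < c by rewrite /c; lra.
apply: (@lipschitz_within _ _ _ _ ((f c - f a) / (a - c))) => x y ax xy yb.
rewrite distrC ger0_norm ?subr_ge0 ?fle//; last exact: lt_le_trans ax.
exact: (fine_phi_lipschitz x00 HP Hphi).
Qed.

Let fint a b : xl < a -> mu.-integrable `[a, b] (EFin \o (fun x => f x)).
Proof.
move=> xla; apply: continuous_compact_integrable; first exact: segment_compact.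
exact: fine_phi_within.
Qed.

Let J a b := \int[mu]_(x in `[a, b]) f x.

Let J_bounds a b : xl < a -> a <= b -> (b - a) * f b <= J a b <= (b - a) * f a.
Proof.
move=> xla ab.
have E c : \int[mu]_(x in `[a, b]) (cst c x) = (b - a) * c.
  rewrite Rintegral_cst//= lebesgue_measure_itv/= lte_fin.
  move: ab; rewrite le_eqVlt => /predU1P[->|ab]; first by rewrite ltxx subrr/= mulr0 mul0r.
  by rewrite ab/= mulrC.
have ic (c : R) : mu.-integrable `[a, b] (EFin \o cst c).
  apply: continuous_compact_integrable; first exact: segment_compact.
  by apply: continuous_subspaceT => ?; exact: cst_continuous.
apply/andP; split; rewrite -E; apply: le_Rintegral => //.
- exact: fint.
- move=> x /=; rewrite in_itv/= => /andP[ax xb]; apply: fle => //.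
  exact: lt_le_trans ax.
- exact: fint.
- by move=> x /=; rewrite in_itv/= => /andP[ax xb]; exact: fle.
Qed.

Let J_add a b c : xl < a -> a <= b -> b <= c -> J a c - J a b = J b c.
Proof.
move=> xla ab bc; rewrite /J Rintegral_itvB//=; last exact: fint.
rewrite Rintegral_itv_obnd_cbnd//.
apply: integrableS (fint c xla) => //.
by move=> x /=; rewrite !in_itv/= => /andP[bx ->]; rewrite (le_trans ab)// ltW.
Qed.

Let Jxx a : J a a = 0.
Proof. by rewrite /J set_itv1 Rintegral_set1. Qed.

Let F x := oriented_integral x0 x (fun y => f y).

Let FB a b : xl < a -> a <= b -> F b - F a = J a b.
Proof.
move=> xla ab; rewrite /F /oriented_integral -!/(J _ _).
have xl0 : xl < x0 := x_low_lt x00 HP Hphi.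
have [x0a|ax0] := leP x0 a; first by rewrite (le_trans x0a ab) J_add.
have [x0b|bx0] := leP x0 b.
  by rewrite opprK -(J_add xla (ltW ax0) x0b); lra.
by rewrite -(J_add xla ab (ltW bx0)); lra.
Qed.

Lemma scale_spot : s x0 = 0.
Proof.
rewrite /scale /oriented_integral lexx -/(J x0 x0) Jxx (fine_phi_spot x00 HP Hphi).
by rewrite mulr0 mulr1 add0r subrr.
Qed.

(** Monotonicity of phi puts the integral over [[x, y]] between [(y - x) * f y] and [(y - x) * f x].
    The second estimate is a difference form of [ds = f dx - x df]; in the variable [s] it will say
    that the Wronskian of [g] and [f o g] is 1. *)
Lemma scale_increment x y : xl < x -> x <= y ->
  x * (f x - f y) + (y - x) * f y <= s y - s x /\
  `|(y * f x - x * f y) - (s y - s x)| <= (y - x) * (f x - f y).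
Proof.
move=> xlx xy; have /andP[h1 h2] := J_bounds xlx xy.
have E := FB xlx xy; rewrite /scale -/(F x) -/(F y).
by split; [lra|rewrite ler_norml; apply/andP; split; lra].
Qed.

Lemma scale_le x y : xl < x -> x <= y -> s x <= s y.
Proof.
move=> xlx xy; have [h _] := scale_increment xlx xy.
have xp : 0 <= x by rewrite (le_trans (x_low_ge0 x00 HP Hphi))// ltW.
have h1 : 0 <= x * (f x - f y) by rewrite mulr_ge0// subr_ge0 fle.
have h2 : 0 <= (y - x) * f y.
  by rewrite mulr_ge0 ?subr_ge0// f0//; exact: lt_le_trans xy.
lra.
Qed.

Lemma scale_lt x y : xl < x -> x < y -> 0 < f x -> s x < s y.
Proof.
move=> xlx xy fx; have [h _] := scale_increment xlx (ltW xy).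
have xp : 0 < x by rewrite (le_lt_trans (x_low_ge0 x00 HP Hphi)).
have fy := fle xlx (ltW xy).
have fy0 : 0 <= f y by apply: f0; exact: lt_trans xy.
have h1 : 0 <= x * (f x - f y) by rewrite mulr_ge0// ?subr_ge0// ltW.
have h2 : 0 <= (y - x) * f y by rewrite mulr_ge0// subr_ge0 ltW.
have [fye|fyn] := eqVneq (f y) (f x).
  have : 0 < (y - x) * f y by rewrite mulr_gt0 ?subr_gt0// fye.
  lra.
have : 0 < x * (f x - f y) by rewrite mulr_gt0 ?subr_gt0// lt_neqAle fyn.
lra.
Qed.

Lemma scale_within a b : xl < a -> {within `[a, b], continuous s}.
Proof.
move=> xla; pose c := (xl + a) / 2.
have ca : c < a by rewrite /c; lra.
have xlc : xl < c by rewrite /c; lra.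
pose k := (f c - f a) / (a - c).
have k0 : 0 <= k by apply: divr_ge0; rewrite subr_ge0; [apply: fle => //; exact: ltW|exact: ltW].
apply: (@lipschitz_within _ _ _ _ (f a + b * k)) => x y ax xy yb.
have xlx := lt_le_trans xla ax.
rewrite ger0_norm ?subr_ge0 ?scale_le//.
have [_] := scale_increment xlx xy; rewrite ler_norml => /andP[h _].
have fk : f x - f y <= k * (y - x) := fine_phi_lipschitz x00 HP Hphi xlc ca ax xy.
have fxa := fle xla ax.
have xp : 0 <= x by rewrite (le_trans (x_low_ge0 x00 HP Hphi))// ltW.
have yx : 0 <= y - x by rewrite subr_ge0.
have h1 : y * (f x - f y) <= b * (k * (y - x)).
  apply: (@le_trans _ _ (y * (k * (y - x)))).
    by rewrite ler_wpM2l// (le_trans xp).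
  by rewrite ler_wpM2r// mulr_ge0.
have h2 : (y - x) * f x <= (y - x) * f a by rewrite ler_wpM2l.
lra.
Qed.

Notation sl := (scale_low x0 phi).
Notation sr := (scale_infty x0 phi).

Lemma scale_low_inf : sl = ereal_inf [set (s x)%:E | x in [set x | xl < x]].
Proof.
rewrite /scale_low.
have H := @nondecreasing_at_right_cvge R (fun x => (s x)%:E) xl (BInfty _ false).
have -> : [set x | xl < x] = [set` Interval (BRight xl) (BInfty _ false)].
  by apply/seteqP; split => x; rewrite /= in_itv/= andbT.
apply/cvg_lim => //; apply: H => // x y; rewrite !in_itv/= !andbT => hx hy xy.
by rewrite lee_fin scale_le.
Qed.

Lemma scale_low_le x : xl < x -> (sl <= (s x)%:E)%E.
Proof. by move=> hx; rewrite scale_low_inf; apply: ereal_inf_lbound; exists x. Qed.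

Lemma scale_low_approx (c : \bar R) : (sl < c)%E -> exists2 x, xl < x & ((s x)%:E < c)%E.
Proof. by rewrite scale_low_inf => /ereal_inf_lt[_ [x hx <-] xc]; exists x. Qed.

Lemma scale_infty_sup : sr = ereal_sup [set (s x)%:E | x in [set x | xl < x]].
Proof.
rewrite /scale_infty; pose c := (xl + x0) / 2.
have xl0 : xl < x0 := x_low_lt x00 HP Hphi.
have xlc : xl < c by rewrite /c; lra.
have nd : {homo (fun x => (s (Num.max c x))%:E) : x y / x <= y >-> (x <= y)%E}.
  move=> x y xy; rewrite lee_fin scale_le//; first by rewrite lt_max xlc.
  by rewrite ge_max !le_max lexx xy orbT.
have cv := nondecreasing_cvge nd; apply/cvg_lim => //.
rewrite (_ : ereal_sup _ = ereal_sup (range (fun x => (s (Num.max c x))%:E))).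
  apply: cvg_trans cv; apply: near_eq_cvg.
  by exists c; split; [exact: num_real|move=> x cx; rewrite max_r// ltW].
apply/eqP; rewrite eq_le; apply/andP; split; apply: ge_ereal_sup => _ [x /= hx <-].
  apply: (@le_trans _ _ (s (Num.max c x))%:E); last by apply: ereal_sup_ubound; exists x.
  by rewrite lee_fin scale_le// le_max lexx orbT.
by apply: ereal_sup_ubound; exists (Num.max c x) => //=; rewrite lt_max xlc.
Qed.

Lemma scale_infty_ge x : xl < x -> ((s x)%:E <= sr)%E.
Proof. by move=> hx; rewrite scale_infty_sup; apply: ereal_sup_ubound; exists x. Qed.

Lemma scale_infty_approx (c : \bar R) : (c < sr)%E -> exists2 x, xl < x & (c < (s x)%:E)%E.
Proof. by rewrite scale_infty_sup => /ereal_sup_gt[_ [x hx <-] xc]; exists x. Qed.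

End scale_function.

Section local_quadratic_bound.
Context {R : realType}.

Lemma is_derive_near_sqbound (f : R -> R) (x l C e : R) : 0 < e -> 0 <= C ->
  (forall t, `|t| < e -> `|f (x + t) - f x - l * t| <= C * t ^+ 2) -> is_derive x 1 f l.
Proof.
move=> e0 C0 fC; pose f2 z := if `|z - x| < e then f z else f x + l * (z - x).
have fx : f2 x = f x by rewrite /f2 subrr normr0 e0.
apply: (@near_eq_is_derive _ _ _ f2).
  apply/nbhs_ballP; exists e => // z; rewrite /ball/= => xz.
  by rewrite /f2 distrC xz.
apply: (@is_derive_sqbound _ _ _ _ C) => t; rewrite fx /f2 (_ : x + t - x = t); last by ring.
case: ifPn => [te|_]; first exact: fC.
by rewrite [f x + _]addrC addrK subrr normr0 mulr_ge0// sqr_ge0.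
Qed.

End local_quadratic_bound.

(** * The ratio of two functions with Wronskian 1, in difference form *)

Section harmonic_pairs.
Context {R : realType} {s0 s1 : \bar R} {g h : R -> R}.
Notation I y := (s0 < y%:E < s1)%E.
Hypotheses (g_gt0 : forall y, I y -> 0 < g y) (h_gt0 : forall y, I y -> 0 < h y).
Hypothesis pair : forall y y', (s0 < y%:E)%E -> y <= y' -> (y'%:E < s1)%E ->
  [/\ g y <= g y', h y' <= h y, (g y' - g y) * h y' <= y' - y, g y * (h y - h y') <= y' - y &
    `|(g y' * h y - g y * h y') - (y' - y)| <= (g y' - g y) * (h y - h y')].

Let between y a b : (s0 < a%:E)%E -> (b%:E < s1)%E -> a <= y <= b -> I y.
Proof.
move=> s0a bs1 /andP[ay yb]; rewrite (lt_le_trans s0a) ?lee_fin//=.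
by rewrite (le_lt_trans _ bs1)// lee_fin.
Qed.

Let margin y : I y -> exists2 e, 0 < e & I (y - e) /\ I (y + e).
Proof.
move=> /andP[sy ys]; have [e e0 [h1 h2]] := open_interval_margin sy ys.
exists (2 * e); first by rewrite mulr_gt0.
by split; apply: (between h1 h2); apply/andP; split; lra.
Qed.

Let g_lipschitz y e z : 0 < e -> I (y - e) -> I (y + e) -> `|z - y| <= e ->
  `|g z - g y| <= `|z - y| / h (y + e).
Proof.
move=> e0 /andP[Im1 Im2] /andP[Ip1 Ip2]; rewrite ler_norml => /andP[z1 z2].
have hp : 0 < h (y + e) by apply: h_gt0; rewrite Ip1.
have Iz : I z by apply: (between Im1 Ip2); apply/andP; split; lra.
have Iy : I y by apply: (between Im1 Ip2); apply/andP; split; lra.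
have /andP[zs0 zs1] := Iz; have /andP[ys0 ys1] := Iy.
have [yz|zy] := leP y z.
  have [gyz _ H _ _] := pair ys0 yz zs1.
  have zye : z <= y + e by lra.
  have [_ hz _ _ _] := pair zs0 zye Ip2.
  rewrite !ger0_norm ?subr_ge0// ler_pdivlMr//; apply: (le_trans _ H).
  by rewrite ler_wpM2l ?subr_ge0.
have [gyz _ H _ _] := pair zs0 (ltW zy) ys1.
have yye : y <= y + e by lra.
have [_ hz _ _ _] := pair ys0 yye Ip2.
rewrite !ler0_norm ?subr_le0 ?(ltW zy)// !opprB ler_pdivlMr//; apply: (le_trans _ H).
by rewrite ler_wpM2l ?subr_ge0.
Qed.

Lemma pair_continuous y : I y -> {for y, continuous g}.
Proof.
move=> Iy; have [e e0 [I1 I2]] := margin Iy.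
have hp : 0 < h (y + e) by exact: h_gt0.
apply/cvgrPdist_le => t t0; apply/nbhs_ballP.
exists (Num.min e (t * h (y + e))); first by rewrite /= lt_min e0 mulr_gt0.
move=> z; rewrite /ball/= distrC lt_min => /andP[ze zt]; rewrite distrC.
apply: (le_trans (g_lipschitz e0 I1 I2 (ltW ze))).
by rewrite ler_pdivrMr// ltW.
Qed.

(** The difference form of [(h / g)' = - 1 / g ^ 2], multiplied by [g y ^+ 2 * g y'] to clear the
    denominators. *)
Let slope y y' : (s0 < y%:E)%E -> y <= y' -> (y'%:E < s1)%E ->
  `|h y' / g y' - h y / g y + (y' - y) / (g y * g y')| * (g y ^+ 2 * g y') <=
  (g y' - g y) * (y' - y).
Proof.
move=> sy yy ys; have Iy : I y by apply: (between sy ys); rewrite lexx.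
have Iy' : I y' by apply: (between sy ys); rewrite lexx yy.
have gy := g_gt0 Iy; have gy' := g_gt0 Iy'.
have [gg _ _ h1 h2] := pair sy yy ys.
rewrite -[X in `|_| * X]gtr0_norm ?mulr_gt0 ?exprn_gt0// -normrM.
rewrite (_ : _ * _ = - (g y * ((g y' * h y - g y * h y') - (y' - y)))); last first.
  by field; rewrite !gt_eqF.
rewrite normrN normrM gtr0_norm//; apply: (le_trans (ler_wpM2l (ltW gy) h2)).
by rewrite mulrCA ler_wpM2l// subr_ge0.
Qed.

(** The error in [slope] is the increment of [g] times that of [y], and [g] is locally Lipschitz by
    [(g y' - g y) * h y' <= y' - y]. The total error is quadratic, so the ratio is differentiable
    even where [g] and [h] have kinks. *)
Lemma pair_derive y : I y -> is_derive y 1 (fun z => h z / g z) (- (g y ^+ 2)^-1).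
Proof.
move=> Iy; have [e e0 [I1 I2]] := margin Iy.
have /andP[I11 I12] := I1; have /andP[I21 I22] := I2.
have hp : 0 < h (y + e) by exact: h_gt0.
have gm : 0 < g (y - e) by exact: g_gt0.
pose C := 2 / (g (y - e) ^+ 3 * h (y + e)).
have C0 : 0 <= C by rewrite divr_ge0// mulr_ge0 ?exprn_ge0 ?ltW.
apply: (is_derive_near_sqbound e0 C0) => t te; set z := y + t.
have zE : z - y = t by rewrite /z; ring.
have ze : `|z - y| <= e by rewrite zE ltW.
have := ze; rewrite ler_norml => /andP[z1 z2].
have Iz : I z by apply: (between I11 I22); apply/andP; split; lra.
have /andP[zs0 zs1] := Iz; have /andP[ys0 ys1] := Iy.
have gy := g_gt0 Iy; have gz := g_gt0 Iz.
have gmy : g (y - e) <= g y by have ye : y - e <= y by [lra]; have [] := pair I11 ye ys1.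
have gmz : g (y - e) <= g z by have ye : y - e <= z by [lra]; have [] := pair I11 ye zs1.
have L := g_lipschitz e0 I1 I2 ze; rewrite zE in L.
have m3 : 0 < g (y - e) ^+ 3 by rewrite exprn_gt0.
have cube u v : g (y - e) <= u -> g (y - e) <= v -> g (y - e) ^+ 3 <= u ^+ 2 * v.
  move=> hu hv; have u0 := lt_le_trans gm hu.
  rewrite exprSr; apply: ler_pM => //; [exact/ltW/exprn_gt0|exact: ltW|].
  by rewrite ler_pXn2r// nnegrE ltW.
have H1 : `|h z / g z - h y / g y + t / (g y * g z)| * g (y - e) ^+ 3 <= `|g z - g y| * `|t|.
  have [yz|zy] := leP y z.
    have := slope ys0 yz zs1; rewrite zE => H; rewrite [`|g z - g y|]ger0_norm ?subr_ge0//; last first.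
      by have [] := pair ys0 yz zs1.
    have t0 : 0 <= t by lra.
    rewrite [`|t|]ger0_norm//; apply: (le_trans _ H); rewrite ler_wpM2l//.
    exact: cube.
  have := slope zs0 (ltW zy) ys1; rewrite (_ : y - z = - t); last by rewrite -zE opprB.
  move=> H.
  rewrite [`|g z - g y|]distrC [`|g y - g z|]ger0_norm ?subr_ge0//; last by have [] := pair zs0 (ltW zy) ys1.
  have t0 : t <= 0 by lra.
  rewrite [`|t|]ler0_norm//; apply: (le_trans _ H).
  rewrite -normrN (_ : - (_ + _) = h y / g y - h z / g z + - t / (g z * g y)); last first.
    by rewrite [g z * g y]mulrC; ring.
  by rewrite ler_wpM2l// cube.
have H2 : `|t / (g y * g z) - t / g y ^+ 2| * g (y - e) ^+ 3 <= `|g z - g y| * `|t|.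
  rewrite (_ : _ - _ = - (t * (g z - g y)) / (g y ^+ 2 * g z)); last by field; rewrite !gt_eqF.
  have gg : 0 < g y ^+ 2 * g z by rewrite mulr_gt0// exprn_gt0.
  rewrite normrM normrN normfV [`|_ * g z|]gtr0_norm// mulrAC ler_pdivrMr//.
  rewrite normrM [`|t| * _]mulrC; apply: ler_wpM2l; first by rewrite mulr_ge0.
  exact: cube.
have H3 : `|h z / g z - h y / g y - - (g y ^+ 2)^-1 * t| * g (y - e) ^+ 3 <=
    2 * (`|g z - g y| * `|t|).
  rewrite mulr2n mulrDl !mul1r; apply: (le_trans _ (lerD H1 H2)); rewrite -mulrDl ler_pM2r//.
  apply: (le_trans _ (ler_normB _ _)); rewrite le_eqVlt; apply/orP; left; apply/eqP.
  by congr (`|_|); rewrite mulNr opprK [_^-1 * t]mulrC; ring.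
rewrite /C -(real_normK (num_real t)) mulrAC ler_pdivlMr ?mulr_gt0// mulrA.
apply: (@le_trans _ _ (2 * (`|g z - g y| * `|t|) * h (y + e))).
  by rewrite ler_pM2r.
rewrite -mulrA ler_pM2l// expr2 mulrAC ler_wpM2r//.
by rewrite -ler_pdivlMr.
Qed.

End harmonic_pairs.

Section inverse_scale.
Context {R : realType} {x0 : R} {P : R -> R} {phi : R -> \bar R}.
Hypotheses (x00 : 0 < x0) (HP : hypothesis_H x0 P) (Hphi : admissible_phi x0 P phi).
Notation xl := (x_low x0 phi).
Notation f x := (fine (phi x)).
Notation s := (scale x0 phi).
Notation sl := (scale_low x0 phi).
Notation sr := (scale_infty x0 phi).
Notation s0 := (scale_zero x0 phi).
Notation g := (inv_scale x0 phi).
Implicit Types (x y z K t : R).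

Let fle := fine_phi_le x00 HP Hphi.
Let f0 := fine_phi_ge0 x00 HP Hphi.
Let xl0 := x_low_lt x00 HP Hphi.
Let xlp := x_low_ge0 x00 HP Hphi.
Let slt := scale_lt x00 HP Hphi.
Let sle := scale_le x00 HP Hphi.
Let sinc := scale_increment x00 HP Hphi.

Lemma scale_lt_infty x : xl < x -> 0 < f x -> ((s x)%:E < sr)%E.
Proof.
move=> hx fx; apply: (@lt_le_trans _ _ (s (x + 1))%:E).
  by rewrite lte_fin slt// ltrDl.
by apply: (scale_infty_ge x00 HP Hphi); rewrite (lt_trans hx)// ltrDl.
Qed.

Lemma low_lt_scale x : xl < x -> 0 < f x -> (sl < (s x)%:E)%E.
Proof.
move=> hx fx; pose z := (xl + x) / 2.
have z1 : xl < z by rewrite /z; lra.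
have z2 : z < x by rewrite /z; lra.
apply: (le_lt_trans (scale_low_le x00 HP Hphi z1)).
by rewrite lte_fin slt// (lt_le_trans fx)// fle// ltW.
Qed.

Let f1 : 0 < f x0. Proof. by rewrite (fine_phi_spot x00 HP Hphi). Qed.

Lemma scale_low_lt0 : (sl < 0)%E.
Proof. by have := low_lt_scale xl0 f1; rewrite (scale_spot x00 HP Hphi). Qed.

Lemma scale_zero_lt0 : (s0 < 0)%E.
Proof. by rewrite /scale_zero; case: ifP => _; [exact: ltNyr|exact: scale_low_lt0]. Qed.

Lemma scale_infty_gt0 : (0 < sr)%E.
Proof. by have := scale_lt_infty xl0 f1; rewrite (scale_spot x00 HP Hphi). Qed.

Lemma inv_scaleP y : (sl < y%:E < sr)%E -> [/\ xl < g y, s (g y) = y & 0 < f (g y)].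
Proof.
move=> /andP[ly yr].
have [x1 hx1 x1y] := scale_low_approx x00 HP Hphi ly.
have [x2 hx2 yx2] := scale_infty_approx x00 HP Hphi yr.
rewrite !lte_fin in x1y yx2.
have x12 : x1 <= x2.
  rewrite leNgt; apply/negP => /ltW x21.
  by have := sle hx2 x21; rewrite leNgt (lt_trans x1y).
have [x xI sx] : exists2 x, x \in `[x1, x2] & s x = y.
  apply: (IVT x12 (scale_within x00 HP Hphi hx1)).
  by rewrite min_l ?max_r ?sle// !ltW.
have [hg sg] : xl < g y /\ s (g y) = y.
  rewrite /inv_scale leNgt ly/=.
  apply: (@xgetPex _ xl [set x | xl < x /\ s x = y]); exists x; split => //.
  by move: xI; rewrite in_itv/= => /andP[x1x _]; exact: lt_le_trans x1x.
(* If phi vanished at [g y], the scale would be constant to the right of it, and [y] could not be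
   below its supremum. *)
split => //; rewrite lt_neqAle f0// andbT eq_sym; apply/eqP => fg0.
have gx2 : g y <= x2.
  rewrite leNgt; apply/negP => /ltW x2g.
  by have := sle hx2 x2g; rewrite sg leNgt yx2.
have fx2 : f x2 = 0.
  by apply/eqP; rewrite eq_le f0// andbT -fg0 fle.
have [_] := sinc hg gx2; rewrite fg0 fx2 !mulr0 subrr mulr0 sub0r normrN sg.
by rewrite normr_le0 subr_eq0 => /eqP yE; move: yx2; rewrite yE ltxx.
Qed.

Lemma scale_inj x z : xl < x -> xl < z -> 0 < f x -> 0 < f z -> s x = s z -> x = z.
Proof.
move=> hx hz fx fz sE; have [xz|zx|//] := ltgtP x z.
  by have := slt hx xz fx; rewrite sE ltxx.
by have := slt hz zx fz; rewrite sE ltxx.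
Qed.

Lemma inv_scaleK x : xl < x -> 0 < f x -> g (s x) = x.
Proof.
move=> hx fx; have [|h1 h2 h3] := @inv_scaleP (s x).
  by rewrite low_lt_scale// scale_lt_infty.
exact: scale_inj.
Qed.

Lemma inv_scale_low y : (y%:E <= sl)%E -> g y = xl.
Proof. by rewrite /inv_scale => ->. Qed.

Lemma inv_scale0 : g 0 = x0.
Proof. by rewrite -[in LHS](scale_spot x00 HP Hphi) inv_scaleK. Qed.

End inverse_scale.

(** * The second harmonic function and the put inequality on the scale *)

Section put_on_scale.
Context {R : realType} {x0 : R} {P : R -> R} {phi : R -> \bar R}.
Hypotheses (x00 : 0 < x0) (HP : hypothesis_H x0 P) (Hphi : admissible_phi x0 P phi).
Notation xl := (x_low x0 phi).
Notation f x := (fine (phi x)).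
Notation s := (scale x0 phi).
Notation sl := (scale_low x0 phi).
Notation sr := (scale_infty x0 phi).
Notation s0 := (scale_zero x0 phi).
Notation g := (inv_scale x0 phi).
Notation I y := (s0 < y%:E < sr)%E.
Implicit Types (x y z K t : R).

Let fle := fine_phi_le x00 HP Hphi.
Let f0 := fine_phi_ge0 x00 HP Hphi.
Let xl0 := x_low_lt x00 HP Hphi.
Let xlp := x_low_ge0 x00 HP Hphi.
Let slt := scale_lt x00 HP Hphi.
Let sle := scale_le x00 HP Hphi.
Let sinc := scale_increment x00 HP Hphi.
Let gP y : (sl < y%:E)%E -> (y%:E < sr)%E -> [/\ xl < g y, s (g y) = y & 0 < f (g y)].
Proof. by move=> ly ys; apply: (inv_scaleP x00 HP Hphi); rewrite ly. Qed.

Let fx0 := fine_phi_spot x00 HP Hphi.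
Let sx0 := scale_spot x00 HP Hphi.

(** As phi is nonincreasing, this is its right limit at [x_low]. *)
Definition low_phi : R := sup [set f x | x in [set x | xl < x]].

(* The function f o g, continued below the scale of x_low with slope - 1 / x_low. *)
Definition scale_put y : R :=
  if (y%:E <= sl)%E then low_phi - (y - fine sl) / xl else f (g y).
Notation h := scale_put.

Lemma scale_put_below y m : sl = m%:E -> y <= m -> h y = low_phi + (m - y) / xl.
Proof.
by move=> slE ym; rewrite /scale_put slE lee_fin ym/=; congr (_ + _); rewrite -mulNr opprB.
Qed.

Lemma below_scale_low y : (s0 < y%:E)%E -> (y%:E <= sl)%E ->
  0 < xl /\ exists2 m : R, sl = m%:E & y <= m.
Proof.
rewrite /scale_zero; case: ifPn => [xp _|_]; last by move=> /lt_le_trans H /H; rewrite ltxx.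
have := scale_low_lt0 x00 HP Hphi; case: sl => [m| |]//= _.
by rewrite lee_fin => ym; split => //; exists m.
Qed.

Section finite_low.
Variable m : R.
Hypotheses (xp : 0 < xl) (slE : sl = m%:E).

(** A finite scale at a positive [x_low] bounds phi: by [scale_increment] between [x] and the spot,
    [xl * (f x - 1)] is at most [- m]. *)
Let low_has_sup : has_sup [set f x | x in [set x | xl < x]].
Proof.
split; first by exists (f x0), x0.
have m0 : m < 0 by have := scale_low_lt0 x00 HP Hphi; rewrite slE lte_fin.
exists (1 - m / xl) => _ [x /= hx <-].
suff : f x - 1 <= - m / xl by lra.
rewrite ler_pdivlMr//; have [xx0|x0x] := leP x x0; last first.
  have : f x - 1 <= 0 by rewrite subr_le0 -fx0 fle// ltW.
  by move=> H; apply: (@le_trans _ _ 0); [rewrite mulr_le0_ge0// ltW|lra].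
have := sinc hx xx0; rewrite fx0 sx0 => -[H _].
have := scale_low_le x00 HP Hphi hx; rewrite slE lee_fin => ms.
have fx1 : 0 <= f x - 1 by rewrite subr_ge0 -fx0 fle.
have : (f x - 1) * xl <= x * (f x - 1) by rewrite mulrC ler_wpM2r// ltW.
lra.
Qed.

Lemma low_phi_ge x : xl < x -> f x <= low_phi.
Proof. by move=> hx; apply: ub_le_sup; [exact: low_has_sup.2|exists x]. Qed.

Lemma low_approx e x' : 0 < e -> xl < x' ->
  exists x, [/\ xl < x, x <= x', x <= xl + e, s x <= m + e & low_phi - e <= f x].
Proof.
move=> e0 hx'.
have [_ [x1 /= h1 <-] fx1] := sup_adherent e0 low_has_sup.
have [|x2 h2 sx2] := @scale_low_approx _ _ _ _ x00 HP Hphi (m + e)%:E.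
  by rewrite slE lte_fin ltrDl.
pose x := Num.min (Num.min x1 x2) (Num.min x' (xl + e)).
have hx : xl < x by rewrite !lt_min h1 h2 hx' ltrDl.
exists x; split => //.
- by rewrite !ge_min lexx !orbT.
- by rewrite !ge_min lexx !orbT.
- by rewrite lte_fin in sx2; apply: (le_trans _ (ltW sx2)); rewrite sle// !ge_min lexx orbT.
- by apply: (le_trans (ltW fx1)); rewrite fle// !ge_min lexx.
Qed.

(** The limit of [scale_increment] as its left point [z] decreases to [x_low]; each estimate is
    taken with an error proportional to [e], which is then removed by [scaled]. *)
Lemma low_increment x : xl < x ->
  [/\ xl * (low_phi - f x) <= s x - m, (x - xl) * f x <= s x - m &
  `|(x * low_phi - xl * f x) - (s x - m)| <= (x - xl) * (low_phi - f x)].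
Proof.
move=> hx; have fx := f0 hx; have flx := low_phi_ge hx.
have scaled (a b C : R) : 0 <= C -> (forall e, 0 < e -> a <= b + C * e) -> a <= b.
  move=> C0 H; apply/ler_addgt0Pr => t t0.
  have C1 : 0 < C + 1 by rewrite ltr_wpDl.
  apply: (le_trans (H (t / (C + 1)) _)); first by rewrite divr_gt0.
  by rewrite lerD2l mulrCA ler_piMr ?(ltW t0)// ler_pdivrMr// mul1r lerDl.
have key e : 0 < e -> exists z, [/\ xl < z, z <= x, z <= xl + e, m <= s z <= m + e &
    [/\ low_phi - e <= f z <= low_phi, 0 <= f z - f x &
    z * (f z - f x) + (x - z) * f x <= s x - s z /\
    `|(x * f z - z * f x) - (s x - s z)| <= (x - z) * (f z - f x)]].
  move=> e0; have [z [h1 h2 h3 h4 h5]] := low_approx e0 hx; exists z; split => //.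
    by rewrite h4 andbT -lee_fin -slE (scale_low_le x00 HP Hphi).
  by split; [rewrite h5 low_phi_ge|rewrite subr_ge0 fle|exact: sinc].
have x0' : 0 < x := lt_trans xp hx.
split.
- apply: (@scaled _ _ xl); first exact: ltW.
  move=> e e0; have [z [h1 h2 h3 /andP[h4 h5] [/andP[h6 h7] h8 [h9 _]]]] := key e e0.
  have : xl * (low_phi - f x) <= xl * (f z - f x + e) by rewrite ler_wpM2l// ?(ltW xp)//; lra.
  have : xl * (f z - f x) <= z * (f z - f x) by rewrite ler_wpM2r// ltW.
  have : 0 <= (x - z) * f x by rewrite mulr_ge0// subr_ge0.
  lra.
- apply: (@scaled _ _ (f x)) => // e e0.
  have [z [h1 h2 h3 /andP[h4 h5] [_ h8 [h9 _]]]] := key e e0.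
  have : 0 <= z * (f z - f x) by rewrite mulr_ge0// (le_trans (ltW xp))// ltW.
  have : (z - xl) * f x <= e * f x by rewrite ler_wpM2r//; lra.
  lra.
- apply: (@scaled _ _ (x + f x + 1)); first by rewrite !addr_ge0// ltW.
  move=> e e0; have [z [h1 h2 h3 /andP[h4 h5] [/andP[h6 h7] h8 [_ h9]]]] := key e e0.
  have W : (x - z) * (f z - f x) <= (x - xl) * (low_phi - f x).
    by apply: ler_pM => //; rewrite ?subr_ge0//; lra.
  have a1 : x * (low_phi - f z) <= x * e by rewrite ler_wpM2l// ?(ltW x0')//; lra.
  have a2 : (z - xl) * f x <= e * f x by rewrite ler_wpM2r//; lra.
  have a3 : 0 <= x * (low_phi - f z) by rewrite mulr_ge0 ?subr_ge0// ltW.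
  have a4 : 0 <= (z - xl) * f x by rewrite mulr_ge0// subr_ge0 ltW.
  have a5 : 0 <= x * e by rewrite mulr_ge0// ltW.
  have a6 : 0 <= e * f x by rewrite mulr_ge0// ltW.
  move: h9; rewrite !ler_norml => /andP[? ?]; apply/andP; split; lra.
Qed.

End finite_low.

(** Above the scale of [x_low] this is [scale_increment] in the variable [s]. Below it [g] is
    constant, and the slope [- 1 / xl] of [h] is the one that keeps the Wronskian equal to 1. For
    points on either side the two contributions add up. *)
Lemma scale_put_pair y y' : (s0 < y%:E)%E -> y <= y' -> (y'%:E < sr)%E ->
  [/\ g y <= g y', h y' <= h y, (g y' - g y) * h y' <= y' - y, g y * (h y - h y') <= y' - y &
    `|(g y' * h y - g y * h y') - (y' - y)| <= (g y' - g y) * (h y - h y')].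
Proof.
move=> sy yy ys.
have [yl|ly] := leP y%:E sl.
  have [xp [m slE ym]] := below_scale_low sy yl.
  have e1 : (m - y) / xl * xl = m - y by rewrite divfK// gt_eqF.
  have d0 : 0 <= (m - y) / xl by rewrite divr_ge0 ?subr_ge0// ltW.
  have hyE := scale_put_below slE ym.
  have [y'l|ly'] := leP y'%:E sl.
    have ym' : y' <= m by rewrite slE lee_fin in y'l.
    have hyE' := scale_put_below slE ym'.
    have e2 : (m - y') / xl * xl = m - y' by rewrite divfK// gt_eqF.
    rewrite !inv_scale_low// hyE hyE' subrr !mul0r; split => //.
    - by rewrite lerD2l ler_pM2r ?invr_gt0//; lra.
    - by rewrite subr_ge0.
    - rewrite [leLHS](_ : _ = (m - y) / xl * xl - (m - y') / xl * xl); last by ring.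
      by rewrite e1 e2; lra.
    - rewrite [X in `|X|](_ : _ = (m - y) / xl * xl - (m - y') / xl * xl - (y' - y)); last by ring.
      by rewrite e1 e2 (_ : _ - _ = 0) ?normr0//; ring.
  have [hg sg fg] := gP ly' ys.
  have hy'E : h y' = f (g y') by rewrite /scale_put leNgt ly'.
  have [h1 h2 h3] := low_increment xp slE hg; rewrite sg in h1 h2 h3.
  have fl := low_phi_ge xp slE hg.
  rewrite (inv_scale_low yl) hyE hy'E; split.
  - exact: ltW.
  - by rewrite (le_trans fl)// lerDl.
  - by apply: (le_trans h2); lra.
  - rewrite (_ : xl * _ = xl * (low_phi - f (g y')) + (m - y) / xl * xl); last by ring.
    by rewrite e1; lra.
  - rewrite (_ : _ - _ - _ = (g y' * low_phi - xl * f (g y') - (y' - m)) +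
      ((g y' - xl) * ((m - y) / xl) + ((m - y) / xl * xl - (m - y)))); last by ring.
    rewrite e1 subrr addr0; apply: (le_trans (ler_normD _ _)).
    rewrite [X in _ + X]ger0_norm ?mulr_ge0 ?subr_ge0 ?invr_ge0 ?(ltW xp) ?(ltW hg)//.
    rewrite [leRHS](_ : _ = (g y' - xl) * (low_phi - f (g y')) +
      (g y' - xl) * ((m - y) / xl)); last by ring.
    by rewrite lerD2r.
have ly' : (sl < y'%:E)%E by rewrite (lt_le_trans ly)// lee_fin.
have ys1 : (y%:E < sr)%E by rewrite (le_lt_trans _ ys)// lee_fin.
have [hg sg fg] := gP ly ys1.
have [hg' sg' fg'] := gP ly' ys.
have gg : g y <= g y'.
  rewrite leNgt; apply/negP => gl; have := slt hg' gl fg'; rewrite sg sg' ltNge yy//.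
have := sinc hg gg; rewrite sg sg' => -[h1 h2].
rewrite /scale_put !leNgt ly ly'/=; have ff := fle hg gg.
have gp : 0 <= g y by rewrite (le_trans xlp)// ltW.
have a1 : 0 <= g y * (f (g y) - f (g y')) by rewrite mulr_ge0// subr_ge0.
have a2 : 0 <= (g y' - g y) * f (g y') by rewrite mulr_ge0 ?subr_ge0 ?f0.
by split => //; lra.
Qed.

Lemma inv_scale_gt0 y : I y -> 0 < g y.
Proof.
move=> /andP[sy ys]; have [yl|ly] := leP y%:E sl.
  by have [xp _] := below_scale_low sy yl; rewrite inv_scale_low.
have [hg _ _] := gP ly ys.
exact: le_lt_trans hg.
Qed.

Lemma scale_put_gt0 y : I y -> 0 < h y.
Proof.
move=> /andP[sy ys]; have [yl|ly] := leP y%:E sl.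
  have [xp [m slE ym]] := below_scale_low sy yl; rewrite (scale_put_below slE ym).
  rewrite ltr_wpDr ?divr_ge0 ?subr_ge0 ?(ltW xp)//.
  by apply: (lt_le_trans ltr01); rewrite -fx0 (low_phi_ge xp slE).
by rewrite /scale_put leNgt ly/=; have [_ _ fg] := gP ly ys.
Qed.

Let I0 : I 0.
Proof. by rewrite (scale_zero_lt0 x00 HP Hphi) (scale_infty_gt0 x00 HP Hphi). Qed.

Lemma scale_put_above y : (sl < y%:E)%E -> h y = f (g y).
Proof. by move=> ly; rewrite /scale_put leNgt ly. Qed.

Lemma scale_put0 : h 0 = 1.
Proof.
by rewrite scale_put_above ?(inv_scale0 x00 HP Hphi)//; exact: (scale_low_lt0 x00 HP Hphi).
Qed.

(** The Wronskian estimate between 0 and [y] gives [y <= 2 * g y] on the right and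
    [- y <= 2 * x0 * h y] on the left, so one of the two functions grows at least linearly. *)
Lemma scale_put_growth (M : R) : exists C : R, forall y : R,
  I y -> C < `|y| -> M <= g y + h y.
Proof.
exists (2 * `|M| + 2 * x0 * `|M|) => y Iy Cy; have /andP[sy ys] := Iy.
have M0 : 0 <= `|M| by []. have MM := ler_norm M.
have xM : 0 <= x0 * `|M| by rewrite mulr_ge0// ltW.
have gp := inv_scale_gt0 Iy; have hp := scale_put_gt0 Iy.
have /andP[s00 s10] := I0.
have g0 := inv_scale0 x00 HP Hphi; have h0 := scale_put0.
have [y0|y0] := leP 0 y.
  have [gg hh _ _] := scale_put_pair s00 y0 ys; rewrite g0 h0 ler_norml => /andP[a1 a2].
  rewrite [`|y|]ger0_norm// in Cy; have a3 : 0 <= x0 * h y by rewrite mulr_ge0 ?ltW.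
  have a4 : 0 <= g y * h y by rewrite mulr_ge0 ?ltW.
  have x0p : 0 <= x0 by exact: ltW.
  have H : y <= 2 * g y - g y * h y - x0 by lra.
  suff : `|M| <= g y by lra.
  lra.
have [gg hh _ _] := scale_put_pair sy (ltW y0) s10; rewrite g0 h0 ler_norml => /andP[a1 a2].
rewrite [`|y|]ltr0_norm// in Cy.
have a3 : 0 <= g y * h y by rewrite mulr_ge0 ?ltW.
suff : x0 * `|M| <= x0 * h y.
  by rewrite ler_pM2l// => MH; rewrite (le_trans MM)// (le_trans MH)// lerDr ltW.
lra.
Qed.

(** The intermediate value theorem provides a point where phi equals [e] exactly. Its positivity
    there places the point strictly below the end of the scale, even if phi vanishes further on. *)
Lemma scale_put_small e : 0 < e -> exists2 c : R, (c%:E < sr)%E &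
  forall z : R, c <= z -> (z%:E < sr)%E -> h z <= e.
Proof.
move=> e0; have /andP[s00 s10] := I0.
have [e1|e1] := leP 1 e.
  exists 0 => // z z0 zs; have [_ hz _ _ _] := scale_put_pair s00 z0 zs.
  by rewrite (le_trans hz)// scale_put0.
have [y xy fy] := fine_phi_small Hphi e0.
have [x xI fx] : exists2 x, x \in `[x0, y] & f x = e.
  apply: (IVT (ltW xy) (fine_phi_within x00 HP Hphi xl0)).
  by rewrite fx0 min_r ?max_l ?fy ?(ltW e1)// -fx0 fle// ltW.
have hx : xl < x by move: xI; rewrite in_itv/= => /andP[h1 _]; exact: lt_le_trans h1.
have fxp : 0 < f x by rewrite fx.
have gs := inv_scaleK x00 HP Hphi hx fxp.
have sxl := low_lt_scale x00 HP Hphi hx fxp.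
exists (s x); first exact: (scale_lt_infty x00 HP Hphi).
move=> z xz zs.
have sxs0 : (s0 < (s x)%:E)%E.
  by rewrite /scale_zero; case: ifP => _; [exact: ltNyr|].
have [_ hz _ _ _] := scale_put_pair sxs0 xz zs.
by rewrite (le_trans hz)// scale_put_above// gs fx.
Qed.

Lemma scale_put_le K y : 0 <= K ->
  (forall Ks, (forall K', Ks <= K' -> P K' = K' - x0) -> K < Ks) ->
  I y -> K - g y <= P K * h y.
Proof.
move=> K0 KKs /andP[sy ys]; have [yl|ly] := leP y%:E sl.
  have [xp [m slE ym]] := below_scale_low sy yl; rewrite inv_scale_low//.
  apply/ler_addgt0Pr => e e0.
  have hx : xl < xl + e by rewrite ltrDl.
  have hy : f (xl + e) <= h y.
    rewrite (scale_put_below slE ym) (le_trans (low_phi_ge xp slE hx))//.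
    by rewrite lerDl divr_ge0 ?subr_ge0// ltW.
  have := put_le x00 HP Hphi hx K0 KKs.
  have := ler_wpM2l (price_ge0 HP K0) hy; lra.
have [hg _ _] := gP ly ys.
by rewrite scale_put_above//; exact: (put_le x00 HP Hphi).
Qed.

Lemma inv_scale_at_left (m t : R) : s0 = m%:E -> 0 < t ->
  exists2 e : R, 0 < e & forall y, m < y < m + e -> g y < t.
Proof.
move=> s0E t0; have [xlE slE] : xl = 0 /\ sl = m%:E.
  move: s0E; rewrite /scale_zero; case: ifPn => // xn sE; split => //.
  by apply/eqP; rewrite eq_le xlp leNgt xn.
pose x := Num.min (t / 2) x0.
have xp : xl < x by rewrite xlE lt_min x00 divr_gt0.
have fx : 0 < f x.
  by apply: (lt_le_trans ltr01); rewrite -fx0 fle// ge_min lexx orbT.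
have xt : x < t by rewrite gt_min; apply/orP; left; lra.
have sm := low_lt_scale x00 HP Hphi xp fx; rewrite slE lte_fin in sm.
exists (s x - m); first by rewrite subr_gt0.
move=> y; rewrite addrC subrK => /andP[my yx].
have ly : (sl < y%:E)%E by rewrite slE lte_fin.
have ys : (y%:E < sr)%E.
  by apply: (@lt_trans _ _ (s x)%:E); [rewrite lte_fin|exact: (scale_lt_infty x00 HP Hphi)].
have [hg sg _] := gP ly ys.
apply: (lt_trans _ xt); rewrite ltNge; apply/negP => xg.
by have := sle xp xg; rewrite sg leNgt yx.
Qed.

Notation gbar := (inv_scale_sup x0 phi).

Let above_left y y' : (s0 < y%:E)%E -> y <= y' -> (y'%:E < sr)%E -> g y <= g y'.
Proof. by move=> sy yy ys; have [] := scale_put_pair sy yy ys. Qed.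

Lemma inv_scale_sup_spec : (forall y, I y -> ((g y)%:E <= gbar)%E) /\
  (forall m K, sr = m%:E -> (K%:E < gbar)%E ->
    exists2 e : R, 0 < e & forall y, m - e < y < m -> K < g y).
Proof.
have /andP[s00 s10] := I0.
rewrite /inv_scale_sup; case srE : sr => [c| |].
- have c0 : 0 < c by move: s10; rewrite srE lte_fin.
  have -> : lim ((g y)%:E @[y --> c^'-]) = ereal_sup [set (g y)%:E | y in `]0, c[%classic].
    apply/cvg_lim => //.
    (* Reflection turns the left limit at [c] into a right limit at [- c] of a nonincreasing
       function. *)
    apply/(cvg_at_leftNP (fun y => (g y)%:E)); rewrite -/(fun z : R => (g (- z))%:E).
    have -> : [set (g y)%:E | y in `]0, c[%classic] =
        [set (g (- z))%:E | z in [set` Interval (BRight (- c)) (BLeft 0)]].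
      apply/seteqP; split => _ [z /= + <-]; rewrite in_itv/= => /andP[z1 z2].
        by exists (- z); rewrite /= ?opprK// in_itv/= ltrN2 z2 oppr_lt0.
      by exists (- z) => //; rewrite /= in_itv/= oppr_gt0 z2 ltrNl.
    apply: nonincreasing_at_right_cvge; first by rewrite bnd_simp oppr_lt0.
    move=> z z'; rewrite !in_itv/= => /andP[z1 z2] /andP[z3 z4] zz.
    rewrite lee_fin above_left ?lerN2//.
      by rewrite (lt_trans s00)// lte_fin oppr_gt0.
    by rewrite srE lte_fin ltrNl.
  split.
    move=> y /andP[sy]; rewrite lte_fin => yc.
    pose z := Num.max y (c / 2).
    have zc : z < c by rewrite gt_max yc/=; lra.
    apply: (@le_trans _ _ (g z)%:E).
      by rewrite lee_fin above_left// ?srE ?lte_fin// le_max lexx.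
    by apply: ereal_sup_ubound; exists z => //; rewrite /= in_itv/= zc lt_max divr_gt0 ?orbT.
  move=> m K [<-] /ereal_sup_gt[_ [y /= + <-]]; rewrite in_itv/= lte_fin => /andP[y0 yc] Ky.
  exists (c - y); first by rewrite subr_gt0.
  move=> z; rewrite subKr => /andP[yz zc]; apply: (lt_le_trans Ky).
  by rewrite above_left ?srE ?lte_fin ?(ltW yz)// (lt_trans s00)// lte_fin.
- split; last by [].
  have nd : {homo (fun y => (g (Num.max 0 y))%:E) : x y / x <= y >-> (x <= y)%E}.
    move=> x y xy; rewrite lee_fin above_left ?srE ?ltry//.
      by rewrite (lt_le_trans s00)// lee_fin le_max lexx.
    by rewrite ge_max !le_max lexx xy orbT.
  have cv := nondecreasing_cvge nd.
  have -> : lim ((g y)%:E @[y --> +oo]) = ereal_sup (range (fun y => (g (Num.max 0 y))%:E)).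
    apply/cvg_lim => //; apply: cvg_trans cv; apply: near_eq_cvg.
    by exists 0; split; [exact: num_real|move=> x cx; rewrite max_r// ltW].
  move=> y /andP[sy _]; apply: (@le_trans _ _ (g (Num.max 0 y))%:E).
    by rewrite lee_fin above_left ?srE ?ltry// le_max lexx orbT.
  by apply: ereal_sup_ubound; exists y.
- by move: s10; rewrite srE.
Qed.

Definition scale_ratio y : R := h y / g y.

Lemma inv_scale_harmonic r nu : is_speed_measure r x0 phi nu ->
  speed_harmonic r s0 sr g scale_ratio nu.
Proof.
move=> spd; split.
- exact: speed_interior spd.
- by move=> y; apply: (pair_continuous scale_put_gt0 scale_put_pair).
- exact: inv_scale_gt0.
- exact: above_left.
- by move=> y; apply: (pair_derive inv_scale_gt0 scale_put_gt0 scale_put_pair).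
Qed.

Lemma scale_ratioE y : I y -> g y * scale_ratio y = h y.
Proof. by move=> Iy; rewrite /scale_ratio mulrC divfK// gt_eqF// inv_scale_gt0. Qed.

Lemma speed_infinite r nu : is_speed_measure r x0 phi nu ->
  forall y : R, (y%:E <= s0 \/ sr <= y%:E)%E -> nu [set y] = +oo%E.
Proof.
move=> spd y [ys|ys]; last first.
  by apply: (speed_right spd) => //; apply: (le_lt_trans ys); rewrite ltry.
have sy : (-oo < s0)%E by apply: (lt_le_trans _ ys); rewrite ltNyr.
apply: (speed_left spd) => //.
move: sy; rewrite /scale_zero; case: ifPn => // xn _.
by apply/eqP; rewrite eq_le xlp leNgt xn.
Qed.

End put_on_scale.

(** * The put price *)

Section regular_price.
Context {R : realType} {d : measure_display} {T : measurableType d}.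
Context {Pr : probability T R} {F : R -> set (set T)} {B : R -> T -> R}.
Context {L : R -> R -> T -> R}.
Hypotheses (uF : usual_filtration Pr F) (bm : regular_bm Pr F B).
Hypothesis rL : regular_local_time B L.
Context {r x0 : R} {P : R -> R} {phi : R -> \bar R} {nu : {measure set R -> \bar R}}.
Hypotheses (r0 : 0 < r) (x00 : 0 < x0) (HP : hypothesis_H x0 P).
Hypothesis Hphi : admissible_phi x0 P phi.
Hypothesis spd : is_speed_measure r x0 phi nu.
Notation FZ := (time_changed_filtration nu L F).
Notation xl := (x_low x0 phi).
Notation f x := (fine (phi x)).
Notation s := (scale x0 phi).
Notation sr := (scale_infty x0 phi).
Notation s0 := (scale_zero x0 phi).
Notation g := (inv_scale x0 phi).
Notation q := (scale_ratio (x0 := x0) (phi := phi)).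
Notation h := (scale_put (x0 := x0) (phi := phi)).
Notation gbar := (inv_scale_sup x0 phi).
Notation I y := (s0 < y%:E < sr)%E.
Notation X := (stock nu L r x0 phi B).
Notation price K tau := (\int[Pr]_w (discounted_put r K X tau w)%:E)%E.
Implicit Types (K e : R) (tau : T -> \bar R).

Let sh := inv_scale_harmonic x00 HP Hphi spd.
Let s00 := scale_zero_lt0 x00 HP Hphi.
Let s10 := scale_infty_gt0 x00 HP Hphi.
Let nu_out := speed_infinite x00 HP Hphi spd.
Let qE y : I y -> g y * q y = h y. Proof. exact: (scale_ratioE x00 HP Hphi). Qed.

Let q_ge0 y : I y -> 0 <= q y.
Proof.
by move=> Iy; rewrite divr_ge0// ltW ?(scale_put_gt0 x00 HP Hphi)// (inv_scale_gt0 x00 HP Hphi).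
Qed.

Let q_gt0 y : I y -> 0 < q y.
Proof.
by move=> Iy; rewrite divr_gt0 ?(scale_put_gt0 x00 HP Hphi)// (inv_scale_gt0 x00 HP Hphi).
Qed.

Let I0 : I 0. Proof. by rewrite s00 s10. Qed.

Let gq0 : g 0 * q 0 = 1. Proof. by rewrite qE// (scale_put0 x00 HP Hphi). Qed.

Let growth (M : R) : exists C : R, forall y : R,
  I y -> C < `|y| -> M <= g y + g y * q y.
Proof.
have [C HC] := scale_put_growth x00 HP Hphi M; exists C => y Iy Cy.
by rewrite qE//; exact: HC.
Qed.

Let gbar_ub := (inv_scale_sup_spec x00 HP Hphi).1.
Let g_right := (inv_scale_sup_spec x00 HP Hphi).2.
Let g_left := inv_scale_at_left x00 HP Hphi.
Let g0 := inv_scale0 x00 HP Hphi.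

Let threshold Ks K : 0 <= K -> K < Ks -> (forall K', x0 <= K' < Ks -> K' - x0 < P K') ->
  K - x0 < P K /\ forall Ks', (forall K', Ks' <= K' -> P K' = K' - x0) -> K < Ks'.
Proof.
move=> K0 KKs gap; have gK : K - x0 < P K.
  have [x0K|Kx0] := leP x0 K; first by apply: gap; rewrite x0K.
  by apply: (lt_le_trans _ (price_ge0 HP K0)); rewrite subr_lt0.
split => // Ks' H; rewrite ltNge; apply/negP => /H PK.
by move: gK; rewrite PK ltxx.
Qed.

(** Strikes at or above the threshold are written as a strike just below it plus a surplus; there
    [P] has slope 1, so the surplus is accounted for up to [e]. *)
Lemma regular_price_le K tau : stopping_time FZ tau -> 0 <= K -> (price K tau <= (P K)%:E)%E.
Proof.
move=> st K0; have [a [b ex]] := exhaustion_exists s00 s10.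
have [Ks [xKs PKs gap]] := H_threshold HP.
have U K' c : 0 <= K' -> K' < Ks -> 0 <= c -> (price (K' + c) tau <= (P K' + c)%:E)%E.
  move=> K'0 K's c0; have [_ KK] := threshold K'0 K's gap.
  have := @put_price_le R d T Pr F B L uF bm rL r s0 sr g q nu r0 sh s00 s10 nu_out a b ex
    q_ge0 (q_gt0 I0) growth gbar x0 gbar_ub g_left g_right g0 tau K' (P K') c st K'0
    (price_ge0 HP K'0) c0.
  rewrite gq0 mulr1; apply => y Iy; rewrite qE//.
  exact: (scale_put_le x00 HP Hphi).
have [KKs|KsK] := ltP K Ks; first by have := U K 0 K0 KKs (lexx 0); rewrite !addr0.
(* The minimum keeps the auxiliary strike [Ks - e'] nonnegative. *)
apply/lee_addgt0Pr => e e0; pose e' := Num.min e Ks.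
have Ksp : 0 < Ks by rewrite (lt_trans x00).
have e'0 : 0 < e' by rewrite lt_min e0.
have e'e : e' <= e by rewrite ge_min lexx.
have e'K : e' <= Ks by rewrite ge_min lexx orbT.
have := U (Ks - e') (K - (Ks - e')); rewrite (_ : Ks - e' + (K - (Ks - e')) = K); last by ring.
move=> H.
apply: (le_trans (H _ _ _)).
- by rewrite subr_ge0.
- by rewrite ltrBlDr ltrDl.
- lra.
rewrite -EFinD lee_fin (PKs K KsK).
have : P (Ks - e') <= P Ks by apply: (price_le HP); [rewrite subr_ge0|rewrite gerBl ltW].
by rewrite (PKs _ (lexx _)); lra.
Qed.

Lemma immediate_exercise K : stopping_time FZ (cst 0%E) /\
  price K (cst 0%E) = (Num.max (K - x0) 0)%:E.
Proof.
have [a [b ex]] := exhaustion_exists s00 s10; split.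
  split => // t t0; rewrite (_ : [set w | _] = setT); last first.
    by apply/seteqP; split => w //= _; rewrite lee_fin.
  rewrite /time_changed_filtration; case: ifP => _; first exact: (filtration_setT uF (lexx 0)).
  split => // u u0; rewrite setTI.
  exact: (stopping_time_change uF bm rL r0 sh s00 s10 nu_out ex).
rewrite (_ : (fun w => _) = cst (Num.max (K - x0) 0)%:E).
  by rewrite integral_cst//= probability_setT mule1.
by apply/funext => w; rewrite /discounted_put/= /stock lexx mulr0 oppr0 expR0 mul1r.
Qed.

Lemma regular_price_ge K e : 0 <= K -> 0 < e ->
  exists2 tau, stopping_time FZ tau & ((P K - e)%:E <= price K tau)%E.
Proof.
move=> K0 e0; have [st0 V0] := immediate_exercise K.
have [Ks [xKs PKs gap]] := H_threshold HP.
have at0 : P K <= Num.max (K - x0) 0 ->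
    exists2 tau, stopping_time FZ tau & ((P K - e)%:E <= price K tau)%E.
  by move=> H; exists (cst 0%E) => //; rewrite V0 lee_fin lerBlDr (le_trans H)// lerDl ltW.
have [KsK|KKs] := leP Ks K; first by apply: at0; rewrite PKs// le_max lexx.
have [PK|PK] := ltP 0 (P K); last by apply: at0; rewrite le_max PK orbT.
have [gK _] := threshold K0 KKs gap.
have [m [/andP[m0 m1] xK0 xKx0 fm]] := put_ge HP Hphi K0 KKs PK (PKs _ (lexx _)) gK.
set xK := K - P K / m in xK0 xKx0 fm.
have xKK : xK < K by rewrite /xK ltrBlDr ltrDl divr_gt0.
(* The exercise level [x] lies slightly to the right of the zero [xK] of a supporting line of slope
   [m], where phi is at most [1 / m]. Hence [(K - x) / phi x] is at least [(K - x) * m], which is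
   [P K - dl * m]. *)
pose dl := Num.min (Num.min (x0 - xK) (K - xK)) e / 2.
have d0 : 0 < dl by rewrite divr_gt0// !lt_min e0 !subr_gt0 xKx0 xKK.
have dx : 2 * dl <= x0 - xK by rewrite mulrC divfK// !ge_min lexx.
have dK : 2 * dl <= K - xK by rewrite mulrC divfK// !ge_min lexx orbT.
have de : 2 * dl <= e by rewrite mulrC divfK// !ge_min lexx orbT.
pose x := xK + dl.
have xx0 : x <= x0 by rewrite /x; lra.
have xKx : x < K by rewrite /x; lra.
have hx : xl < x.
  apply: (@le_lt_trans _ _ (xK + dl / 2)); last by rewrite /x; lra.
  apply: ge_inf; first by exists 0 => z [/andP[/ltW]].
  have z1 : 0 < xK + dl / 2 by lra.
  have z2 : xK + dl / 2 <= x0 by move: xx0; rewrite /x; lra.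
  split; first by rewrite z1.
  by apply: (le_lt_trans (fm _ _ z2)); rewrite ?ltry//; lra.
have fx1 : 1 <= f x by rewrite -(fine_phi_spot x00 HP Hphi) (fine_phi_le x00 HP Hphi).
have fx0 := lt_le_trans ltr01 fx1.
have fxm : f x <= m^-1.
  by rewrite -lee_fin -(fine_phiE x00 HP Hphi hx) fm// /x; lra.
have y0 : s x <= 0.
  by rewrite -(scale_spot x00 HP Hphi) (scale_le x00 HP Hphi).
have ly := low_lt_scale x00 HP Hphi hx fx0.
have yr := scale_lt_infty x00 HP Hphi hx fx0.
have sy : (s0 < (s x)%:E)%E.
  by rewrite /scale_zero; case: ifP => _; [exact: ltNyr|].
have Iy : I (s x) by rewrite sy.
have gy := inv_scaleK x00 HP Hphi hx fx0.
have hy : g (s x) * q (s x) = f x by rewrite qE// (scale_put_above ly) gy.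
have Kp : 0 < K by rewrite (le_lt_trans xK0).
(* The floor of the exercise clock is chosen so that it reduces the strike by at most [K - x] and at
   most [dl]; the first keeps the reduced strike above the exercise level. *)
pose e1 := Num.min (K - x) dl / (r * K).
have e10 : 0 < e1 by rewrite divr_gt0 ?mulr_gt0// lt_min d0 subr_gt0 xKx.
have Ke : K - Num.min (K - x) dl <= K * expR (- (r * e1)).
  rewrite (_ : _ - _ = K * (1 + - (r * e1))); last first.
    by rewrite /e1; field; rewrite !gt_eqF.
  by rewrite ler_pM2l// expR_ge1Dx.
have m1' : Num.min (K - x) dl <= K - x by rewrite ge_min lexx.
have m2' : Num.min (K - x) dl <= dl by rewrite ge_min lexx orbT.
have [a [b ex]] := exhaustion_exists s00 s10.
have := @put_price_ge R d T Pr F B L uF bm rL r s0 sr g q nu r0 sh s00 s10 nu_out a b ex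
  (s x) y0 q_ge0 (q_gt0 I0).
have hN z z' : (s0 < z%:E)%E -> z <= z' -> (z'%:E < sr)%E -> g z' * q z' <= g z * q z.
  move=> s0z zz zs.
  have Iz : I z by rewrite s0z (le_lt_trans _ zs)// lee_fin.
  have Iz' : I z' by rewrite zs andbT (lt_le_trans s0z)// lee_fin.
  by rewrite !qE//; have [] := scale_put_pair x00 HP Hphi s0z zz zs.
have hs t : 0 < t -> exists2 c : R, (c%:E < sr)%E &
    forall z : R, c <= z -> (z%:E < sr)%E -> g z * q z <= t.
  move=> t0; have [c cs Hc] := scale_put_small x00 HP Hphi t0.
  exists (Num.max c 0); first by rewrite EFin_max gt_max cs s10.
  move=> z; rewrite ge_max => /andP[cz z0] zs; rewrite qE ?Hc//.
  by rewrite zs andbT (lt_le_trans s00)// lee_fin.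
move=> /(_ hN hs sy growth gbar x0 gbar_ub g_left g_right K e1 K0 e10 (q_gt0 Iy)).
rewrite hy gq0 gy; case; first by lra.
move=> tau st H; exists tau => //; apply: (le_trans _ H); rewrite lee_fin div1r.
have mf : m <= (f x)^-1 by rewrite -[m]invrK lef_pV2 ?posrE ?invr_gt0.
have Kx0 : 0 <= K * expR (- (r * e1)) - x by lra.
apply: (le_trans _ (ler_wpM2l Kx0 mf)).
have mP : (K - xK) * m = P K by rewrite /xK subKr divfK// gt_eqF.
have : (K - x - dl) * m <= (K * expR (- (r * e1)) - x) * m by rewrite ler_pM2r//; lra.
have : dl * m <= dl by rewrite ler_piMr ?ltW.
by rewrite /x; lra.
Qed.

Lemma regular_put_price K : 0 <= K ->
  ereal_sup [set price K tau | tau in stopping_time FZ] = (P K)%:E.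
Proof.
move=> K0; apply/eqP; rewrite eq_le; apply/andP; split.
  by apply: ge_ereal_sup => _ [tau st <-]; exact: regular_price_le.
apply/lee_subgt0Pr => e e0; have [tau st H] := regular_price_ge K0 e0.
by rewrite -EFinB (le_trans H)//; apply: ereal_sup_ubound; exists tau.
Qed.

End regular_price.

(** * Replacing the exceptional paths *)

Section regular_paths.
Context {R : realType} {d : measure_display} {T : measurableType d}.
Notation mu := (@lebesgue_measure R).
Context {Pr : probability T R} {F : R -> set (set T)} {B : R -> T -> R}.
Context {L : R -> R -> T -> R}.
Hypotheses (uF : usual_filtration Pr F) (bm : brownian_motion Pr F B).
Hypothesis lt : is_local_time Pr B L.
Implicit Types (u v t : R) (w : T).

Lemma ae_eq_probability (A A' N : set T) : measurable A -> measurable A' -> Pr.-negligible N ->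
  (forall w, ~ N w -> A w <-> A' w) -> Pr A = Pr A'.
Proof.
move=> mA mA' N0 AA'.
rewrite -[A]setIT -[A']setIT -!integral_indic//.
have i0 (S : set T) w : (0 <= (\1_S w : R)%:E)%E by rewrite lee_fin indicE.
have E w : ~ N w -> \1_A w = \1_A' w :> R.
  by move=> /AA' H; rewrite !indicE; congr (_%:R); congr nat_of_bool; apply/idP/idP => /set_mem/H/mem_set.
apply/eqP; rewrite eq_le; apply/andP; split; apply: ge0_ae_le_integral_nonmeasurable => //;
  by apply: (negligibleS _ N0) => w /= H; apply: contrapT => Nw; apply: H; rewrite E.
Qed.

Definition regular_path w : Prop := [/\ B 0 w = 0,
  {within `[0, +oo[, continuous (fun t => B t w)},
  {within [set zu : R * R | 0 <= zu.2], continuous (fun zu => L zu.1 zu.2 w)} &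
  forall (u : R) (S : set R), 0 <= u -> measurable S ->
    mu [set s : R | 0 <= s <= u /\ S (B s w)] = (\int[mu]_(z in S) (L z u w)%:E)%E].

Lemma almost_every_path_regular : Pr.-negligible [set w | ~ regular_path w].
Proof.
apply: (negligibleS _ (negligibleU (bm_start bm) (negligibleU (bm_continuous bm) lt))).
move=> w /= nr; apply: contrapT => /not_orP[n1 /not_orP[n2 n3]]; apply: nr.
by move: n1 n2 n3 => /contrapT ? /contrapT ? /contrapT[? ?]; split.
Qed.

Lemma regular_path_exists : exists w, regular_path w.
Proof.
apply: contrapT => N; have [A [mA A0 H]] := almost_every_path_regular.
have AT : A = setT by apply/seteqP; split => // w _; apply: H => /= rw; apply: N; exists w.
by move: A0; rewrite AT probability_setT => /eqP; rewrite onee_eq0.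
Qed.

Let w0 := projT1 (cid regular_path_exists).

(* Replaces the exceptional paths by a fixed regular one. *)
Definition regular_point w : T := if pselect (regular_path w) then w else w0.

Let rp w : regular_path (regular_point w).
Proof. by rewrite /regular_point; case: pselect => //= _; exact: projT2 (cid regular_path_exists). Qed.

Let rpE w : regular_path w -> regular_point w = w.
Proof. by rewrite /regular_point; case: pselect. Qed.

(** Constant at negative times, so that continuity holds on the whole line. *)
Definition regular_motion t w : R := B (Num.max 0 t) (regular_point w).
Definition regular_density (z u : R) w : R := L z u (regular_point w).

Let BE t w : 0 <= t -> regular_path w -> regular_motion t w = B t w.
Proof. by move=> t0 /rpE rw; rewrite /regular_motion rw max_r. Qed.

Let bad_negligible := almost_every_path_regular.

Let good w : ~ [set w | ~ regular_path w] w -> regular_path w.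
Proof. by move=> /= /contrapT. Qed.

Lemma continuous_extend (f : R -> R) : {within `[0, +oo[, continuous f} ->
  continuous (fun t => f (Num.max 0 t)).
Proof.
move=> /subspace_continuousP cf t.
have D u : `[0, +oo[%classic (Num.max 0 u).
  by rewrite /= in_itv/= andbT le_max lexx.
apply: (@cvg_trans _ (f x @[x --> within `[0, +oo[%classic (nbhs (Num.max 0 t))])); last exact: cf.
move=> A /= HA; have {}HA : nbhs (Num.max 0 t) (fun x => `[0, +oo[%classic x -> A (f x)) by [].
have [e /= e0 He] := (nbhs_ballP _ _).1 HA.
apply/nbhs_ballP; exists e => // u ut; apply: (He (Num.max 0 u) _ (D u)); move: ut; rewrite /ball/=.
rewrite !ltr_norml => /andP[u1 u2].
have [t0|t0] := leP t 0; have [u0|u0] := leP u 0;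
  rewrite ?(max_l t0) ?(max_l u0) ?(max_r (ltW t0)) ?(max_r (ltW u0)); apply/andP; split; lra.
Qed.

(** The new motion agrees with the old one off a null set: completeness keeps it adapted, and the
    laws of the increments and their independence from the past are unchanged. *)
Lemma regular_motion_bm : regular_bm Pr F regular_motion.
Proof.
have FB t S : 0 <= t -> measurable S -> F t (regular_motion t @^-1` S).
  move=> t0 mS; apply: (filtration_almost_eq uF t0 bad_negligible (bm_adapted bm t0 mS)).
  by move=> w /good rw; rewrite /= BE.
have mB t : 0 <= t -> measurable_fun setT (B t).
  by move=> t0 _ S mS; rewrite setTI; apply: (filtration_measurable uF t0); exact: (bm_adapted bm).
have mB' t : 0 <= t -> measurable_fun setT (regular_motion t).
  by move=> t0 _ S mS; rewrite setTI; apply: (filtration_measurable uF t0); exact: FB.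
have mI s t S : 0 <= s -> 0 <= t -> measurable S -> measurable (increment B s t @^-1` S).
  move=> s0 t0 mS; rewrite -[X in measurable X]setTI.
  exact: (measurable_funB (mB t t0) (mB s s0) measurableT mS).
have mI' s t S : 0 <= s -> 0 <= t -> measurable S ->
    measurable (increment regular_motion s t @^-1` S).
  move=> s0 t0 mS; rewrite -[X in measurable X]setTI.
  exact: (measurable_funB (mB' t t0) (mB' s s0) measurableT mS).
have incE s t w : 0 <= s -> 0 <= t -> regular_path w ->
    increment regular_motion s t w = increment B s t w.
  by move=> s0 t0 rw; rewrite /increment !BE.
have PE s t S : 0 <= s -> 0 <= t -> measurable S ->
    Pr (increment regular_motion s t @^-1` S) = Pr (increment B s t @^-1` S).
  move=> s0 t0 mS; apply: (ae_eq_probability _ _ bad_negligible); [exact: mI'|exact: mI|].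
  by move=> w /good rw /=; rewrite incE.
split.
- by move=> t t0 S mS; exact: FB.
- by move=> w; rewrite /regular_motion max_l//; have [] := rp w.
- move=> s t s0 st S mS; have t0 := le_trans s0 (ltW st).
  by rewrite PE//; exact: (bm_increment bm).
- move=> s t s0 st A S FA mS; have t0 := le_trans s0 (ltW st).
  rewrite PE// -(bm_independent bm s0 st FA mS).
  have mA := filtration_measurable uF s0 FA.
  apply: (ae_eq_probability _ _ bad_negligible).
  + by apply: measurableI => //; exact: mI'.
  + by apply: measurableI => //; exact: mI.
  + by move=> w /good rw /=; rewrite incE.
- by move=> w; have [_ cb _ _] := rp w; exact: (continuous_extend cb).
Qed.

Lemma regular_density_local_time : regular_local_time regular_motion regular_density.
Proof.
move=> w; have [_ _ h1 h2] := rp w; split => // u S u0 mS; rewrite -h2//.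
congr (mu _); apply/seteqP; split => s /= [/andP[s0 su]]; rewrite /regular_motion max_r//;
  by rewrite s0.
Qed.

Context {nu : {measure set R -> \bar R}} {r x0 : R} {phi : R -> \bar R}.
Notation X := (stock nu L r x0 phi B).
Notation X' := (stock nu regular_density r x0 phi regular_motion).

Let AE t w : regular_path w ->
  time_change nu regular_density t w = time_change nu L t w.
Proof.
move=> rw; change (time_change nu L t (regular_point w) = time_change nu L t w).
by rewrite rpE.
Qed.

Let inf_ge0 (S : set R) : (forall u, S u -> 0 <= u) -> 0 <= fine (ereal_inf [set u%:E | u in S]).
Proof.
by move=> S0; apply: fine_ge0; apply: le_ereal_inf_tmp => _ [u Su <-]; rewrite lee_fin S0.
Qed.

Let XE t w : regular_path w -> X' t w = X t w.
Proof.
move=> rw; rewrite /stock.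
have -> : additive_functional_at_explosion nu regular_density w =
    additive_functional_at_explosion nu L w.
  change (additive_functional_at_explosion nu L (regular_point w) =
    additive_functional_at_explosion nu L w).
  by rewrite rpE.
have -> : explosion_time nu regular_density w = explosion_time nu L w.
  by change (explosion_time nu L (regular_point w) = explosion_time nu L w); rewrite rpE.
have -> : time_changed_bm nu regular_density regular_motion t w = time_changed_bm nu L B t w.
  by rewrite /time_changed_bm AE// BE// inf_ge0// => u [].
by rewrite BE// inf_ge0// => u [].
Qed.

(** At positive times the two time changes differ on a null set only, which a complete filtration
    cannot distinguish; at time 0 both filtrations are [F 0]. *)
Lemma stopping_time_regular :
  stopping_time (time_changed_filtration nu regular_density F) =
  stopping_time (time_changed_filtration nu L F) :> set (T -> \bar R).
Proof.
suff E t : time_changed_filtration nu regular_density F t = time_changed_filtration nu L F t.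
  by apply/seteqP; split => tau [h1 h2]; split => // t t0; have := h2 t t0; rewrite E.
rewrite /time_changed_filtration; case: ifP => [_|_]; first by [].
apply/seteqP; split => S [mS HS]; split => // u u0;
  apply: (filtration_almost_eq uF u0 bad_negligible (HS u u0)) => w /good rw;
  by rewrite /= AE.
Qed.

(** The payoffs agree almost surely but may be nonmeasurable, so equality comes from monotonicity of
    the lower integral in both directions. *)
Lemma price_regular (K : R) (tau : T -> \bar R) :
  (\int[Pr]_w (discounted_put r K X' tau w)%:E =
   \int[Pr]_w (discounted_put r K X tau w)%:E)%E.
Proof.
have E w : ~ [set w | ~ regular_path w] w ->
    discounted_put r K X' tau w = discounted_put r K X tau w.
  by move=> /good rw; rewrite /discounted_put; case: (tau w) => [t| |]; [rewrite (XE t rw)|..].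
have V0 (Y : R -> T -> R) w : (0 <= (discounted_put r K Y tau w)%:E)%E.
  by rewrite lee_fin; exact: discounted_put_ge0.
have ae_le (Y Y' : R -> T -> R) : (forall w, ~ [set w | ~ regular_path w] w ->
    discounted_put r K Y tau w = discounted_put r K Y' tau w) ->
    (\int[Pr]_w (discounted_put r K Y tau w)%:E <=
     \int[Pr]_w (discounted_put r K Y' tau w)%:E)%E.
  move=> YY'; apply: ge0_ae_le_integral_nonmeasurable; [exact: V0|exact: V0|].
  apply: (negligibleS _ bad_negligible) => w H rw; apply: H.
  by rewrite /= YY'// => /(_ rw).
have l1 := ae_le X' X E.
have l2 := ae_le X X' (fun w nw => esym (E w nw)).
have anti (u v : \bar R) : (u <= v -> v <= u -> u = v)%E.
  by move=> h1 h2; apply/eqP; rewrite eq_le h1.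
exact (anti _ _ l1 l2).
Qed.

End regular_paths.

Theorem theorem7p1 (R : realType) (r x0 : R) (P : R -> R) (phi : R -> \bar R)
    (nu : {measure set R -> \bar R})
    (d : measure_display) (Omega : measurableType d) (Pr : probability Omega R)
    (FB : R -> set (set Omega)) (B : R -> Omega -> R)
    (L : R -> R -> Omega -> R) :
  0 < r -> 0 < x0 ->
  hypothesis_H x0 P ->
  admissible_phi x0 P phi ->
  is_speed_measure r x0 phi nu ->
  usual_filtration Pr FB ->
  brownian_motion Pr FB B ->
  is_local_time Pr B L ->
  forall K : R, 0 <= K ->
    ereal_sup [set ('E_Pr[discounted_put r K (stock nu L r x0 phi B) tau])%E |
               tau in stopping_time (time_changed_filtration nu L FB)] =
    (P K)%:E.
Proof.
move=> r0 x00 HP Hphi spd uF bm lt K K0.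
rewrite -(regular_put_price uF (regular_motion_bm uF bm lt) (regular_density_local_time bm lt)
  r0 x00 HP Hphi spd K0) (stopping_time_regular uF bm lt).
by congr ereal_sup; apply/seteqP; split => _ [tau st <-]; (exists tau; first exact: st);
  rewrite (price_regular bm lt) unlock.
Qed.
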